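(* Let $n\ge 1$, let $s,s_1,s_2\in(0,1)$ with $s_1+s_2=2s$, and let $K\in L^\infty(\mathbb{R}^n\times\mathbb{R}^n)$. Then the operator $T_{K,s_1,s_2}$ with kernel $A_{K,s_1,s_2}$ (defined in the context) is a Calderón–Zygmund operator. In particular, for any $p\in(1,\infty)$ there is a constant $C$ (independent of $K$ and $f$) such that 1. $\|T_{K,s_1,s_2}f\|_{L^{1,\infty}(\mathbb{R}^n)}\le C\,\|K\|_{L^\infty(\mathbb{R}^n\times\mathbb{R}^n)}\,\|f\|_{L^1(\mathbb{R}^n)}$ for all $f\in L^1(\mathbb{R}^n)$; 2. $\|T_{K,s_1,s_2}f\|_{L^p(\mathbb{R}^n)}\le C\,\|K\|_{L^\infty(\mathbb{R}^n\times\mathbb{R}^n)}\,\|f\|_{L^p(\mathbb{R}^n)}$ for all $f\in L^p(\mathbb{R}^n)$; 3. $[T_{K,s_1,s_2}f]_{BMO(\mathbb{R}^n)}\le C\,\|K\|_{L^\infty(\mathbb{R}^n\times\mathbb{R}^n)}\,\|f\|_{L^\infty(\mathbb{R}^n)}$ for all $f\in L^\infty(\mathbb{R}^n)$.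
   Context: Kernel: for $z_1\ne z_2$ in $\mathbb{R}^n$, $$A_{K,s_1,s_2}(z_1,z_2)=\int_{\mathbb{R}^n}\int_{\mathbb{R}^n}\frac{K(x,y)\left(|x-z_1|^{s_1-n}-|y-z_1|^{s_1-n}\right)\left(|x-z_2|^{s_2-n}-|y-z_2|^{s_2-n}\right)}{|x-y|^{n+2s}}\,dx\,dy.$$ Operator: formally $T_{K,s_1,s_2}f(z_1)=\int_{\mathbb{R}^n}A_{K,s_1,s_2}(z_1,z_2)f(z_2)\,dz_2$. This (possibly singular) integral is understood in the weak sense obtained by interchanging the order of integration: for $f,\varphi\in C_c^\infty(\mathbb{R}^n)$, $$\int_{\mathbb{R}^n}(T_{K,s_1,s_2}f)\,\varphi\,dz=\int_{\mathbb{R}^n}\int_{\mathbb{R}^n}K(x,y)\frac{\left(I^{s_1}\varphi(x)-I^{s_1}\varphi(y)\right)\left(I^{s_2}f(x)-I^{s_2}f(y)\right)}{|x-y|^{n+2s}}\,dx\,dy,$$ where $I^{t}g(x)=\int_{\mathbb{R}^n}|x-z|^{t-n}g(z)\,dz$. The operator is extended to $L^2(\mathbb{R}^n)$ by continuity, to $L^p(\mathbb{R}^n)$ ($1\le p<\infty$) by density, and to $L^\infty(\mathbb{R}^n)$ (modulo constants) in the usual way for Calderón–Zygmund operators. A Calderón–Zygmund operator is a linear operator $T$, bounded from $L^2(\mathbb{R}^n)$ to $L^2(\mathbb{R}^n)$, which is associated with a standard kernel $A$, i.e. $Tf(z_1)=\int A(z_1,z_2)f(z_2)\,dz_2$ for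 $f\in C_c^\infty(\mathbb{R}^n)$ and $z_1\notin\operatorname{supp}f$, where $A$, defined for $z_1\neq z_2$, satisfies for some constants $C,\alpha>0$: $|A(z_1,z_2)|\le C|z_1-z_2|^{-n}$, and $|A(z_1+h,z_2)-A(z_1,z_2)|+|A(z_1,z_2+h)-A(z_1,z_2)|\le C|h|^\alpha|z_1-z_2|^{-n-\alpha}$ whenever $|h|\le\frac12|z_1-z_2|$. Norms: $\|g\|_{L^{1,\infty}(\mathbb{R}^n)}=\sup_{\lambda>0}\lambda\,|\{x:|g(x)|>\lambda\}|$ and $[b]_{BMO(\mathbb{R}^n)}=\sup_Q\frac1{|Q|}\int_Q\left|b(x)-\frac1{|Q|}\int_Qb(y)\,dy\right|dx$, the supremum being over all cubes $Q\subset\mathbb{R}^n$. *)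

(* Defs.v *)
From HB Require Import structures.
From mathcomp Require Import all_boot all_order all_algebra.
From mathcomp Require Import all_classical all_reals all_analysis.
Set Implicit Arguments.
Unset Strict Implicit.
Unset Printing Implicit Defensive.
Import Order.TTheory GRing.Theory Num.Theory.
Import numFieldNormedType.Exports.
Local Open Scope classical_set_scope.
Local Open Scope ring_scope.

(* The library has no Lebesgue measure on R^n.  The type 'rV[R]_n gets the
   product sigma-algebra (the one generated by the coordinates, i.e. the Borel
   sets) and Lebesgue measure is built as an iterated product;
   [lebesgue_rV_box] gives its value on boxes. *)
Definition rV_display : measure_display. Proof. exact. Qed.

Section measurable_rV.
Context {R : realType} (n : nat).

Let coors : 'I_n -> 'rV[R]_n -> R := fun i x => x ord0 i.

Let rV_set0 : g_sigma_preimage coors set0.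
Proof. exact: sigma_algebra0. Qed.

Let rV_setC A : g_sigma_preimage coors A -> g_sigma_preimage coors (~` A).
Proof. exact: sigma_algebraC. Qed.

Let rV_bigcup (F : _^nat) : (forall i, g_sigma_preimage coors (F i)) ->
  g_sigma_preimage coors (\bigcup_i (F i)).
Proof. exact: sigma_algebra_bigcup. Qed.

HB.instance Definition _ := @isMeasurable.Build rV_display
  'rV[R]_n (g_sigma_preimage coors) rV_set0 rV_setC rV_bigcup.

Lemma measurable_coord (i : 'I_n) :
  measurable_fun [set: 'rV[R]_n] (fun x : 'rV[R]_n => x ord0 i).
Proof.
move=> _ Y mY; rewrite setTI; apply: sub_sigma_algebra => /=.
rewrite -bigcup_seq/=; exists i => /=; first by rewrite mem_index_enum.
by exists Y => //; rewrite setTI.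
Qed.

Lemma measurable_fun_rV d (T : measurableType d) (f : T -> 'rV[R]_n) :
  (forall i, measurable_fun [set: T] (fun t => f t ord0 i)) ->
  measurable_fun [set: T] f.
Proof.
move=> mf.
suff H : g_sigma_preimage (fun i => coors i \o f) `<=` measurable.
  move=> _ A mA; apply: H.
  by rewrite g_sigma_preimage_comp; exists A.
apply: smallest_sub; first exact: sigma_algebra_measurable.
rewrite -bigcup_seq/=; apply: bigcup_sub => i _.
by move=> A [B mB <-]; exact: mf.
Qed.

End measurable_rV.

Section lebesgue_rV.
Context {R : realType}.

Definition consrV n (p : R * 'rV[R]_n) : 'rV[R]_n.+1 :=
  \row_i oapp (fun j => p.2 ord0 j) p.1 (unlift ord0 i).

Definition unconsrV n (x : 'rV[R]_n.+1) : R * 'rV[R]_n :=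
  (x ord0 ord0, \row_j x ord0 (lift ord0 j)).

Lemma unconsrVK n : cancel (@unconsrV n) (@consrV n).
Proof.
move=> x; apply/rowP => i; rewrite !mxE /=.
by case: unliftP => [j ->|->] //=; rewrite mxE.
Qed.

Lemma consrVK n : cancel (@consrV n) (@unconsrV n).
Proof.
move=> [a x]; rewrite /unconsrV; congr pair; first by rewrite mxE unlift_none.
by apply/rowP => j; rewrite !mxE liftK.
Qed.

Lemma measurable_consrV n : measurable_fun setT (@consrV n).
Proof.
apply: measurable_fun_rV => i; case: (unliftP ord0 i) => [j ->|->].
  under eq_fun do rewrite mxE liftK /=.
  exact: (measurableT_comp (measurable_coord j) measurable_snd).
under eq_fun do rewrite mxE unlift_none /=.
exact: measurable_fst.
Qed.

Lemma measurable_unconsrV n : measurable_fun setT (@unconsrV n).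
Proof.
apply: measurable_fun_pair => /=; first exact: measurable_coord.
apply: measurable_fun_rV => i.
by under eq_fun do rewrite mxE; exact: measurable_coord.
Qed.

Section step.
Variables (n : nat) (mu : {sigma_finite_measure set 'rV[R]_n -> \bar R}).

Local Notation prod := (@lebesgue_measure R \x mu)%E.

Definition lebesgue_step : set 'rV[R]_n.+1 -> \bar R :=
  fun A => prod (@consrV n @^-1` A).

Let measurable_pre (A : set 'rV[R]_n.+1) : measurable A ->
  measurable (@consrV n @^-1` A).
Proof. by move=> mA; rewrite -[X in measurable X]setTI; exact: measurable_consrV. Qed.

Let lebesgue_step0 : lebesgue_step set0 = 0%E.
Proof. by rewrite /lebesgue_step preimage_set0 measure0. Qed.

Let lebesgue_step_ge0 A : (0 <= lebesgue_step A)%E.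
Proof. exact: measure_ge0. Qed.

Let lebesgue_step_sigma_additive : semi_sigma_additive lebesgue_step.
Proof.
move=> F mF tF mUF; rewrite /lebesgue_step preimage_bigcup.
apply: measure_semi_sigma_additive.
- by move=> k; exact: measurable_pre.
- apply/trivIsetP => /= i j _ _ ij; rewrite -preimage_setI.
  by move/trivIsetP : tF => /(_ _ _ _ _ ij) ->//; rewrite preimage_set0.
- by rewrite -preimage_bigcup; exact: measurable_pre.
Qed.

HB.instance Definition _ := isMeasure.Build _ _ _ lebesgue_step
  lebesgue_step0 lebesgue_step_ge0 lebesgue_step_sigma_additive.

Let lebesgue_step_sigma_finite : sigma_finite setT lebesgue_step.
Proof.
have /sigma_finiteP[F [TF ndF Foo]] := sigma_finiteT (@lebesgue_measure R).
have /sigma_finiteP[G [TG ndG Goo]] := sigma_finiteT mu.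
exists (fun k => @unconsrV n @^-1` (F k `*` G k)).
  rewrite -preimage_bigcup (_ : \bigcup_k _ = setT) ?preimage_setT//.
  apply/seteqP; split => // -[t x] _.
  have [i _ Fi] : (\bigcup_k F k) t by rewrite -TF.
  have [j _ Gj] : (\bigcup_k G k) x by rewrite -TG.
  exists (maxn i j) => //; split => /=.
    by move: t Fi; exact/subsetPset/ndF/leq_maxl.
  by move: x Gj; exact/subsetPset/ndG/leq_maxr.
move=> k; have [mF Fk] := Foo k; have [mG Gk] := Goo k; split.
  rewrite -[X in measurable X]setTI; apply: measurable_unconsrV => //.
  exact: measurableX.
rewrite /lebesgue_step -comp_preimage (_ : _ \o _ = id); last first.
  by apply/funext => p; exact: consrVK.
by rewrite product_measure1E// lte_mul_pinfty// ge0_fin_numE.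
Qed.

HB.instance Definition _ := Measure_isSigmaFinite.Build _ _ _ lebesgue_step
  lebesgue_step_sigma_finite.

End step.

Fixpoint lebesgue_rV n : {sigma_finite_measure set 'rV[R]_n -> \bar R} :=
  match n with
  | 0%N => \d_(0 : 'rV[R]_0)
  | n'.+1 => lebesgue_step (lebesgue_rV n')
  end.

Lemma lebesgue_rV_box n (a b : 'I_n -> R) : (forall i, a i <= b i) ->
  lebesgue_rV n [set x | forall i, a i <= x ord0 i <= b i] =
  (\prod_i (b i - a i))%:E.
Proof.
elim: n a b => [|n IH] a b ab.
  by rewrite big_ord0 /= diracE mem_set// => -[].
rewrite big_ord_recl /= /lebesgue_step.
set B := [set x : 'rV[R]_n |
  forall i, a (lift ord0 i) <= x ord0 i <= b (lift ord0 i)].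
have -> : @consrV n @^-1` [set x | forall i, a i <= x ord0 i <= b i] =
    `[a ord0, b ord0]%classic `*` B.
  apply/seteqP; split => -[t x] /=.
    move=> H; split; first by have := H ord0; rewrite mxE unlift_none in_itv.
    by move=> i; have := H (lift ord0 i); rewrite mxE liftK.
  move=> [Ht Hx] i; rewrite mxE; case: (unliftP ord0 i) => [j ->|->] /=.
    exact: Hx.
  by move: Ht; rewrite in_itv.
have mB : measurable B.
  have -> : B = \bigcap_(i in [set: 'I_n])
      ((fun x : 'rV[R]_n => x ord0 i) @^-1`
         `[a (lift ord0 i), b (lift ord0 i)]%classic).
    apply/seteqP; split => [x Bx i _ /=|x Hx i]; first by rewrite in_itv; exact: Bx.
    by have := Hx i I; rewrite /= in_itv.
  apply: fin_bigcap_measurable => // i _.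
  by rewrite -[X in measurable X]setTI; exact: measurable_coord.
rewrite product_measure1E// EFinM IH//.
congr (_ * _)%E; rewrite /= (_ : _ `[a ord0, b ord0]%classic =
  @lebesgue_measure R `[a ord0, b ord0]%classic)// lebesgue_measure_itv/=.
by have := ab ord0; rewrite lte_fin le_eqVlt => /predU1P[->|->];
  rewrite ?ltxx ?subrr.
Qed.

End lebesgue_rV.

Section function_spaces.
Context {R : realType} {n : nat}.
Implicit Types (f g : 'rV[R]_n -> R) (x y z : 'rV[R]_n).
Local Notation mu := (@lebesgue_rV R n).

(* [`|x|] is the sup norm on 'rV[R]_n, hence this Euclidean norm. *)
Definition enorm x : R := Num.sqrt (\sum_i x ord0 i ^+ 2).

Definition eball x (r : R) : set 'rV[R]_n := [set y | enorm (y - x) < r].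

Definition smooth f : Prop := forall vs : seq 'rV[R]_n,
  let g := foldr (fun v h => fun x => 'D_v h x) f vs in
  continuous g /\ forall x v, derivable g x v.

Definition supp f : set 'rV[R]_n := closure [set x | f x != 0].

Definition test_function f : Prop := smooth f /\ compact (supp f).

Definition locally_integrable_rV f : Prop :=
  measurable_fun setT f /\
  forall D : set 'rV[R]_n, compact D -> (\int[mu]_(x in D) `|f x|%:E < +oo)%E.

Definition weakL1_norm g : \bar R :=
  ereal_sup [set (l%:E * mu [set x | (l < `|g x|)%R])%E | l in [set l : R | 0 < l]].

Definition cube x (l : R) : set 'rV[R]_n :=
  [set y | forall i, x ord0 i <= y ord0 i <= x ord0 i + l].

Definition average (Q : set 'rV[R]_n) f : R :=
  (fine (mu Q))^-1 * \int[mu]_(x in Q) f x.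

Definition bmo_norm f : \bar R :=
  ereal_sup [set ((fine (mu (cube xl.1 xl.2)))^-1%:E *
      \int[mu]_(x in cube xl.1 xl.2) `|f x - average (cube xl.1 xl.2) f|%:E)%E
    | xl in [set xl : 'rV[R]_n * R | 0 < xl.2]].

Definition cvg_in_measure (u : nat -> 'rV[R]_n -> R) g : Prop :=
  forall e : R, 0 < e ->
    mu [set x | e <= `|u k x - g x|] @[k --> \oo] --> 0%E.

End function_spaces.

Section operator.
Context {R : realType} {n : nat}.
Implicit Types (s t : R) (f g phi : 'rV[R]_n -> R) (x y z : 'rV[R]_n).
Implicit Types (K : 'rV[R]_n * 'rV[R]_n -> R) (A : 'rV[R]_n -> 'rV[R]_n -> R).
Implicit Types (T : ('rV[R]_n -> R) -> 'rV[R]_n -> R).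
Local Notation mu := (@lebesgue_rV R n).
Local Notation mu2 := (@lebesgue_rV R n \x @lebesgue_rV R n)%E.

(* The singular values ([0 `^ r = 0] for [r != 0], [_ / 0 = 0]) only occur on
   null sets. *)
Definition riesz t x z : R := enorm (x - z) `^ (t - n%:R).

Definition kernel_integrand s s1 s2 K z1 z2 (xy : 'rV[R]_n * 'rV[R]_n) : R :=
  K xy * (riesz s1 xy.1 z1 - riesz s1 xy.2 z1)
       * (riesz s2 xy.1 z2 - riesz s2 xy.2 z2)
  / enorm (xy.1 - xy.2) `^ (n%:R + 2 * s).

Definition kernelA s s1 s2 K z1 z2 : R :=
  \int[mu2]_xy kernel_integrand s s1 s2 K z1 z2 xy.

Definition riesz_potential t g x : R := \int[mu]_z (riesz t x z * g z).

Definition form_integrand s s1 s2 K phi f (xy : 'rV[R]_n * 'rV[R]_n) : R :=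
  K xy * (riesz_potential s1 phi xy.1 - riesz_potential s1 phi xy.2)
       * (riesz_potential s2 f xy.1 - riesz_potential s2 f xy.2)
  / enorm (xy.1 - xy.2) `^ (n%:R + 2 * s).

(* [T] acts on everywhere defined functions but stands for an operator on
   classes of functions, so all identities are a.e.

   [is_operatorT s s1 s2 K T] says that [T] is T_{K,s1,s2}: the weak definition
   on test functions, the extension to L^2 by continuity, to L^p (p < oo) by
   density (with limits in measure, since for p = 1 there is no convergence in
   norm), and to L^oo modulo constants.  On a ball B = B(x0, r) the latter is
   T (f 1_{2B}) (x) + \int_{z notin 2B} (A(x, z) - A(x0, z)) f(z) dz + c_B.
   The fields determine [T f] a.e. on L^p, and up to a constant on L^oo. *)
Record is_operatorT s s1 s2 K T : Prop := {
  operatorT_weak : forall f, test_function f ->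
    locally_integrable_rV (T f) /\
    forall phi, test_function phi ->
      mu2.-integrable setT (EFin \o form_integrand s s1 s2 K phi f) /\
      \int[mu]_z (T f z * phi z) =
        \int[mu2]_xy form_integrand s s1 s2 K phi f xy ;
  operatorT_measurable : forall (p : \bar R) f, (1 <= p)%E ->
    f \in Lfun mu p -> measurable_fun setT (T f) ;
  operatorT_L2 : forall f (u : nat -> 'rV[R]_n -> R),
    f \in Lfun mu 2%:E -> (forall k, test_function (u k)) ->
    'N[mu]_2%:E[EFin \o (u k \- f)%R]%E @[k --> \oo] --> 0%E ->
    'N[mu]_2%:E[EFin \o (T (u k) \- T f)%R]%E @[k --> \oo] --> 0%E ;
  operatorT_Lp : forall (p : R) f (u : nat -> 'rV[R]_n -> R), 1 <= p ->
    f \in Lfun mu p%:E -> (forall k, test_function (u k)) ->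
    'N[mu]_p%:E[EFin \o (u k \- f)%R]%E @[k --> \oo] --> 0%E ->
    cvg_in_measure (fun k => T (u k)) (T f) ;
  operatorT_Loo : forall f, f \in Lfun mu +oo%E ->
    forall (x0 : 'rV[R]_n) (r : R), 0 < r -> exists c : R,
      {ae mu, forall x, eball x0 r x ->
        let D := ~` eball x0 (2 * r) in
        let tail z := (kernelA s s1 s2 K x z - kernelA s s1 s2 K x0 z) * f z in
        mu.-integrable D (EFin \o tail) /\
        T f x = T (fun z => f z * \1_(eball x0 (2 * r)) z) x
                + \int[mu]_(z in D) tail z + c} }.

Definition standard_kernel A : Prop := exists C alpha : R,
  [/\ 0 < C, 0 < alpha,
    forall z1 z2, z1 != z2 -> `|A z1 z2| <= C * enorm (z1 - z2) `^ (- n%:R) &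
    forall z1 z2 h, z1 != z2 -> enorm h <= 2^-1 * enorm (z1 - z2) ->
      `|A (z1 + h) z2 - A z1 z2| + `|A z1 (z2 + h) - A z1 z2|
      <= C * enorm h `^ alpha * enorm (z1 - z2) `^ (- n%:R - alpha)].

Definition associated_kernel T A : Prop := forall f, test_function f ->
  {ae mu, forall z1, ~ supp f z1 ->
    mu.-integrable setT (fun z2 => (A z1 z2 * f z2)%:E) /\
    T f z1 = \int[mu]_z2 (A z1 z2 * f z2)}.

Record calderon_zygmund T A : Prop := {
  cz_linear : forall (a : R) f g, f \in Lfun mu 2%:E -> g \in Lfun mu 2%:E ->
    {ae mu, forall x, T (fun y => a * f y + g y) x = a * T f x + T g x} ;
  cz_bounded : exists C : R, forall f, f \in Lfun mu 2%:E ->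
    T f \in Lfun mu 2%:E /\
    ('N[mu]_2%:E[EFin \o T f] <= C%:E * 'N[mu]_2%:E[EFin \o f])%E ;
  cz_associated : associated_kernel T A ;
  cz_standard : standard_kernel A }.

End operator.

(* Main.v *)
(* Write u = |x - y|.  The difference |x-z|^(t-n) - |y-z|^(t-n) is at most C u^t
   times the sum of two L^1-normalised bumps of scale u, centred at x and y, and
   second differences gain a power of the ratio of the two scales involved.
   Integrating products of such bumps gives the size and Hölder estimates of the
   kernel.  They also make the kernel of T T^* summable, where T sends f to
   (I^t f(x) - I^t f(y)) / u^(n/2+t), because z |-> |x-z|^(t-n) - |y-z|^(t-n) has
   integral 0; Schur's test then bounds the double integral of
   |I^t f(x) - I^t f(y)|^2 / u^(n+2t) by C |f|_2^2, and Cauchy-Schwarz bounds the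
   operator on L^2.  On Lipschitz functions of compact support, where the operator
   is given by an absolutely convergent integral, a Calderon-Zygmund decomposition
   gives the weak type (1,1), dyadic interpolation the case 1 < p < 2 and duality
   (the transpose of T_{K,s1,s2} is T_{K,s2,s1}) the case p > 2.  Density of test
   functions carries these bounds over to L^p; on L^oo the operator is the limit of
   T(f 1_B) over growing balls B, up to additive constants.  All bounds are linear
   in any M > |K|_oo, since K equals its truncation at level M almost everywhere. *)
Require Import Defs.
From HB Require Import structures.
From mathcomp Require Import all_boot all_order all_algebra.
From mathcomp Require Import all_classical all_reals all_analysis.
From mathcomp Require Import measurable_realfun ess_sup_inf ring lra.
Set Implicit Arguments.
Unset Strict Implicit.
Unset Printing Implicit Defensive.
Import Order.TTheory GRing.Theory Num.Theory.
Import numFieldNormedType.Exports.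
Local Open Scope classical_set_scope.
Local Open Scope ring_scope.

(** Lipschitz functions of bounded support are the working class: truncation, on which interpolation
    rests, preserves them, and their potentials are Lipschitz, which makes the double integral of
    the operator converge. The pieces of a Calderon-Zygmund decomposition leave this class and enter
    only through the bilinear form, which exists for all bounded functions of bounded support. So
    the operator is estimated by testing: against its sign on a set, its own restriction to a ball,
    or a power of itself. Cauchy-Schwarz and Hölder are replaced by weighted inequalities of
    arithmetic-geometric or Young type, and the half that reproduces the left-hand side is absorbed;
    this needs a priori finiteness, hence the cutoffs that Fatou's lemma removes afterwards. In
    $L^1$ only convergence in measure is available, so the extension to each $L^p$ is characterised
    by a weak-type inequality. One function must serve for all spaces that contain [f]: values for
    two exponents are compared along test functions converging in both, and the value on $L^\infty$
    must agree with the one on $L^p$. *)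

Notation meas := (measurable_fun setT).
Notation integ m f := (m.-integrable setT (EFin \o f)).

Lemma le_of_eq d (T : preorderType d) (x y : T) : x = y -> (x <= y)%O.
Proof. by move->. Qed.

Lemma le_via d (T : preorderType d) (y x z : T) : (x <= y)%O -> (y <= z)%O -> (x <= z)%O.
Proof. exact: le_trans. Qed.
Arguments le_via {d T} y {x z}.

Lemma le_lt_via d (T : preorderType d) (y x z : T) : (x <= y)%O -> (y < z)%O -> (x < z)%O.
Proof. exact: le_lt_trans. Qed.
Arguments le_lt_via {d T} y {x z}.

(** * Measurability and integrals of nonnegative functions *)

Section measurability.
Context {R : realType} {d : measure_display} {T : measurableType d}.
Implicit Types f g : T -> R.
Local Notation mf := (measurable_fun [set: T]).

Lemma mfD f g : mf f -> mf g -> mf (fun x => f x + g x).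
Proof. exact: measurable_funD. Qed.

Lemma mfB f g : mf f -> mf g -> mf (fun x => f x - g x).
Proof. exact: measurable_funB. Qed.

Lemma mfN f : mf f -> mf (fun x => - f x).
Proof. by move=> ?; apply: measurableT_comp. Qed.

Lemma mfM f g : mf f -> mf g -> mf (fun x => f x * g x).
Proof. exact: measurable_funM. Qed.

Lemma mfX f k : mf f -> mf (fun x => f x ^+ k).
Proof. exact: measurable_funX. Qed.

Lemma mfnorm f : mf f -> mf (fun x => `|f x|).
Proof. by move=> ?; apply: measurableT_comp. Qed.

Lemma mfpow f p : mf f -> mf (fun x => f x `^ p).
Proof. by move=> ?; apply: (measurableT_comp (measurable_powR p)). Qed.

Lemma mfmin f g : mf f -> mf g -> mf (fun x => Num.min (f x) (g x)).
Proof. exact: measurable_minr. Qed.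

Lemma mfmax f g : mf f -> mf g -> mf (fun x => Num.max (f x) (g x)).
Proof. exact: measurable_maxr. Qed.

(** Reduced to real powers by $x^{-1}=x\,|x|^{-1}|x|^{-1}$, which also holds at 0 because
    $0^{-1}=0$. *)
Lemma mfV f : mf f -> mf (fun x => (f x)^-1).
Proof.
move=> mff; have -> : (fun x => (f x)^-1) =
    (fun x => f x * ((`|f x| `^ (-1)) * (`|f x| `^ (-1)))).
  apply/funext => x; rewrite !powR_inv1//.
  have [->|f0] := eqVneq (f x) 0; first by rewrite invr0 mul0r.
  by rewrite -invfM -normrM ger0_norm ?sqr_ge0// invfM mulVKf.
by do 2! (apply: mfM => //); apply: mfpow; exact: mfnorm.
Qed.

Lemma mfE f : mf f -> mf (fun x => (f x)%:E).
Proof. by move=> ?; apply/measurable_EFinP. Qed.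

Lemma mfindic (A : set T) : measurable A -> mf (\1_A : T -> R).
Proof. by []. Qed.

Lemma mf_lt f g : mf f -> mf g -> measurable [set x | f x < g x].
Proof.
move=> mff mfg; have := measurable_fun_ltr mff mfg.
by move=> /(_ measurableT [set true] Logic.I); rewrite setTI; apply.
Qed.

Lemma mf_le f g : mf f -> mf g -> measurable [set x | f x <= g x].
Proof.
move=> mff mfg; have := measurable_fun_ler mff mfg.
by move=> /(_ measurableT [set true] Logic.I); rewrite setTI; apply.
Qed.

End measurability.

Section rV_measurability.
Context {R : realType} {n : nat} {d : measure_display} {T : measurableType d}.
Implicit Types f g : T -> 'rV[R]_n.
Local Notation mf := (measurable_fun [set: T]).

Lemma mfvD f g : mf f -> mf g -> mf (fun x => f x + g x).
Proof.
move=> mff mfg; apply: measurable_fun_rV => i.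
under eq_fun do rewrite mxE.
by apply: mfD; apply: (measurableT_comp (measurable_coord i)).
Qed.

Lemma mfvN f : mf f -> mf (fun x => - f x).
Proof.
move=> mff; apply: measurable_fun_rV => i.
under eq_fun do rewrite mxE.
by apply: mfN; apply: (measurableT_comp (measurable_coord i)).
Qed.

Lemma mfvB f g : mf f -> mf g -> mf (fun x => f x - g x).
Proof. by move=> ? ?; apply: mfvD => //; exact: mfvN. Qed.

Lemma mfenorm f : mf f -> mf (fun x => enorm (f x)).
Proof.
move=> mff; rewrite /enorm.
have -> : (fun x => Num.sqrt (\sum_i f x ord0 i ^+ 2)) =
    (fun x => (\sum_i f x ord0 i ^+ 2) `^ 2^-1).
  by apply/funext => x; rewrite powR12_sqrt// sumr_ge0// => i _; exact: sqr_ge0.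
apply: mfpow; apply: measurable_sum => i; apply: mfX.
by apply: (measurableT_comp (measurable_coord i)).
Qed.

Lemma mfriesz t f g : mf f -> mf g -> mf (fun x => riesz t (f x) (g x)).
Proof. by move=> ? ?; apply: mfpow; apply: mfenorm; apply: mfvD => //; exact: mfvN. Qed.

End rV_measurability.

Lemma mfcomp d1 d2 d3 (T1 : measurableType d1) (T2 : measurableType d2) (T3 : measurableType d3)
  (f : T2 -> T3) (g : T1 -> T2) :
  meas f -> meas g -> meas (fun x => f (g x)).
Proof. exact: measurableT_comp. Qed.

(** [mset] and [mfun_ext] are hooks, redefined later so that [mfun] also treats the sets and
    functions introduced there. *)
Ltac mset := fail.

Ltac mfun_ext := fail.

Ltac mfun_step := match goal with
  | H : measurable_fun _ ?f |- measurable_fun _ ?g => constr_eq f g; exact: H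
  | |- measurable_fun _ (fun _ => ?c) => exact: measurable_cst
  | |- measurable_fun _ (fun x => x) => exact: measurable_id
  | |- measurable_fun _ fst => exact: measurable_fst
  | |- measurable_fun _ snd => exact: measurable_snd
  | |- measurable_fun _ (EFin \o _) => apply/measurable_EFinP
  | |- measurable_fun _ (fun x => EFin (@?f x)) => refine (@mfE _ _ _ f _)
  | |- measurable_fun _ (fun x => GRing.add (@?f x) (GRing.opp (@?g x))) =>
      first [refine (@mfB _ _ _ f g _ _) | refine (@mfvB _ _ _ _ f g _ _)]
  | |- measurable_fun _ (fun x => GRing.add (@?f x) (@?g x)) =>
      first [refine (@mfD _ _ _ f g _ _) | refine (@mfvD _ _ _ _ f g _ _)]
  | |- measurable_fun _ (fun x => GRing.opp (@?f x)) =>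
      first [refine (@mfN _ _ _ f _) | refine (@mfvN _ _ _ _ f _)]
  | |- measurable_fun _ (fun x => GRing.mul (@?f x) (@?g x)) => refine (@mfM _ _ _ f g _ _)
  | |- measurable_fun _ (fun x => GRing.exp (@?f x) _) => refine (@mfX _ _ _ f _ _)
  | |- measurable_fun _ (fun x => GRing.inv (@?f x)) => refine (@mfV _ _ _ f _)
  | |- measurable_fun _ (fun x => Num.norm (@?f x)) => refine (@mfnorm _ _ _ f _)
  | |- measurable_fun _ (fun x => powR (@?f x) _) => refine (@mfpow _ _ _ f _ _)
  | |- measurable_fun _ (fun x => Order.min (@?f x) (@?g x)) => refine (@mfmin _ _ _ f g _ _)
  | |- measurable_fun _ (fun x => Order.max (@?f x) (@?g x)) => refine (@mfmax _ _ _ f g _ _)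
  | |- measurable_fun _ (fun x => enorm (@?f x)) => refine (@mfenorm _ _ _ _ f _)
  | |- measurable_fun _ (fun x => riesz _ (@?f x) (@?g x)) => refine (@mfriesz _ _ _ _ _ f g _ _)
  | |- measurable_fun _ (fun x => (@?f x, @?g x)) => apply: measurable_fun_pair
  | |- measurable_fun _ (indic ?A) => refine (mfindic _); mset
  | |- measurable_fun _ (fun x => indic ?A x) => refine (mfindic _); mset
  | |- measurable_fun _ _ => mfun_ext
  | |- measurable_fun _ (fun p => fst (@?f p)) => refine (@mfcomp _ _ _ _ _ _ fst f measurable_fst _)
  | |- measurable_fun _ (fun p => snd (@?f p)) => refine (@mfcomp _ _ _ _ _ _ snd f measurable_snd _)
  | H : measurable_fun _ ?f |- measurable_fun _ (fun x => ?h (@?g x)) =>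
      constr_eq f h; refine (@mfcomp _ _ _ _ _ _ f g H _)
  | H : forall z, measurable_fun _ (?f z) |- measurable_fun _ (fun x => ?h ?z (@?g x)) =>
      constr_eq f h; refine (@mfcomp _ _ _ _ _ _ (f z) g (H z) _)
  | H : forall z, measurable_fun _ (?f z) |- measurable_fun _ (?h ?z) =>
      constr_eq f h; exact: (H z)
  | |- measurable_fun ?D ?f =>
      lazymatch f with (fun _ => _) => fail | _ => change (measurable_fun D (fun x => f x)) end
  end.
Ltac mfun := repeat mfun_step.

Section nonneg_integral.
Context {R : realType} {d : measure_display} {T : measurableType d}.
Variable mu : {measure set T -> \bar R}.
Implicit Types f g : T -> R.
Local Notation mf := (measurable_fun [set: T]).

Lemma int_le f g : mf f -> mf g -> (forall x, 0 <= f x <= g x) ->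
  (\int[mu]_x (f x)%:E <= \int[mu]_x (g x)%:E)%E.
Proof.
move=> ? ? fg; apply: ge0_le_integral; try by mfun.
- by move=> x _; rewrite lee_fin; case/andP: (fg x).
- by move=> x _; rewrite lee_fin; case/andP: (fg x).
Qed.

Lemma intZl k f : 0 <= k -> mf f -> (forall x, 0 <= f x) ->
  (\int[mu]_x (k * f x)%:E = k%:E * \int[mu]_x (f x)%:E)%E.
Proof.
move=> k0 mff f0; under eq_integral do rewrite EFinM.
by rewrite ge0_integralZl//; [mfun | move=> x _; rewrite lee_fin].
Qed.

Lemma intD f g : mf f -> mf g -> (forall x, 0 <= f x) -> (forall x, 0 <= g x) ->
  (\int[mu]_x (f x + g x)%:E = \int[mu]_x (f x)%:E + \int[mu]_x (g x)%:E)%E.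
Proof.
move=> ? ? f0 g0; under eq_integral do rewrite EFinD.
by rewrite ge0_integralD//; try mfun; move=> x _; rewrite lee_fin.
Qed.

Lemma int_integ f : mf f -> (\int[mu]_x (`|f x|)%:E < +oo)%E ->
  integ mu f.
Proof. by move=> ? fi; apply/integrableP; split; [mfun|]. Qed.

Lemma integrable_int f : integ mu f ->
  (\int[mu]_x (`|f x|)%:E < +oo)%E.
Proof. by case/integrableP. Qed.

Lemma integrable_mf f : integ mu f -> mf f.
Proof. by case/integrableP => /measurable_EFinP. Qed.

(** When the extended integral of [f] is not finite, its real value is 0 by convention and the bound
    is trivial; otherwise this is the triangle inequality for integrals. *)
Lemma Rint_le f (c : \bar R) : mf f -> (\int[mu]_x (`|f x|)%:E <= c)%E ->
  (`|\int[mu]_x f x|%:E <= c)%E.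
Proof.
move=> mff fc; apply: le_trans fc.
rewrite /Rintegral.
have [fi|fi] := boolP (\int[mu]_x (f x)%:E \is a fin_num)%E; last first.
  have -> : fine (\int[mu]_x (f x)%:E)%E = 0.
    by move: fi; case: (\int[mu]_x (f x)%:E)%E.
  by rewrite normr0; apply: integral_ge0 => x _; rewrite lee_fin.
rewrite -abse_EFin fineK//.
by apply: (le_trans (le_abse_integral _ _ _)); mfun.
Qed.

Lemma Rint_ge0E f : mf f -> (forall x, 0 <= f x) -> (\int[mu]_x (f x)%:E < +oo)%E ->
  ((\int[mu]_x f x)%:E = \int[mu]_x (f x)%:E)%E.
Proof.
move=> mff f0 fi; rewrite fineK// ge0_fin_numE//.
by apply: integral_ge0 => x _; rewrite lee_fin.
Qed.

Lemma RintE f : integ mu f ->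
  ((\int[mu]_x f x)%:E = \int[mu]_x (f x)%:E)%E.
Proof. by move=> fi; rewrite fineK//; exact: integrable_fin_num. Qed.

End nonneg_integral.

Section tonelli.
Context {R : realType} {d1 d2 : measure_display}.
Context {X : measurableType d1} {Y : measurableType d2}.
Variables (m1 : {sigma_finite_measure set X -> \bar R}).
Variables (m2 : {sigma_finite_measure set Y -> \bar R}).
Implicit Types f : X * Y -> R.

Lemma mf_section1 d3 (Z : measurableType d3) (f : X * Y -> Z) x :
  meas f -> meas (fun y => f (x, y)).
Proof. by move=> mff; apply: (measurableT_comp mff); by []. Qed.

Lemma mf_section2 d3 (Z : measurableType d3) (f : X * Y -> Z) y :
  meas f -> meas (fun x => f (x, y)).
Proof. by move=> mff; apply: (measurableT_comp mff); by []. Qed.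

Lemma mf_int1 f : meas f -> (forall z, 0 <= f z) ->
  meas (fun x => \int[m2]_y (f (x, y))%:E)%E.
Proof.
move=> mff f0; apply: (@measurable_fun_fubini_tonelli_F _ _ _ _ _ m2 (fun z => (f z)%:E)).
- by mfun.
- by [].
Qed.

Lemma mf_int2 f : meas f -> (forall z, 0 <= f z) ->
  meas (fun y => \int[m1]_x (f (x, y))%:E)%E.
Proof.
move=> mff f0; apply: (@measurable_fun_fubini_tonelli_G _ _ _ _ _ m1 (fun z => (f z)%:E)).
- by mfun.
- by [].
Qed.

Lemma tonelli1 f : meas f -> (forall z, 0 <= f z) ->
  (\int[m1 \x m2]_z (f z)%:E = \int[m1]_x \int[m2]_y (f (x, y))%:E)%E.
Proof.
move=> mff f0; apply: (@fubini_tonelli1 _ _ _ _ _ m1 m2 (fun z => (f z)%:E)).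
- by mfun.
- by [].
Qed.

Lemma tonelli2 f : meas f -> (forall z, 0 <= f z) ->
  (\int[m1 \x m2]_z (f z)%:E = \int[m2]_y \int[m1]_x (f (x, y))%:E)%E.
Proof.
move=> mff f0; apply: (@fubini_tonelli2 _ _ _ _ _ m1 m2 (fun z => (f z)%:E)).
- by mfun.
- by [].
Qed.

Lemma tonelli12 f : meas f -> (forall z, 0 <= f z) ->
  (\int[m1]_x \int[m2]_y (f (x, y))%:E = \int[m2]_y \int[m1]_x (f (x, y))%:E)%E.
Proof. by move=> mff f0; rewrite -tonelli1// tonelli2. Qed.

End tonelli.

(** * Lebesgue measure on R^n and the Euclidean norm *)

Section euclidean_norm.
Context {R : realType} {n : nat}.
Implicit Types x y z : 'rV[R]_n.

Lemma enorm_sum_ge0 x : 0 <= \sum_i x ord0 i ^+ 2.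
Proof. by apply: sumr_ge0 => i _; exact: sqr_ge0. Qed.

Lemma enorm_ge0 x : 0 <= enorm x.
Proof. exact: sqrtr_ge0. Qed.
Hint Resolve enorm_ge0 : core.

Lemma sqr_enorm x : enorm x ^+ 2 = \sum_i x ord0 i ^+ 2.
Proof. by rewrite sqr_sqrtr// enorm_sum_ge0. Qed.

Lemma enormN x : enorm (- x) = enorm x.
Proof. by congr Num.sqrt; apply: eq_bigr => i _; rewrite mxE sqrrN. Qed.

Lemma enormC x y : enorm (x - y) = enorm (y - x).
Proof. by rewrite -opprB enormN. Qed.

Lemma enorm0 : enorm (0 : 'rV[R]_n) = 0.
Proof.
rewrite /enorm big1 ?sqrtr0// => i _.
by rewrite mxE expr2 mulr0.
Qed.

Lemma coord_le_enorm x i : `|x ord0 i| <= enorm x.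
Proof.
rewrite -sqrtr_sqr; apply: ler_wsqrtr.
rewrite (bigD1 i)//= lerDl; apply: sumr_ge0 => j _; exact: sqr_ge0.
Qed.

Lemma enorm_eq0 x : (enorm x == 0) = (x == 0).
Proof.
apply/idP/eqP => [/eqP x0|->]; last by rewrite enorm0.
apply/rowP => i; rewrite mxE; apply/normr0_eq0/eqP.
by rewrite eq_le normr_ge0 -x0 coord_le_enorm.
Qed.

Lemma enorm_gt0 x : (0 < enorm x) = (x != 0).
Proof. by rewrite lt_def enorm_ge0 andbT enorm_eq0. Qed.

Lemma enormB_gt0 x y : (0 < enorm (x - y)) = (x != y).
Proof. by rewrite enorm_gt0 subr_eq0. Qed.

Lemma enorm_le_coord x (c : R) : 0 <= c -> (forall i, `|x ord0 i| <= c) ->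
  enorm x <= n%:R * c.
Proof.
move=> c0 xc; rewrite -(@ler_pXn2r _ 2) ?nnegrE ?mulr_ge0// sqr_enorm.
apply: (le_via (\sum_(i < n) c ^+ 2)).
  by apply: ler_sum => i _; rewrite -real_normK ?num_real// ler_pXn2r.
rewrite sumr_const card_ord exprMn -[leLHS]mulr_natl.
apply: ler_wpM2r; first exact: sqr_ge0.
by rewrite -natrX ler_nat; case: n => // k; rewrite leq_pmulr.
Qed.

Lemma enormD x y : enorm (x + y) <= enorm x + enorm y.
Proof.
have [->|x0] := eqVneq x 0; first by rewrite enorm0 !add0r.
have [->|y0] := eqVneq y 0; first by rewrite enorm0 !addr0.
move: x0 y0; rewrite -!enorm_gt0 => x0 y0.
rewrite -(@ler_pXn2r _ 2) ?nnegrE ?addr_ge0//.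
rewrite sqrrD !sqr_enorm.
under eq_bigr do rewrite mxE sqrrD.
rewrite !big_split/= lerD2r lerD2l.
pose a := enorm x; pose b := enorm y.
suff : \sum_i x ord0 i * y ord0 i <= a * b.
  by move=> h; rewrite lerD.
(* Cauchy-Schwarz: $x_iy_i\le\frac{ab}2(x_i^2/a^2+y_i^2/b^2)$, summed over the coordinates with [a],
   [b] the two norms. *)
apply: (le_via (\sum_i 2^-1 * (a * b) *
    (x ord0 i ^+ 2 / a ^+ 2 + y ord0 i ^+ 2 / b ^+ 2))).
  apply: ler_sum => i _.
  have -> : 2^-1 * (a * b) * (x ord0 i ^+ 2 / a ^+ 2 + y ord0 i ^+ 2 / b ^+ 2) =
     x ord0 i * y ord0 i + 2^-1 * (a * b) * (x ord0 i / a - y ord0 i / b) ^+ 2.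
    by field; rewrite !gt_eqF.
  rewrite lerDl; apply: mulr_ge0; last exact: sqr_ge0.
  by apply: mulr_ge0; [lra | apply: mulr_ge0; exact: enorm_ge0].
rewrite -mulr_sumr big_split/= -!mulr_suml -!sqr_enorm -/a -/b.
by rewrite !divff ?expf_neq0 ?gt_eqF// mulrAC mulVf ?mul1r.
Qed.

Lemma enormBD x y z : enorm (x - z) <= enorm (x - y) + enorm (y - z).
Proof. by apply: le_trans (enormD _ _); rewrite addrA subrK. Qed.

End euclidean_norm.
#[export] Hint Resolve enorm_ge0 : core.
#[global] Opaque enorm.
Section generic.
Context {R : realType} {d : measure_display} {T : measurableType d}.
Variable mu : {measure set T -> \bar R}.

Lemma nneseries_geometric_le (c q : R) (u : nat -> \bar R) : 0 <= c -> 0 < q < 1 ->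
  (forall k, 0 <= u k <= (c * q ^+ k)%:E)%E ->
  (\sum_(0 <= k <oo) u k <= (c / (1 - q))%:E)%E.
Proof.
move=> c0 /andP[q0 q1] hu.
apply: lime_le; first by apply: is_cvg_nneseries => k _ _; case/andP: (hu k).
apply: nearW => k; apply: (le_via (\sum_(0 <= i < k) (c * q ^+ i)%:E)%E).
  by apply: lee_sum => i _; case/andP: (hu i).
rewrite sumEFin; apply: (le_trans _ (geometric_le_lim k c0 q0 _)) => //.
by rewrite ger0_norm// ltW.
Qed.

(** Made for dyadic decompositions: at each point one piece [h k] dominates [f], so [f] is below the
    sum of all pieces, whose integral is a geometric series. *)
Lemma int_geometric_le (f : T -> R) (h : nat -> T -> R) (c q : R) :
  0 <= c -> 0 < q < 1 -> meas f -> (forall x, 0 <= f x) ->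
  (forall k, meas (h k)) -> (forall k x, 0 <= h k x) ->
  (forall k, (\int[mu]_x (h k x)%:E <= (c * q ^+ k)%:E)%E) ->
  (forall x, exists k, f x <= h k x) ->
  (\int[mu]_x (f x)%:E <= (c / (1 - q))%:E)%E.
Proof.
move=> c0 q01 mf f0 mh h0 hc fh.
apply: (le_via (\int[mu]_x (\sum_(0 <= k <oo) (h k x)%:E))%E).
  apply: ge0_le_integral => //.
  - by move=> x _; rewrite lee_fin.
  - exact: mfE.
  - apply: (@ge0_emeasurable_sum _ _ _ setT (fun k x => (h k x)%:E) xpredT).
    + by move=> k x _ _; rewrite lee_fin.
    + by move=> k _; apply: mfE.
  - move=> x _; have [k fk] := fh x.
    apply: (le_via (\sum_(0 <= i < k.+1) (h i x)%:E)%E).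
      rewrite big_nat_recr//=; apply: (le_via (h k x)%:E); first by [].
      by rewrite leeDr// sume_ge0// => i _; rewrite lee_fin.
    by apply: nneseries_lim_ge => i _ _; rewrite lee_fin.
rewrite integral_nneseries//.
- apply: nneseries_geometric_le => // k; rewrite hc andbT.
  by apply: integral_ge0 => x _; rewrite lee_fin.
- by move=> k; apply: mfE.
- by move=> k x _; rewrite lee_fin.
Qed.

End generic.

Section translation_invariance.
Context {R : realType}.

Lemma lebesgue_measure_shift (v : R) (A : set R) : measurable A ->
  lebesgue_measure ((fun x : R => x + v) @^-1` A) = lebesgue_measure A.
Proof.
move=> mA.
have mv : meas (fun x : R => x + v) by mfun.
have -> : lebesgue_measure ((fun x : R => x + v) @^-1` A) =
  pushforward lebesgue_measure (fun x : measurableTypeR R => (x + v : measurableTypeR R)) A by [].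
apply/esym/lebesgue_measure_unique => //= _ [[a b]] _ <-.
rewrite /pushforward.
have -> : (fun x => x + v) @^-1` `]a, b] = `]a - v, b - v]%classic.
  by apply/seteqP; split => x /=; rewrite !in_itv/= ltrBlDr lerBrDr.
rewrite !lebesgue_measure_itv/= !lte_fin ltrD2r.
by case: ifP => // _; rewrite -!EFinD opprB addrA subrK.
Qed.

(** Induction on the dimension: through [consrV] a translation becomes a product of two
    translations, and the product measure is determined by its values on rectangles. *)
Lemma lebesgue_rV_shift n (v : 'rV[R]_n) (A : set 'rV[R]_n) : measurable A ->
  lebesgue_rV n ((fun x => x + v) @^-1` A) = lebesgue_rV n A.
Proof.
elim: n v A => [|n IH] v A mA.
  by congr (lebesgue_rV _ _); apply/seteqP; split => x /=;
    rewrite [x + v]thinmx0 [x]thinmx0.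
rewrite /= /lebesgue_step.
pose w := unconsrV v.
pose S (p : R * 'rV[R]_n) := (p.1 + w.1, p.2 + w.2).
have mS : meas S by apply: measurable_fun_pair; mfun.
have consS p : consrV p + v = consrV (S p).
  apply/rowP => i; rewrite !mxE; case: (unliftP ord0 i) => [j ->|->].
    by rewrite /= !mxE.
  by [].
have mcA : measurable (@consrV R n @^-1` A).
  by rewrite -[X in measurable X]setTI; exact: measurable_consrV.
pose P := (@lebesgue_measure R \x lebesgue_rV n)%E.
pose P' := pushforward (@lebesgue_measure R \x lebesgue_rV n)%E
  (S : measurableTypeR R * 'rV[R]_n -> measurableTypeR R * 'rV[R]_n).
transitivity (P' (@consrV R n @^-1` A)).
  by rewrite /P'; congr (_ _); apply/seteqP; split => p /=; rewrite consS.
apply/esym/product_measure_unique => //= B C mB mC; rewrite /pushforward.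
have -> : S @^-1` (B `*` C) =
    ((fun x => x + w.1) @^-1` B) `*` ((fun x => x + w.2) @^-1` C) by [].
rewrite product_measure1E.
- by rewrite IH// -(lebesgue_measure_shift w.1).
- by rewrite -[X in measurable X]setTI; apply: mfD.
- by rewrite -[X in measurable X]setTI; apply: mfvD.
Qed.

Context {n : nat}.
Local Notation mu := (@lebesgue_rV R n).

Lemma int_shift (f : 'rV[R]_n -> \bar R) (v : 'rV[R]_n) : meas f ->
  (forall x, 0 <= f x)%E -> (\int[mu]_x f (x + v)%R = \int[mu]_x f x)%E.
Proof.
move=> mf f0.
have mv : meas (fun x : 'rV[R]_n => x + v) by mfun.
have := @ge0_integral_pushforward _ _ _ _ R _ mv mu setT f measurableT mf.
rewrite preimage_setT => <-; last by [].
apply: eq_measure_integral => A mA _; exact: lebesgue_rV_shift.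
Qed.

End translation_invariance.

Section topology_measurability.
Context {R : realType} {n : nat}.

Lemma rV_nbhs_box (x : 'rV[R]_n) (U : set 'rV[R]_n) : nbhs x U ->
  exists2 e : R, 0 < e & forall y : 'rV[R]_n, (forall i, `|y ord0 i - x ord0 i| < e) -> U y.
Proof.
move/nbhs_ballP => [e /= e0 xU]; exists e => // y xy; apply: xU; split => // i j.
by rewrite (ord1 i) /ball /= distrC.
Qed.

Lemma rV_nbhs_enorm (x : 'rV[R]_n) (U : set 'rV[R]_n) : nbhs x U ->
  exists2 e : R, 0 < e & forall y, enorm (y - x) < e -> U y.
Proof.
move=> /rV_nbhs_box[e e0 eU]; exists e => // y yx; apply: eU => i.
by apply: le_lt_trans yx; have := coord_le_enorm (y - x) i; rewrite !mxE.
Qed.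

(** The sigma-algebra is generated by the coordinates, so an open set has to be written as a
    countable union of boxes: those with rational centre and radius $1/(k+1)$ that it contains. *)
Lemma open_measurable_rV (U : set 'rV[R]_n) : open U -> measurable U.
Proof.
move=> oU.
pose B (p : 'rV[rat]_n * nat) : set 'rV[R]_n :=
  [set y | forall i, `|y ord0 i - ratr (p.1 ord0 i)| < p.2.+1%:R^-1].
have mB p : measurable (B p).
  have -> : B p = \bigcap_(i in [set: 'I_n])
      [set y | `|y ord0 i - ratr (p.1 ord0 i)| < p.2.+1%:R^-1].
    by apply/seteqP; split => y /= yB i; [move=> _; exact: yB|exact: yB].
  apply: fin_bigcap_measurable => // i _.
  apply: mf_lt; last by mfun.
  by mfun; exact: measurable_coord.
have -> : U = \bigcup_p (if `[< B p `<=` U >] then B p else set0).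
  apply/seteqP; split => [x Ux|x [p _]]; last by case: asboolP => // pU /pU.
  have [e e0 eU] := rV_nbhs_box (open_nbhs_nbhs (conj oU Ux)).
  pose k := Num.truncn (2 / e).
  have ke : 2 * k.+1%:R^-1 < e.
    rewrite ltr_pdivrMr// -ltr_pdivrMl// mulrC; exact: truncnS_gt.
  have q i : {q : rat | `|x ord0 i - ratr q| < k.+1%:R^-1}.
    apply: cid; have [|q] := @rat_in_itvoo R (x ord0 i - k.+1%:R^-1) (x ord0 i + k.+1%:R^-1).
      by rewrite ltrBlDr -addrA ltrDl.
    by rewrite in_itv/= => /andP[q1 q2]; exists q; move: q1 q2; set c := _^-1 => q1 q2; rewrite ltr_norml; lra.
  exists (\row_i sval (q i), k) => //.
  case: asboolP => [_|[]].
    by move=> i; rewrite mxE; exact: svalP (q i).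
  move=> y By; apply: eU => i.
  have := By i; rewrite mxE /= => h1; have h2 := svalP (q i).
  rewrite distrC in h2.
  rewrite -(subrK (ratr (sval (q i))) (y ord0 i)) -addrA.
  move: h1 h2 ke; set c := _^-1 => h1 h2 ke.
  by apply: (le_lt_trans (ler_normD _ _)); lra.
apply: countable_bigcupT_measurable => [|p]; first by [].
by case: ifP.
Qed.

Lemma closed_measurable_rV (U : set 'rV[R]_n) : closed U -> measurable U.
Proof. by move=> cU; rewrite -(setCK U); apply: measurableC; apply: open_measurable_rV; exact: closed_openC. Qed.

Lemma compact_measurable_rV (U : set 'rV[R]_n) : compact U -> measurable U.
Proof. by move=> cU; apply: closed_measurable_rV; apply: compact_closed. Qed.

Lemma continuous_measurable_rV (f : 'rV[R]_n -> R) : continuous f -> meas f.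
Proof.
move=> cf; apply: (measurability _ (RGenOInfty.measurableE R)).
move=> /= _ [_ [a ->] <-]; rewrite setTI; apply: open_measurable_rV.
by apply: open_comp => // x _; exact: cf.
Qed.

End topology_measurability.

Section balls.
Context {R : realType} {n : nat}.
Local Notation mu := (@lebesgue_rV R n).
Implicit Types a x : 'rV[R]_n.

Definition cball a (r : R) : set 'rV[R]_n := [set x | enorm (x - a) <= r].

Lemma meas_cball a r : measurable (cball a r).
Proof. by apply: mf_le; mfun. Qed.

Lemma meas_eball a r : measurable (eball a r).
Proof. by apply: mf_lt; mfun. Qed.

Lemma measurable_box (a b : 'I_n -> R) :
  measurable [set x : 'rV[R]_n | forall i, a i <= x ord0 i <= b i].
Proof.
have -> : [set x : 'rV[R]_n | forall i, a i <= x ord0 i <= b i] =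
  \bigcap_(i in [set: 'I_n]) ([set x | a i <= x ord0 i] `&` [set x | x ord0 i <= b i]).
  apply/seteqP; split => x /= h i; first by move=> _; have /andP[] := h i.
  by have [] := h i Logic.I => /= -> ->.
apply: fin_bigcap_measurable => // i _.
by apply: measurableI; apply: mf_le; mfun; exact: measurable_coord.
Qed.

Lemma mu_cball_le a r : 0 <= r -> (mu (cball a r) <= ((2 * r) ^+ n)%:E)%E.
Proof.
move=> r0.
have -> : (2 * r) ^+ n = \prod_(i < n) ((a ord0 i + r) - (a ord0 i - r)).
  under eq_bigr do rewrite opprB addrC addrA subrK -mulr2n -mulr_natl.
  by rewrite prodr_const card_ord.
rewrite -lebesgue_rV_box; last by move=> i; lra.
apply: le_measure; rewrite ?inE; [exact: meas_cball|exact: measurable_box|].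
move=> x /= xa i; have := le_trans (coord_le_enorm (x - a) i) xa.
by rewrite !mxE ler_norml; lra.
Qed.

Lemma mu_cball_lty a r : (mu (cball a r) < +oo)%E.
Proof.
have [r0|r0] := leP 0 r; first exact: le_lt_trans (mu_cball_le a r0) (ltry _).
rewrite (_ : cball a r = set0) ?measure0//.
by rewrite -subset0 => x /= xa; have := le_trans (enorm_ge0 _) xa; lra.
Qed.

End balls.

Ltac mset ::= first [match goal with H : measurable ?A |- measurable ?B => constr_eq A B; exact: H end |
  exact: meas_cball | exact: meas_eball | apply: measurableC; mset].
Section real_powers.
Context {R : realType}.
Implicit Types a b t x : R.

Lemma powR_add x a b : 0 < x -> x `^ a * x `^ b = x `^ (a + b).
Proof. by move=> x0; rewrite powRD//; apply/implyP => _; rewrite gt_eqF. Qed.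

Lemma powR_neg_antitone a x y : 0 <= a -> 0 < x -> x <= y -> y `^ (- a) <= x `^ (- a).
Proof.
move=> a0 x0 xy; rewrite !powRN lef_pV2 ?posrE ?powR_gt0//; last by lra.
by apply: ge0_ler_powR => //; rewrite nnegrE; lra.
Qed.

Lemma dyadic_scale t : 1 <= t -> exists k, 2 ^+ k <= t < 2 ^+ k.+1.
Proof.
move=> t1; have ex : exists k, t < 2 ^+ k.
  by exists (Num.Def.archi_bound t); apply: upper_nthrootP.
pose m := ex_minn ex.
have : t < 2 ^+ m /\ (forall k, t < 2 ^+ k -> (m <= k)%N) by rewrite /m; case: ex_minnP.
case: m => [|k] [tm mk]; first by move: tm; rewrite ltNge t1.
exists k; rewrite tm andbT leNgt; apply/negP => /mk; by rewrite ltnn.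
Qed.

Lemma powR_bernoulli a h : 0 <= a -> 0 <= h -> 1 - a * h <= (1 + h) `^ (- a).
Proof.
move=> a0 h0; rewrite /powR gt_eqF; last by lra.
apply: (le_trans _ (expR_ge1Dx _)); rewrite lerD2l mulNr lerN2 ler_wpM2l//.
by apply: le_ln1Dx; lra.
Qed.

Lemma le_interpolate (X A B l : R) : 0 <= X -> X <= A -> X <= B -> 0 <= l <= 1 ->
  X <= A `^ l * B `^ (1 - l).
Proof.
move=> X0 XA XB /andP[l0 l1].
move: X0; rewrite le_eqVlt => /predU1P[<-|X0]; first by rewrite mulr_ge0// powR_ge0.
have -> : X = X `^ l * X `^ (1 - l).
  by rewrite powR_add// addrC subrK powRr1// ltW.
by apply: ler_pM; rewrite ?powR_ge0// ge0_ler_powR ?nnegrE ?subr_ge0//; lra.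
Qed.

End real_powers.

(** * Normalised bumps and differences of Riesz kernels *)

(* [annular d u] is, up to constants, the L^1-normalised dilate to scale u of
   the profile min(r, 1/r)^d / r^n. *)
Section annular.
Context {R : realType} (n : nat).
Hypothesis n0 : (0 < n)%N.
Implicit Types d u r P Q : R.

Definition annular d u r : R := r `^ (- n%:R) * (Num.min (r / u) (u / r)) `^ d.

Lemma annular_ge0 d u r : 0 <= annular d u r.
Proof. by rewrite mulr_ge0// powR_ge0. Qed.

Lemma annular_r0 d u : annular d u 0 = 0.
Proof. by rewrite /annular powR0 ?mul0r// oppr_eq0 pnatr_eq0 -lt0n. Qed.

Lemma annular_u0 d r : d != 0 -> annular d 0 r = 0.
Proof. by move=> d0; rewrite /annular invr0 mulr0 mul0r minxx powR0 ?mulr0. Qed.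

Lemma annular_ler d u r : 0 < r -> r <= u -> annular d u r = r `^ (- n%:R) * (r / u) `^ d.
Proof.
move=> r0 ru; rewrite /annular; congr (_ * _ `^ _); apply/min_idPl.
have u0 : 0 < u by lra.
apply: (@le_trans _ _ 1); first by rewrite ler_pdivrMr// mul1r.
by rewrite ler_pdivlMr// mul1r.
Qed.

Lemma annular_geu d u r : 0 < u -> u <= r -> annular d u r = r `^ (- n%:R) * (u / r) `^ d.
Proof.
move=> u0 ur; rewrite /annular; congr (_ * _ `^ _); apply/min_idPr.
have r0 : 0 < r by lra.
apply: (@le_trans _ _ 1); first by rewrite ler_pdivrMr// mul1r.
by rewrite ler_pdivlMr// mul1r.
Qed.

Lemma annular_min01 u r : 0 <= u -> 0 <= r -> 0 <= Num.min (r / u) (u / r) <= 1.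
Proof.
move=> u0 r0; rewrite le_min !divr_ge0//= ge_min.
have [ur|ru] := leP u r.
  move: u0; rewrite le_eqVlt => /predU1P[<-|u0]; first by rewrite invr0 mulr0 ler01.
  by apply/orP; right; rewrite ler_pdivrMr; lra.
by apply/orP; left; rewrite ler_pdivrMr; lra.
Qed.

Lemma annular_le_pow d u r : 0 <= d -> 0 <= u -> 0 <= r -> annular d u r <= r `^ (- n%:R).
Proof.
move=> d0 u0 r0; rewrite ler_piMr ?powR_ge0//.
have /andP[m0 m1] := annular_min01 u0 r0.
rewrite -[leRHS](_ : 1 `^ d = 1); last by rewrite powR1.
by apply: ge0_ler_powR => //; rewrite nnegrE.
Qed.

Lemma annular_le_exp d d' u r : 0 < d' <= d -> 0 <= u -> 0 <= r ->
  annular d u r <= annular d' u r.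
Proof.
move=> /andP[d0 dd] u0 r0; rewrite ler_wpM2l ?powR_ge0//.
have /andP[] := annular_min01 u0 r0; rewrite le_eqVlt => /predU1P[<- _|m0 m1].
  by rewrite !powR0; lra.
by apply: ger_powR => //; rewrite m0.
Qed.

(** Below the scale [u] the bump is a multiple of $r^{d-n}$, which decreases because $d\le1\le n$;
    above it both factors decrease. *)
Lemma annular_antitone d u r r' : 0 < d <= 1 -> 0 <= u -> 0 < r -> r <= r' ->
  annular d u r' <= annular d u r.
Proof.
move=> /andP[d0 d1] u0 r0 rr'.
move: u0; rewrite le_eqVlt => /predU1P[<-|u0]; first by rewrite !annular_u0 ?gt_eqF.
have N0 : 0 <= n%:R - d by rewrite subr_ge0 (le_trans d1)// ler1n.
have small (s s' : R) : 0 < s -> s <= s' -> s' <= u -> annular d u s' <= annular d u s.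
  move=> s0 ss' s'u; have s'0 : 0 < s' by lra.
  rewrite !annular_ler//; last by lra.
  rewrite !powRM ?invr_ge0; try lra.
  rewrite !mulrA ler_wpM2r ?powR_ge0// !powR_add//.
  have -> : - n%:R + d = - (n%:R - d) by rewrite opprB addrC.
  exact: powR_neg_antitone.
have large (s s' : R) : 0 < s -> s <= s' -> u <= s -> annular d u s' <= annular d u s.
  move=> s0 ss' us; have s'0 : 0 < s' by lra.
  rewrite !annular_geu//; last by lra.
  apply: ler_pM; rewrite ?powR_ge0//.
    exact: powR_neg_antitone.
  apply: ge0_ler_powR; rewrite ?nnegrE ?divr_ge0; try lra.
  by rewrite ler_pM2l// lef_pV2.
have [r'u|ur'] := leP r' u; first exact: small.
have [ru|ur] := leP r u; last by apply: large => //; exact: ltW.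
by apply: (le_via (annular d u u)); [apply: large => //; exact: ltW|exact: small].
Qed.

Lemma annular_max2 d P Q : 0 < d <= 1 -> 0 <= P -> 0 <= Q ->
  (forall u, 0 <= u -> annular d u P <= annular d u Q) \/
  (forall u, 0 <= u -> annular d u Q <= annular d u P).
Proof.
move=> d01; rewrite le_eqVlt => /predU1P[<- _|P0].
  by left=> u u0; rewrite annular_r0 annular_ge0.
rewrite le_eqVlt => /predU1P[<-|Q0].
  by right=> u u0; rewrite annular_r0 annular_ge0.
by have [PQ|QP] := leP P Q; [right|left]=> u u0; apply: annular_antitone => //; exact: ltW.
Qed.

(** By monotonicity in the distance, the same [m] maximises the bump at every scale. Interpolation
    between two scales needs this: both sums of bumps are replaced by a bump at the same distance,
    and no cross terms appear. *)
Lemma annular_max4 d P1 P2 P3 P4 : 0 < d <= 1 -> 0 <= P1 -> 0 <= P2 -> 0 <= P3 -> 0 <= P4 ->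
  exists2 m : R, [\/ m = P1, m = P2, m = P3 | m = P4] &
  forall u, 0 <= u -> [/\ annular d u P1 <= annular d u m, annular d u P2 <= annular d u m,
    annular d u P3 <= annular d u m & annular d u P4 <= annular d u m].
Proof.
move=> d01 p1 p2 p3 p4.
have [h12|h12] := annular_max2 d01 p1 p2;
have [h34|h34] := annular_max2 d01 p3 p4.
- have [h|h] := annular_max2 d01 p2 p4; [exists P4; first by constructor 4|exists P2; first by constructor 2];
  move=> u u0; move: (h12 u u0) (h34 u u0) (h u u0);
  set A := annular d u P1; set B := annular d u P2; set C := annular d u P3;
  set D := annular d u P4 => *; split; lra.
- have [h|h] := annular_max2 d01 p2 p3; [exists P3; first by constructor 3|exists P2; first by constructor 2];
  move=> u u0; move: (h12 u u0) (h34 u u0) (h u u0);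
  set A := annular d u P1; set B := annular d u P2; set C := annular d u P3;
  set D := annular d u P4 => *; split; lra.
- have [h|h] := annular_max2 d01 p1 p4; [exists P4; first by constructor 4|exists P1; first by constructor 1];
  move=> u u0; move: (h12 u u0) (h34 u u0) (h u u0);
  set A := annular d u P1; set B := annular d u P2; set C := annular d u P3;
  set D := annular d u P4 => *; split; lra.
- have [h|h] := annular_max2 d01 p1 p3; [exists P3; first by constructor 3|exists P1; first by constructor 1];
  move=> u u0; move: (h12 u u0) (h34 u u0) (h u u0);
  set A := annular d u P1; set B := annular d u P2; set C := annular d u P3;
  set D := annular d u P4 => *; split; lra.
Qed.

(** The two regimes account for the constraints on [d]. For $P\le u$ the larger power alone
    suffices, and $P^t=u^t(P/u)^t$ asks for $d\le t$. For $P>u$ Bernoulli's inequality gains a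
    factor $u/P$, of which $(u/P)^{1-t}$ is left once $P^t$ has been exchanged for $u^t$; this asks
    for $d\le1-t$. *)
Lemma powR_diff_annular_ord (t : R) d u P Q : 0 < t < 1 -> 0 < d <= t -> d <= 1 - t ->
  0 < P -> P <= Q -> Q <= P + u ->
  `|P `^ (t - n%:R) - Q `^ (t - n%:R)| <= n%:R * u `^ t * annular d u P.
Proof.
move=> /andP[t0 t1] /andP[d0 dt] dt1 P0 PQ QPu.
have Q0 : 0 < Q by lra.
have N1 : 1 <= n%:R :> R by rewrite ler1n.
have NE : t - n%:R = - (n%:R - t) by rewrite opprB.
have a0 : 0 <= n%:R - t by lra.
have antit (s s' : R) : 0 < s -> s <= s' -> s' `^ (t - n%:R) <= s `^ (t - n%:R).
  by move=> s0 ss'; rewrite NE; exact: powR_neg_antitone.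
rewrite ger0_norm ?subr_ge0; last exact: antit.
have [uE|u0] := leP u 0.
  have -> : Q = P by lra.
  by rewrite subrr !mulr_ge0 ?powR_ge0.
have PtE : P `^ (t - n%:R) = P `^ (- n%:R) * P `^ t.
  by rewrite powR_add// addrC.
have [Pu|uP] := leP P u.
  apply: (le_via (P `^ (t - n%:R))); first by rewrite gerBl powR_ge0.
  rewrite annular_ler// PtE -mulrA.
  apply: (le_via (u `^ t * (P `^ (- n%:R) * (P / u) `^ d))).
    rewrite mulrCA ler_wpM2l ?powR_ge0//.
    apply: (le_via (u `^ t * (P / u) `^ t)).
      rewrite -powRM; [|exact: ltW|by rewrite divr_ge0// ltW].
      have -> : u * (P / u) = P by field; rewrite gt_eqF.
      by [].
    rewrite ler_wpM2l ?powR_ge0// ger_powR// divr_gt0//=.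
    by rewrite ler_pdivrMr// mul1r.
  by rewrite ler_peMl// !mulr_ge0 ?powR_ge0.
apply: (le_via (P `^ (t - n%:R) * ((n%:R - t) * (u / P)))).
  have : P `^ (t - n%:R) * (1 - (n%:R - t) * (u / P)) <= Q `^ (t - n%:R).
    apply: (le_via ((P + u) `^ (t - n%:R))); last exact: antit.
    have -> : P + u = P * (1 + u / P) by field; rewrite gt_eqF.
    rewrite powRM; [|lra|by rewrite addr_ge0// divr_ge0// ltW].
    rewrite ler_wpM2l ?powR_ge0// NE; apply: powR_bernoulli => //.
    by rewrite divr_ge0// ltW.
  by rewrite mulrBr; lra.
rewrite annular_geu//; last exact: ltW.
rewrite mulrCA -mulrA; apply: ler_pM => //.
- by rewrite mulr_ge0 ?powR_ge0// divr_ge0// ltW.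
- by lra.
rewrite PtE -mulrA [leRHS]mulrCA ler_wpM2l ?powR_ge0//.
apply: (le_via (u `^ t * (u / P) `^ (1 - t))).
  rewrite -[X in P `^ t * X]powRr1; last by rewrite divr_ge0// ltW.
  have -> : (u / P) `^ 1 = (u / P) `^ (1 - t) * (u / P) `^ t.
    by rewrite powR_add ?divr_gt0// subrK.
  rewrite mulrCA [leRHS]mulrC ler_wpM2l ?powR_ge0// -powRM; [|exact: ltW|by rewrite divr_ge0// ltW].
  have -> : P * (u / P) = u by field; rewrite gt_eqF.
  by [].
rewrite ler_wpM2l ?powR_ge0// ger_powR// divr_gt0//=.
by rewrite ler_pdivrMr// mul1r ltW.
Qed.

(** Symmetric form of the preceding bound. The hypothesis $u\le P+Q$ handles the convention
    $0^{t-n}=0$: at $P=0$ it forces $Q=u$, and the bump at [Q] then bounds the remaining power. *)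
Lemma powR_diff_annular (t : R) d u P Q : 0 < t < 1 -> 0 < d <= t -> d <= 1 - t ->
  0 <= P -> 0 <= Q -> Q <= P + u -> P <= Q + u -> u <= P + Q ->
  `|P `^ (t - n%:R) - Q `^ (t - n%:R)| <=
  n%:R * u `^ t * (annular d u P + annular d u Q).
Proof.
move=> t01 d0t dt1 P0 Q0 QPu PQu uPQ.
have N1 : 1 <= n%:R :> R by rewrite ler1n.
have tn : t - n%:R != 0 by rewrite lt_eqF; lra.
have c0 (v : R) : 0 <= n%:R * u `^ t * annular d u v.
  by rewrite !mulr_ge0 ?powR_ge0.
have zero (v : R) : 0 <= v -> `|v `^ (t - n%:R)| <= n%:R * v `^ t * annular d v v.
  rewrite le_eqVlt => /predU1P[<-|v0].
    by rewrite powR0// normr0 annular_r0.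
  rewrite ger0_norm ?powR_ge0// annular_ler// divff ?gt_eqF// powR1 mulr1.
  by rewrite -mulrA powR_add// ler_peMl ?powR_ge0.
move: P0; rewrite le_eqVlt => /predU1P[P0|P0].
  have uE : u = Q by lra.
  by rewrite -P0 powR0// sub0r normrN annular_r0 add0r uE zero.
move: Q0; rewrite le_eqVlt => /predU1P[Q0|Q0].
  have uE : u = P by lra.
  by rewrite -Q0 powR0// subr0 annular_r0 addr0 uE zero// ltW.
have [PQ|QP] := leP P Q.
  apply: (le_trans (powR_diff_annular_ord t01 d0t dt1 P0 PQ QPu)).
  by rewrite mulrDr lerDl.
rewrite distrC; apply: (le_trans (powR_diff_annular_ord t01 d0t dt1 Q0 (ltW QP) PQu)).
by rewrite mulrDr lerDr.
Qed.

(* Interpolates the bounds at the scales u and v of a second difference. *)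
Lemma annular_interpolate (c X t : R) d (l : R) u (v : R) P1 P2 P3 P4 :
  0 <= c -> 0 <= X -> 0 <= t -> 0 < d <= 1 -> 0 <= l < 1 -> 0 <= u -> 0 <= v ->
  0 <= P1 -> 0 <= P2 -> 0 <= P3 -> 0 <= P4 ->
  X <= c * v `^ t * (annular d v P1 + annular d v P2 + annular d v P3 + annular d v P4) ->
  X <= c * u `^ t * (annular d u P1 + annular d u P2 + annular d u P3 + annular d u P4) ->
  X <= 4 * c * v `^ (t * l) * u `^ (t * (1 - l)) *
     (annular (d * (1 - l)) u P1 + annular (d * (1 - l)) u P2 +
      annular (d * (1 - l)) u P3 + annular (d * (1 - l)) u P4).
Proof.
move=> c0 X0 t0 d01 /andP[l0 l1] u0 v0 p1 p2 p3 p4 Xv Xu.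
have [m mP mmax] := annular_max4 d01 p1 p2 p3 p4.
have m0 : 0 <= m by case: mP => ->.
have le4 (w : R) : 0 <= w -> c * w `^ t * (annular d w P1 + annular d w P2 +
    annular d w P3 + annular d w P4) <= 4 * c * w `^ t * annular d w m.
  move=> w0; have [a1 a2 a3 a4] := mmax w w0.
  have -> : 4 * c * w `^ t * annular d w m = c * w `^ t * (4 * annular d w m) by ring.
  apply: ler_wpM2l; first by rewrite mulr_ge0// powR_ge0.
  move: a1 a2 a3 a4; set A := annular d w P1; set B := annular d w P2.
  set C := annular d w P3; set D := annular d w P4; set E := annular d w m; lra.
have {}Xv := le_trans Xv (le4 v v0).
have {}Xu := le_trans Xu (le4 u u0).
have l01 : 0 <= l <= 1 by rewrite l0 ltW.
apply: (le_trans (le_interpolate X0 Xv Xu l01)).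
set A := (X in _ <= _ * X).
have mA : annular (d * (1 - l)) u m <= A.
  have h P : 0 <= annular (d * (1 - l)) u P by exact: annular_ge0.
  rewrite /A; move: (h P1) (h P2) (h P3) (h P4).
  set p := annular _ u P1; set q := annular _ u P2; set r := annular _ u P3.
  by set w := annular _ u P4; case: mP => -> *; rewrite -/p -/q -/r -/w; lra.
have z0 : 0 <= 4 * c by rewrite mulr_ge0.
move: (4 * c) z0 => z z0.
apply: (le_via (z * v `^ (t * l) * u `^ (t * (1 - l)) * annular (d * (1 - l)) u m));
  last by rewrite ler_wpM2l ?mulr_ge0 ?powR_ge0.
rewrite (@powRM _ (z * v `^ t)) ?mulr_ge0 ?powR_ge0 ?annular_ge0//.
rewrite (@powRM _ (z * u `^ t)) ?mulr_ge0 ?powR_ge0 ?annular_ge0//.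
rewrite (@powRM _ z (v `^ t)) ?powR_ge0// (@powRM _ z (u `^ t)) ?powR_ge0//.
rewrite -(powRrM v) -(powRrM u).
have zE : z `^ l * z `^ (1 - l) = z.
  move: z0; rewrite le_eqVlt => /predU1P[<-|z0].
    by rewrite (@powR0 _ (1 - l)) ?mulr0// subr_eq0 gt_eqF.
  by rewrite powR_add// addrC subrK powRr1// ltW.
set M := annular d v m `^ l * annular d u m `^ (1 - l).
have -> : z `^ l * v `^ (t * l) * annular d v m `^ l *
    (z `^ (1 - l) * u `^ (t * (1 - l)) * annular d u m `^ (1 - l)) =
  (z `^ l * z `^ (1 - l)) * v `^ (t * l) * u `^ (t * (1 - l)) * M.
  rewrite /M; move: (z `^ l) (z `^ (1 - l)) (v `^ (t * l)) (u `^ (t * (1 - l)))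
    (annular d v m `^ l) (annular d u m `^ (1 - l)) => a1 a2 a3 a4 a5 a6.
  by ring.
rewrite zE ler_wpM2l ?mulr_ge0 ?powR_ge0// /M.
move: m0; rewrite le_eqVlt => /predU1P[<-|m0].
  by rewrite !annular_r0 [X in _ * X]powR0 ?mulr0//; rewrite subr_eq0 gt_eqF.
(* At the scale [v] only the size $m^{-n}$ is kept; the decay, with exponent $d(1-l)$, comes from
   the scale [u]. *)
apply: (le_via ((m `^ (- n%:R)) `^ l * annular d u m `^ (1 - l))).
  rewrite ler_wpM2r ?powR_ge0// ge0_ler_powR ?nnegrE ?annular_ge0 ?powR_ge0//.
  by apply: annular_le_pow; lra.
have /andP[m1 _] := annular_min01 u0 (ltW m0).
rewrite /annular powRM ?powR_ge0// -!powRrM mulrA powR_add//.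
by rewrite -mulrDr addrC subrK mulr1.
Qed.

End annular.

Section annular_integrals.
Context {R : realType} {n : nat}.
Hypothesis n0 : (0 < n)%N.
Local Notation mu := (@lebesgue_rV R n).
Local Notation mu2 := (@lebesgue_rV R n \x @lebesgue_rV R n)%E.
Local Notation X := 'rV[R]_n.
Local Notation G := (@annular R n).

Lemma mfannular dT (T : measurableType dT) (f g : T -> R) (d : R) :
  meas f -> meas g ->
  meas (fun x => G d (f x) (g x)).
Proof. by move=> mf mg; rewrite /annular; mfun. Qed.

(** Two geometric series of ratio $2^{-d}$, one for the dyadic shells outside the scale and one for
    those inside. A shell of radius [s] costs $8^n$ because the ball of radius [4s] lies in a cube
    of side [8s]. *)
Definition annular_cst (d : R) : R := 2 * 8 ^+ n / (1 - 2 `^ (- d)).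

Lemma pow2N_lt1 (d : R) : 0 < d -> (0 : R) < 2 `^ (- d) < 1.
Proof.
move=> d0; rewrite powR_gt0//= powRN invf_lt1 ?powR_gt0//.
by rewrite /powR gt_eqF//= expR_gt1 mulr_gt0// ln_gt0// ltr1n.
Qed.

Lemma annular_cst_ge0 (d : R) : 0 < d -> 0 <= annular_cst d.
Proof.
by move=> /pow2N_lt1/andP[_ h]; rewrite divr_ge0 ?exprn_ge0// subr_ge0 ltW.
Qed.

Lemma int_annular (d u : R) (a : X) : 0 < d -> 0 <= u ->
  (\int[mu]_x (G d u (enorm (x - a)))%:E <= (annular_cst d)%:E)%E.
Proof.
move=> d0; rewrite le_eqVlt => /predU1P[<-|u0].
  under eq_integral do rewrite annular_u0 ?gt_eqF//.
  by rewrite integral0 lee_fin annular_cst_ge0.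
set q := 2 `^ (- d).
have q01 : 0 < q < 1 by apply: pow2N_lt1.
have q0 : 0 <= q by case/andP: q01 => /ltW.
(* A point at distance [r] lies in a shell $s\le r\le 2s$, with [s = s1 k] if $r\ge u$ and
   [s = s2 k] if $r<u$. There $\min(r/u,u/r)\le2^{-k}$, and [e s] dominates $r^{-n}$. *)
pose s1 k : R := u * 2 ^+ k.
pose s2 k : R := u / 2 ^+ k.+1.
have s10 k : 0 < s1 k by rewrite mulr_gt0.
have s20 k : 0 < s2 k by rewrite divr_gt0.
pose e (s : R) (x : X) : R := s `^ (- n%:R) * \1_(cball a (4 * s)) x.
have e0 s x : 0 <= e s x by rewrite mulr_ge0 ?powR_ge0.
have me s : meas (e s).
  by apply: mfM => //; apply: mfindic; exact: meas_cball.
have ie s : 0 < s -> (\int[mu]_x (e s x)%:E <= (8 ^+ n)%:E)%E.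
  move=> s0; rewrite intZl ?powR_ge0//; last by apply: mfindic; exact: meas_cball.
  rewrite integral_indic//; last exact: meas_cball.
  rewrite setIT.
  apply: (le_via ((s `^ (- n%:R))%:E * ((2 * (4 * s)) ^+ n)%:E)%E).
    by apply: lee_wpmul2l; rewrite ?lee_fin ?powR_ge0//; apply: mu_cball_le; lra.
  rewrite lee_fin powR_invn ?(ltW s0)// -exprVn -exprMn.
  suff -> : s^-1 * (2 * (4 * s)) = 8 by [].
  by field; rewrite gt_eqF.
apply: (@int_geometric_le _ _ _ mu _ (fun k x => q ^+ k * (e (s1 k) x + e (s2 k) x))) => //.
- by apply: mfannular; mfun.
- by move=> x; exact: annular_ge0.
- by move=> k; mfun.
- by move=> k x; rewrite mulr_ge0 ?exprn_ge0// addr_ge0.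
- move=> k; rewrite intZl ?exprn_ge0//; [|mfun|by move=> x; rewrite addr_ge0].
  rewrite mulrC EFinM; apply: lee_wpmul2l; first by rewrite lee_fin exprn_ge0.
  rewrite intD//; apply: (le_via ((8 ^+ n)%:E + (8 ^+ n)%:E)%E).
    by apply: leeD; apply: ie.
  by rewrite lee_fin; lra.
- move=> x; set r := enorm (x - a).
  have r0 : 0 <= r by exact: enorm_ge0.
  have main k (s : R) : 0 < s -> s <= r -> r <= 4 * s ->
      Num.min (r / u) (u / r) <= (2 ^+ k)^-1 -> G d u r <= q ^+ k * e s x.
    move=> s0 sr r4s mk.
    have -> : e s x = s `^ (- n%:R) by rewrite /e indicE mem_set// mulr1.
    rewrite /annular mulrC; apply: ler_pM; rewrite ?powR_ge0//.
      apply: (le_via ((2 ^+ k)^-1 `^ d)).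
        rewrite ge0_ler_powR ?nnegrE ?exprn_ge0//; first exact: ltW.
        by case/andP: (annular_min01 (ltW u0) r0).
      rewrite -powR_inv1 ?exprn_ge0// -powRrM mulN1r -powR_mulrn// powRAC.
      by rewrite powR_mulrn.
    exact: powR_neg_antitone.
  move: r0; rewrite le_eqVlt => /predU1P[<-|r0].
    by exists 0%N; rewrite annular_r0// mulr_ge0 ?exprn_ge0// addr_ge0.
  have [ur|ru] := leP u r.
    have [|k /andP[k1 k2]] := @dyadic_scale _ (r / u); first by rewrite ler_pdivlMr// mul1r.
    exists k; apply: (le_via (q ^+ k * e (s1 k) x)); last first.
      by rewrite ler_wpM2l ?exprn_ge0// lerDl.
    apply: main => //.
    + by rewrite /s1 mulrC -ler_pdivlMr.
    + move: k2; rewrite ltr_pdivrMr// exprS => h; rewrite /s1.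
      have := s10 k; rewrite /s1; nra.
    + rewrite ge_min; apply/orP; right.
      by rewrite -(invf_div r u) lef_pV2 ?posrE ?exprn_gt0// divr_gt0.
  have [|k /andP[k1 k2]] := @dyadic_scale _ (u / r); first by rewrite ler_pdivlMr// mul1r ltW.
  exists k; apply: (le_via (q ^+ k * e (s2 k) x)); last first.
    by rewrite ler_wpM2l ?exprn_ge0// lerDr.
  apply: main => //.
  + rewrite ler_pdivrMr ?exprn_gt0// mulrC -ler_pdivrMr//; exact: ltW.
  + rewrite /s2 exprS invfM; rewrite ler_pdivlMr// in k1.
    have -> : 4 * (u * (2^-1 * (2 ^+ k)^-1)) = 2 * u / 2 ^+ k by field; rewrite gt_eqF.
    by rewrite ler_pdivlMr//; nra.
  + rewrite ge_min; apply/orP; left.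
    by rewrite -(invf_div u r) lef_pV2 ?posrE ?exprn_gt0// divr_gt0.
Qed.

Lemma int_annularC (d u : R) (a : X) : 0 < d -> 0 <= u ->
  (\int[mu]_x (G d u (enorm (a - x)))%:E <= (annular_cst d)%:E)%E.
Proof. by move=> ? ?; under eq_integral do rewrite enormC; exact: int_annular. Qed.

Lemma int_annular0 (d u : R) : 0 < d -> 0 <= u ->
  (\int[mu]_x (G d u (enorm x))%:E <= (annular_cst d)%:E)%E.
Proof.
move=> d0 u0; have := int_annular 0 d0 u0.
by under eq_integral do rewrite subr0.
Qed.

End annular_integrals.
#[global] Opaque annular annular_cst.

Ltac nneg := lazymatch goal with
 | |- is_true (0 <= _ * _) => apply: mulr_ge0; nneg
 | |- is_true (0 <= _ + _) => apply: addr_ge0; nneg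
 | |- is_true (0 <= _ ^+ 2) => exact: sqr_ge0
 | |- is_true (0 <= _ ^+ _) => apply: exprn_ge0; nneg
 | |- is_true (0 <= _ `^ _) => exact: powR_ge0
 | |- is_true (0 <= annular _ _ _ _) => exact: annular_ge0
 | |- is_true (0 <= annular_cst _) => apply: annular_cst_ge0; try assumption
 | |- is_true (0 <= enorm _) => exact: enorm_ge0
 | |- is_true (0 <= `|_|) => exact: normr_ge0
 | |- is_true (0 <= _%:R) => exact: ler0n
 | |- is_true (0 <= _^-1) => rewrite invr_ge0; nneg
 | |- is_true (0 <= indic _ _) => rewrite indicE; exact: ler0n
 | |- is_true (0 <= Num.max _ 0) => rewrite le_max lexx orbT; exact: isT
 | |- is_true (0 <= _) => try assumption; try (match goal with H : forall _, is_true (0 <= _) |- _ => exact: H end);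
        try (match goal with H : is_true (0 < ?x) |- is_true (0 <= ?x) => exact: (ltW H) end);
        try (match goal with H : forall _ _, is_true (0 <= _) |- _ => exact: H end)
 | |- is_true (_%:E <= _%:E)%E => rewrite lee_fin; nneg
 | |- forall _, _ => intro; nneg
 | _ => idtac
 end.
Section riesz_differences.
Context {R : realType} {n : nat}.
Hypothesis n0 : (0 < n)%N.
Local Notation X := 'rV[R]_n.
Local Notation G := (@annular R n).
Implicit Types (x y z h : X) (t d : R).

Definition rdiff t x y z : R := riesz t x z - riesz t y z.

Lemma riesz_diff_le t d x y z : 0 < t < 1 -> 0 < d <= t -> d <= 1 - t ->
  `|rdiff t x y z| <= n%:R * enorm (x - y) `^ t *
    (G d (enorm (x - y)) (enorm (x - z)) + G d (enorm (x - y)) (enorm (y - z))).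
Proof.
move=> t01 d0t dt1; apply: powR_diff_annular => //.
- by rewrite [leRHS]addrC (enormC x y); exact: (enormBD y x z).
- by rewrite [leRHS]addrC; exact: (enormBD x y z).
- by rewrite (enormC y z); exact: (enormBD x z y).
Qed.

Definition rdiff2 t x y z h : R := rdiff t x y (z + h) - rdiff t x y z.

(** A second difference can be read in two ways: as two differences of step [h], seen from [x] and
    from [y], or as two differences of step $x-y$, seen from [z + h] and from [z]. The first reading
    gives a bound at scale $|h|$, the second one at scale $|x-y|$, and [annular_interpolate] mixes
    them with weights [l] and [1 - l]. *)
Lemma riesz_diff2_le t d (l : R) x y z h : 0 < t < 1 -> 0 < d <= t -> d <= 1 - t -> 0 <= l < 1 ->
  let u := enorm (x - y) in let v := enorm h in
  `|rdiff2 t x y z h| <= 4 * n%:R * v `^ (t * l) * u `^ (t * (1 - l)) *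
    (G (d * (1 - l)) u (enorm (x - (z + h))) + G (d * (1 - l)) u (enorm (x - z)) +
     G (d * (1 - l)) u (enorm (y - (z + h))) + G (d * (1 - l)) u (enorm (y - z))).
Proof.
move=> t01 d0t dt1 l01 /=; set u := enorm (x - y); set v := enorm h.
have d01 : 0 < d <= 1 by case/andP: t01; case/andP: d0t; lra.
have t0 : 0 <= t by case/andP: t01; lra.
apply: annular_interpolate => //; try exact: enorm_ge0.
- have -> : rdiff2 t x y z h = - rdiff t (z + h) z y + rdiff t (z + h) z x.
    rewrite /rdiff2 /rdiff /riesz (enormC _ y) (enormC _ y) (enormC _ x) (enormC _ x).
    move: (enorm (x - (z + h)) `^ _) (enorm (y - (z + h)) `^ _) (enorm (x - z) `^ _)
      (enorm (y - z) `^ _) => p1 p2 p3 p4.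
    by ring.
  have vE : enorm (z + h - z) = v by rewrite addrC addKr.
  have h1 := riesz_diff_le (z + h) z y t01 d0t dt1.
  have h2 := riesz_diff_le (z + h) z x t01 d0t dt1.
  rewrite vE !(enormC _ y) in h1; rewrite vE !(enormC _ x) in h2.
  apply: (le_trans (ler_normD _ _)); rewrite normrN.
  apply: (le_trans (lerD h1 h2)); rewrite -mulrDr.
  move: (G d v (enorm (y - (z + h)))) (G d v (enorm (y - z)))
    (G d v (enorm (x - (z + h)))) (G d v (enorm (x - z))) => p q r w.
  by rewrite addrC addrA.
- have h1 := riesz_diff_le x y (z + h) t01 d0t dt1.
  have h2 := riesz_diff_le x y z t01 d0t dt1.
  apply: (le_trans (ler_normB _ _)).
  apply: (le_trans (lerD h1 h2)); rewrite -mulrDr -/u.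
  move: (G d u (enorm (y - (z + h)))) (G d u (enorm (y - z)))
    (G d u (enorm (x - (z + h)))) (G d u (enorm (x - z))) => p q r w.
  by rewrite addrACA addrA.
Qed.

Lemma mf_rdiff t dT (T : measurableType dT) (f g k : T -> X) :
  meas f -> meas g -> meas k ->
  meas (fun w => rdiff t (f w) (g w) (k w)).
Proof. by move=> ? ? ?; rewrite /rdiff; mfun. Qed.

End riesz_differences.

Ltac mfun_annular := match goal with
  | |- measurable_fun _ (fun x => annular _ _ (@?f x) (@?g x)) => refine (@mfannular _ _ _ _ f g _ _ _)
  | |- measurable_fun _ (fun x => rdiff _ (@?f x) (@?g x) (@?h x)) => refine (@mf_rdiff _ _ _ _ _ f g h _ _ _)
  end.
Ltac mfun_ext ::= mfun_annular.

(** * Double integrals of products of bumps *)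

Section double_integrals.
Context {R : realType} {d1 d2 : measure_display}.
Context {X : measurableType d1} {Y : measurableType d2}.
Variables (m1 : {sigma_finite_measure set X -> \bar R}).
Variables (m2 : {sigma_finite_measure set Y -> \bar R}).

Lemma double_le (f : X * Y -> R) (k : X -> R) : meas f -> (forall z, 0 <= f z) ->
  meas k -> (forall x, (\int[m2]_y (f (x, y))%:E <= (k x)%:E)%E) ->
  (\int[m1]_x \int[m2]_y (f (x, y))%:E <= \int[m1]_x (k x)%:E)%E.
Proof.
move=> mf f0 mk fk; apply: ge0_le_integral => //.
- by move=> x _; apply: integral_ge0 => y _; rewrite lee_fin.
- exact: mf_int1.
- exact: mfE.
Qed.

Lemma double_le2 (f : X * Y -> R) (k : Y -> R) : meas f -> (forall z, 0 <= f z) ->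
  meas k -> (forall y, (\int[m1]_x (f (x, y))%:E <= (k y)%:E)%E) ->
  (\int[m2]_y \int[m1]_x (f (x, y))%:E <= \int[m2]_y (k y)%:E)%E.
Proof.
move=> mf f0 mk fk; apply: ge0_le_integral => //.
- by move=> x _; apply: integral_ge0 => y _; rewrite lee_fin.
- exact: mf_int2.
- exact: mfE.
Qed.

Lemma int_prod (f : X -> R) (g : Y -> R) (a b : R) :
  meas f -> meas g -> (forall x, 0 <= f x) -> (forall x, 0 <= g x) ->
  (\int[m1]_x (f x)%:E <= a%:E)%E -> (\int[m2]_x (g x)%:E <= b%:E)%E ->
  (\int[m1 \x m2]_p (f p.1 * g p.2)%:E <= (a * b)%:E)%E.
Proof.
move=> mf mg f0 g0 fa gb.
have b0 : 0 <= b by rewrite -lee_fin; apply: le_trans gb; apply: integral_ge0 => y _; rewrite lee_fin.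
rewrite (tonelli1 m1 m2 (f := fun p => f p.1 * g p.2)); last 2 first.
- by mfun.
- by nneg.
apply: (le_via (\int[m1]_x (b * f x)%:E)%E).
  apply: (@double_le (fun p : X * Y => f p.1 * g p.2) (fun x => b * f x)).
  - by mfun.
  - by nneg.
  - by mfun.
  - move=> x /=; rewrite intZl//; rewrite mulrC EFinM; apply: lee_wpmul2l => //.
    by rewrite lee_fin.
by rewrite intZl// mulrC EFinM; apply: lee_wpmul2l => //; rewrite lee_fin.
Qed.

End double_integrals.

Section linear_bounds.
Context {R : realType} {d : measure_display} {T : measurableType d}.
Variable mu : {measure set T -> \bar R}.

Lemma intD_le (f g : T -> R) (a b : R) : meas f -> meas g ->
  (forall x, 0 <= f x) -> (forall x, 0 <= g x) ->
  (\int[mu]_x (f x)%:E <= a%:E)%E -> (\int[mu]_x (g x)%:E <= b%:E)%E ->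
  (\int[mu]_x (f x + g x)%:E <= (a + b)%:E)%E.
Proof. by move=> mf mg f0 g0 fa gb; rewrite intD// EFinD; exact: leeD. Qed.

Lemma intZl_le (k : R) (f : T -> R) (a : R) : 0 <= k -> meas f ->
  (forall x, 0 <= f x) -> (\int[mu]_x (f x)%:E <= a%:E)%E ->
  (\int[mu]_x (k * f x)%:E <= (k * a)%:E)%E.
Proof.
move=> k0 mf f0 fa; by rewrite intZl// (EFinM k); apply: lee_wpmul2l.
Qed.

Lemma int_lin4_le (F1 F2 F3 F4 : T -> R) (k l a1 a2 a3 a4 : R) : 0 <= k -> 0 <= l ->
  meas F1 -> meas F2 ->
  meas F3 -> meas F4 ->
  (forall x, 0 <= F1 x) -> (forall x, 0 <= F2 x) ->
  (forall x, 0 <= F3 x) -> (forall x, 0 <= F4 x) ->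
  (\int[mu]_x (F1 x)%:E <= a1%:E)%E -> (\int[mu]_x (F2 x)%:E <= a2%:E)%E ->
  (\int[mu]_x (F3 x)%:E <= a3%:E)%E -> (\int[mu]_x (F4 x)%:E <= a4%:E)%E ->
  (\int[mu]_x (k * (F1 x + F2 x) + l * (F3 x + F4 x))%:E <=
    (k * (a1 + a2) + l * (a3 + a4))%:E)%E.
Proof.
move=> k0 l0 m1 m2 m3 m4 p1 p2 p3 p4 i1 i2 i3 i4.
apply: intD_le; try mfun.
- by nneg.
- by nneg.
- apply: intZl_le => //; [mfun|by nneg|exact: intD_le].
- apply: intZl_le => //; [mfun|by nneg|exact: intD_le].
Qed.

End linear_bounds.

Section kernel_integrals.
Context {R : realType} {n : nat}.
Hypothesis n0 : (0 < n)%N.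
Local Notation mu := (@lebesgue_rV R n).
Local Notation mu2 := (@lebesgue_rV R n \x @lebesgue_rV R n)%E.
Local Notation X := 'rV[R]_n.
Local Notation G := (@annular R n).
Local Notation C := (@annular_cst R n).
Implicit Types (x y z h a b : X) (t d : R).

Lemma int_shear (Phi : X * X -> R) : meas Phi -> (forall p, 0 <= Phi p) ->
  (\int[mu2]_p (Phi p)%:E = \int[mu]_w \int[mu]_x (Phi (x, (w + x)%R))%:E)%E.
Proof.
move=> mP P0; rewrite (tonelli1 mu mu mP P0).
transitivity (\int[mu]_x \int[mu]_w (Phi (x, (w + x)%R))%:E)%E.
  apply: eq_integral => x _; symmetry.
  apply: (@int_shift R n (fun y => (Phi (x, y))%:E) x).
    by apply: mfE; exact: mf_section1.
  by move=> y; rewrite lee_fin.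
have mS : meas (fun p : X * X => Phi (p.1, p.2 + p.1)).
  by apply: (measurableT_comp mP); apply: measurable_fun_pair; mfun.
exact: (tonelli12 mu mu mS (fun p => P0 _)).
Qed.

Lemma int_shear2 (Phi : X * X -> R) : meas Phi -> (forall p, 0 <= Phi p) ->
  (\int[mu2]_p (Phi p)%:E = \int[mu]_w \int[mu]_x (Phi ((w + x)%R, x))%:E)%E.
Proof.
move=> mP P0; rewrite (tonelli2 mu mu mP P0).
transitivity (\int[mu]_x \int[mu]_w (Phi ((w + x)%R, x))%:E)%E.
  apply: eq_integral => x _; symmetry.
  apply: (@int_shift R n (fun y => (Phi (y, x))%:E) x).
    by apply: mfE; exact: mf_section2.
  by move=> y; rewrite lee_fin.
have mS : meas (fun p : X * X => Phi (p.2 + p.1, p.1)).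
  by apply: (measurableT_comp mP); apply: measurable_fun_pair; mfun.
exact: (tonelli12 mu mu mS (fun p => P0 _)).
Qed.

(** The substitution $w=p_2-p_1$ or $w=p_1-p_2$ freezes the scale, so that the inner integral is
    that of a single bump and costs [C d]. Each of the two summands is sheared with respect to its
    own point. *)
Lemma int_radial_annular (k : R -> R) (B d : R) a : meas k ->
  (forall u, 0 <= k u) -> 0 < d -> (\int[mu]_w (k (enorm w))%:E <= B%:E)%E ->
  (\int[mu2]_p (k (enorm (p.1 - p.2)) * (G d (enorm (p.1 - p.2)) (enorm (p.1 - a)) +
     G d (enorm (p.1 - p.2)) (enorm (p.2 - a))))%:E <= (2 * C d * B)%:E)%E.
Proof.
move=> mk k0 d0 kB.
have C0 : 0 <= C d by nneg.
pose u (p : X * X) := enorm (p.1 - p.2).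
have mu_ : meas u by rewrite /u; mfun.
under eq_integral do rewrite mulrDr.
rewrite intD; last 4 first.
- by apply: mfM; mfun.
- by apply: mfM; mfun.
- by nneg.
- by nneg.
have -> : 2 * C d * B = C d * B + C d * B by ring.
have mkw : meas (fun w : X => C d * k (enorm w)).
  by apply: mfM => //; apply: (measurableT_comp mk); mfun.
have kC : (\int[mu]_w (C d * k (enorm w))%:E <= (C d * B)%:E)%E.
  rewrite intZl//; mfun.
  by rewrite (EFinM (C d)); apply: lee_wpmul2l => //; rewrite lee_fin.
rewrite EFinD; apply: leeD.
- rewrite (int_shear (Phi := fun p => k (u p) * G d (u p) (enorm (p.1 - a)))); last 2 first.
  + by apply: mfM; mfun.
  + by nneg.
  apply: le_trans kC.
  apply: (@double_le _ _ _ _ _ mu mu (fun q : X * X => k (u (q.2, q.1 + q.2)) * G d (u (q.2, q.1 + q.2)) (enorm (q.2 - a)))).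
  + have mq : meas (fun q : X * X => u (q.2, q.1 + q.2)).
      by rewrite /=; mfun.
    by apply: mfM; [apply: (measurableT_comp mk)|mfun].
  + by nneg.
  + by [].
  + move=> w /=.
    under eq_integral do rewrite /u opprD addrCA subrr addr0 enormN.
    rewrite intZl//; [|mfun|by nneg].
    by rewrite (mulrC (C d)) (EFinM _ (C d)); apply: lee_wpmul2l; rewrite ?lee_fin//; exact: int_annular.
- rewrite (int_shear2 (Phi := fun p => k (u p) * G d (u p) (enorm (p.2 - a)))); last 2 first.
  + by apply: mfM; mfun.
  + by nneg.
  apply: le_trans kC.
  apply: (@double_le _ _ _ _ _ mu mu (fun q : X * X => k (u (q.1 + q.2, q.2)) * G d (u (q.1 + q.2, q.2)) (enorm (q.2 - a)))).
  + have mq : meas (fun q : X * X => u (q.1 + q.2, q.2)).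
      by rewrite /=; mfun.
    by apply: mfM; [apply: (measurableT_comp mk)|mfun].
  + by nneg.
  + by [].
  + move=> w /=.
    under eq_integral do rewrite /u addrK.
    rewrite intZl//; [|mfun|by nneg].
    by rewrite (mulrC (C d)) (EFinM _ (C d)); apply: lee_wpmul2l; rewrite ?lee_fin//; exact: int_annular.
Qed.

(** The profile $\min(u/E,E/u)$ is symmetric in scale and distance. Exchanging their roles turns the
    weight in [u] into an integrable bump in [u] at the fixed scale [E]; the factor $u^{-b}$ is paid
    with [b] units of decay, since $\min(u/E,E/u)\le u/E$. *)
Lemma weight_annular (b d u E : R) : 0 <= b < d -> 0 <= u -> 0 < E ->
  u `^ (- n%:R - b) * G d u E <= E `^ (- n%:R - b) * G (d - b) E u.
Proof.
move=> /andP[b0 bd] u0 E0.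
move: u0; rewrite le_eqVlt => /predU1P[<-|u0].
  by rewrite annular_u0 ?mulr0 ?mulr_ge0 ?powR_ge0; lra.
with_strategy transparent [annular] rewrite /annular; rewrite (minC (u / E)); set m := Num.min _ _.
have m0 : 0 < m by rewrite lt_min !divr_gt0.
have mle : m <= u / E by rewrite ge_min lexx orbT.
have mdE : m `^ d = m `^ (d - b) * m `^ b by rewrite powR_add// subrK.
have wE (v : R) : 0 < v -> v `^ (- n%:R - b) = v `^ (- n%:R) * v `^ (- b).
  by move=> v0; rewrite powR_add.
rewrite mdE !wE//.
have : m `^ b * u `^ (- b) <= E `^ (- b).
  apply: (le_via ((u / E) `^ b * u `^ (- b))).
    rewrite ler_wpM2r ?powR_ge0//; apply: ge0_ler_powR => //; rewrite nnegrE; first exact: ltW.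
    by nneg.
  rewrite powRM ?invr_ge0 ?(ltW E0) ?(ltW u0)// mulrAC powR_add// subrr powRr0 mul1r.
  by rewrite -powR_inv1 ?(ltW E0)// -powRrM mulN1r.
have := powR_ge0 u (- n%:R); have := powR_ge0 E (- n%:R); have := powR_ge0 m (d - b).
move: (u `^ (- n%:R)) (E `^ (- n%:R)) (m `^ (d - b)) (m `^ b) (u `^ (- b)) (E `^ (- b)).
move=> A B D F H I D0 B0 A0 FH.
have -> : A * H * (B * (D * F)) = (A * B * D) * (F * H) by ring.
have -> : B * I * (A * D) = (A * B * D) * I by ring.
by apply: ler_wpM2l => //; rewrite !mulr_ge0.
Qed.

Lemma annular_pair_far d u P Q E : 0 < d <= 1 -> 0 <= u -> 0 <= P -> 0 <= Q -> 0 < E ->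
  E <= P \/ E <= Q -> G d u P * G d u Q <= G d u E * (G d u P + G d u Q).
Proof.
move=> d01 u0 P0 Q0 E0 [EP|EQ]; rewrite mulrDr.
- apply: (le_via (G d u E * G d u Q)); last by rewrite lerDr mulr_ge0// annular_ge0.
  by rewrite ler_wpM2r ?annular_ge0//; exact: annular_antitone.
- apply: (le_via (G d u E * G d u P)); last by rewrite lerDl mulr_ge0// annular_ge0.
  by rewrite mulrC ler_wpM2r ?annular_ge0//; exact: annular_antitone.
Qed.

Lemma annular_le_scale d u P E : 0 < d -> P < E -> 0 <= P -> E <= u -> G d u P <= G d E P.
Proof.
move=> d0 PE; rewrite le_eqVlt => /predU1P[<-|P0] Eu; first by rewrite !annular_r0.
rewrite !annular_ler; try lra.
rewrite ler_wpM2l ?powR_ge0//; apply: ge0_ler_powR; rewrite ?nnegrE ?divr_ge0; try lra.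
by rewrite ler_pM2l// lef_pV2 ?posrE; lra.
Qed.

(** If one distance is at least [E], its bump is traded for the one at distance [E]. Otherwise $u\ge
    E$ while both distances are small: [x] is near one pole and [y] near the other, and the bumps
    decouple into a product at the fixed scale [E]. *)
Lemma annular_pair_cross (b d u P Q E : R) : 0 < d <= 1 -> 0 <= b -> 0 <= u -> 0 <= P -> 0 <= Q -> 0 < E ->
  [\/ E <= P, E <= Q | E <= u] ->
  u `^ (- n%:R - b) * (G d u P * G d u Q) <=
  u `^ (- n%:R - b) * (G d u E * (G d u P + G d u Q)) +
  E `^ (- n%:R - b) * (G d E P * G d E Q).
Proof.
move=> d01 b0 u0 P0 Q0 E0 h.
have third : 0 <= E `^ (- n%:R - b) * (G d E P * G d E Q).
  by nneg.
have first : E <= P \/ E <= Q -> u `^ (- n%:R - b) * (G d u P * G d u Q) <=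
  u `^ (- n%:R - b) * (G d u E * (G d u P + G d u Q)) +
  E `^ (- n%:R - b) * (G d E P * G d E Q).
  move=> hPQ; rewrite -[leLHS]addr0; apply: lerD => //.
  by rewrite ler_wpM2l ?powR_ge0//; exact: annular_pair_far.
have [EP|PE] := leP E P; first by apply: first; left.
have [EQ|QE] := leP E Q; first by apply: first; right.
have Eu : E <= u by case: h => //; lra.
apply: (le_via (E `^ (- n%:R - b) * (G d E P * G d E Q))); last first.
  by rewrite lerDr !mulr_ge0 ?powR_ge0 ?addr_ge0 ?annular_ge0.
apply: ler_pM; rewrite ?mulr_ge0 ?powR_ge0 ?annular_ge0//.
  by rewrite -opprD; apply: powR_neg_antitone => //; rewrite addr_ge0.
by case/andP: d01 => d0 _; apply: ler_pM; rewrite ?annular_ge0//; apply: annular_le_scale.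
Qed.

(** The first term stands for two integrals of the type [int_radial_annular], each with a factor 2
    and taken with weight 4; the second for the two product integrals at the fixed scale. *)
Definition kernel_cst (b d : R) : R := 16 * C d * C (d - b) + 2 * (C d * C d).

Lemma kernel_cst_ge0 (b d : R) : 0 <= b < d -> 0 <= kernel_cst b d.
Proof.
move=> /andP[b0 bd]; have h1 : 0 <= C d by apply: annular_cst_ge0; lra.
have h2 : 0 <= C (d - b) by apply: annular_cst_ge0; lra.
by apply: addr_ge0; apply: mulr_ge0 => //; apply: mulr_ge0.
Qed.

(** The product expands into four pairs. In the pairs [P1], [Q1] and [P2], [Q2] one point is
    compared with both poles, so one of the distances is at least [E]; the pairs [P1], [Q2] and
    [P2], [Q1] fall under [annular_pair_cross]. *)
Lemma annular_pairs_le (b d E u P1 P2 Q1 Q2 : R) : 0 <= b < d -> d <= 1 -> 0 < E -> 0 <= u ->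
  0 <= P1 -> 0 <= P2 -> 0 <= Q1 -> 0 <= Q2 ->
  4 * E <= P1 + Q1 -> 4 * E <= P2 + Q2 -> 4 * E <= P1 + (u + Q2) -> 4 * E <= P2 + (u + Q1) ->
  u `^ (- n%:R - b) * ((G d u P1 + G d u P2) * (G d u Q1 + G d u Q2)) <=
  4 * (E `^ (- n%:R - b) * G (d - b) E u * (G d u P1 + G d u P2) +
       E `^ (- n%:R - b) * G (d - b) E u * (G d u Q1 + G d u Q2)) +
  E `^ (- n%:R - b) * (G d E P1 * G d E Q2 + G d E Q1 * G d E P2).
Proof.
move=> /andP[b0 bd] d1 E0 u0 P10 P20 Q10 Q20 D1 D2 D3 D4.
have d01 : 0 < d <= 1 by rewrite (le_lt_trans b0 bd).
have G0 v r : 0 <= G d v r by nneg.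
have w0 := powR_ge0 u (- n%:R - b).
have kE : u `^ (- n%:R - b) * G d u E <= E `^ (- n%:R - b) * G (d - b) E u.
  by apply: weight_annular => //; rewrite b0.
have k0 : 0 <= E `^ (- n%:R - b) * G (d - b) E u by nneg.
move: kE k0 w0; set k := E `^ (- n%:R - b) * G (d - b) E u; set w := u `^ (- n%:R - b).
move=> kE k0 w0.
have far P Q : 0 <= P -> 0 <= Q -> 4 * E <= P + Q ->
    w * (G d u P * G d u Q) <= k * (G d u P + G d u Q).
  move=> P0 Q0 DPQ.
  apply: (le_via (w * (G d u E * (G d u P + G d u Q)))).
    rewrite ler_wpM2l//; apply: annular_pair_far => //.
    have [EP|PE] := leP E P; first by left.
    by right; move: PE DPQ E0; clear; move=> *; lra.
  by rewrite mulrA ler_wpM2r// addr_ge0.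
have cross P Q : 0 <= P -> 0 <= Q -> 4 * E <= P + (u + Q) ->
    w * (G d u P * G d u Q) <= k * (G d u P + G d u Q) + E `^ (- n%:R - b) * (G d E P * G d E Q).
  move=> P0 Q0 DPQ.
  apply: (le_trans (annular_pair_cross d01 b0 u0 P0 Q0 E0 _)).
    have [EP|PE] := leP E P; first by constructor 1.
    have [EQ|QE] := leP E Q; first by constructor 2.
    by constructor 3; move: PE QE DPQ E0; clear; move=> *; lra.
  by rewrite lerD2r mulrA ler_wpM2r// addr_ge0.
have := far _ _ P10 Q10 D1; have := far _ _ P20 Q20 D2.
have := cross _ _ P10 Q20 D3; have := cross _ _ P20 Q10 D4.
rewrite (mulrC (G d E P2)).
move: (E `^ (- n%:R - b)) (powR_ge0 E (- n%:R - b)) => Ew Ew0.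
move: (G d u P1) (G d u P2) (G d u Q1) (G d u Q2) (G0 u P1) (G0 u P2) (G0 u Q1) (G0 u Q2).
move: (G d E P1 * G d E Q2) (G d E Q1 * G d E P2).
clear kE w0 far cross G0; move: k k0 w; clear => k k0 w A B p1 p2 q1 q2 p10 p20 q10 q20 h1 h2 h3 h4.
have := mulr_ge0 k0 p10; have := mulr_ge0 k0 p20; have := mulr_ge0 k0 q10; have := mulr_ge0 k0 q20.
move: h1 h2 h3 h4; rewrite !mulrDr => *; lra.
Qed.

(** The integral behind both kernel estimates: [b = 0] gives the size, and [b] equal to the Hölder
    exponent gives the regularity. *)
Lemma int_annular_pairs (b d E : R) z1 z2 : 0 <= b < d -> d <= 1 -> 0 < E -> 4 * E <= enorm (z1 - z2) ->
  (\int[mu2]_p (enorm (p.1 - p.2) `^ (- n%:R - b) *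
     ((G d (enorm (p.1 - p.2)) (enorm (p.1 - z1)) + G d (enorm (p.1 - p.2)) (enorm (p.2 - z1))) *
      (G d (enorm (p.1 - p.2)) (enorm (p.1 - z2)) + G d (enorm (p.1 - p.2)) (enorm (p.2 - z2)))))%:E
   <= (kernel_cst b d * E `^ (- n%:R - b))%:E)%E.
Proof.
move=> /andP[b0 bd] d1 E0 ED.
have d0 : 0 < d by lra.
pose u (p : X * X) := enorm (p.1 - p.2).
pose S z (p : X * X) := G d (u p) (enorm (p.1 - z)) + G d (u p) (enorm (p.2 - z)).
pose k (v : R) := E `^ (- n%:R - b) * G (d - b) E v.
pose F1 (p : X * X) := k (u p) * S z1 p.
pose F2 (p : X * X) := k (u p) * S z2 p.
pose F3 (p : X * X) := G d E (enorm (p.1 - z1)) * G d E (enorm (p.2 - z2)).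
pose F4 (p : X * X) := G d E (enorm (p.1 - z2)) * G d E (enorm (p.2 - z1)).
have G0 v r : 0 <= G d v r by nneg.
have k0 v : 0 <= k v by rewrite mulr_ge0 ?powR_ge0// annular_ge0.
have S0 z p : 0 <= S z p by rewrite addr_ge0.
have mu_ : meas u by rewrite /u; mfun.
have mk : meas k by rewrite /k; mfun.
have mS z : meas (S z) by rewrite /S; mfun.
have mF1 : meas F1 by rewrite /F1; mfun.
have mF2 : meas F2 by rewrite /F2; mfun.
have mF3 : meas F3 by rewrite /F3; mfun.
have mF4 : meas F4 by rewrite /F4; mfun.
have F10 p : 0 <= F1 p by rewrite mulr_ge0.
have F20 p : 0 <= F2 p by rewrite mulr_ge0.
have F30 p : 0 <= F3 p by rewrite mulr_ge0.
have F40 p : 0 <= F4 p by rewrite mulr_ge0.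
have Ew0 := powR_ge0 E (- n%:R - b).
apply: (le_via (\int[mu2]_p (4 * (F1 p + F2 p) + E `^ (- n%:R - b) * (F3 p + F4 p))%:E)%E).
  apply: int_le.
  - by apply: mfM; [mfun|apply: mfM; [exact: (mS z1)|exact: (mS z2)]].
  - by mfun.
  move=> p.
  have D1 : 4 * E <= enorm (p.1 - z1) + enorm (p.1 - z2).
    by apply: (le_trans ED); rewrite (enormC p.1 z1); exact: enormBD.
  have D2 : 4 * E <= enorm (p.2 - z1) + enorm (p.2 - z2).
    by apply: (le_trans ED); rewrite (enormC p.2 z1); exact: enormBD.
  have D3 : 4 * E <= enorm (p.1 - z1) + (enorm (p.1 - p.2) + enorm (p.2 - z2)).
    apply: (le_trans ED); rewrite (enormC p.1 z1); apply: (le_trans (enormBD z1 p.1 z2)).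
    by rewrite lerD2l; exact: enormBD.
  have D4 : 4 * E <= enorm (p.2 - z1) + (enorm (p.1 - p.2) + enorm (p.1 - z2)).
    apply: (le_trans ED); rewrite (enormC p.2 z1); apply: (le_trans (enormBD z1 p.2 z2)).
    by rewrite lerD2l (enormC p.1 p.2); exact: enormBD.
  apply/andP; split; first by nneg.
  apply: annular_pairs_le; try by [].
  by rewrite b0.
have kB : (\int[mu]_w (k (enorm w))%:E <= (E `^ (- n%:R - b) * C (d - b))%:E)%E.
  rewrite intZl//; [|mfun|by nneg].
  rewrite EFinM; apply: lee_wpmul2l; rewrite ?lee_fin//.
  by apply: int_annular0; [exact: n0|move: b0 bd; clear; move=> *; lra|exact: ltW].
have i1 := int_radial_annular z1 mk k0 d0 kB.
have i2 := int_radial_annular z2 mk k0 d0 kB.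
have mG z : meas (fun x : X => G d E (enorm (x - z))) by mfun.
have i3 := int_prod (mG z1) (mG z2) (fun x => G0 _ _) (fun x => G0 _ _)
  (int_annular n0 z1 d0 (ltW E0)) (int_annular n0 z2 d0 (ltW E0)).
have i4 := int_prod (mG z2) (mG z1) (fun x => G0 _ _) (fun x => G0 _ _)
  (int_annular n0 z2 d0 (ltW E0)) (int_annular n0 z1 d0 (ltW E0)).
apply: (le_trans (int_lin4_le (ler0n _ 4) Ew0 mF1 mF2 mF3 mF4 F10 F20 F30 F40 i1 i2 i3 i4)).
rewrite lee_fin /kernel_cst; clear.
by move: (C d) (C (d - b)) (E `^ _) => p q r; apply: le_of_eq; ring.
Qed.

End kernel_integrals.
(** * Schur's test *)

Section real_fubini.
Context {R : realType} {d1 d2 : measure_display}.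
Context {X : measurableType d1} {Y : measurableType d2}.
Variables (m1 : {sigma_finite_measure set X -> \bar R}).
Variables (m2 : {sigma_finite_measure set Y -> \bar R}).
Implicit Types f : X * Y -> R.

Lemma mf_fine dT (T : measurableType dT) (g : T -> \bar R) : meas g ->
  meas (fun x => fine (g x)).
Proof. by move=> mg; apply: (measurableT_comp (@fine_measurable R setT measurableT)). Qed.

Lemma Rint_posneg dT (T : measurableType dT) (m : {measure set T -> \bar R}) (g : T -> R) :
  (\int[m]_x g x = fine (\int[m]_x (Num.max (g x) 0)%:E - \int[m]_x (Num.max (- g x) 0)%:E)%E)%R.
Proof.
rewrite /Rintegral integralE; congr (fine (_ - _)%E); apply: eq_integral => x _.
  by rewrite funeposE EFin_max.
by rewrite funenegE EFin_max.
Qed.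

(** The default value of a divergent integral does no harm to measurability: the real integral is
    [fine] of a difference of two integrals of nonnegative functions, each measurable by Tonelli. *)
Lemma mf_Rint1 f : meas f -> meas (fun x => \int[m2]_y f (x, y)).
Proof.
move=> mf; under eq_fun do rewrite Rint_posneg.
apply: mf_fine; apply: emeasurable_funB.
- apply: (@mf_int1 _ _ _ _ _ m2 (fun z => Num.max (f z) 0)); first by mfun.
  by move=> z; rewrite le_max lexx orbT.
- apply: (@mf_int1 _ _ _ _ _ m2 (fun z => Num.max (- f z) 0)); first by mfun.
  by move=> z; rewrite le_max lexx orbT.
Qed.

Lemma mf_Rint2 f : meas f -> meas (fun y => \int[m1]_x f (x, y)).
Proof.
move=> mf; under eq_fun do rewrite Rint_posneg.
apply: mf_fine; apply: emeasurable_funB.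
- apply: (@mf_int2 _ _ _ _ _ m1 (fun z => Num.max (f z) 0)); first by mfun.
  by move=> z; rewrite le_max lexx orbT.
- apply: (@mf_int2 _ _ _ _ _ m1 (fun z => Num.max (- f z) 0)); first by mfun.
  by move=> z; rewrite le_max lexx orbT.
Qed.

Lemma integrable_prod1 f : meas f ->
  (\int[m1]_x \int[m2]_y (`|f (x, y)|)%:E < +oo)%E ->
  (m1 \x m2)%E.-integrable setT (EFin \o f).
Proof.
move=> mf fi; apply: int_integ => //.
by rewrite (tonelli1 m1 m2 (f := fun z => `|f z|)); mfun.
Qed.

Lemma integrable_prod2 f : meas f ->
  (\int[m2]_y \int[m1]_x (`|f (x, y)|)%:E < +oo)%E ->
  (m1 \x m2)%E.-integrable setT (EFin \o f).
Proof.
move=> mf fi; apply: int_integ => //.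
by rewrite (tonelli2 m1 m2 (f := fun z => `|f z|)); mfun.
Qed.

Lemma Rfubini1 f : (m1 \x m2)%E.-integrable setT (EFin \o f) ->
  \int[(m1 \x m2)%E]_z f z = \int[m1]_x \int[m2]_y f (x, y).
Proof.
move=> fi; have mf := integrable_mf fi.
rewrite {1}/Rintegral -(integral12_prod_meas1 fi); congr fine.
apply: ae_eq_integral => //.
- exact: (measurable_fubini_F fi).
- by apply: mfE; exact: mf_Rint1.
- apply: filterS (ae_integrable1 fi) => x fx _.
  by rewrite RintE.
Qed.

Lemma Rfubini2 f : (m1 \x m2)%E.-integrable setT (EFin \o f) ->
  \int[(m1 \x m2)%E]_z f z = \int[m2]_y \int[m1]_x f (x, y).
Proof.
move=> fi; have mf := integrable_mf fi.
rewrite {1}/Rintegral -(integral21_prod_meas1 fi); congr fine.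
apply: ae_eq_integral => //.
- exact: (measurable_fubini_G fi).
- by apply: mfE; exact: mf_Rint2.
- apply: filterS (ae_integrable2 fi) => x fx _.
  by rewrite RintE.
Qed.

Lemma Rfubini f : (m1 \x m2)%E.-integrable setT (EFin \o f) ->
  \int[m1]_x \int[m2]_y f (x, y) = \int[m2]_y \int[m1]_x f (x, y).
Proof. by move=> fi; rewrite -Rfubini1// Rfubini2. Qed.

Lemma Rint_prod (f : X -> R) (g : Y -> R) :
  integ m1 f -> integ m2 g ->
  (m1 \x m2)%E.-integrable setT (EFin \o (fun z => f z.1 * g z.2)) /\
  \int[(m1 \x m2)%E]_z (f z.1 * g z.2) = (\int[m1]_x f x) * (\int[m2]_y g y).
Proof.
move=> fi gi; have mf := integrable_mf fi; have mg := integrable_mf gi.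
have int : (m1 \x m2)%E.-integrable setT (EFin \o (fun z => f z.1 * g z.2)).
  apply: int_integ; first by mfun.
  have fb : (\int[m1]_x (`|f x|)%:E <= (fine (\int[m1]_x (`|f x|)%:E))%:E)%E.
    by rewrite fineK//; apply: integrable_fin_num => //; exact: (integrable_norm fi).
  have gb : (\int[m2]_x (`|g x|)%:E <= (fine (\int[m2]_x (`|g x|)%:E))%:E)%E.
    by rewrite fineK//; apply: integrable_fin_num => //; exact: (integrable_norm gi).
  under eq_integral do rewrite normrM.
  apply: le_lt_trans (ltry _).
  by apply: int_prod fb gb; mfun.
split => //; rewrite Rfubini1//=.
under eq_Rintegral do rewrite RintegralZl//.
by under eq_Rintegral do rewrite mulrC; rewrite RintegralZl// mulrC.
Qed.

End real_fubini.

Section integrable_of_Rint.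
Context {R : realType} {d : measure_display} {T : measurableType d}.
Variable mu : {measure set T -> \bar R}.

Lemma fine_sub_neq0 (a b : \bar R) : (0 <= a)%E -> (0 <= b)%E -> fine (a - b)%E != 0 ->
  (a < +oo)%E /\ (b < +oo)%E.
Proof. by case: a => [a||]; case: b => [b||]//= _ _; rewrite ?eqxx// !ltry. Qed.

(* An integral with junk value is 0. *)
Lemma Rint_neq0_integrable (f : T -> R) (c : R) : meas f -> c != 0 ->
  \int[mu]_x (c * f x) <> 0 -> integ mu f.
Proof.
move=> mf c0 /eqP; rewrite Rint_posneg => /fine_sub_neq0[].
- by apply: integral_ge0 => x _; rewrite lee_fin le_max lexx orbT.
- by apply: integral_ge0 => x _; rewrite lee_fin le_max lexx orbT.
move=> pos neg; apply: int_integ => //.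
have c0' : 0 < `|c|^-1 by rewrite invr_gt0 normr_gt0.
have nE (x : T) : `|f x| = `|c|^-1 * (Num.max (c * f x) 0 + Num.max (- (c * f x)) 0).
  have -> : Num.max (c * f x) 0 + Num.max (- (c * f x)) 0 = `|c * f x|.
    case: (leP 0 (c * f x)) => h; last by rewrite (ltr0_norm h) max_l ?add0r// lerNr oppr0 ltW.
    by rewrite max_r ?addr0 ?ger0_norm// lerNl oppr0.
  by rewrite normrM mulKf// normr_eq0.
under eq_integral do rewrite nE.
rewrite intZl ?(ltW c0')//; [|mfun|]; last first.
  by nneg.
rewrite intD; [|mfun|mfun|by move=> x; rewrite le_max lexx orbT|by move=> x; rewrite le_max lexx orbT].
by rewrite lte_mul_pinfty ?(ltW c0')// lte_add_pinfty.
Qed.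

End integrable_of_Rint.

(* The library registers no sigma-finite structure on [m1 \x m2] itself, which
   iterated products need. *)
Section prod_measure.
Context {R : realType} {d1 d2 : measure_display}.
Context {X : measurableType d1} {Y : measurableType d2}.
Variables (m1 : {sigma_finite_measure set X -> \bar R}).
Variables (m2 : {sigma_finite_measure set Y -> \bar R}).

Definition prod_measure : set (X * Y) -> \bar R := (m1 \x m2)%E.

HB.instance Definition _ := Measure.on prod_measure.

Lemma prod_measure_sigma_finite : sigma_finite setT prod_measure.
Proof.
have /sigma_finiteP[F [TF ndF Foo]] := sigma_finiteT m1.
have /sigma_finiteP[G [TG ndG Goo]] := sigma_finiteT m2.
exists (fun k => F k `*` G k).
  rewrite -setXTT TF TG; apply/seteqP; split => [[x y] /= [[i _ Fi] [j _ Gj]]|[x y] [k _ [Fk Gk]]].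
    exists (maxn i j); split => /=.
      by move: x Fi; exact/subsetPset/ndF/leq_maxl.
    by move: y Gj; exact/subsetPset/ndG/leq_maxr.
  by split; exists k.
move=> k; have [mF Fk] := Foo k; have [mG Gk] := Goo k.
split; first exact: measurableX.
by rewrite /prod_measure product_measure1E// lte_mul_pinfty// ge0_fin_numE.
Qed.

HB.instance Definition _ := Measure_isSigmaFinite.Build _ _ _ prod_measure
  prod_measure_sigma_finite.

End prod_measure.

Section TTstar.
Context {R : realType} {d1 d2 : measure_display}.
Context {Y : measurableType d1} {X : measurableType d2}.
Variables (m1 : {sigma_finite_measure set Y -> \bar R}).
Variables (m2 : {sigma_finite_measure set X -> \bar R}).

(* Schur's test for the kernel of T T^*, where T f (y) = int k(y, x) f(x) dx. *)
Lemma TTstar_schur (k : Y * X -> R) (p : Y -> R) (f : X -> R) (M B C : R) :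
  meas k -> meas p -> meas f ->
  (forall y, 0 <= p y) -> (forall y, p y = 0 -> forall x, k (y, x) = 0) ->
  0 <= M -> 0 <= B -> 0 < C ->
  (forall y, (\int[m2]_x (`|k (y, x)|)%:E <= M%:E)%E) ->
  (forall x, (\int[m1]_y (`|k (y, x)|)%:E <= M%:E)%E) ->
  (forall x, `|f x| <= B) -> (\int[m2]_x (`|f x|)%:E < +oo)%E ->
  (forall y, (\int[m1]_y' (`|\int[m2]_x (k (y, x) * k (y', x))| * p y')%:E <= (C * p y)%:E)%E) ->
  (\int[m1]_y ((\int[m2]_x (k (y, x) * f x)) ^+ 2)%:E <= C%:E * \int[m2]_x (f x ^+ 2)%:E)%E.
Proof.
move=> mk mp mf p0 pk0 M0 B0 C0 kM1 kM2 fB fi schur.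
have [F1 F1i] : exists F1 : R, (\int[m2]_x (`|f x|)%:E = F1%:E)%E.
  exists (fine (\int[m2]_x (`|f x|)%:E)%E); rewrite fineK// ge0_fin_numE//.
  by apply: integral_ge0 => x _; rewrite lee_fin.
have [u uE] : exists u : Y -> R, forall y, u y = \int[m2]_x (k (y, x) * f x) by eexists.
have mkf : meas (fun z : Y * X => k z * f z.2) by mfun.
have mu : meas u.
  rewrite (funext uE); exact: (mf_Rint1 m2 mkf).
have kfi y : (\int[m2]_x (`|k (y, x) * f x|)%:E <= (B * M)%:E)%E.
  apply: (le_via (\int[m2]_x (B * `|k (y, x)|)%:E)%E).
    apply: int_le; [mfun|mfun|] => x.
    by rewrite normr_ge0 normrM mulrC ler_wpM2r.
  by apply: intZl_le; mfun.
have u_le y : `|u y| <= B * M.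
  by rewrite -lee_fin uE; apply: Rint_le; mfun.
have kkf : (\int[m1]_y \int[m2]_x (`|k (y, x) * f x|)%:E <= (M * F1)%:E)%E.
  rewrite (tonelli12 m1 m2 (f := fun z => `|k z * f z.2|))//; last by mfun.
  rewrite EFinM -F1i -intZl//; last by mfun.
  apply: (@double_le2 _ _ _ _ _ m1 m2 (fun z => `|k z * f z.2|) (fun x => M * `|f x|)) => //.
  - by mfun.
  - by mfun.
  - move=> x /=; under eq_integral do rewrite normrM mulrC.
    rewrite (mulrC M); apply: intZl_le => //; mfun.
have ui : (\int[m1]_y (`|u y|)%:E <= (M * F1)%:E)%E.
  apply: le_trans kkf; apply: ge0_le_integral => //.
  - by mfun.
  - by apply: (@mf_int1 _ _ _ _ _ m2 (fun z => `|k z * f z.2|)); mfun.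
  - by move=> y _; rewrite uE; apply: Rint_le; mfun.
(* With $u=Tf$, [H] is $T^*u$; [h] is the same integral with absolute values and supplies every
   integrability needed below. *)
have [H HE] : exists H : X -> R, forall x, H x = \int[m1]_y (k (y, x) * u y) by eexists.
have [h hE] : exists h : X -> R, forall x, h x = \int[m1]_y (`|k (y, x) * u y|) by eexists.
have mku : meas (fun z : Y * X => k z * u z.1) by mfun.
have mH : meas H.
  rewrite (funext HE); exact: (mf_Rint2 m1 mku).
have mh : meas h.
  rewrite (funext hE); by apply: (@mf_Rint2 _ _ _ _ _ m1 (fun z => `|k z * u z.1|)); mfun.
have kui x : (\int[m1]_y (`|k (y, x) * u y|)%:E <= (B * M * M)%:E)%E.
  apply: (le_via (\int[m1]_y (B * M * `|k (y, x)|)%:E)%E).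
    apply: int_le; [mfun|mfun|] => y.
    by rewrite normr_ge0 normrM mulrC ler_wpM2r.
  by apply: intZl_le => //; [exact: mulr_ge0|mfun].
have kui' x : integ m1 (fun y => k (y, x) * u y).
  apply: int_integ; last exact: le_lt_trans (kui x) (ltry _).
  by mfun.
have hhE x : ((h x)%:E = \int[m1]_y (`|k (y, x) * u y|)%:E)%E.
  rewrite hE Rint_ge0E//; last exact: le_lt_trans (kui x) (ltry _).
  by mfun.
have h0 x : 0 <= h x by rewrite -lee_fin hhE; apply: integral_ge0 => y _; rewrite lee_fin.
have h_le x : h x <= B * M * M by rewrite -lee_fin hhE.
have Hh x : `|H x| <= h x.
  by rewrite -lee_fin hhE HE; apply: Rint_le; mfun.
have hi : (\int[m2]_x (h x)%:E <= (M * (M * F1))%:E)%E.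
  under eq_integral do rewrite hhE.
  rewrite -(tonelli12 m1 m2 (f := fun z => `|k z * u z.1|))//; last by mfun.
  apply: (le_via (\int[m1]_y (M * `|u y|)%:E)%E).
    apply: (@double_le _ _ _ _ _ m1 m2 (fun z => `|k z * u z.1|) (fun y => M * `|u y|)) => //.
    - by mfun.
    - by mfun.
    - move=> y /=; under eq_integral do rewrite normrM mulrC.
      rewrite (mulrC M); apply: intZl_le => //; mfun.
  by apply: intZl_le; mfun.
have iu2 : integ m1 (fun y => u y ^+ 2).
  apply: int_integ; first by mfun.
  apply: (le_lt_via (\int[m1]_y (B * M * `|u y|)%:E)%E).
    apply: int_le; [mfun|mfun|] => y.
    by rewrite normr_ge0 normrX ler_wpM2r.
  apply: le_lt_trans (ltry (B * M * (M * F1))).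
  by apply: intZl_le => //; [exact: mulr_ge0|mfun].
have if2 : integ m2 (fun y => f y ^+ 2).
  apply: int_integ; first by mfun.
  apply: (le_lt_via (\int[m2]_y (B * `|f y|)%:E)%E).
    apply: int_le; [mfun|mfun|] => y.
    by rewrite normr_ge0 normrX ler_wpM2r.
  apply: le_lt_trans (ltry (B * F1)).
  by apply: intZl_le => //; [mfun|rewrite F1i].
have iH2 : integ m2 (fun y => H y ^+ 2).
  apply: int_integ; first by mfun.
  apply: (le_lt_via (\int[m2]_y (B * M * M * h y)%:E)%E).
    apply: int_le; [mfun|mfun|] => y.
    rewrite normr_ge0 normrX; apply: ler_pM => //.
    exact: le_trans (Hh y) (h_le y).
  apply: le_lt_trans (ltry (B * M * M * (M * (M * F1)))).
  by apply: intZl_le => //; rewrite !mulr_ge0.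
have ifH : integ m2 (fun y => f y * H y).
  apply: int_integ; first by mfun.
  apply: (le_lt_via (\int[m2]_y (B * h y)%:E)%E).
    apply: int_le; [mfun|mfun|] => y.
    by rewrite normr_ge0 normrM; apply: ler_pM.
  apply: le_lt_trans (ltry (B * (M * (M * F1)))).
  by apply: intZl_le.
(* Duality: $\langle Tf,u\rangle=\langle f,T^*u\rangle$. *)
have eq1 : \int[m1]_y (u y ^+ 2) = \int[m2]_x (f x * H x).
  transitivity (\int[m1]_y \int[m2]_x (u y * (k (y, x) * f x))).
    apply: eq_Rintegral => y _; rewrite RintegralZl//; first by rewrite -uE.
    by apply: int_integ; [mfun|exact: le_lt_trans (kfi y) (ltry _)].
  rewrite (@Rfubini _ _ _ _ _ m1 m2 (fun z => u z.1 * (k z * f z.2))).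
    apply: eq_Rintegral => x _ /=; rewrite HE -RintegralZl//.
    by apply: eq_Rintegral => y _; ring.
  apply: integrable_prod1; first by mfun.
  apply: (le_lt_via (\int[m1]_y (`|u y| * (B * M))%:E)%E).
    apply: (@double_le _ _ _ _ _ m1 m2 (fun z => `|u z.1 * (k z * f z.2)|) (fun y => `|u y| * (B * M))) => //.
    - by mfun.
    - by mfun.
    - by move=> y /=; under eq_integral do rewrite normrM; apply: intZl_le; mfun.
  under eq_integral do rewrite mulrC.
  apply: le_lt_trans (ltry (B * M * (M * F1))).
  by apply: intZl_le => //; [exact: mulr_ge0|mfun].
have [L LE] : exists L : Y * Y -> R,
    forall q, L q = \int[m2]_x (k (q.1, x) * k (q.2, x)) by eexists.
have mkk : meas (fun z : (Y * Y) * X => k (z.1.1, z.2) * k (z.1.2, z.2)) by mfun.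
have mL : meas L.
  have -> : L = fun q => \int[m2]_x (k (q.1, x) * k (q.2, x)) by apply/funext.
  exact: (@mf_Rint1 _ _ _ _ _ m2 _ mkk).
have Lsym q : L q = L (q.2, q.1).
  by rewrite !LE; apply: eq_Rintegral => x _; rewrite mulrC.
have eq2 : \int[m2]_x (H x ^+ 2) = \int[(m1 \x m1)%E]_q (u q.1 * u q.2 * L q).
  transitivity (\int[m2]_x \int[(m1 \x m1)%E]_q ((k (q.1, x) * u q.1) * (k (q.2, x) * u q.2))).
    apply: eq_Rintegral => x _.
    by have [_ ->] := Rint_prod (kui' x) (kui' x); rewrite -HE.
  rewrite (@Rfubini _ _ _ _ _ m2 (prod_measure m1 m1 : {sigma_finite_measure set _ -> \bar R})
    (fun z => (k (z.2.1, z.1) * u z.2.1) * (k (z.2.2, z.1) * u z.2.2))).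
    apply: eq_Rintegral => q _ /=; rewrite LE.
    have [/eqP uq|uq] := boolP (u q.1 * u q.2 == 0).
      rewrite uq mul0r; under eq_Rintegral do rewrite mulrACA uq mulr0.
      by rewrite Rintegral_cst// mul0r.
    (* If the product of two rows is not integrable, the integrals of all its nonzero multiples are
       0 by convention, and the identity still holds. *)
    have [kk|nkk] := pselect (integ m2 (fun x => k (q.1, x) * k (q.2, x))).
      by rewrite -RintegralZl//; apply: eq_Rintegral => x _; ring.
    have nint (c : R) : c != 0 -> \int[m2]_x (c * (k (q.1, x) * k (q.2, x))) = 0.
      move=> c0; have [//|/eqP n0] := eqVneq (\int[m2]_x (c * (k (q.1, x) * k (q.2, x)))) 0.
      exfalso; apply: nkk; apply: Rint_neq0_integrable (c0) n0.
      by mfun.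
    have := nint 1 (oner_neq0 _); under eq_Rintegral do rewrite mul1r; move=> ->.
    rewrite mulr0 -[RHS](nint _ uq).
    by apply: eq_Rintegral => x _; ring.
  apply: integrable_prod1; first by mfun.
  apply: (le_lt_via (\int[m2]_x (B * M * M * h x)%:E)%E).
    apply: (@double_le _ _ _ _ _ m2 (prod_measure m1 m1 : {sigma_finite_measure set _ -> \bar R})
      (fun z => `|(k (z.2.1, z.1) * u z.2.1) * (k (z.2.2, z.1) * u z.2.2)|) (fun x => B * M * M * h x)) => //.
    - by mfun.
    - by mfun.
    - move=> x /=; under eq_integral do rewrite normrM.
      apply: (le_via (h x * h x)%:E); last by rewrite lee_fin ler_wpM2r.
      apply: (@int_prod _ _ _ _ _ m1 m1 (fun y => `|k (y, x) * u y|) (fun y => `|k (y, x) * u y|)) => //.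
      + by mfun.
      + by mfun.
      + by rewrite hhE.
      + by rewrite hhE.
  apply: le_lt_trans (ltry (B * M * M * (M * (M * F1)))).
  by apply: intZl_le => //; rewrite !mulr_ge0.
have U0 : 0 <= \int[m1]_y (u y ^+ 2) by apply: Rintegral_ge0 => y _; exact: sqr_ge0.
have UE : ((\int[m1]_y (u y ^+ 2))%:E = \int[m1]_y (u y ^+ 2)%:E)%E by rewrite RintE.
(* Schur's test: $|u(y)u(y')L(y,y')|$ is at most half the sum of [S] at $(y,y')$ and at $(y',y)$,
   and the hypothesis on [p] integrates [S] in its second variable. *)
have [S SE] : exists S : Y * Y -> R, forall q, S q = u q.1 ^+ 2 * (p q.1)^-1 * (`|L q| * p q.2) by eexists.
have mS : meas S.
  have -> : S = fun q => u q.1 ^+ 2 * (p q.1)^-1 * (`|L q| * p q.2) by apply/funext.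
  by mfun.
have S0 q : 0 <= S q.
  rewrite SE; apply: mulr_ge0; last exact: mulr_ge0.
  by nneg.
have Si : (\int[m1 \x m1]_q (S q)%:E <= (C * \int[m1]_y (u y ^+ 2))%:E)%E.
  rewrite (tonelli1 m1 m1 mS S0) (EFinM C) UE -intZl; [|exact: ltW|mfun|by nneg].
  apply: (@double_le _ _ _ _ _ m1 m1 S (fun y => C * u y ^+ 2)) => //; first by mfun.
  move=> y; under eq_integral do rewrite SE /=.
  have py := p0 y.
  apply: (le_via (u y ^+ 2 * (p y)^-1 * (C * p y))%:E).
    apply: intZl_le.
    - by nneg.
    - by mfun; by [].
    - by nneg.
    - by under eq_integral do rewrite LE /=; by [].
  rewrite lee_fin; have [->|pn] := eqVneq (p y) 0.
    by rewrite !mulr0 mulr_ge0 ?sqr_ge0// ltW.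
  by rewrite mulrCA -mulrA mulVf// mulr1.
have Si' : (\int[m1 \x m1]_q (S (q.2, q.1))%:E <= (C * \int[m1]_y (u y ^+ 2))%:E)%E.
  have mS' : meas (fun q : Y * Y => S (q.2, q.1)) by mfun.
  rewrite (tonelli2 m1 m1 mS' (fun q => S0 _)) /=.
  by rewrite -(tonelli1 m1 m1 mS S0).
have VU : \int[m2]_x (H x ^+ 2) <= C * \int[m1]_y (u y ^+ 2).
  rewrite eq2; apply: le_trans (ler_norm _) _.
  rewrite -lee_fin; apply: Rint_le; first by mfun.
  apply: (le_via (\int[m1 \x m1]_q (2^-1 * (S q + S (q.2, q.1)))%:E)%E).
    apply: int_le; [mfun|mfun|] => q; rewrite normr_ge0/=.
    rewrite !SE /= -(Lsym q).
    have pq1 := p0 q.1; have pq2 := p0 q.2.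
    have [pz|pn1] := eqVneq (p q.1) 0.
      have -> : L q = 0.
        rewrite LE; under eq_Rintegral do rewrite (pk0 _ pz) mul0r.
        by rewrite Rintegral_cst// mul0r.
      by rewrite !mulr0 normr0 !mul0r !mulr0.
    have [pz|pn2] := eqVneq (p q.2) 0.
      have -> : L q = 0.
        rewrite LE; under eq_Rintegral do rewrite (pk0 _ pz) mulr0.
        by rewrite Rintegral_cst// mul0r.
      by rewrite !mulr0 normr0 !mul0r !mulr0.
    rewrite !normrM.
    have a0 : 0 < p q.1 by rewrite lt_def pn1.
    have b0 : 0 < p q.2 by rewrite lt_def pn2.
    have L0 : 0 <= `|L q| by [].
    rewrite -(real_normK (num_real (u q.1))) -(real_normK (num_real (u q.2))).
    move: (`|L q|) (`|u q.1|) (`|u q.2|) (p q.1) (p q.2) L0 a0 b0; clear => l v w a b l0 a0 b0.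
    rewrite -subr_ge0.
    have -> : 2^-1 * (v ^+ 2 / a * (l * b) + w ^+ 2 / b * (l * a)) - v * w * l =
       2^-1 * l * (a * b) * (v / a - w / b) ^+ 2 by field; rewrite !gt_eqF.
    apply: mulr_ge0; last exact: sqr_ge0.
    by nneg.
  apply: (le_via (2^-1 * (C * \int[m1]_y (u y ^+ 2) + C * \int[m1]_y (u y ^+ 2)))%:E).
    apply: intZl_le => //.
    - by mfun.
    - by nneg.
    - apply: intD_le => //; mfun.
  by rewrite -mulr2n -[X in 2^-1 * X]mulr_natl mulKf.
(* Absorption: since $\int H^2\le C\int u^2$, the last term is at most $\frac12\int u^2$, that is,
   half of the finite left-hand side. *)
have key : \int[m2]_x (f x * H x) <=
    2^-1 * C * (\int[m2]_x (f x ^+ 2)) + (2 * C)^-1 * \int[m2]_x (H x ^+ 2).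
  rewrite -!RintegralZl// -RintegralD//; last 2 first.
  - exact: (integrableZl measurableT (2^-1 * C) if2).
  - exact: (integrableZl measurableT (2 * C)^-1 iH2).
  apply: le_Rintegral => //.
    have := integrableD measurableT (integrableZl measurableT (2^-1 * C) if2)
      (integrableZl measurableT (2 * C)^-1 iH2).
    by [].
  move=> x _; rewrite -subr_ge0.
  have -> : 2^-1 * C * f x ^+ 2 + (2 * C)^-1 * H x ^+ 2 - f x * H x =
    (2 * C)^-1 * (C * f x - H x) ^+ 2 by field; rewrite gt_eqF.
  by nneg.
under eq_integral do rewrite -uE.
rewrite -UE -RintE// lee_fin.
rewrite eq1 in VU U0 *.
move: key VU; set V := \int[m2]_x (H x ^+ 2); set U := \int[m2]_x (f x * H x).
set F := \int[m2]_x (f x ^+ 2) => key VU.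
have : (2 * C)^-1 * V <= 2^-1 * U.
  by rewrite invfM -mulrA ler_wpM2l ?invr_ge0// ler_pdivrMl.
move: key; rewrite -mulrA; move: (C * F) ((2 * C)^-1 * V) => cf v h1 h2.
move: h1 h2; clear -cf v; lra.
Qed.

End TTstar.
Section product_bounds.
Context {R : realType} {d1 d2 : measure_display}.
Context {Y : measurableType d1} {Z : measurableType d2}.
Variables (m1 : {sigma_finite_measure set Y -> \bar R}).
Variables (m2 : {sigma_finite_measure set Z -> \bar R}).

Lemma int_prod_mid (g : Y -> R) (a : Y * Z -> R) (b : Z -> R) (A B : R) :
  meas g -> meas a -> meas b ->
  (forall y, 0 <= g y) -> (forall p, 0 <= a p) -> (forall z, 0 <= b z) -> 0 <= A ->
  (forall z, (\int[m1]_y (g y * a (y, z))%:E <= A%:E)%E) -> (\int[m2]_z (b z)%:E <= B%:E)%E ->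
  (\int[m1 \x m2]_p (g p.1 * (a p * b p.2))%:E <= (A * B)%:E)%E.
Proof.
move=> mg ma mb g0 a0 b0 A0 hA hB.
have mF : meas (fun p : Y * Z => g p.1 * (a p * b p.2)) by mfun.
have F0 p : 0 <= g p.1 * (a p * b p.2) by nneg.
rewrite (tonelli2 m1 m2 mF F0).
apply: (le_via (\int[m2]_z (A * b z)%:E)%E); last exact: intZl_le.
apply: (@double_le2 _ _ _ _ _ m1 m2 (fun p => g p.1 * (a p * b p.2)) (fun z => A * b z) mF F0); first by mfun.
move=> z /=; rewrite mulrC; under eq_integral do rewrite mulrA mulrC.
apply: intZl_le => //.
- by apply: mfM => //; exact: mf_section2.
- by nneg.
Qed.

Lemma int_prod_fst (h : Y -> R) (b : Y * Z -> R) (A B : R) :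
  meas h -> meas b ->
  (forall y, 0 <= h y) -> (forall p, 0 <= b p) -> 0 <= B ->
  (\int[m1]_y (h y)%:E <= A%:E)%E -> (forall y, (\int[m2]_z (b (y, z))%:E <= B%:E)%E) ->
  (\int[m1 \x m2]_p (h p.1 * b p)%:E <= (B * A)%:E)%E.
Proof.
move=> mh mb h0 b0 B0 hA hB.
have mF : meas (fun p : Y * Z => h p.1 * b p) by mfun.
have F0 p : 0 <= h p.1 * b p by nneg.
rewrite (tonelli1 m1 m2 mF F0).
apply: (le_via (\int[m1]_y (B * h y)%:E)%E); last exact: intZl_le.
apply: (@double_le _ _ _ _ _ m1 m2 (fun p => h p.1 * b p) (fun y => B * h y) mF F0); first by mfun.
move=> y /=; rewrite (mulrC B); apply: intZl_le => //.
exact: mf_section1.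
Qed.

End product_bounds.

(** * Limits of integrals, truncation, a flat function, and norms *)

Section limits.
Context {R : realType} {d : measure_display} {T : measurableType d}.
Variable mu : {measure set T -> \bar R}.

Lemma einfs_le (u : (\bar R)^nat) k : (einfs u k <= u k)%E.
Proof. by rewrite /einfs; apply: ereal_inf_lbound; exists k => //=. Qed.

Lemma limn_einf_le (u : (\bar R)^nat) (c : \bar R) : (forall k, u k <= c)%E -> (limn_einf u <= c)%E.
Proof.
move=> uc; rewrite limn_einf_lim; apply: lime_le; first exact: is_cvg_einfs.
by apply: nearW => k; exact: le_trans (einfs_le _ _) (uc k).
Qed.

(** Fatou's lemma, in the form in which it removes the cutoffs of the later estimates. *)
Lemma int_lim_le (g_ : nat -> T -> R) (g : T -> R) (c : \bar R) :
  (forall k, meas (g_ k)) -> (forall k x, 0 <= g_ k x) ->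
  (forall x, g_ k x @[k --> \oo] --> g x) ->
  (forall k, \int[mu]_x (g_ k x)%:E <= c)%E -> (\int[mu]_x (g x)%:E <= c)%E.
Proof.
move=> mg g0 gl gc.
have := @fatou _ _ R mu setT measurableT (fun k x => (g_ k x)%:E).
move=> /(_ (fun k => mfE (mg k))) h.
have {}h := h (fun k x _ => g0 k x).
apply: (le_trans _ (le_trans h (limn_einf_le gc))).
apply: le_of_eq; apply: eq_integral => x _.
have hx : (g_ k x)%:E @[k --> \oo] --> (g x)%:E by apply: cvg_EFin; [exact: nearW|exact: gl].
rewrite is_cvg_limn_einfE; last by apply/cvg_ex; exists (g x)%:E.
by rewrite (cvg_lim _ hx).
Qed.

End limits.

Section clipping.
Context {R : realType}.
Implicit Types (v w c : R).

(** Serves two purposes: it splits functions at a height in the interpolation argument, and it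
    replaces essentially bounded functions by everywhere bounded ones. *)
Definition clip c v : R := Num.max (- c) (Num.min v c).

Lemma clipP c v : 0 <= c -> [\/ v <= - c /\ clip c v = - c, - c <= v <= c /\ clip c v = v | c <= v /\ clip c v = c].
Proof.
move=> c0; rewrite /clip; have [h|h] := leP v c.
  have [k|k] := leP (- c) v; first by constructor 2; split => //; apply/andP.
  by constructor 1; split => //; exact: ltW.
constructor 3; split; first exact: ltW.
by rewrite max_r// (le_trans _ c0)// oppr_le0.
Qed.

Lemma clip_abs c v : 0 <= c -> `|clip c v| = Num.min `|v| c.
Proof.
move=> c0; case: (clipP v c0) => -[h ->].
- have v0 : v <= 0 by apply: (le_trans h); rewrite oppr_le0.
  by rewrite normrN (ger0_norm c0) (ler0_norm v0) min_r// lerNr.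
- by rewrite min_l// ler_norml.
- by rewrite min_r ger0_norm//; exact: le_trans h.
Qed.

Lemma clip_sub_abs c v : 0 <= c -> `|v - clip c v| = Num.max (`|v| - c) 0.
Proof.
move=> c0; case: (clipP v c0) => -[h ->].
- have v0 : v <= 0 by apply: (le_trans h); rewrite oppr_le0.
  have vc : v - - c <= 0 by rewrite subr_le0.
  rewrite (ler0_norm v0) (ler0_norm vc) opprD opprK max_l//.
  by rewrite subr_ge0 lerNr.
- by rewrite subrr normr0 max_r// subr_le0 ler_norml.
- have v0 : 0 <= v by exact: le_trans h.
  have vc : 0 <= v - c by rewrite subr_ge0.
  by rewrite (ger0_norm v0) (ger0_norm vc) max_l.
Qed.

Lemma clip_lipschitz c v w : 0 <= c -> `|clip c v - clip c w| <= `|v - w|.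
Proof.
move=> c0; have h1 := ler_norm (v - w); have h2 := ler_norm (- (v - w)); rewrite normrN in h2.
rewrite ler_norml; move: (`|v - w|) h1 h2 => d h1 h2.
case: (clipP v c0) => -[a ->]; case: (clipP w c0) => -[b ->]; apply/andP; split; lra.
Qed.

End clipping.

Section flat_function.
Context {R : realType}.
Implicit Types (x h : R) (k : nat).

(** The powers of $1/x$ are carried along because the family is then closed under differentiation up
    to linear combinations ([flat_derive]), which lets smoothness be proved by induction. *)
Definition flat k x : R := if 0 < x then x^-1 ^+ k * expR (- x^-1) else 0.

Lemma flat_ge0 k x : 0 <= flat k x.
Proof. by rewrite /flat; case: ifPn => // x0; rewrite mulr_ge0 ?expR_ge0// exprn_ge0// invr_ge0 ltW. Qed.

Lemma flat_npos k x : x <= 0 -> flat k x = 0.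
Proof. by rewrite /flat ltNge => ->. Qed.

(** From $u^{k+1}\le(k+1)!\,e^u$ at $u=1/x$. Applied to [flat k.+1], which is the difference
    quotient of [flat k] at 0, it gives the derivative 0 there. *)
Lemma flat_le k x : flat k x <= (k.+1)`!%:R * `|x|.
Proof.
have [x0|x0] := leP x 0; first by rewrite flat_npos.
rewrite /flat x0 gtr0_norm// expRN ler_pdivrMr ?expR_gt0//.
have u0 : 0 <= x^-1 by nneg.
have := expR_ge1Dxn k u0; rewrite -lerBrDl => h.
have {}h : x^-1 ^+ k.+1 <= (k.+1)`!%:R * expR x^-1.
  rewrite -ler_pdivrMl// mulrC; apply: (le_trans h); rewrite lerBlDr lerDl//.
rewrite mulrAC -ler_pdivrMr//; apply: le_trans h.
by rewrite exprSr.
Qed.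

Lemma flat_derive k x : is_derive x (1 : R) (flat k) (flat k.+2 x - k%:R * flat k.+1 x).
Proof.
have [x0|x0|x0] := ltgtP x 0.
- have F0 : \forall y \near x, (fun=> 0) y = flat k y.
    near=> y; rewrite flat_npos//; near: y.
    by apply: filterS (lt_nbhsl x0) => y /=; exact: ltW.
  rewrite !flat_npos ?(ltW x0)// mulr0 subr0.
  by apply: near_eq_is_derive F0 _; by [].
- have F0 : \forall y \near x, (fun y => y^-1 ^+ k * expR (- y^-1)) y = flat k y.
    near=> y; rewrite /flat (_ : 0 < y)//; near: y; exact: lt_nbhsr.
  apply: near_eq_is_derive F0 _.
  have x1 : x != 0 by rewrite gt_eqF.
  have D1 (u : R) : is_derive u (1 : R) (fun v => v ^+ k * expR (- v))
      (u ^+ k * (- expR (- u)) + expR (- u) * (k%:R * u ^+ k.-1)).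
    have A : is_derive u (1 : R) (fun v : R => v ^+ k) (k%:R * u ^+ k.-1).
      have := is_deriveX k (is_derive_id u (1 : R)); rewrite exprfctE => D.
      by apply: (is_derive_eq D); rewrite /GRing.scale /= mulr1.
    have B : is_derive u (1 : R) (fun v : R => expR (- v)) (- expR (- u)).
      have := is_derive1_comp (is_derive_expR (- u)) (is_deriveN (is_derive_id u (1 : R))).
      by rewrite mulrN1.
    exact: is_derive_eq (is_deriveM A B) _.
  have D2 : is_derive x (1 : R) (fun y : R => y^-1) (- x^-1 ^+ 2).
    apply: (is_derive_eq (is_deriveV x1 (is_derive_id x (1 : R)))).
    by rewrite /GRing.scale /= mulr1 exprVn.
  have := is_derive1_comp (D1 x^-1) D2.
  move=> D; apply: (is_derive_eq D); rewrite /flat x0.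
  case: (k) => [|j]; rewrite /= ?exprS; [ring|].
  rewrite ?exprS; ring.
- subst x; rewrite !flat_npos// mulr0 subr0.
  have q0 : (fun h : R => h^-1 *: ((flat k \o shift 0) (h *: (1 : R)) - flat k 0)) @ 0^' --> (0 : R).
    rewrite (_ : (fun h : R => _) = flat k.+1); last first.
      apply/funext => h; rewrite /= addr0 /GRing.scale /= mulr1 (flat_npos k (lexx 0)) subr0 /flat.
      by case: ifPn => _; rewrite ?mulr0// mulrA -exprS.
    apply: cvg_within_filter; apply/cvgr0Pnorm_le => e e0.
    have C0 : (0 : R) < (k.+2)`!%:R by [].
    near=> h; rewrite ger0_norm ?flat_ge0//; apply: (le_trans (flat_le _ _)).
    rewrite -ler_pdivlMl// mulrC; near: h.
    exact: (@nbhs0_le _ R^o (e / (k.+2)`!%:R) (divr_gt0 e0 C0)).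
  split; first by apply/cvg_ex; exists 0.
  exact: cvg_lim q0.
Unshelve. all: by end_near.
Qed.

Lemma flat_continuous k : continuous (flat k).
Proof.
move=> x; apply: differentiable_continuous; apply/derivable1_diffP.
by have [] := flat_derive k x.
Qed.

End flat_function.

Section dominated.
Context {R : realType} {d : measure_display} {T : measurableType d}.
Variable mu : {measure set T -> \bar R}.

Lemma dominated_vanish (h : nat -> T -> R) (g : T -> R) (e : R) :
  (forall k, meas (h k)) -> (forall x, h k x @[k --> \oo] --> (0 : R)) ->
  meas g -> (forall k x, `|h k x| <= g x) -> (\int[mu]_x (g x)%:E < +oo)%E ->
  0 < e -> exists N : nat, forall k, (N <= k)%N -> (\int[mu]_x (`|h k x|)%:E <= e%:E)%E.
Proof.
move=> mh h0 mg hg ig e0.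
have g0 x : 0 <= g x by apply: le_trans (hg 0%N x).
have [|||||_ + _] := @dominated_convergence _ _ _ mu setT measurableT (fun k x => (h k x)%:E) (fun=> 0%E) (fun x => (g x)%:E).
- by move=> k; exact: mfE.
- by [].
- by apply: aeW => x _; apply/fine_cvgP; split; [exact: nearW|exact: h0].
- apply: int_integ => //; under eq_integral do rewrite ger0_norm//; exact: ig.
- by apply: aeW => x k _; rewrite lee_fin.
move=> H; have := H [set y | (y < e%:E)%E]; case.
  by apply: lt_nbhsl; have : (0%:E < e%:E)%E by [].
move=> N _ hN; exists N => k Nk; have := hN k Nk => /=.
by under eq_integral do rewrite subr0; exact: ltW.
Qed.

Lemma l1_triangle (f g h : T -> R) (a b : R) :
  meas f -> meas g -> meas h ->
  (\int[mu]_x (`|f x - g x|)%:E <= a%:E)%E -> (\int[mu]_x (`|g x - h x|)%:E <= b%:E)%E ->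
  (\int[mu]_x (`|f x - h x|)%:E <= (a + b)%:E)%E.
Proof.
move=> mf mg mh fa gb; apply: (le_via (\int[mu]_x (`|f x - g x| + `|g x - h x|)%:E)%E).
  apply: int_le; [mfun|mfun|] => x; rewrite normr_ge0 /=.
  by rewrite -[f x - h x](subrKA (g x)) ler_normD.
by apply: intD_le; mfun.
Qed.

End dominated.

Definition superlevel {R : realType} {T : Type} (f : T -> R) (t : R) : set T := [set x | t < `|f x|].

Section ae_limits.
Context {R : realType} {d : measure_display} {T : measurableType d}.
Variable mu : {measure set T -> \bar R}.
Implicit Types (g h : T -> R).

Lemma int_lim_ae_le (g_ : nat -> T -> R) g (c : \bar R) :
  (forall k, meas (g_ k)) -> meas g ->
  (forall k x, 0 <= g_ k x) -> (forall x, 0 <= g x) ->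
  {ae mu, forall x, g_ k x @[k --> \oo] --> g x} ->
  (forall k, (\int[mu]_x (g_ k x)%:E <= c)%E) -> (\int[mu]_x (g x)%:E <= c)%E.
Proof.
move=> mg_ mg g_0 g0 [N [mN N0 hN]] H.
have -> : (\int[mu]_x (g x)%:E = \int[mu]_x (g x * \1_(~` N) x)%:E)%E.
  apply: ae_eq_integral => //; [mfun|mfun|].
  exists N; split => // x /= h; apply: contrapT => xN; apply: h => _.
  by rewrite indicE mem_set// mulr1.
apply: (@int_lim_le _ _ _ mu (fun k x => g_ k x * \1_(~` N) x)).
- by move=> k; mfun.
- by nneg.
- move=> x; have [xN|xN] := pselect (N x).
    rewrite indicE memNset; last by [].
    by rewrite mulr0; under eq_fun do rewrite mulr0; exact: cvg_cst.
  by apply: cvgM; [apply: contrapT => h; apply: xN; exact: hN|exact: cvg_cst].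
move=> k; apply: le_trans (H k); apply: int_le => //; [mfun|] => x.
by rewrite mulr_ge0//= ler_piMr.
Qed.

Lemma meas_superlevel h (t : R) : meas h -> measurable (superlevel h t).
Proof. by move=> mh; apply: mf_lt; mfun. Qed.

Lemma superlevel_lim_le (h_ : nat -> T -> R) h (t : R) (c : \bar R) :
  (forall k, meas (h_ k)) -> meas h ->
  {ae mu, forall x, h_ k x @[k --> \oo] --> h x} ->
  (forall k, (mu (superlevel (h_ k) t) <= c)%E) -> (mu (superlevel h t) <= c)%E.
Proof.
move=> mh_ mh [N [mN N0 hN]] H.
have [E EE] : exists E : nat -> set T, forall m, E m = \bigcap_(k in [set k | (m <= k)%N]) superlevel (h_ k) t.
  by eexists.
have mE m : measurable (E m).
  by rewrite EE; apply: bigcap_measurable => [|k _]; [exists m => /=|exact: meas_superlevel].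
have mU : measurable (\bigcup_m E m) by exact: bigcup_measurable.
have Ec m : (mu (E m) <= c)%E.
  apply: le_trans (H m); apply: le_measure; rewrite ?inE; [exact: mE|exact: meas_superlevel|].
  by rewrite EE => x; apply => /=.
have Uc : (mu (\bigcup_m E m) <= c)%E.
  have ndE : {homo E : n m / (n <= m)%N >-> (n <= m)%O}.
    by move=> i j ij; apply/subsetPset; rewrite !EE => x hx k /= jk; apply: hx => /=; exact: leq_trans jk.
  have cv := nondecreasing_cvg_mu (mu := mu) mE mU ndE.
  rewrite -(cvg_lim _ cv)//; apply: lime_le; first by apply/cvg_ex; eexists; exact: cv.
  by apply: nearW => m; exact: Ec.
apply: (le_via (mu (\bigcup_m E m `|` N))).
  apply: le_measure; rewrite ?inE; [exact: meas_superlevel|exact: measurableU|].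
  move=> x hx; have [xN|xN] := pselect (N x); first by right.
  left; have cvx : `|h_ k x| @[k --> \oo] --> `|h x|.
    by apply: cvg_norm; apply: contrapT => h'; apply: xN; exact: hN.
  have [m _ hm] : \forall k \near \oo, t < `|h_ k x| by apply: (cvx [set y | t < y]); exact: lt_nbhsr.
  by exists m => //; rewrite EE => k /=; exact: hm.
suff hc : (mu (\bigcup_m E m) + mu N <= c)%E by apply: le_trans hc; exact: measureU2.
by rewrite N0 adde0.
Qed.

Lemma ae_eq_superlevel g h : meas g -> meas h ->
  (forall t e : R, 0 < t -> 0 < e -> (mu (superlevel (fun x => (g x - h x)%R) t) <= e%:E)%E) ->
  {ae mu, forall x, g x = h x}.
Proof.
move=> mg mh H.
have Z (k : nat) : {ae mu, forall x, `|g x - h x| <= k.+1%:R^-1}.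
  exists (superlevel (fun x => g x - h x) k.+1%:R^-1); split.
  - by apply: meas_superlevel; mfun.
  - apply/eqP; rewrite eq_le measure_ge0 andbT; apply/lee_addgt0Pr => e e0; rewrite add0e.
    by apply: H; rewrite ?invr_gt0.
  - by move=> x /= /negP; rewrite -ltNge.
have := ae_foralln Z; apply: filterS => x hx; apply/eqP; rewrite -subr_eq0 -normr_le0.
apply/ler_addgt0Pr => e e0; rewrite add0r; apply: (le_trans (hx (Num.bound e^-1))).
rewrite -[leRHS]invrK lef_pV2 ?posrE ?invr_gt0//.
by apply: (le_trans (ltW (archi_boundP _))); rewrite ?invr_ge0 ?(ltW e0)// ler_nat.
Qed.

(** The measures are summable, so the limit superior of the sets is null. The rate $2^{-k}$ outside
    it is what makes a sequence with increments [a k] convergent. *)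
Lemma borel_cantelli_cvg (a : nat -> T -> R) :
  (forall k, meas (a k)) ->
  (forall k, (mu (superlevel (a k) (2^-1 ^+ k)) <= (2^-1 ^+ k)%:E)%E) ->
  exists N, [/\ measurable N, mu N = 0%E & forall x, ~ N x ->
    exists m, forall k, (m <= k)%N -> `|a k x| <= 2^-1 ^+ k].
Proof.
move=> ma H; exists (lim_sup_set (fun k => superlevel (a k) (2^-1 ^+ k))); split.
- apply: bigcapT_measurable => k; apply: bigcup_measurable => j _; exact: meas_superlevel.
- apply: lim_sup_set_cvg0; first by move=> k; exact: meas_superlevel.
  apply: (le_lt_via (1 / (1 - 2^-1))%:E); last exact: ltry.
  apply: (nneseries_geometric_le (u := fun k => mu (superlevel (a k) (2^-1 ^+ k)))) => //.
    by rewrite invr_gt0 ltr0n invf_lt1// ltr1n.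
  by move=> k; rewrite measure_ge0 mul1r; exact: H.
move=> x; rewrite /lim_sup_set => /existsNP[m] /not_implyP[_ h]; exists m => k mk.
by rewrite leNgt; apply/negP => hk; apply: h; exists k.
Qed.

End ae_limits.

Lemma cvge0_nonneg {R : realType} (a : nat -> \bar R) : (forall k, 0 <= a k)%E ->
  (a k @[k --> \oo] --> 0%E) <->
  (forall e : R, 0 < e -> exists N : nat, forall k, (N <= k)%N -> (a k <= e%:E)%E).
Proof.
move=> a0; split=> H.
  move=> e e0; have h : (0%:E < e%:E)%E by [].
  by have [N _ hN] := H [set y | (y < e%:E)%E] (lt_nbhsl h); exists N => k /hN /ltW.
apply/fine_cvgP; split.
  have [N hN] := H 1 ltr01; exists N => // k /= /hN h.
  by rewrite ge0_fin_numE//; exact: le_lt_trans h (ltry _).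
apply/cvgr0Pnorm_le => e e0; have [N hN] := H e e0; exists N => // k /= /hN h.
rewrite ger0_norm -lee_fin fineK// ge0_fin_numE//; exact: le_lt_trans h (ltry _).
Qed.

Section Lnorm_real.
Context {R : realType} {d : measure_display} {T : measurableType d}.
Variable mu : {measure set T -> \bar R}.
Implicit Types (f g : T -> R) (p e c F : R).
Local Open Scope ereal_scope.

Lemma LnormE p f : 'N[mu]_p%:E[EFin \o f] = (\int[mu]_x (`|f x| `^ p)%:E) `^ p^-1.
Proof.
rewrite unlock; by [].
Qed.

Let int_ge0 p f : 0 <= \int[mu]_x (`|f x| `^ p)%:E.
Proof. by apply: integral_ge0 => x _; rewrite lee_fin. Qed.

Lemma Lnorm_real p f F : \int[mu]_x (`|f x| `^ p)%:E = F%:E -> 'N[mu]_p%:E[EFin \o f] = (F `^ p^-1)%:E.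
Proof. by move=> FE; rewrite LnormE FE. Qed.

Lemma Lnorm_le_real p f e : (1 <= p)%R -> (0 <= e)%R ->
  ('N[mu]_p%:E[EFin \o f] <= e%:E) = (\int[mu]_x (`|f x| `^ p)%:E <= (e `^ p)%:E).
Proof.
move=> p1 e0; have p0 : (0 < p)%R by apply: lt_le_trans p1.
rewrite LnormE; have := int_ge0 p f; case: (\int[mu]_x _) => [r| |]//.
- rewrite !lee_fin => r0.
  have E : (e = (e `^ p) `^ p^-1)%R by rewrite -powRrM divff ?gt_eqF// powRr1.
  apply/idP/idP => h.
    have := ge0_ler_powR (ltW p0) (powR_ge0 _ _ : (_ \in Num.nneg)) (e0 : e \in Num.nneg) h.
    by rewrite -powRrM mulVf ?gt_eqF// powRr1.
  by rewrite E; apply: ge0_ler_powR; rewrite ?nnegrE ?powR_ge0// invr_ge0 ltW.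
- by move=> _; rewrite poweRyr// gt_eqF// invr_gt0.
Qed.

Lemma Lfun_int p f : (1 <= p)%R -> (f \in Lfun mu p%:E) <->
  (meas f /\ \int[mu]_x (`|f x| `^ p)%:E < +oo).
Proof.
move=> p1; have p0 : (p^-1 != 0)%R by rewrite gt_eqF// invr_gt0; apply: lt_le_trans p1.
split.
  rewrite inE => /andP[/[!inE]/= mf]; rewrite /finite_norm LnormE => /(lty_poweRy p0).
  by [].
move=> [mf h]; rewrite inE; apply/andP; rewrite !inE/=; split=> //.
by rewrite /finite_norm LnormE; exact: poweR_lty.
Qed.

Lemma Lnorm_cvg0 p (h : nat -> T -> R) : (1 <= p)%R ->
  ('N[mu]_p%:E[EFin \o h k] @[k --> \oo] --> 0) <->
  (forall e, (0 < e)%R -> exists N : nat, forall k, (N <= k)%N -> \int[mu]_x (`|h k x| `^ p)%:E <= e%:E).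
Proof.
move=> p1; have p0 : (0 < p)%R by apply: lt_le_trans p1.
have N0 k : 0 <= 'N[mu]_p%:E[EFin \o h k] by exact: Lnorm_ge0.
split=> [/(cvge0_nonneg N0) H e e0|H].
  have e1 : (0 < e `^ p^-1)%R by rewrite powR_gt0.
  have [N hN] := H _ e1; exists N => k /hN; rewrite Lnorm_le_real ?(ltW e1)//.
  by rewrite -powRrM mulVf ?gt_eqF// powRr1// ltW.
apply/(cvge0_nonneg N0) => e e0; have [N hN] := H _ (powR_gt0 p e0).
by exists N => k /hN; rewrite Lnorm_le_real// ltW.
Qed.

Lemma Lnorm_bound p c f g : (1 <= p)%R -> (0 <= c)%R -> \int[mu]_x (`|f x| `^ p)%:E < +oo ->
  \int[mu]_x (`|g x| `^ p)%:E <= (c `^ p)%:E * \int[mu]_x (`|f x| `^ p)%:E ->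
  'N[mu]_p%:E[EFin \o g] <= c%:E * 'N[mu]_p%:E[EFin \o f].
Proof.
move=> p1 c0 fp; have p0 : (0 < p)%R by apply: lt_le_trans p1.
have [F F0 FE] : exists2 F, (0 <= F)%R & \int[mu]_x (`|f x| `^ p)%:E = F%:E.
  exists (fine (\int[mu]_x (`|f x| `^ p)%:E)); first by rewrite fine_ge0.
  by rewrite fineK// ge0_fin_numE.
rewrite FE (Lnorm_real FE) -!EFinM => h; rewrite Lnorm_le_real ?mulr_ge0 ?powR_ge0//.
by rewrite powRM ?powR_ge0// -powRrM mulVf ?gt_eqF// powRr1.
Qed.

Lemma Linfty_ae f F : f \in Lfun mu +oo -> 'N[mu]_+oo[EFin \o f] < F%:E ->
  {ae mu, forall x, (`|f x| <= F)%R}.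
Proof.
move=> _; rewrite unlock; case: ifPn => [_ h|m0 _].
  have /ess_supP := ltW h; by [].
(* When the whole space is null, the essential norm is 0 by definition and every property holds
   almost everywhere. *)
exists setT; split => //.
by apply/eqP; rewrite eq_le measure_ge0 andbT leNgt.
Qed.

Lemma Linfty_mf f : f \in Lfun mu +oo -> meas f.
Proof. by rewrite inE => /andP[/[!inE]]. Qed.

Lemma Linfty_fin f : f \in Lfun mu +oo -> exists2 F, (0 <= F)%R & 'N[mu]_+oo[EFin \o f] = F%:E.
Proof.
rewrite inE => /andP[_]; rewrite inE /= /finite_norm => h.
exists (fine 'N[mu]_+oo[EFin \o f]); first by rewrite fine_ge0// Lnorm_ge0.
by rewrite fineK// ge0_fin_numE// Lnorm_ge0.
Qed.

End Lnorm_real.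

Lemma superlevel_ae_eq (R : realType) (d : measure_display) (T : measurableType d) (mu : {measure set T -> \bar R})
  (g h : T -> R) (t : R) : meas g -> meas h -> {ae mu, forall x, g x = h x} ->
  mu (superlevel g t) = mu (superlevel h t).
Proof.
move=> mg mh gh; apply/eqP; rewrite eq_le; apply/andP; split.
  apply: (@superlevel_lim_le _ _ _ mu (fun=> h) g) => //.
  by apply: filterS gh => x ->; exact: cvg_cst.
apply: (@superlevel_lim_le _ _ _ mu (fun=> g) h) => //.
by apply: filterS gh => x ->; exact: cvg_cst.
Qed.

Lemma max0_lipschitz (R : realDomainType) (a b c : R) :
  `|Num.max (a - c) 0 - Num.max (b - c) 0| <= `|a - b|.
Proof.
have mx (v : R) : (Num.max v 0 = v /\ 0 <= v) \/ (Num.max v 0 = 0 /\ v <= 0).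
  by case: (ltP v 0) => h; [right|left]; split => //; exact: ltW.
have h1 := ler_norm (a - b); have h2 := ler_norm (- (a - b)); rewrite normrN in h2.
rewrite ler_norml.
case: (mx (a - c)) => -[-> h3]; case: (mx (b - c)) => -[-> h4];
  move: (`|a - b|) h1 h2 => k h1 h2; apply/andP; split; lra.
Qed.

Lemma Rint_subr_cst d (T : measurableType d) (R : realType) (m : {measure set T -> \bar R})
    (f g : T -> R) (c : R) :
  integ m (fun z => f z * g z) -> integ m f ->
  \int[m]_z f z = 0 -> \int[m]_z (f z * g z) = \int[m]_z (f z * (g z - c)).
Proof.
move=> fgi fi f0; under [RHS]eq_Rintegral do rewrite mulrBr.
rewrite RintegralB; [|by []|exact: fgi|exact: (integrableZr measurableT c fi)].
under [X in _ - X]eq_Rintegral do rewrite mulrC.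
by rewrite RintegralZl// f0 mulr0 subr0.
Qed.

(** For $c\ne0$, as soon as one of the two integrals is nonzero [f] is integrable and linearity
    applies; otherwise both are 0. Default values thus scale as well. *)
Lemma Rint_scale (R : realType) dT (T : measurableType dT) (m : {measure set T -> \bar R}) (f : T -> R) (c : R) :
  meas f -> \int[m]_x (c * f x) = c * \int[m]_x f x.
Proof.
move=> mf; have [->|c0] := eqVneq c 0.
  by rewrite mul0r; under eq_Rintegral do rewrite mul0r; rewrite Rintegral_cst// mul0r.
have [cf0|cf0] := eqVneq (\int[m]_x (c * f x)) 0; last first.
  by rewrite RintegralZl//; apply: (Rint_neq0_integrable mf c0); exact/eqP.
have [f0|f0] := eqVneq (\int[m]_x f x) 0; first by rewrite f0 mulr0.
rewrite RintegralZl//; apply: (@Rint_neq0_integrable _ _ _ m _ 1 mf (oner_neq0 _)).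
by under eq_Rintegral do rewrite mul1r; exact/eqP.
Qed.

Lemma Rint_sub dT (T : measurableType dT) (R : realType) (m : {measure set T -> \bar R}) (f g : T -> R) :
  integ m f -> integ m g ->
  \int[m]_x f x - \int[m]_x g x = \int[m]_x (f x - g x).
Proof. by move=> fi gi; rewrite RintegralB. Qed.

Lemma Rint_scaler (R : realType) dT (T : measurableType dT) (m : {measure set T -> \bar R}) (c : R) (f : T -> R) :
  meas f -> \int[m]_x (f x * c) = (\int[m]_x f x) * c.
Proof. by move=> mf; under eq_Rintegral do rewrite mulrC; rewrite Rint_scale// mulrC. Qed.

Lemma powR_add_le (R : realType) (p a b : R) : 0 <= p -> `|a + b| `^ p <= 2 `^ p * (`|a| `^ p + `|b| `^ p).
Proof.
move=> p0; have [ab|ab] := leP `|a| `|b|.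
  apply: (le_via ((2 * `|b|) `^ p)).
    by apply: ge0_ler_powR; rewrite ?nnegrE ?mulr_ge0// mulr_natl (le_trans (ler_normD _ _))// lerD2r.
  by rewrite powRM// ler_wpM2l ?powR_ge0// lerDr.
apply: (le_via ((2 * `|a|) `^ p)).
  by apply: ge0_ler_powR; rewrite ?nnegrE ?mulr_ge0// mulr_natl (le_trans (ler_normD _ _))// lerD2l ltW.
by rewrite powRM// ler_wpM2l ?powR_ge0// lerDl.
Qed.

Lemma le_linear_eps (R : realFieldType) (a b c : R) : 0 <= c -> (forall e, 0 < e -> a <= b + c * e) -> a <= b.
Proof.
move=> c0 H; apply/ler_addgt0Pr => e e0; have c1 : 0 < c + 1 by rewrite ltr_pwDr.
apply: (le_trans (H (e / (c + 1)) (divr_gt0 e0 c1))).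
by rewrite lerD2l mulrCA ger_pMr// ler_pdivrMr// mul1r lerDl.
Qed.

Lemma amgm_eps (R : realFieldType) (a b e : R) : 0 < e -> `|a| * `|b| <= e * b ^+ 2 + e^-1 * a ^+ 2.
Proof.
move=> e0; have e1 : e != 0 by rewrite gt_eqF.
rewrite -[a ^+ 2]real_normK ?num_real// -[b ^+ 2]real_normK ?num_real//.
rewrite -subr_ge0 (_ : _ - _ = e^-1 * ((`|a| - e * `|b|) ^+ 2 + e * (`|a| * `|b|))); last by field.
by nneg.
Qed.

Lemma powR_norm2 (R : realType) (a : R) : `|a| `^ 2 = a ^+ 2.
Proof. by rewrite powR_mulrn// real_normK ?num_real. Qed.

(** * Potentials, the bilinear form and the kernel *)

Section rV_operators.
Context {R : realType} {n : nat}.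
Hypothesis n0 : (0 < n)%N.
Local Notation mu := (@lebesgue_rV R n).
Local Notation mu2 := (@lebesgue_rV R n \x @lebesgue_rV R n)%E.
(* This is [mu2] with its sigma-finite structure. *)
Local Notation pm := (prod_measure (@lebesgue_rV R n) (@lebesgue_rV R n)).
Local Notation X := 'rV[R]_n.
Local Notation G := (@annular R n).
Local Notation C := (@annular_cst R n).

Section riesz_cancellation.
Implicit Types (x y z : X) (t d : R).

Lemma int_rdiff_le t d x y : 0 < t < 1 -> 0 < d <= t -> d <= 1 - t ->
  (\int[mu]_z (`|rdiff t x y z|)%:E <= (2 * n%:R * C d * enorm (x - y) `^ t)%:E)%E.
Proof.
move=> t01 d0t dt1; have d0 : 0 < d by case/andP: d0t.
apply: (le_via (\int[mu]_z (n%:R * enorm (x - y) `^ t *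
    (G d (enorm (x - y)) (enorm (x - z)) + G d (enorm (x - y)) (enorm (y - z))))%:E)%E).
  apply: int_le; [mfun|mfun|] => z.
  by rewrite normr_ge0; exact: riesz_diff_le.
have -> : 2 * n%:R * C d * enorm (x - y) `^ t = n%:R * enorm (x - y) `^ t * (C d + C d) by ring.
apply: intZl_le.
- by nneg.
- by mfun.
- by nneg.
- apply: intD_le; [mfun|mfun|by nneg|by nneg| |];
  exact: int_annularC.
Qed.

Lemma rdiff_integrable t x y : 0 < t < 1 -> integ mu (rdiff t x y).
Proof.
move=> t01; pose d := Num.min t (1 - t).
have [d0 [dt dt1]] : 0 < d /\ d <= t /\ d <= 1 - t.
  by split; [rewrite lt_min; move: t01; clear; lra|rewrite !ge_min !lexx orbT].
apply: int_integ; first by mfun.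
apply: (le_lt_trans (int_rdiff_le x y t01 _ dt1) (ltry _)).
by rewrite d0.
Qed.

Lemma riesz_ge0 t x z : 0 <= riesz t x z.
Proof. exact: powR_ge0. Qed.

Lemma riesz_shift t x y z : riesz t y (z + (y - x)) = riesz t x z.
Proof. rewrite /riesz (_ : y - (z + (y - x)) = x - z)//.
by apply/rowP => i; rewrite !mxE; ring. Qed.

Lemma riesz_le_annular t (r : R) x z : 0 < t < 1 -> 0 < r -> enorm (x - z) <= r ->
  riesz t x z <= r `^ t * G t r (enorm (x - z)).
Proof.
move=> /andP[t0 t1] r0 xzr.
have [xz|xz] := eqVneq (enorm (x - z)) 0.
  rewrite /riesz xz powR0 ?mulr_ge0 ?powR_ge0 ?annular_ge0// subr_eq0 lt_eqF//.
  by rewrite (lt_le_trans t1)// ler1n.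
have {}xz : 0 < enorm (x - z) by rewrite lt_def xz enorm_ge0.
rewrite annular_ler// powRM ?invr_ge0 ?(ltW r0) ?(ltW xz)//.
have -> : (r^-1) `^ t = (r `^ t)^-1.
  by rewrite -powR_inv1 ?(ltW r0)// -powRrM mulN1r powRN.
rewrite /riesz (addrC t) -powR_add//.
move: (powR_gt0 t r0) (enorm (x - z) `^ (- n%:R)) (enorm (x - z) `^ t); move: (r `^ t).
move=> c c0 a b; apply: le_of_eq; field.
by rewrite gt_eqF.
Qed.

Lemma int_riesz_ball t (r : R) x : 0 < t < 1 -> 0 < r ->
  (\int[mu]_z (riesz t x z * \1_(cball x r) z)%:E <= (r `^ t * C t)%:E)%E.
Proof.
move=> t01 r0; have t0 : 0 < t by case/andP: t01.
apply: (le_via (\int[mu]_z (r `^ t * G t r (enorm (x - z)))%:E)%E).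
  apply: int_le; [mfun|mfun|] => z.
  rewrite mulr_ge0 ?riesz_ge0//= indicE; case: (boolP (z \in _)) => [|_]; last first.
    by rewrite mulr0 mulr_ge0 ?powR_ge0// annular_ge0.
  rewrite inE => xr; rewrite mulr1; apply: riesz_le_annular => //.
  by rewrite enormC.
apply: intZl_le; [exact: powR_ge0|mfun|by nneg|].
by apply: int_annularC => //; exact: ltW.
Qed.

Lemma riesz_small t (c : R) x z : 0 < t < 1 -> 0 < c ->
  c `^ (- (n%:R - t)^-1) < enorm (x - z) -> riesz t x z <= c.
Proof.
move=> /andP[t0 t1] c0.
have nt : 0 < n%:R - t by rewrite subr_gt0 (lt_le_trans t1)// ler1n.
set r := c `^ _ => rx.
have r0 : 0 < r by exact: powR_gt0.
have -> : c = r `^ (- (n%:R - t)).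
  by rewrite -powRrM mulrNN mulVf ?powRr1 ?(ltW c0)// gt_eqF.
rewrite /riesz -(opprB n%:R t); apply: powR_neg_antitone => //; exact: ltW.
Qed.

(** The Riesz kernel is not integrable at infinity; its part above a positive level has bounded
    support and is. *)
Definition riesz_trunc t (c : R) x z := Num.max (riesz t x z - c) 0.

Lemma riesz_trunc_integrable t (c : R) x : 0 < t < 1 -> 0 < c ->
  integ mu (riesz_trunc t c x).
Proof.
move=> t01 c0; set r := c `^ (- (n%:R - t)^-1).
have r0 : 0 < r by exact: powR_gt0.
have mt : meas (riesz_trunc t c x) by rewrite /riesz_trunc; mfun.
apply: int_integ => //.
apply: le_lt_trans (le_lt_trans (int_riesz_ball x t01 r0) (ltry _)).
apply: int_le; [mfun|mfun|] => z; rewrite normr_ge0/=.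
rewrite ger0_norm; last by rewrite le_max lexx orbT.
rewrite ge_max mulr_ge0 ?riesz_ge0//= ?andbT lerBlDr.
rewrite indicE; case: (boolP (_ \in _)) => [_|].
  by rewrite mulr1 lerDl ltW.
rewrite notin_setE /cball /= mulr0 add0r enormC => /negP; rewrite -ltNge; exact: riesz_small.
Qed.

(** Neither kernel is integrable by itself, so translation invariance does not apply to them
    directly. It applies to their parts above the level $1/(k+1)$, which are integrable translates
    of each other; as truncation is 1-Lipschitz, [rdiff] dominates the difference of these parts and
    the limit may be taken. *)
Lemma Rint_rdiff t x y : 0 < t < 1 -> \int[mu]_z rdiff t x y z = 0.
Proof.
move=> t01.
have ti k : integ mu (riesz_trunc t (k.+1%:R^-1) x).
  by apply: riesz_trunc_integrable.
have ti' k : integ mu (riesz_trunc t (k.+1%:R^-1) y).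
  by apply: riesz_trunc_integrable.
have mt c w : meas (riesz_trunc t c w) by rewrite /riesz_trunc; mfun.
have zero k : (\int[mu]_z (riesz_trunc t k.+1%:R^-1 x z - riesz_trunc t k.+1%:R^-1 y z)%:E = 0)%E.
  under eq_integral do rewrite EFinB.
  rewrite integralB//; [|exact: ti|exact: ti'].
  rewrite -[X in (_ - X)%E](@int_shift R n (fun z => (riesz_trunc t k.+1%:R^-1 y z)%:E) (y - x)).
  - under [X in (_ - X)%E]eq_integral do rewrite /riesz_trunc riesz_shift.
    rewrite subee//; exact: (integrable_fin_num measurableT (ti k)).
  - by mfun.
  - by move=> z; rewrite lee_fin le_max lexx orbT.
have tc w z : riesz_trunc t k.+1%:R^-1 w z @[k --> \oo] --> riesz t w z.
  apply: (@squeeze_cvgr _ _ _ _ (fun k => riesz t w z - k.+1%:R^-1) (fun=> riesz t w z)).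
  - apply: nearW => k; rewrite le_max lexx ge_max riesz_ge0 andbT.
    by rewrite /= gerBl.
  - by rewrite -[X in _ --> X]subr0; apply: cvgB; [exact: cvg_cst|exact: cvg_harmonic].
  - exact: cvg_cst.
have [] := @dominated_convergence _ _ R mu setT measurableT
  (fun k z => (riesz_trunc t k.+1%:R^-1 x z - riesz_trunc t k.+1%:R^-1 y z)%:E)
  (EFin \o rdiff t x y) (fun z => `|rdiff t x y z|%:E).
- by move=> k; mfun.
- by mfun.
- by apply: nearW => z _; apply: cvg_EFin; [exact: nearW|apply: cvgB; exact: tc].
- exact: (integrable_norm (rdiff_integrable x y t01)).
- apply: nearW => z k _; rewrite lee_fin /rdiff /riesz_trunc.
  move: (riesz t x z) (riesz t y z) (k.+1%:R^-1 : R) => a b c.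
  exact: max0_lipschitz.
move=> _ _; under eq_fun do rewrite zero.
move=> h; have {}h := cvg_unique _ h (cvg_cst 0%E).
by rewrite /Rintegral h.
Qed.

End riesz_cancellation.

(* Names a function without leaving its body visible to the unifier. *)
Lemma ex_fun (A B : Type) (f : A -> B) : exists g, forall x, g x = f x.
Proof. by exists f. Qed.

(** * Correlations of Riesz differences *)

Section schur_estimate.
Implicit Types (x y z : X) (t d : R).

(** Moments cost decay: as $\min(r/u,u/r)\le u/r$, the factor $r^e$ becomes $u^e$ in exchange for
    [e] units of the exponent. *)
Lemma powR_annular_moment (e d u r : R) : 0 < e < d -> 0 <= u -> 0 <= r ->
  r `^ e * G d u r <= u `^ e * G (d - e) u r.
Proof.
move=> /andP[e0 ed] u0 r0.
have h0 : 0 <= u `^ e * G (d - e) u r by nneg.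
move: r0 h0; rewrite le_eqVlt => /predU1P[<-|r0] h0; first by rewrite annular_r0// mulr0.
move: u0 h0; rewrite le_eqVlt => /predU1P[<-|u0] h0.
  by rewrite annular_u0 ?mulr0 ?gt_eqF ?(lt_trans e0).
with_strategy transparent [annular] rewrite /annular.
set m := Num.min _ _.
have m0 : 0 < m by rewrite lt_min !divr_gt0.
have mle : m <= u / r by rewrite ge_min lexx orbT.
have -> : m `^ d = m `^ (d - e) * m `^ e by rewrite powR_add// subrK.
have h : r `^ e * m `^ e <= u `^ e.
  rewrite -powRM ?(ltW r0) ?(ltW m0)//.
  apply: ge0_ler_powR; rewrite ?nnegrE ?mulr_ge0 ?(ltW r0) ?(ltW m0) ?(ltW e0) ?(ltW u0)//.
  by rewrite mulrC -ler_pdivlMr.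
move: (powR_ge0 r (- n%:R)) (powR_ge0 m (d - e)) h.
move: (r `^ e) (r `^ (- n%:R)) (m `^ (d - e)) (m `^ e) (u `^ e) => a b c f g b0 c0 h.
have -> : a * (b * (c * f)) = b * c * (a * f) by ring.
have -> : g * (b * c) = b * c * g by ring.
by rewrite ler_wpM2l// mulr_ge0.
Qed.

Lemma powR_subadd (e a b : R) : 0 < e <= 1 -> 0 <= a -> 0 <= b ->
  (a + b) `^ e <= a `^ e + b `^ e.
Proof.
move=> /andP[e0 e1]; rewrite le_eqVlt => /predU1P[<- b0|a0].
  by rewrite powR0 ?add0r// gt_eqF.
rewrite le_eqVlt => /predU1P[<-|b0].
  by rewrite powR0 ?addr0// gt_eqF.
have s0 : 0 < a + b by rewrite addr_gt0.
have le1 c : 0 < c -> c <= a + b -> c / (a + b) * (a + b) `^ e <= c `^ e.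
  move=> c0 cs.
  have -> : c `^ e = (c / (a + b)) `^ e * (a + b) `^ e.
    by rewrite -powRM ?divfK ?gt_eqF ?divr_ge0// ltW.
  rewrite ler_wpM2r ?powR_ge0// ger1_powR// divr_gt0//=.
  by rewrite ler_pdivrMr// mul1r.
have ha := le1 a a0; have hb := le1 b b0.
have -> : (a + b) `^ e = a / (a + b) * (a + b) `^ e + b / (a + b) * (a + b) `^ e.
  by rewrite -mulrDl -mulrDl divff ?mul1r// gt_eqF.
by apply: lerD; [apply: ha; rewrite lerDl ltW|apply: hb; rewrite lerDr ltW].
Qed.

Lemma annular_sum_moment (e d : R) x y z : 0 < e < d -> d <= 1 ->
  let u := enorm (x - y) in
  enorm (z - x) `^ e * (G d u (enorm (x - z)) + G d u (enorm (y - z))) <=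
  2 * u `^ e * (G (d - e) u (enorm (x - z)) + G (d - e) u (enorm (y - z))).
Proof.
move=> /andP[e0 ed] d1 /=; set u := enorm (x - y).
have ee : 0 < e < d by rewrite e0.
have e01 : 0 < e <= 1 by rewrite e0; move: ed d1; clear -e d; lra.
have u0 : 0 <= u by exact: enorm_ge0.
have p1 : 0 <= enorm (x - z) by [].
have p2 : 0 <= enorm (y - z) by [].
have m1 := powR_annular_moment ee u0 p1.
have m2 := powR_annular_moment ee u0 p2.
have zx : enorm (z - x) `^ e <= enorm (y - z) `^ e + u `^ e.
  apply: (le_trans _ (powR_subadd e01 p2 u0)); apply: ge0_ler_powR; rewrite ?nnegrE ?addr_ge0 ?enorm_ge0 ?(ltW e0)//.
  by rewrite /u (enormC y z) (enormC x y); exact: enormBD.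
have ex : G d u (enorm (y - z)) <= G (d - e) u (enorm (y - z)).
  apply: annular_le_exp => //; rewrite subr_gt0 ed; move: e0; clear -e d; lra.
have g1 := annular_ge0 n (d - e) u (enorm (x - z)).
have g2 := annular_ge0 n (d - e) u (enorm (y - z)).
have g3 := annular_ge0 n d u (enorm (y - z)).
have ue := powR_ge0 u e.
rewrite (enormC z x) in zx *.
move: zx m1 m2 ex g1 g2 g3 ue.
move: (enorm (x - z) `^ e) (enorm (y - z) `^ e) (u `^ e) (G d u (enorm (x - z)))
  (G d u (enorm (y - z))) (G (d - e) u (enorm (x - z))) (G (d - e) u (enorm (y - z))).
clear => a b c p q p' q' zx m1 m2 ex g1 g2 g3 c0.
have h1 : a * q <= (b + c) * q by rewrite ler_wpM2r.
have h2 : c * q <= c * q' by rewrite ler_wpM2l.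
have h3 : 0 <= c * p' by nneg.
move: h1; rewrite mulrDl => h1; lra.
Qed.

(** [schur_d] is the decay of first differences. A share [schur_l] of a second difference is spent
    on its small step, which gains the power [schur_eta] of that step; [schur_e] is the decay left
    in the other factor after a moment of this order has been taken. *)
Definition schur_d (t : R) := Num.min t (1 - t).
Definition schur_l (t : R) := schur_d t / 2.
Definition schur_eta (t : R) := t * schur_l t.
Definition schur_e (t : R) := schur_d t - schur_eta t.

Lemma schur_exponents t : 0 < t < 1 ->
  [/\ 0 < schur_d t <= t, schur_d t <= 1 - t, 0 <= schur_l t < 1, 0 < schur_eta t < schur_d t &
  0 < schur_e t <= schur_d t * (1 - schur_l t) /\ schur_d t <= 1].
Proof.
move=> /andP[a b]; rewrite /schur_e /schur_eta /schur_l.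
have : 0 < schur_d t by rewrite lt_min a subr_gt0.
have : schur_d t <= t by rewrite ge_min lexx.
have : schur_d t <= 1 - t by rewrite ge_min lexx orbT.
move: (schur_d t) => d dt1 dt d0; clear -a b dt1 dt d0.
have h1 : 0 < t * (d / 2) by rewrite mulr_gt0// divr_gt0.
have h2 : t * (d / 2) < d / 2 by rewrite gtr_pMl// divr_gt0.
have h3 : d * (d / 2) <= t * (d / 2) by rewrite ler_wpM2r// ltW// divr_gt0.
split; try lra; split; try lra.
Qed.

Definition annular2 (d : R) (q : X * X) z : R :=
  G d (enorm (q.1 - q.2)) (enorm (q.1 - z)) + G d (enorm (q.1 - q.2)) (enorm (q.2 - z)).

Lemma annular2_ge0 d q z : 0 <= annular2 d q z.
Proof. by rewrite addr_ge0// annular_ge0. Qed.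

Local Ltac nneg2 := try match goal with |- is_true (0 <= _) => nneg end; try exact: annular2_ge0.

Lemma mf_annular2 d dT (T : measurableType dT) (f : T -> X * X) (g : T -> X) :
  meas f -> meas g ->
  meas (fun w => annular2 d (f w) (g w)).
Proof.
move=> mf mg.
by rewrite /annular2; mfun.
Qed.

Lemma int_annular2 d q : 0 < d -> (\int[mu]_z (annular2 d q z)%:E <= (2 * C d)%:E)%E.
Proof.
move=> d0; have -> : 2 * C d = C d + C d by ring.
apply: intD_le; [mfun|mfun|by nneg|by nneg| |];
  by apply: int_annularC; by [].
Qed.

(** The kernel of $TT^*$ for the map that sends [f] to the increments of its potential, before the
    weights are attached. *)
Definition rcorr t (q q' : X * X) : R := \int[mu]_z (rdiff t q.1 q.2 z * rdiff t q'.1 q'.2 z).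

Lemma rcorrC t q q' : rcorr t q q' = rcorr t q' q.
Proof. by apply: eq_Rintegral => z _; exact: mulrC. Qed.

(* As [rdiff q] has integral 0, its correlation with [rdiff q'] only sees the oscillation of
   the latter. *)
Lemma rcorr_le t (q q' : X * X) : 0 < t < 1 ->
  let u := enorm (q.1 - q.2) in let u' := enorm (q'.1 - q'.2) in
  ((`|rcorr t q q'|)%:E <= \int[mu]_z (8 * n%:R ^+ 2 *
    (u `^ t * u `^ (schur_eta t) * u' `^ (t - schur_eta t)) *
    (annular2 (schur_e t) q z * (annular2 (schur_e t) q' z + annular2 (schur_e t) q' q.1)))%:E)%E.
Proof.
move=> t01 /=.
have [/andP[d0 dt] dt1 l01 ed [/andP[e0 eld] d1]] := schur_exponents t01.
have d0t : 0 < schur_d t <= t by rewrite d0.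
set u := enorm (q.1 - q.2); set u' := enorm (q'.1 - q'.2).
set d := schur_d t in d0 dt dt1 ed eld d0t d1 *.
set eta := schur_eta t in ed *; set e := schur_e t in e0 eld *.
set l := schur_l t in l01 eld.
set c0 := rdiff t q'.1 q'.2 q.1.
have ma (p : X * X) : meas (annular2 e p).
  by apply: mf_annular2; by [].
(* A nonzero correlation means that the product is integrable, which is needed before the constant
   [c0] can be subtracted from its second factor. *)
have [->|L0] := eqVneq (rcorr t q q') 0.
  rewrite normr0; apply: integral_ge0 => z _; rewrite lee_fin.
  by nneg; nneg2.
have pi : integ mu (fun z => rdiff t q.1 q.2 z * rdiff t q'.1 q'.2 z).
  apply: (@Rint_neq0_integrable _ _ _ mu _ 1); rewrite ?oner_neq0//; first by mfun.
  by under eq_Rintegral do rewrite mul1r; move/eqP: L0.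
have ri : integ mu (rdiff t q.1 q.2) by exact: rdiff_integrable.
have -> : rcorr t q q' = \int[mu]_z (rdiff t q.1 q.2 z * (rdiff t q'.1 q'.2 z - c0)).
  exact: (Rint_subr_cst c0 pi ri (Rint_rdiff q.1 q.2 t01)).
apply: Rint_le; first by mfun.
apply: int_le; [mfun|mfun|] => z; rewrite normr_ge0/= normrM.
have h1 := riesz_diff_le n0 q.1 q.2 z t01 d0t dt1.
have h2 := riesz_diff2_le n0 q'.1 q'.2 q.1 (z - q.1) t01 d0t dt1 l01.
have h3 := @annular_sum_moment eta d q.1 q.2 z ed d1.
rewrite /rdiff2 (addrC q.1 (z - q.1)) subrK in h2; rewrite /= -/u -/u' -/c0 in h1 h2 h3.
have tE : t * (1 - l) = t - eta by rewrite /eta /schur_eta -/l; ring.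
have etaE : t * l = eta by [].
have eE : d - eta = e by [].
rewrite tE etaE eE in h2 h3.
have ex (w : X) : G (d * (1 - l)) u' (enorm (w - z)) <= G e u' (enorm (w - z)).
  by apply: annular_le_exp; rewrite ?e0// enorm_ge0.
have ex' (w : X) : G (d * (1 - l)) u' (enorm (w - q.1)) <= G e u' (enorm (w - q.1)).
  by apply: annular_le_exp; rewrite ?e0// enorm_ge0.
have {}h2 : `|rdiff t q'.1 q'.2 z - c0| <= 4 * n%:R * enorm (z - q.1) `^ eta * u' `^ (t - eta) *
    (annular2 e q' z + annular2 e q' q.1).
  apply: (le_trans h2); apply: ler_wpM2l; first by nneg.
  rewrite /annular2 -/u'; move: (ex q'.1) (ex q'.2) (ex' q'.1) (ex' q'.2).
  move: (G _ _ _) (G _ _ _) (G _ _ _) (G _ _ _) (G _ _ _) (G _ _ _) (G _ _ _) (G _ _ _).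
  by move=> a1 a2 a3 a4 a5 a6 a7 a8; clear -a1 a2 a3 a4 a5 a6 a7 a8; lra.
have h1' : `|rdiff t q.1 q.2 z| <= n%:R * u `^ t * annular2 d q z by [].
have h3' : enorm (z - q.1) `^ eta * annular2 d q z <= 2 * u `^ eta * annular2 e q z by [].
apply: (le_trans (ler_pM (normr_ge0 _) (normr_ge0 _) h1' h2)).
have := powR_ge0 u t; have := powR_ge0 u' (t - eta).
have := annular2_ge0 e q' z; have := annular2_ge0 e q' q.1.
have := ler0n R n; move: h3'.
move: (annular2 d q z) (annular2 e q z) (annular2 e q' z) (annular2 e q' q.1).
move: (u `^ t) (u `^ eta) (u' `^ (t - eta)) (enorm _ `^ eta) (n%:R : R).
clear => a b c f m A B D E h m0 E0 D0 c0 a0.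
have -> : m * a * A * (4 * m * f * c * (D + E)) = 4 * m ^+ 2 * a * c * (D + E) * (f * A) by ring.
have -> : 8 * m ^+ 2 * (a * b * c) * (B * (D + E)) = 4 * m ^+ 2 * a * c * (D + E) * (2 * b * B) by ring.
by rewrite ler_wpM2l// !mulr_ge0 ?addr_ge0.
Qed.

(** Here and in [schur_weight_lt] the cancellation at the smaller scale has gained the ratio of the
    scales to the power [e]. This gain turns the critical weight $u'^{-n}$ into an integrable bump
    in [u'] at scale [u]. *)
Lemma schur_weight_ge (t e u u' : R) : 0 < e -> 0 <= u -> u <= u' ->
  u' `^ (- n%:R - t) * (u `^ e * u' `^ (t - e)) <= G e u u'.
Proof.
move=> e0 u0 uu'; have G0 := annular_ge0 n e u u'.
move: u0 uu' G0; rewrite le_eqVlt => /predU1P[<-|u0] uu' G0.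
  by rewrite (powR0 (x := e)) ?gt_eqF// mul0r mulr0.
have u'0 : 0 < u' by exact: lt_le_trans uu'.
rewrite annular_geu// powRM ?invr_ge0 ?(ltW u0) ?(ltW u'0)//.
rewrite -[u'^-1]powR_inv1 ?(ltW u'0)// -powRrM mulN1r mulrCA powR_add//.
rewrite [leRHS]mulrCA powR_add// le_eqVlt; apply/orP; left; apply/eqP; congr (_ * _ `^ _); ring.
Qed.

Lemma schur_weight_lt (t e u u' : R) : 0 < e -> 0 <= u' -> u' < u ->
  u' `^ (- n%:R - t) * (u' `^ t * u' `^ e * u `^ (t - e)) <= u `^ t * G e u u'.
Proof.
move=> e0 u0 uu'; have u0' : 0 < u by exact: le_lt_trans uu'.
have G0 : 0 <= u `^ t * G e u u' by nneg.
move: u0 uu' G0; rewrite le_eqVlt => /predU1P[<-|u'0] uu' G0.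
  by rewrite (powR0 (x := e)) ?gt_eqF// mulr0 mul0r mulr0.
rewrite annular_ler ?(ltW uu')// powRM ?invr_ge0 ?(ltW u'0) ?(ltW u0')//.
rewrite -[u^-1]powR_inv1 ?(ltW u0')// -powRrM mulN1r.
rewrite [leRHS](_ : _ = (u' `^ (- n%:R) * u' `^ e) * (u `^ t * u `^ (- e))); last first.
  by move: (u `^ t) (u' `^ _) (u' `^ _) (u `^ _); clear => *; ring.
rewrite !powR_add// mulrA powR_add// le_eqVlt; apply/orP; left; apply/eqP.
by congr (_ `^ _ * _); ring.
Qed.

(** The bounds of [rcorr_le] for both orders of the pair are added, so that one function serves
    whichever scale is the smaller. *)
Definition schur_fun t (q q' : X * X) z : R :=
  annular2 (schur_e t) q z * (annular2 (schur_e t) q' z + annular2 (schur_e t) q' q.1) +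
  annular2 (schur_e t) q' z * (annular2 (schur_e t) q z + annular2 (schur_e t) q q'.1).

Lemma mf_schur_fun t q : meas (fun p : (X * X) * X => schur_fun t q p.1 p.2).
Proof.
rewrite /schur_fun.
have m1 : meas (fun p : (X * X) * X => annular2 (schur_e t) q p.2).
  by apply: mf_annular2; mfun.
have m2 : meas (fun p : (X * X) * X => annular2 (schur_e t) p.1 p.2).
  by apply: mf_annular2; mfun.
have m3 : meas (fun p : (X * X) * X => annular2 (schur_e t) p.1 q.1).
  by apply: mf_annular2; mfun.
have m4 : meas (fun p : (X * X) * X => annular2 (schur_e t) q p.1.1).
  by apply: mf_annular2; mfun.
by mfun.
Qed.

Lemma schur_pointwise t (q q' : X * X) : 0 < t < 1 ->
  let u := enorm (q.1 - q.2) in let u' := enorm (q'.1 - q'.2) in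
  ((u' `^ (- n%:R - t) * `|rcorr t q q'|)%:E <= \int[mu]_z (8 * n%:R ^+ 2 * u `^ t *
    (G (schur_eta t) u u' * schur_fun t q q' z))%:E)%E.
Proof.
move=> t01 /=; set u := enorm (q.1 - q.2); set u' := enorm (q'.1 - q'.2).
have [_ _ _ /andP[e0 _] _] := schur_exponents t01.
have u0 : 0 <= u by exact: enorm_ge0.
have u'0 : 0 <= u' by exact: enorm_ge0.
have ma (p : X * X) : meas (annular2 (schur_e t) p).
  by apply: mf_annular2; by [].
have a0 (p : X * X) z : 0 <= annular2 (schur_e t) p z by exact: annular2_ge0.
have N0 : 0 <= 8 * n%:R ^+ 2 :> R by [].
have G0 := annular_ge0 n (schur_eta t) u u'.
have gen (c : R) (H : X -> R) : (forall z, 0 <= H z) -> meas H ->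
    (forall z, H z <= schur_fun t q q' z) -> 0 <= c ->
    u' `^ (- n%:R - t) * c <= u `^ t * G (schur_eta t) u u' ->
    ((`|rcorr t q q'|)%:E <= \int[mu]_z (8 * n%:R ^+ 2 * c * H z)%:E)%E ->
    ((u' `^ (- n%:R - t) * `|rcorr t q q'|)%:E <= \int[mu]_z (8 * n%:R ^+ 2 * u `^ t *
    (G (schur_eta t) u u' * schur_fun t q q' z))%:E)%E.
  move=> H0 mH Hle c0 hc hL; rewrite EFinM.
  apply: (le_trans (lee_wpmul2l _ hL)); first by rewrite lee_fin powR_ge0.
  rewrite -intZl ?powR_ge0//; last 2 first.
  - by mfun.
  - by nneg.
  apply: int_le; [mfun| |].
    apply: mfM => //.
    apply: mfM => //.
    by rewrite /schur_fun; mfun.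
  move=> z; apply/andP; split; first by nneg.
  move: (H0 z) (Hle z) hc c0 N0 G0 (powR_ge0 u t).
  move: (H z) (schur_fun t q q' z) (u' `^ _) (u `^ t) (G _ _ _) (8 * n%:R ^+ 2 : R).
  clear => h s w a g N h0 hs hc c0 N0 g0 a0.
  have -> : w * (N * c * h) = N * ((w * c) * h) by ring.
  have -> : N * a * (g * s) = N * ((a * g) * s) by ring.
  rewrite ler_wpM2l//; apply: (le_via ((a * g) * h)); first by rewrite ler_wpM2r.
  by rewrite ler_wpM2l// mulr_ge0.
(* The integral 0 is exploited for the factor of smaller scale; the second case exchanges the
   factors by [rcorrC]. *)
have [uu'|u'u] := leP u u'.
  apply: gen (rcorr_le q q' t01).
  - by nneg.
  - by mfun.
  - by move=> z; rewrite lerDl mulr_ge0// addr_ge0.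
  - by nneg.
  - apply: (le_trans _ (ler_wpM2l (powR_ge0 u t) (schur_weight_ge t e0 u0 uu'))).
    apply: le_of_eq.
    by move: (u `^ t) (u `^ _) (u' `^ _) (u' `^ _); clear => *; ring.
apply: gen; last by rewrite rcorrC; exact: (rcorr_le q' q t01).
- by move=> z; rewrite mulr_ge0// addr_ge0.
- by mfun.
- by move=> z; rewrite lerDr mulr_ge0// addr_ge0.
- by nneg.
- exact: schur_weight_lt.
Qed.

Lemma int_radial_fst (k : R -> R) (g : X -> R) (A B : R) : meas k ->
  (forall u, 0 <= k u) -> meas g -> (forall x, 0 <= g x) ->
  (\int[mu]_w (k (enorm w))%:E <= A%:E)%E -> (\int[mu]_x (g x)%:E <= B%:E)%E -> 0 <= B ->
  (\int[mu2]_q (k (enorm (q.1 - q.2)) * g q.1)%:E <= (B * A)%:E)%E.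
Proof.
move=> mk k0 mg g0 kA gB B0.
rewrite (int_shear (Phi := fun q => k (enorm (q.1 - q.2)) * g q.1)); last 2 first.
- by mfun.
- by nneg.
have mkw : meas (fun w : X => k (enorm w)).
  by apply: (measurableT_comp mk); mfun.
apply: (le_via (\int[mu]_w (B * k (enorm w))%:E)%E); last exact: intZl_le.
apply: (@double_le _ _ _ _ _ mu mu (fun q : X * X => k (enorm (q.2 - (q.1 + q.2))) * g q.2)).
- apply: mfM; last by mfun.
  by apply: (measurableT_comp mk); mfun.
- by nneg.
- by mfun.
- move=> w /=; under eq_integral do rewrite opprD addrCA subrr addr0 enormN.
  by rewrite (mulrC B); apply: intZl_le.
Qed.

(** The leading 1 makes the constant positive, as [TTstar_schur] requires. The factor 16 comes from
    the four products in [schur_fun], each of two sums of two bumps. *)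
Definition schur_cst t : R :=
  1 + 8 * n%:R ^+ 2 * (16 * (C (schur_e t) ^+ 2 * C (schur_eta t))).

Lemma schur_cst_gt0 t : 0 < t < 1 -> 0 < schur_cst t.
Proof.
move=> t01; have [_ _ _ /andP[e0 _] [/andP[e1 _] _]] := schur_exponents t01.
by rewrite ltr_wpDr; nneg.
Qed.

Lemma int_schur_fun t (q : X * X) : 0 < t < 1 ->
  (\int[mu2]_q' \int[mu]_z (G (schur_eta t) (enorm (q.1 - q.2)) (enorm (q'.1 - q'.2)) *
     schur_fun t q q' z)%:E <= (16 * (C (schur_e t) ^+ 2 * C (schur_eta t)))%:E)%E.
Proof.
move=> t01; have [_ _ _ /andP[eta0 _] [/andP[e0 _] _]] := schur_exponents t01.
set eta := schur_eta t in eta0 *; set e := schur_e t in e0 *; set u := enorm (q.1 - q.2).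
have u0 : 0 <= u by exact: enorm_ge0.
have a0 (p : X * X) z : 0 <= annular2 e p z by exact: annular2_ge0.
have G0 v : 0 <= G eta u v by nneg.
have mG : meas (G eta u) by mfun.
have mGu : meas (fun p : X * X => G eta u (enorm (p.1 - p.2))).
  by apply: (measurableT_comp mG); mfun.
have iG : (\int[mu]_w (G eta u (enorm w))%:E <= (C eta)%:E)%E by exact: int_annular0.
have [g gE] := ex_fun (fun p : X * X => G eta u (enorm (p.1 - p.2))).
have mg : meas g by rewrite (funext gE).
have g0 p : 0 <= g p by rewrite gE; exact: G0.
have mg1 : meas (fun p : (X * X) * X => g p.1) by apply: (measurableT_comp mg measurable_fst).
have mA1 : meas (fun p : (X * X) * X => annular2 e q p.2).
  by apply: mf_annular2; mfun.
have mA2 : meas (fun p : (X * X) * X => annular2 e p.1 p.2).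
  by apply: mf_annular2; mfun.
have mA3 : meas (fun p : (X * X) * X => annular2 e p.1 q.1).
  by apply: mf_annular2; mfun.
have man (p : X * X) : meas (annular2 e p).
  by apply: mf_annular2; by [].
have rad z : (\int[mu2]_q' (G eta u (enorm (q'.1 - q'.2)) * annular2 e q' z)%:E <=
    (2 * C e * C eta)%:E)%E.
  exact: int_radial_annular.
have {}rad z : (\int[mu2]_q' (g q' * annular2 e q' z)%:E <= (2 * C e * C eta)%:E)%E.
  by under eq_integral do rewrite gE.
(* Two of the four products in [schur_fun] agree. The three types call for different orders of
   integration: [q'] first in [T1], but [z] first in [T2] and [T3]. *)
have [T1 T1E] := ex_fun (fun p : (X * X) * X => g p.1 * (annular2 e p.1 p.2 * annular2 e q p.2)).
have [T2 T2E] := ex_fun (fun p : (X * X) * X => (g p.1 * annular2 e p.1 q.1) * annular2 e q p.2).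
have [T3 T3E] := ex_fun (fun p : (X * X) * X => (g p.1 * annular2 e q p.1.1) * annular2 e p.1 p.2).
have mT1 : meas T1 by rewrite (funext T1E); mfun.
have mT2 : meas T2 by rewrite (funext T2E); mfun.
have mT3 : meas T3 by rewrite (funext T3E); mfun.
have T10 p : 0 <= T1 p by rewrite T1E; apply: mulr_ge0; [exact: g0|apply: mulr_ge0; exact: a0].
have T20 p : 0 <= T2 p by rewrite T2E; apply: mulr_ge0; [apply: mulr_ge0 => //|exact: a0].
have T30 p : 0 <= T3 p by rewrite T3E; apply: mulr_ge0; [apply: mulr_ge0 => //|exact: a0].
have [K KE] : exists K, K = C e ^+ 2 * C eta by eexists.
have i1 : (\int[(pm \x mu)%E]_p (T1 p)%:E <= (4 * K)%:E)%E.
  have -> : 4 * K = 2 * C e * C eta * (2 * C e) by rewrite KE; ring.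
  under eq_integral do rewrite T1E.
  apply: (@int_prod_mid _ _ _ _ _ pm mu g (fun p => annular2 e p.1 p.2) (annular2 e q)).
  - exact: mg.
  - exact: mA2.
  - exact: man.
  - exact: g0.
  - by [].
  - by [].
  - by nneg.
  - exact: rad.
  - exact: int_annular2.
have i2 : (\int[(pm \x mu)%E]_p (T2 p)%:E <= (4 * K)%:E)%E.
  have -> : 4 * K = 2 * C e * (2 * C e * C eta) by rewrite KE; ring.
  under eq_integral do rewrite T2E.
  apply: (@int_prod_fst _ _ _ _ _ pm mu (fun p => g p * annular2 e p q.1) (fun p => annular2 e q p.2)).
  - by apply: mfM => //; apply: mf_annular2; mfun.
  - exact: mA1.
  - by nneg.
  - by [].
  - by nneg.
  - exact: rad.
  - by move=> y; exact: int_annular2.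
have i3 : (\int[(pm \x mu)%E]_p (T3 p)%:E <= (4 * K)%:E)%E.
  have -> : 4 * K = 2 * C e * (2 * C e * C eta) by rewrite KE; ring.
  under eq_integral do rewrite T3E.
  apply: (@int_prod_fst _ _ _ _ _ pm mu (fun p => g p * annular2 e q p.1) (fun p => annular2 e p.1 p.2)).
  - by apply: mfM => //; apply: mf_annular2; mfun.
  - exact: mA2.
  - by nneg.
  - by [].
  - by nneg.
  - under eq_integral do rewrite gE.
    apply: (int_radial_fst mG G0 (man q) (a0 q) iG (int_annular2 q e0)); nneg.
  - by move=> y; exact: int_annular2.
rewrite -KE.
under eq_integral => q' _ do under eq_integral do rewrite -gE.
rewrite -(tonelli1 pm mu (f := fun p => g p.1 * schur_fun t q p.1 p.2)); last 2 first.
- by apply: mfM => //; exact: mf_schur_fun.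
- move=> p; rewrite mulr_ge0// /schur_fun.
  by nneg.
under eq_integral => p _.
  have -> : g p.1 * schur_fun t q p.1 p.2 = T1 p + T1 p + (T2 p + T3 p).
    rewrite /schur_fun T1E T2E T3E -/e.
    move: (g p.1) (annular2 _ _ _) (annular2 _ _ _) (annular2 _ _ _) (annular2 _ _ _).
    by clear => *; ring.
  over.
have -> : 16 * K = 4 * K + 4 * K + (4 * K + 4 * K) by ring.
have m11 : meas (fun p => T1 p + T1 p) by mfun.
have m23 : meas (fun p => T2 p + T3 p) by mfun.
apply: intD_le => //.
- by nneg.
- by nneg.
- exact: intD_le.
- exact: intD_le.
Qed.

(** Schur's condition for the test weight $|x-y|^{-n/2}$: that weight times $|x-y|^{-n/2-t}$ is the
    weight in the integral, and $|x-y|^{-n/2-t}$ times the right-hand side is again a multiple of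
    $|x-y|^{-n/2}$. *)
Lemma schur_estimate t (q : X * X) : 0 < t < 1 ->
  (\int[mu2]_q' (enorm (q'.1 - q'.2) `^ (- n%:R - t) * `|rcorr t q q'|)%:E <=
   (schur_cst t * enorm (q.1 - q.2) `^ t)%:E)%E.
Proof.
move=> t01; set u := enorm (q.1 - q.2).
have mS : meas (fun p : (X * X) * X =>
    8 * n%:R ^+ 2 * u `^ t * (G (schur_eta t) u (enorm (p.1.1 - p.1.2)) * schur_fun t q p.1 p.2)).
  by apply: mfM; [mfun|]; apply: mfM; [mfun|exact: mf_schur_fun].
have s0 q' z : 0 <= schur_fun t q q' z.
  by rewrite /schur_fun; nneg; nneg2.
have S0 p : 0 <= 8 * n%:R ^+ 2 * u `^ t * (G (schur_eta t) u (enorm (p.1.1 - p.1.2)) * schur_fun t q p.1 p.2).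
  by nneg; nneg2.
apply: (le_via (\int[mu2]_q' \int[mu]_z (8 * n%:R ^+ 2 * u `^ t *
    (G (schur_eta t) u (enorm (q'.1 - q'.2)) * schur_fun t q q' z))%:E)%E).
  apply: ge0_le_integral => //.
  - by move=> q' _; rewrite lee_fin mulr_ge0 ?powR_ge0.
  - have mr : meas (rcorr t q).
      apply: (@mf_Rint1 _ _ _ _ _ mu (fun p : (X * X) * X => rdiff t q.1 q.2 p.2 * rdiff t p.1.1 p.1.2 p.2)).
      by mfun.
    by mfun.
  - exact: (mf_int1 mu mS S0).
  - by move=> q' _; exact: schur_pointwise.
have ms (q' : X * X) : meas (fun z => G (schur_eta t) u (enorm (q'.1 - q'.2)) * schur_fun t q q' z).
  by apply: mfM; [mfun|exact: (mf_section1 q' (mf_schur_fun t q))].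
under eq_integral => q' _.
  rewrite intZl; last 3 first.
  - by nneg.
  - exact: ms.
  - by nneg.
  over.
rewrite ge0_integralZl//; last 3 first.
- apply: (@mf_int1 _ _ _ _ _ mu (fun p : (X * X) * X => G (schur_eta t) u (enorm (p.1.1 - p.1.2)) * schur_fun t q p.1 p.2)).
    by apply: mfM; [mfun|exact: mf_schur_fun].
  by nneg.
- by move=> q' _; apply: integral_ge0 => z _; rewrite lee_fin mulr_ge0// annular_ge0.
- by rewrite lee_fin; nneg.
apply: (le_trans (lee_wpmul2l _ (int_schur_fun q t01))).
  by rewrite lee_fin; nneg.
rewrite lee_fin /schur_cst.
have := powR_ge0 u t; move: (u `^ t) (_ * C (schur_eta t)) (8 * n%:R ^+ 2 : R).
clear => a b c a0.
have -> : c * a * (16 * b) = (c * (16 * b)) * a by ring.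
by rewrite ler_wpM2r// lerDr.
Qed.

End schur_estimate.

Ltac mfun_annular2 := first [mfun_annular | match goal with
  |- measurable_fun _ (fun x => annular2 _ _ _) => apply: mf_annular2 end].
Ltac mfun_ext ::= mfun_annular2.

Section bounded_bounded_support.
Implicit Types (x y z : X) (t d : R) (f g : X -> R).

Definition Linfc f := meas f /\
  exists M r : R, 0 <= M /\ 0 < r /\ forall x, `|f x| <= M * \1_(cball 0 r) x.

Lemma Linfc_mf f : Linfc f -> meas f.
Proof. by case. Qed.

Lemma Linfc_intro f (M r : R) : meas f -> (forall x, `|f x| <= M) ->
  (forall x, f x != 0 -> enorm x <= r) -> Linfc f.
Proof.
move=> mf fM fr; split => //; exists M, (`|r| + 1).
have M0 : 0 <= M by exact: le_trans (normr_ge0 _) (fM 0).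
split; [by []|split; first by []]; move=> x; rewrite indicE.
have [->|fx] := eqVneq (f x) 0; first by rewrite normr0 mulr_ge0.
rewrite mem_set; first by rewrite mulr1.
by rewrite /cball /= subr0; apply: (le_trans (fr x fx)); rewrite ler_wpDr// ler_norm.
Qed.

Lemma Linfc_bounded f : Linfc f -> exists2 M : R, 0 <= M & forall x, `|f x| <= M.
Proof.
move=> [mf [M [r [M0 [r0 h]]]]]; exists M => // x; apply: (le_trans (h x)).
by rewrite ler_piMr.
Qed.

Lemma Linfc_support f : Linfc f -> exists2 r : R, 0 < r & forall x, f x != 0 -> enorm x <= r.
Proof.
move=> [mf [M [r [M0 [r0 h]]]]]; exists r => // x fx.
have := h x; rewrite indicE; case: (boolP (x \in _)) => [|_]; last by rewrite mulr0 normr_le0 (negPf fx).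
by rewrite inE /cball /= subr0.
Qed.

Lemma Linfc_integ f : Linfc f -> integ mu f.
Proof.
move=> [mf [M [r [M0 [r0 h]]]]]; apply: int_integ => //.
have mB : meas (\1_(cball 0 r) : X -> R) by apply: mfindic; exact: meas_cball.
apply: (le_lt_via (\int[mu]_x (M * \1_(cball 0 r) x)%:E)%E).
  by apply: int_le; [mfun|mfun|] => x; rewrite normr_ge0 h.
rewrite intZl//.
rewrite integral_indic//; last exact: meas_cball.
by rewrite setIT lte_mul_pinfty ?lee_fin// mu_cball_lty.
Qed.

Lemma LinfcM f g : Linfc f -> Linfc g -> Linfc (fun x => f x * g x).
Proof.
move=> lf lg; have [M M0 fM] := Linfc_bounded lf; have [N N0 gN] := Linfc_bounded lg.
have [r r0 fr] := Linfc_support lf.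
apply: (@Linfc_intro _ (M * N) r).
- by apply: mfM; exact: Linfc_mf.
- by move=> x; rewrite normrM ler_pM.
- by move=> x; rewrite mulf_eq0 negb_or => /andP[/fr].
Qed.

Lemma LinfcD f g : Linfc f -> Linfc g -> Linfc (fun x => f x + g x).
Proof.
move=> lf lg; have [M M0 fM] := Linfc_bounded lf; have [N N0 gN] := Linfc_bounded lg.
have [r r0 fr] := Linfc_support lf; have [r' r'0 gr] := Linfc_support lg.
apply: (@Linfc_intro _ (M + N) (r + r')).
- by apply: mfD; exact: Linfc_mf.
- by move=> x; apply: (le_trans (ler_normD _ _)); apply: lerD.
- move=> x; have [fx|/fr h _] := eqVneq (f x) 0; last by apply: (le_trans h); rewrite lerDl ltW.
  rewrite fx add0r => /gr h; apply: (le_trans h); rewrite lerDr ltW//.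
Qed.

Lemma LinfcZ (c : R) f : Linfc f -> Linfc (fun x => c * f x).
Proof.
move=> lf; have [M M0 fM] := Linfc_bounded lf; have [r r0 fr] := Linfc_support lf.
apply: (@Linfc_intro _ (`|c| * M) r).
- by apply: mfM; [mfun|exact: Linfc_mf].
- by move=> x; rewrite normrM ler_wpM2l.
- by move=> x; rewrite mulf_eq0 negb_or => /andP[_ /fr].
Qed.

Lemma LinfcB f g : Linfc f -> Linfc g -> Linfc (fun x => f x - g x).
Proof.
move=> lf lg; have -> : (fun x => f x - g x) = (fun x => f x + -1 * g x) by apply/funext => x; rewrite mulN1r.
by apply: LinfcD => //; exact: LinfcZ.
Qed.

Lemma Linfc_le f g : meas f -> (forall x, `|f x| <= `|g x|) -> Linfc g -> Linfc f.
Proof.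
move=> mf fg lg; have [M M0 gM] := Linfc_bounded lg; have [r r0 gr] := Linfc_support lg.
apply: (@Linfc_intro _ M r) => //; first by move=> x; exact: le_trans (fg x) (gM x).
move=> x fx; apply: gr; rewrite -normr_gt0; apply: lt_le_trans (fg x).
by rewrite normr_gt0.
Qed.

Lemma cball_sub x (r : R) z : cball 0 r z -> cball x (enorm x + r) z.
Proof.
rewrite /cball /= subr0 => zr; apply: (le_trans (enormD _ _)).
by rewrite enormN addrC lerD2l.
Qed.

Lemma potential_integ t f x : 0 < t < 1 -> Linfc f ->
  integ mu (fun z => riesz t x z * f z).
Proof.
move=> t01 [mf [M [r [M0 [r0 h]]]]].
have r'0 : 0 < enorm x + r by rewrite ltr_wpDl// enorm_ge0.
apply: int_integ; first by mfun.
apply: (le_lt_via (\int[mu]_z (M * (riesz t x z * \1_(cball x (enorm x + r)) z))%:E)%E).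
  apply: int_le; [mfun|mfun|] => z; rewrite normr_ge0/= normrM.
  rewrite (ger0_norm (riesz_ge0 _ _ _)) mulrCA ler_wpM2l ?riesz_ge0//.
  apply: (le_trans (h z)); rewrite ler_wpM2l// !indicE.
  case: (boolP (z \in cball 0 r)) => // zr; rewrite mem_set//.
  by apply: cball_sub; rewrite inE in zr.
apply: le_lt_trans (ltry (M * ((enorm x + r) `^ t * C t))).
apply: intZl_le => //; first by mfun.
  by move=> z; rewrite mulr_ge0 ?riesz_ge0.
exact: int_riesz_ball.
Qed.

Lemma mf_potential t f : meas f -> meas (riesz_potential t f).
Proof.
move=> mf; apply: (@mf_Rint1 _ _ _ _ _ mu (fun p : X * X => riesz t p.1 p.2 * f p.2)).
by mfun.
Qed.

Lemma potentialB t f x y : 0 < t < 1 -> Linfc f ->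
  riesz_potential t f x - riesz_potential t f y = \int[mu]_z (rdiff t x y z * f z).
Proof.
move=> t01 lf; rewrite /rdiff; under [RHS]eq_Rintegral do rewrite mulrBl.
by rewrite RintegralB//; exact: potential_integ.
Qed.

(* The cutoff [1 / m <= u <= m] of the weight makes Schur's test applicable. *)
Definition cut_weight t (m v : R) : R := \1_(`[m^-1, m]%classic) v * v `^ (- (n%:R / 2) - t).

Lemma mf_cut_weight t (m : R) : meas (cut_weight t m).
Proof.
have mI : meas (\1_(`[m^-1, m]%classic) : R -> R) by [].
by rewrite /cut_weight; mfun.
Qed.

Lemma cut_weight_ge0 t (m v : R) : 0 <= cut_weight t m v.
Proof. by rewrite mulr_ge0// powR_ge0. Qed.

Definition cut_ball (m v : R) : R := \1_(`]-oo, m]%classic) v.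

Lemma mf_cut_ball (m : R) : meas (cut_ball m).
Proof. by rewrite /cut_ball; apply: mfindic; by []. Qed.

Lemma int_cut_ball (m : R) : 0 <= m -> (\int[mu]_w (cut_ball m (enorm w))%:E <= ((2 * m) ^+ n)%:E)%E.
Proof.
move=> m0; apply: le_trans (mu_cball_le (0 : X) m0).
apply: le_of_eq.
have mB := meas_cball (0 : X) m.
have -> : mu (cball 0 m) = mu (cball 0 m `&` setT) by rewrite setIT.
rewrite -integral_indic//; apply: eq_integral => x _.
rewrite /cut_ball !indicE (_ : (enorm x \in _) = (x \in cball 0 m))//.
by apply/idP/idP; rewrite !inE /cball /= subr0.
Qed.

Lemma cut_weight_le t (m v : R) : 0 < t -> 1 <= m -> 0 <= v ->
  cut_weight t m v * v `^ t <= m `^ (n%:R / 2 + t) * m `^ t * cut_ball m v.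
Proof.
move=> t0 m1 v0; have m0 : 0 < m by exact: lt_le_trans m1.
rewrite /cut_weight indicE; case: (boolP (_ \in _)) => [|_]; last first.
  by rewrite mul0r mul0r !mulr_ge0 ?powR_ge0.
rewrite inE /= in_itv /= => /andP[v1 v2].
rewrite /cut_ball indicE mem_set /=; last by [].
rewrite mulr1 mul1r; apply: ler_pM; rewrite ?powR_ge0//.
  rewrite -opprD (le_trans (powR_neg_antitone _ _ v1))//.
  - by nneg.
  - by rewrite invr_gt0.
  - by rewrite -powR_inv1 ?(ltW m0)// -powRrM mulN1r opprK.
by apply: ge0_ler_powR; rewrite ?nnegrE ?(ltW t0) ?(ltW m0).
Qed.

Lemma weights_le (a b c e f : R) : 0 <= b -> 0 <= c -> c * e <= f -> `|b * c * a| * e <= b * (f * `|a|).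
Proof.
move=> b0 c0 h; rewrite !normrM (ger0_norm b0) (ger0_norm c0).
have -> : b * c * `|a| * e = b * `|a| * (c * e) by ring.
have -> : b * (f * `|a|) = b * `|a| * f by ring.
by rewrite ler_wpM2l// mulr_ge0.
Qed.

Lemma mf_rcorr t (q : X * X) : meas (rcorr t q).
Proof.
apply: (@mf_Rint1 _ _ _ _ _ mu (fun p : (X * X) * X => rdiff t q.1 q.2 p.2 * rdiff t p.1.1 p.1.2 p.2)).
by mfun.
Qed.

Lemma cut_weight_mid t (m v : R) : 0 <= v ->
  cut_weight t m v * v `^ (- (n%:R / 2)) <= v `^ (- n%:R - t).
Proof.
move=> v0; rewrite /cut_weight indicE; case: (_ \in _); last by rewrite !mul0r powR_ge0.
rewrite mul1r; move: v0; rewrite le_eqVlt => /predU1P[<-|v0].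
  rewrite [X in _ * X]powR0 ?mulr0 ?powR_ge0// oppr_eq0 mulf_neq0// pnatr_eq0.
  by rewrite -lt0n.
rewrite powR_add// le_eqVlt; apply/orP; left; apply/eqP; congr (_ `^ _); by field.
Qed.

Lemma cut_weight_out t (m v : R) : 0 < t -> 0 <= v ->
  cut_weight t m v * v `^ t <= v `^ (- (n%:R / 2)).
Proof.
move=> t0 v0; rewrite /cut_weight indicE; case: (_ \in _); last by rewrite !mul0r powR_ge0.
rewrite mul1r; move: v0; rewrite le_eqVlt => /predU1P[<-|v0].
  by rewrite [X in _ * X]powR0 ?mulr0 ?powR_ge0// gt_eqF.
rewrite powR_add// le_eqVlt; apply/orP; left; apply/eqP; congr (_ `^ _); ring.
Qed.

(** Schur's test for the weighted differences with $p(x,y)=|x-y|^{-n/2}$. The cutoff [m] supplies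
    the a priori bounds on rows and columns, and the resulting constant does not depend on it. *)
Lemma cut_potential_L2 t f (m : R) : 0 < t < 1 -> Linfc f -> 1 <= m ->
  (\int[mu2]_q ((cut_weight t m (enorm (q.1 - q.2)) *
    (riesz_potential t f q.1 - riesz_potential t f q.2)) ^+ 2)%:E <=
   (schur_cst t)%:E * \int[mu]_x (f x ^+ 2)%:E)%E.
Proof.
move=> t01 lf m1; have t0 : 0 < t by case/andP: t01.
have m0 : 0 < m by exact: lt_le_trans m1.
have [M M0 fM] := Linfc_bounded lf; have mf := Linfc_mf lf.
have [/andP[d0 dt] dt1 _ _ _] := schur_exponents t01.
set d := schur_d t in d0 dt dt1.
have d0t : 0 < d <= t by rewrite d0.
have [W WE] : exists W : R, W = n%:R * (m `^ (n%:R / 2 + t) * m `^ t) by eexists.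
have W0 : 0 <= W by rewrite WE; nneg.
have [k kE] := ex_fun (fun p : (X * X) * X => cut_weight t m (enorm (p.1.1 - p.1.2)) * rdiff t p.1.1 p.1.2 p.2).
have mw : meas (fun q : X * X => cut_weight t m (enorm (q.1 - q.2))).
  by apply: (measurableT_comp (mf_cut_weight t m)); mfun.
have mr : meas (fun p : (X * X) * X => rdiff t p.1.1 p.1.2 p.2).
  by mfun.
have mk : meas k.
  by rewrite (funext kE); apply: mfM => //; apply: (measurableT_comp mw measurable_fst).
have mc : meas (fun v : R => W * cut_ball m v).
  by apply: mfM; [mfun|exact: mf_cut_ball].
have mcq : meas (fun q : X * X => W * cut_ball m (enorm (q.1 - q.2))).
  by apply: (measurableT_comp mc); mfun.
have c0 v : 0 <= W * cut_ball m v by nneg.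
have ic : (\int[mu]_w (W * cut_ball m (enorm w))%:E <= (W * (2 * m) ^+ n)%:E)%E.
  apply: intZl_le => //.
  - by apply: (measurableT_comp (mf_cut_ball m)); mfun.
  - by apply: int_cut_ball; exact: ltW.
have kle q z : `|k (q, z)| <= W * cut_ball m (enorm (q.1 - q.2)) * annular2 d q z.
  rewrite kE /= normrM ger0_norm ?cut_weight_ge0//.
  apply: (le_trans (ler_wpM2l (cut_weight_ge0 _ _ _) (riesz_diff_le n0 q.1 q.2 z t01 d0t dt1))).
  have := cut_weight_le t0 m1 (enorm_ge0 (q.1 - q.2)); rewrite -/(annular2 d q z) WE.
  have := annular2_ge0 d q z; have := ler0n R n.
  move: (annular2 d q z) (cut_weight _ _ _) (enorm _ `^ t) (cut_ball _ _) (n%:R : R) (m `^ _) (m `^ _).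
  clear => a b c e f g h f0 a0 hh.
  have -> : b * (f * c * a) = f * a * (b * c) by ring.
  have -> : f * (h * g) * e * a = f * a * (h * g * e) by ring.
  by rewrite ler_wpM2l// mulr_ge0.
have ma2 (q : X * X) : meas (annular2 d q).
  by apply: mf_annular2; by [].
have pc1 v : cut_ball m v <= 1 by rewrite lern1 leq_b1.
have [p pE] := ex_fun (fun q : X * X => enorm (q.1 - q.2) `^ (- (n%:R / 2))).
have mp : meas p by rewrite (funext pE); mfun.
have uE q : \int[mu]_x (k (q, x) * f x) = cut_weight t m (enorm (q.1 - q.2)) *
    (riesz_potential t f q.1 - riesz_potential t f q.2).
  rewrite potentialB// -RintegralZl//.
    by apply: eq_Rintegral => z _; rewrite kE mulrA.
  apply: int_integ; first by mfun.
  apply: (le_lt_via (\int[mu]_z (M * `|rdiff t q.1 q.2 z|)%:E)%E).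
    apply: int_le; [mfun|mfun|] => z; rewrite normr_ge0/= normrM mulrC.
    by apply: ler_wpM2r.
  rewrite intZl//; last by mfun.
  apply: lte_mul_pinfty => //.
  exact: integrable_int (rdiff_integrable q.1 q.2 t01).
under eq_integral do rewrite -uE.
apply: (@TTstar_schur _ _ _ _ _ (prod_measure mu mu) mu k p f (2 * C d * W * (1 + (2 * m) ^+ n)) M (schur_cst t)) => //.
- by move=> q; rewrite pE powR_ge0.
- move=> q; rewrite pE => /eqP; rewrite powR_eq0 => /andP[/eqP q0 _] z.
  rewrite kE /cut_weight q0 indicE memNset ?mul0r//= in_itv /= leNgt invr_gt0 m0//.
- by nneg; by [].
- exact: schur_cst_gt0.
- move=> q; apply: (le_via (\int[mu]_z (W * annular2 d q z)%:E)%E).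
    apply: int_le; [by apply: mfnorm; exact: mf_section1|by apply: mfM => //|] => z.
    rewrite normr_ge0; apply: (le_trans (kle q z)); apply: ler_wpM2r; first exact: annular2_ge0.
    by rewrite ler_piMr.
  apply: (le_via (W * (2 * C d))%:E).
    apply: intZl_le => //; [by move=> z; exact: annular2_ge0|exact: int_annular2].
  rewrite lee_fin (mulrC W) ler_peMr ?lerDl//; nneg.
- move=> z; apply: (le_via (\int[mu2]_q (W * cut_ball m (enorm (q.1 - q.2)) * annular2 d q z)%:E)%E).
    apply: int_le; [by apply: mfnorm; exact: mf_section2| |] => [|q].
      by apply: mfM => //; apply: mf_annular2; mfun.
    by rewrite normr_ge0; exact: kle.
  apply: (le_trans (int_radial_annular n0 z mc c0 d0 ic)).
  by rewrite -(mulrA _ W); apply: ler_wpM2l; [nneg|rewrite ler_wpM2l// lerDr].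
- exact: integrable_int (Linfc_integ lf).
move=> q.
have rE q' : \int[mu]_x (k (q, x) * k (q', x)) =
    cut_weight t m (enorm (q.1 - q.2)) * cut_weight t m (enorm (q'.1 - q'.2)) * rcorr t q q'.
  rewrite -Rint_scale; last by mfun.
  by apply: eq_Rintegral => z _; rewrite !kE mulrACA.
have mrc : meas (rcorr t q) by exact: mf_rcorr.
have mpw : meas (fun q' : X * X => enorm (q'.1 - q'.2) `^ (- n%:R - t) * `|rcorr t q q'|).
  by mfun.
apply: (le_via (\int[mu2]_q' (cut_weight t m (enorm (q.1 - q.2)) *
    (enorm (q'.1 - q'.2) `^ (- n%:R - t) * `|rcorr t q q'|))%:E)%E).
  under eq_integral do rewrite rE pE.
  apply: int_le.
  - apply: mfM; [|mfun].
    by apply: mfnorm; apply: mfM; [apply: mfM; [mfun|exact: mw]|exact: mrc].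
  - by apply: mfM; [mfun|exact: mpw].
  move=> q'; apply/andP; split; first by nneg.
  exact: (weights_le _ (cut_weight_ge0 _ _ _) (cut_weight_ge0 _ _ _) (cut_weight_mid t m (enorm_ge0 (q'.1 - q'.2)))).
apply: (le_via (cut_weight t m (enorm (q.1 - q.2)) * (schur_cst t * enorm (q.1 - q.2) `^ t))%:E).
  apply: intZl_le.
  - exact: cut_weight_ge0.
  - exact: mpw.
  - by move=> q'; nneg.
  - exact: schur_estimate.
rewrite pE mulrCA; apply: ler_wpM2l; first by apply: ltW; exact: schur_cst_gt0.
exact: (cut_weight_out _ t0 (enorm_ge0 _)).
Qed.

Lemma cut_weight_cvg t (v : R) : 0 < v ->
  cut_weight t k.+1%:R v @[k --> \oo] --> v `^ (- (n%:R / 2) - t).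
Proof.
move=> v0; apply: cvg_near_cst.
have [N hN] : exists N : nat, v <= N%:R /\ v^-1 <= N%:R.
  exists (maxn (Num.bound v) (Num.bound v^-1)); split.
    by apply: (le_trans (ltW (archi_boundP (ltW v0)))); rewrite ler_nat leq_maxl.
  by apply: (le_trans (ltW (archi_boundP _))); rewrite ?ler_nat ?leq_maxr// invr_ge0 ltW.
exists N => // k /= Nk; rewrite /cut_weight indicE mem_set ?mul1r//= in_itv /=.
have Nk' : N%:R <= k.+1%:R :> R by rewrite ler_nat; apply: (leq_trans Nk).
apply/andP; split; last by apply: le_trans Nk'; case: hN.
rewrite invf_ple ?posrE//; by apply: le_trans Nk'; case: hN.
Qed.

(** The left-hand side is the squared Gagliardo seminorm of order [t] of the potential; the cutoff
    is removed by Fatou's lemma. *)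
Lemma potential_L2 t f : 0 < t < 1 -> Linfc f ->
  (\int[mu2]_q ((riesz_potential t f q.1 - riesz_potential t f q.2) ^+ 2 /
     enorm (q.1 - q.2) `^ (n%:R + 2 * t))%:E <=
   (schur_cst t)%:E * \int[mu]_x (f x ^+ 2)%:E)%E.
Proof.
move=> t01 lf; have mF := mf_potential t (Linfc_mf lf).
apply: (@int_lim_le _ _ _ mu2 (fun k q => (cut_weight t k.+1%:R (enorm (q.1 - q.2)) *
    (riesz_potential t f q.1 - riesz_potential t f q.2)) ^+ 2)).
- move=> k; apply: mfX; apply: mfM.
    by apply: (measurableT_comp (mf_cut_weight t k.+1%:R)); mfun.
  by mfun.
- by nneg.
- move=> q; have [q12|q12] := eqVneq q.1 q.2.
    have -> : riesz_potential t f q.1 - riesz_potential t f q.2 = 0 by rewrite q12 subrr.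
    rewrite expr0n mul0r; under eq_fun do rewrite mulr0 expr0n.
    exact: cvg_cst.
  have u0 : 0 < enorm (q.1 - q.2) by rewrite enormB_gt0.
  have -> : (riesz_potential t f q.1 - riesz_potential t f q.2) ^+ 2 / enorm (q.1 - q.2) `^ (n%:R + 2 * t) =
      (enorm (q.1 - q.2) `^ (- (n%:R / 2) - t) * (riesz_potential t f q.1 - riesz_potential t f q.2)) ^+ 2.
    rewrite exprMn mulrC; congr (_ * _).
    rewrite -powRN expr2 powR_add//; congr (_ `^ _); by field.
  rewrite expr2; under eq_fun do rewrite expr2.
  by apply: cvgM; apply: cvgM; (exact: cut_weight_cvg || exact: cvg_cst).
- by move=> k; apply: cut_potential_L2 => //; rewrite ler1n.
Qed.

End bounded_bounded_support.

(** * Size and Hölder estimates of the kernel *)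

Section kernel_estimates.
Implicit Types (x y z h : X) (s t d M : R) (K : X * X -> R).

Definition ker_data s s1 s2 K M :=
  [/\ 0 < s1 < 1, 0 < s2 < 1, s1 + s2 = 2 * s, meas K & forall q, `|K q| <= M].

Lemma ker_data_sym s s1 s2 K M : ker_data s s1 s2 K M -> ker_data s s2 s1 K M.
Proof. by case=> a b c d e; split => //; rewrite addrC. Qed.

Lemma ker_data_ge0 s s1 s2 K M : ker_data s s1 s2 K M -> 0 <= M.
Proof. by case=> _ _ _ _ h; exact: le_trans (normr_ge0 _) (h (0, 0)). Qed.

Lemma kernel_integrandC s s1 s2 K z1 z2 q :
  kernel_integrand s s1 s2 K z1 z2 q = kernel_integrand s s2 s1 K z2 z1 q.
Proof. have swap (k a b u : R) : k * a * b / u = k * b * a / u by rewrite (mulrAC k).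
exact: swap. Qed.

Lemma kernelAC s s1 s2 K z1 z2 : kernelA s s1 s2 K z1 z2 = kernelA s s2 s1 K z2 z1.
Proof. by apply: eq_Rintegral => q _; exact: kernel_integrandC. Qed.

Definition ker_d (s1 s2 : R) := Num.min (Num.min s1 (1 - s1)) (Num.min s2 (1 - s2)).
(** The Hölder exponent is $s_1l$ for the share $l=d\,s_2/2$ of a second difference, with [d] equal
    to [ker_d]. This choice is symmetric, so both variables get the same exponent, and small enough
    for the decay $\frac34d$ to survive and exceed it. *)
Definition ker_alpha (s1 s2 : R) := ker_d s1 s2 * s1 * s2 / 2.

Lemma ker_d_sym s1 s2 : ker_d s1 s2 = ker_d s2 s1.
Proof. by rewrite /ker_d minC. Qed.

Lemma ker_alpha_sym s1 s2 : ker_alpha s1 s2 = ker_alpha s2 s1.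
Proof. by rewrite /ker_alpha (ker_d_sym s1) (mulrAC _ s1). Qed.

Lemma ker_dP s s1 s2 K M : ker_data s s1 s2 K M ->
  [/\ 0 < ker_d s1 s2 <= s1, ker_d s1 s2 <= 1 - s1, 0 < ker_d s1 s2 <= s2, ker_d s1 s2 <= 1 - s2 &
   ker_d s1 s2 <= 2^-1].
Proof.
move=> [/andP[a b] /andP[c e] _ _ _].
have h0 : 0 < ker_d s1 s2 by rewrite !lt_min a c !subr_gt0 b.
have h1 : ker_d s1 s2 <= s1 by rewrite !ge_min lexx.
have h2 : ker_d s1 s2 <= 1 - s1 by rewrite !ge_min lexx orbT.
have h3 : ker_d s1 s2 <= s2 by rewrite !ge_min lexx !orbT.
have h4 : ker_d s1 s2 <= 1 - s2 by rewrite !ge_min lexx !orbT.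
split; rewrite ?h0//.
by move: h1 h2; move: (ker_d _ _) => d h1 h2; clear -h1 h2; lra.
Qed.

Lemma ker_alphaP s s1 s2 K M : ker_data s s1 s2 K M ->
  let d := ker_d s1 s2 in let l := d * s2 / 2 in
  [/\ 0 < ker_alpha s1 s2, ker_alpha s1 s2 < 3 / 4 * d, 0 <= l < 1,
      3 / 4 * d <= d * (1 - l) & s1 * l = ker_alpha s1 s2].
Proof.
move=> kd; have [/andP[d0 ds1] _ /andP[_ ds2] _ d12] := ker_dP kd.
case: kd => /andP[a b] /andP[c e] _ _ _ /=; rewrite /ker_alpha.
move: (ker_d s1 s2) d0 ds1 ds2 d12 => d d0 ds1 ds2 d12; clear -d0 ds1 ds2 d12 a b c e.
have h1 : 0 < d * s2 by rewrite mulr_gt0.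
have h2 : d * s2 <= 2^-1 by rewrite (le_trans _ d12)// ler_piMr ?ltW.
have h3 : 0 < d * s1 by rewrite mulr_gt0.
have h4 : d * s1 * s2 <= d.
  rewrite -mulrA ler_piMr ?(ltW d0)// mulr_ile1 ?ltW//.
have h5 : d * (d * s2 / 2) <= d * 4^-1 by rewrite ler_wpM2l ?(ltW d0)//; lra.
split.
- by rewrite divr_gt0// mulr_gt0.
- move: h4; set k := d * s1 * s2; move=> h4; lra.
- by apply/andP; split; lra.
- by rewrite mulrBr; move: h5; set k := d * (d * s2 / 2); move=> h5; lra.
- by rewrite mulrA mulrCA mulrA.
Qed.

Lemma mf_kernel_integrand s s1 s2 K dT (T : measurableType dT) (f g : T -> X) (q : T -> X * X) :
  meas K -> meas f -> meas g -> meas q ->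
  meas (fun w => kernel_integrand s s1 s2 K (f w) (g w) (q w)).
Proof.
move=> mK mf mg mq; rewrite /kernel_integrand.
by mfun.
Qed.

Lemma product_quot_le (M m a b c f v w k r1 r2 : R) : 0 <= M -> 0 <= m -> 0 <= v -> 0 <= w ->
  0 <= a -> 0 <= b -> 0 <= f -> `|k| <= M -> `|r1| <= m * a * v -> `|r2| <= m * b * w ->
  a * b / f <= c -> `|k * r1 * r2 / f| <= M * m ^+ 2 * (c * (v * w)).
Proof.
move=> M0 m0 v0 w0 a0 b0 f0 kM h1 h2 h3; rewrite !normrM normfV (ger0_norm f0).
apply: (le_via (M * (m * a * v) * (m * b * w) / f)).
  by rewrite ler_wpM2r ?invr_ge0//; apply: ler_pM => //; apply: ler_pM.
have -> : M * (m * a * v) * (m * b * w) / f = M * m ^+ 2 * (v * w) * (a * b / f) by ring.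
have -> : M * m ^+ 2 * (c * (v * w)) = M * m ^+ 2 * (v * w) * c by ring.
by rewrite ler_wpM2l// !mulr_ge0.
Qed.

Lemma powR_quot (a b c u : R) : 0 < a -> 0 <= u -> u `^ a * u `^ b / u `^ c <= u `^ (a + b - c).
Proof.
move=> a0; rewrite le_eqVlt => /predU1P[<-|u0]; first by rewrite (powR0 (x := a)) ?gt_eqF// !mul0r.
by rewrite -powRN !powR_add.
Qed.

(** The two differences contribute $|x-y|^{s_1+s_2}=|x-y|^{2s}$, so the weight $|x-y|^{-n}$
    remains. *)
Lemma kernel_integrand_le s s1 s2 K M z1 z2 q : ker_data s s1 s2 K M ->
  let d := ker_d s1 s2 in
  `|kernel_integrand s s1 s2 K z1 z2 q| <= M * n%:R ^+ 2 *
    (enorm (q.1 - q.2) `^ (- n%:R) * (annular2 d q z1 * annular2 d q z2)).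
Proof.
move=> kd /=; set d := ker_d s1 s2; have [e1 e2 e3 e4 _] := ker_dP kd.
have M0 := ker_data_ge0 kd; case: kd => s101 s201 s12 mK KM.
have h1 : `|rdiff s1 q.1 q.2 z1| <= n%:R * enorm (q.1 - q.2) `^ s1 * annular2 d q z1 by exact: riesz_diff_le.
have h2 : `|rdiff s2 q.1 q.2 z2| <= n%:R * enorm (q.1 - q.2) `^ s2 * annular2 d q z2 by exact: riesz_diff_le.
have h3 := @powR_quot s1 s2 (n%:R + 2 * s) (enorm (q.1 - q.2)).
have {}h3 : enorm (q.1 - q.2) `^ s1 * enorm (q.1 - q.2) `^ s2 / enorm (q.1 - q.2) `^ (n%:R + 2 * s) <=
    enorm (q.1 - q.2) `^ (- n%:R).
  rewrite (le_trans (h3 _ _))//; [by case/andP: s101|].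
  by rewrite s12 opprD addrCA subrr addr0.
exact: (product_quot_le M0 (ler0n _ _) (annular2_ge0 _ _ _) (annular2_ge0 _ _ _) (powR_ge0 _ _) (powR_ge0 _ _)
  (powR_ge0 _ _) (KM q) h1 h2 h3).
Qed.

Lemma mf_annular_pairs (b d : R) z1 z2 : meas (fun q : X * X =>
  enorm (q.1 - q.2) `^ (- n%:R - b) * (annular2 d q z1 * annular2 d q z2)).
Proof.
by apply: mfM; [mfun|apply: mfM; apply: mf_annular2; mfun].
Qed.

Lemma powR_scale (c b D : R) : 0 < c -> 0 < D -> (D / c) `^ b = (c `^ b)^-1 * D `^ b.
Proof.
move=> c0 D0; rewrite powRM ?invr_ge0 ?(ltW c0) ?(ltW D0)// mulrC -powR_inv1 ?(ltW c0)//.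
by rewrite -powRrM mulN1r powRN.
Qed.

Definition size_cst s1 s2 : R := n%:R ^+ 2 * kernel_cst (n := n) 0 (ker_d s1 s2) * (4 `^ (- n%:R))^-1.

Lemma size_cst_ge0 s s1 s2 K M : ker_data s s1 s2 K M -> 0 <= size_cst s1 s2.
Proof.
move=> kd; have [/andP[d0 _] _ _ _ _] := ker_dP kd.
by rewrite /size_cst; nneg; apply: kernel_cst_ge0; rewrite lexx.
Qed.

Lemma int_kernel_integrand s s1 s2 K M z1 z2 : ker_data s s1 s2 K M -> z1 != z2 ->
  (\int[mu2]_q (`|kernel_integrand s s1 s2 K z1 z2 q|)%:E <=
   (M * size_cst s1 s2 * enorm (z1 - z2) `^ (- n%:R))%:E)%E.
Proof.
move=> kd z12; have M0 := ker_data_ge0 kd.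
have [/andP[d0 _] _ _ _ d12] := ker_dP kd.
have mK : meas K by case: kd.
have D0 : 0 < enorm (z1 - z2) by rewrite enormB_gt0.
have E0 : 0 < enorm (z1 - z2) / 4 by rewrite divr_gt0.
have mp := mf_annular_pairs 0 (ker_d s1 s2) z1 z2; rewrite subr0 in mp.
apply: (le_via (\int[mu2]_q (M * n%:R ^+ 2 *
    (enorm (q.1 - q.2) `^ (- n%:R) * (annular2 (ker_d s1 s2) q z1 * annular2 (ker_d s1 s2) q z2)))%:E)%E).
  apply: int_le.
  - by apply: mfnorm; apply: mf_kernel_integrand; mfun.
  - by apply: mfM.
  by move=> q; rewrite normr_ge0; exact: kernel_integrand_le.
apply: (le_via (M * n%:R ^+ 2 * (kernel_cst (n := n) 0 (ker_d s1 s2) * (enorm (z1 - z2) / 4) `^ (- n%:R)))%:E).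
  apply: intZl_le => //.
  - by nneg.
  - by move=> q; rewrite mulr_ge0 ?powR_ge0// mulr_ge0// annular2_ge0.
  have := @int_annular_pairs R n n0 0 (ker_d s1 s2) (enorm (z1 - z2) / 4) z1 z2.
  rewrite !subr0; apply => //.
  - by rewrite lexx.
  - by apply: (le_trans d12); rewrite invf_le1// ler1n.
  - by rewrite mulrC divfK.
rewrite powR_scale// lee_fin /size_cst le_eqVlt; apply/orP; left; apply/eqP.
by move: (kernel_cst _ _) ((4 `^ _)^-1) (enorm _ `^ _) => a b c; move: (n%:R : R); clear -M a b c => *; ring.
Qed.

Lemma kernel_integrable s s1 s2 K M z1 z2 : ker_data s s1 s2 K M -> z1 != z2 ->
  integ mu2 (kernel_integrand s s1 s2 K z1 z2).
Proof.
move=> kd z12; apply: int_integ; last exact: le_lt_trans (int_kernel_integrand kd z12) (ltry _).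
by case: (kd) => _ _ _ mK _; apply: mf_kernel_integrand; mfun.
Qed.

Lemma kernelA_size s s1 s2 K M z1 z2 : ker_data s s1 s2 K M -> z1 != z2 ->
  `|kernelA s s1 s2 K z1 z2| <= M * size_cst s1 s2 * enorm (z1 - z2) `^ (- n%:R).
Proof.
move=> kd z12; rewrite -lee_fin; apply: Rint_le; last exact: int_kernel_integrand.
exact: integrable_mf (kernel_integrable kd z12).
Qed.

Definition holder_cst s1 s2 : R :=
  4 * n%:R ^+ 2 * (2 * kernel_cst (n := n) (ker_alpha s1 s2) (3 / 4 * ker_d s1 s2)) *
  (8 `^ (- n%:R - ker_alpha s1 s2))^-1.

Lemma holder_cst_ge0 s s1 s2 K M : ker_data s s1 s2 K M -> 0 <= holder_cst s1 s2.
Proof.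
move=> kd; have [a0 ad _ _ _] := ker_alphaP kd.
by rewrite /holder_cst; nneg; apply: kernel_cst_ge0; rewrite (ltW a0).
Qed.

Lemma holder_cst_sym s1 s2 : holder_cst s1 s2 = holder_cst s2 s1.
Proof. by rewrite /holder_cst ker_alpha_sym ker_d_sym. Qed.

(** Only the first difference depends on [z1], and its increment is a second difference. The share
    of its power that goes to $|h|$ is missing from $|x-y|$, whence the weight
    $|x-y|^{-n-\alpha}$. *)
Lemma kernel_increment_le s s1 s2 K M z1 z2 h q : ker_data s s1 s2 K M ->
  let a := ker_alpha s1 s2 in let d := 3 / 4 * ker_d s1 s2 in
  `|kernel_integrand s s1 s2 K (z1 + h) z2 q - kernel_integrand s s1 s2 K z1 z2 q| <=
  M * (4 * n%:R ^+ 2) * enorm h `^ a *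
  (enorm (q.1 - q.2) `^ (- n%:R - a) * (annular2 d q (z1 + h) * annular2 d q z2) +
   enorm (q.1 - q.2) `^ (- n%:R - a) * (annular2 d q z1 * annular2 d q z2)).
Proof.
move=> kd /=; set a := ker_alpha s1 s2; set d := 3 / 4 * ker_d s1 s2; have [e1 e2 e3 e4 e5] := ker_dP kd.
have [a0 ad l01 dl sl] := ker_alphaP kd; rewrite -/a -/d in a0 ad dl sl.
set l := _ / 2 in l01 dl sl.
have M0 := ker_data_ge0 kd; case: kd => s101 s201 s12 mK KM.
have d0 : 0 < d by exact: lt_trans ad.
have u0 := enorm_ge0 (q.1 - q.2).
have ex (w : X) : G (ker_d s1 s2 * (1 - l)) (enorm (q.1 - q.2)) (enorm w) <= G d (enorm (q.1 - q.2)) (enorm w).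
  by apply: annular_le_exp; rewrite ?d0.
have ex' (w : X) : G (ker_d s1 s2) (enorm (q.1 - q.2)) (enorm w) <= G d (enorm (q.1 - q.2)) (enorm w).
  apply: annular_le_exp; rewrite ?d0 ?enorm_ge0//= /d; move: e1 => /andP[p _].
  by rewrite ler_piMl ?(ltW p)// ler_pdivrMr// mul1r ler_nat.
have h1 : `|rdiff2 s1 q.1 q.2 z1 h| <= 4 * n%:R * enorm h `^ a * enorm (q.1 - q.2) `^ (s1 * (1 - l)) *
    (annular2 d q (z1 + h) + annular2 d q z1).
  have := riesz_diff2_le n0 q.1 q.2 z1 h s101 e1 e2 l01; rewrite /= sl => hh.
  apply: (le_trans hh); apply: ler_wpM2l; first by nneg.
  rewrite /annular2; move: (ex (q.1 - (z1 + h))) (ex (q.2 - (z1 + h))) (ex (q.1 - z1)) (ex (q.2 - z1)).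
  move: (G _ _ _) (G _ _ _) (G _ _ _) (G _ _ _) (G _ _ _) (G _ _ _) (G _ _ _) (G _ _ _).
  by move=> a1 a2 a3 a4 a5 a6 a7 a8; clear -a1 a2 a3 a4 a5 a6 a7 a8; lra.
have h2 : `|rdiff s2 q.1 q.2 z2| <= n%:R * enorm (q.1 - q.2) `^ s2 * annular2 d q z2.
  apply: (le_trans (riesz_diff_le n0 q.1 q.2 z2 s201 e3 e4)); apply: ler_wpM2l; first by nneg.
  by apply: lerD; exact: ex'.
have h3 := @powR_quot (s1 * (1 - l)) s2 (n%:R + 2 * s) _ _ u0.
have {}h3 : enorm (q.1 - q.2) `^ (s1 * (1 - l)) * enorm (q.1 - q.2) `^ s2 / enorm (q.1 - q.2) `^ (n%:R + 2 * s) <=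
    enorm (q.1 - q.2) `^ (- n%:R - a).
  rewrite (le_trans (h3 _))//; first by rewrite mulr_gt0//; [case/andP: s101|case/andP: l01 => _; rewrite subr_gt0].
  rewrite (_ : s1 * (1 - l) + s2 - (n%:R + 2 * s) = - n%:R - a)// -s12 -sl; ring.
have -> : kernel_integrand s s1 s2 K (z1 + h) z2 q - kernel_integrand s s1 s2 K z1 z2 q =
    K q * rdiff2 s1 q.1 q.2 z1 h * rdiff s2 q.1 q.2 z2 / enorm (q.1 - q.2) `^ (n%:R + 2 * s).
  have sub (k a1 a2 b v : R) : k * a1 * b / v - k * a2 * b / v = k * (a1 - a2) * b / v by ring.
  exact: sub.
have H4 : 0 <= 4 * enorm h `^ a by nneg.
have m4 : 4 * n%:R * enorm h `^ a * enorm (q.1 - q.2) `^ (s1 * (1 - l)) * (annular2 d q (z1 + h) + annular2 d q z1) =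
  n%:R * enorm (q.1 - q.2) `^ (s1 * (1 - l)) * (4 * enorm h `^ a * (annular2 d q (z1 + h) + annular2 d q z1)).
  have sw (m b c v : R) : 4 * m * b * c * v = m * c * (4 * b * v) by ring.
  exact: sw.
rewrite m4 in h1.
have V0 : 0 <= 4 * enorm h `^ a * (annular2 d q (z1 + h) + annular2 d q z1).
  by apply: (mulr_ge0 H4); apply: addr_ge0; exact: annular2_ge0.
apply: (le_trans (product_quot_le M0 (ler0n _ _) V0 (annular2_ge0 _ _ _) (powR_ge0 _ _) (powR_ge0 _ _)
  (powR_ge0 _ _) (KM q) h1 h2 h3)).
have alg (m b c v w v' : R) : M * m ^+ 2 * (c * (4 * b * (v + v') * w)) <= M * (4 * m ^+ 2) * b * (c * (v * w) + c * (v' * w)).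
  by apply: le_of_eq; ring.
exact: alg.
Qed.

Lemma half_away z1 z2 h : z1 != z2 -> enorm h <= 2^-1 * enorm (z1 - z2) ->
  2^-1 * enorm (z1 - z2) <= enorm (z1 + h - z2) /\ z1 + h != z2.
Proof.
move=> z12 hh; have D0 : 0 < enorm (z1 - z2) by rewrite enormB_gt0.
have h1 : enorm (z1 - z2) <= enorm (z1 - (z1 + h)) + enorm (z1 + h - z2) by exact: enormBD.
rewrite opprD addrA subrr add0r enormN in h1.
have h2 : 2^-1 * enorm (z1 - z2) <= enorm (z1 + h - z2).
  by move: h1 hh; move: (enorm _) (enorm _) (enorm _) => p q r; clear -p q r; lra.
by split => //; rewrite -enormB_gt0; apply: lt_le_trans h2; rewrite mulr_gt0.
Qed.

Lemma kernelA_holder1 s s1 s2 K M z1 z2 h : ker_data s s1 s2 K M -> z1 != z2 ->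
  enorm h <= 2^-1 * enorm (z1 - z2) ->
  `|kernelA s s1 s2 K (z1 + h) z2 - kernelA s s1 s2 K z1 z2| <=
  M * holder_cst s1 s2 * (enorm h `^ (ker_alpha s1 s2) * enorm (z1 - z2) `^ (- n%:R - ker_alpha s1 s2)).
Proof.
move=> kd z12 hh; have [hz z12'] := half_away z12 hh.
have M0 := ker_data_ge0 kd.
have [a0 ad _ _ _] := ker_alphaP kd; have [/andP[d0 _] _ _ _ d12] := ker_dP kd.
set a := ker_alpha s1 s2 in a0 ad *; set d := 3 / 4 * ker_d s1 s2 in ad.
have D0 : 0 < enorm (z1 - z2) by rewrite enormB_gt0.
(* An eighth, since [z1 + h] may be as close to [z2] as half the distance of [z1], and
   [int_annular_pairs] asks for four times [E]. *)
have E0 : 0 < enorm (z1 - z2) / 8 by rewrite divr_gt0.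
have d1 : d <= 1 by rewrite /d; move: d12; clear; move: (ker_d _ _) => e; lra.
have i1 := kernel_integrable kd z12'; have i2 := kernel_integrable kd z12.
rewrite (Rint_sub i1 i2) -lee_fin.
have mdiff : meas (fun q => kernel_integrand s s1 s2 K (z1 + h) z2 q - kernel_integrand s s1 s2 K z1 z2 q).
  by apply: mfB; [exact: integrable_mf i1|exact: integrable_mf i2].
apply: Rint_le => //.
have mp w := mf_annular_pairs a d w z2.
have p0 w q : 0 <= enorm (q.1 - q.2) `^ (- n%:R - a) * (annular2 d q w * annular2 d q z2).
  by rewrite mulr_ge0 ?powR_ge0// mulr_ge0// annular2_ge0.
apply: (le_via (\int[mu2]_q (M * (4 * n%:R ^+ 2) * enorm h `^ a *
  (enorm (q.1 - q.2) `^ (- n%:R - a) * (annular2 d q (z1 + h) * annular2 d q z2) +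
   enorm (q.1 - q.2) `^ (- n%:R - a) * (annular2 d q z1 * annular2 d q z2)))%:E)%E).
  apply: int_le.
  - exact: mfnorm.
  - by apply: mfM; [mfun|apply: mfD; exact: mp].
  by move=> q; rewrite normr_ge0; exact: kernel_increment_le.
set k := kernel_cst (n := n) a d * (enorm (z1 - z2) / 8) `^ (- n%:R - a).
have pairs w : 4 * (enorm (z1 - z2) / 8) <= enorm (w - z2) ->
  (\int[mu2]_q (enorm (q.1 - q.2) `^ (- n%:R - a) * (annular2 d q w * annular2 d q z2))%:E <= k%:E)%E.
  by move=> hw; apply: int_annular_pairs => //; rewrite (ltW a0).
apply: (le_via (M * (4 * n%:R ^+ 2) * enorm h `^ a * (k + k))%:E).
  apply: intZl_le.
  - by nneg.
  - by apply: mfD; exact: mp.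
  - by move=> q; rewrite addr_ge0.
  - apply: intD_le; [exact: mp|exact: mp|exact: p0|exact: p0|apply: pairs|apply: pairs].
    + by move: hz; move: (enorm _) (enorm _) => p r; clear -p r; lra.
    + by move: D0; move: (enorm _) => p; clear -p; lra.
rewrite lee_fin /k powR_scale// /holder_cst -/a -/d.
have alg (m b c e f : R) : M * (4 * m ^+ 2) * b * (c * (e * f) + c * (e * f)) <= M * (4 * m ^+ 2 * (2 * c) * e) * (b * f).
  by apply: le_of_eq; ring.
exact: alg.
Qed.

Lemma kernelA_holder2 s s1 s2 K M z1 z2 h : ker_data s s1 s2 K M -> z1 != z2 ->
  enorm h <= 2^-1 * enorm (z1 - z2) ->
  `|kernelA s s1 s2 K z1 (z2 + h) - kernelA s s1 s2 K z1 z2| <=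
  M * holder_cst s1 s2 * (enorm h `^ (ker_alpha s1 s2) * enorm (z1 - z2) `^ (- n%:R - ker_alpha s1 s2)).
Proof.
move=> kd z12 hh; rewrite !(kernelAC s s1) holder_cst_sym ker_alpha_sym enormC.
by apply: kernelA_holder1; [exact: ker_data_sym|rewrite eq_sym|rewrite enormC].
Qed.

(** Read as a bump of scale [r], the Hölder bound integrates over the complement of a ball to
    Hörmander's condition. *)
Lemma holder_annular (a r D : R) : 0 < a -> 0 <= r -> 2 * r <= D -> 
  r `^ a * D `^ (- n%:R - a) <= G a r D.
Proof.
move=> a0; rewrite le_eqVlt => /predU1P[<- _|r0 rD]; first by rewrite powR0 ?gt_eqF// mul0r annular_ge0.
have D0 : 0 < D by move: r0 rD; clear -r D; lra.
rewrite annular_geu//; last by move: r0 rD; clear -r D; lra.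
rewrite powRM ?invr_ge0 ?(ltW r0) ?(ltW D0)// -[D^-1]powR_inv1 ?(ltW D0)// -powRrM mulN1r.
by rewrite -powR_add// mulrCA.
Qed.

Lemma mf_kernelA s s1 s2 K dT (T : measurableType dT) (f g : T -> X) :
  meas K -> meas f -> meas g ->
  meas (fun w => kernelA s s1 s2 K (f w) (g w)).
Proof.
move=> mK mf mg.
apply: (@mf_Rint1 _ _ _ _ _ (prod_measure mu mu) (fun p : T * (X * X) => kernel_integrand s s1 s2 K (f p.1) (g p.1) p.2)).
by apply: mf_kernel_integrand => //; [exact: (measurableT_comp mf measurable_fst)|exact: (measurableT_comp mg measurable_fst)].
Qed.

End kernel_estimates.

Ltac mfun_ext ::= first [mfun_annular2 | match goal with
  |- measurable_fun _ (fun x => kernelA _ _ _ _ _ _) => apply: mf_kernelA end].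

(** * The bilinear form and the operator on Lipschitz functions *)

Section form_estimates.
Implicit Types (x y z h : X) (s t d M : R) (K : X * X -> R) (f g phi : X -> R).

Lemma form_integrandC s s1 s2 K phi f q :
  form_integrand s s1 s2 K phi f q = form_integrand s s2 s1 K f phi q.
Proof.
have swap (k a b u : R) : k * a * b / u = k * b * a / u by rewrite (mulrAC k).
exact: swap.
Qed.

Definition pairing s s1 s2 K phi f : R := \int[mu2]_q form_integrand s s1 s2 K phi f q.

Lemma pairingC s s1 s2 K phi f : pairing s s1 s2 K phi f = pairing s s2 s1 K f phi.
Proof. by apply: eq_Rintegral => q _; exact: form_integrandC. Qed.

Lemma mf_form_integrand s s1 s2 K phi f : meas K -> Linfc phi -> Linfc f ->
  meas (form_integrand s s1 s2 K phi f).
Proof.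
move=> mK lp lf; rewrite /form_integrand.
have mF := mf_potential s1 (Linfc_mf lp); have mG := mf_potential s2 (Linfc_mf lf).
by mfun.
Qed.

Lemma amgm_quot (k M a b p q l : R) : `|k| <= M -> 0 < l ->
  `|k * a * b / (p * q)| <= M / 2 * (l * (a ^+ 2 / p ^+ 2) + l^-1 * (b ^+ 2 / q ^+ 2)).
Proof.
move=> kM l0.
have -> : k * a * b / (p * q) = k * ((a / p) * (b / q)) by rewrite invfM; ring.
rewrite -!expr_div_n; move: (a / p) (b / q) => x y; rewrite !normrM -mulrA.
apply: ler_pM => //.
rewrite -(real_normK (num_real x)) -(real_normK (num_real y)); move: (`|x|) (`|y|) => v w.
rewrite -subr_ge0.
have -> : 2^-1 * (l * v ^+ 2 + l^-1 * w ^+ 2) - v * w = 2^-1 * l^-1 * (l * v - w) ^+ 2.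
  by field; rewrite gt_eqF.
by nneg.
Qed.

Definition sqint f : R := \int[mu]_x (f x ^+ 2).

Lemma sqintE f : Linfc f -> (\int[mu]_x (f x ^+ 2)%:E = (sqint f)%:E)%E.
Proof.
move=> lf; rewrite RintE//.
by under [EFin \o _]eq_fun do rewrite expr2; exact: Linfc_integ (LinfcM lf lf).
Qed.

Lemma sqint_ge0 f : 0 <= sqint f.
Proof. by apply: Rintegral_ge0 => x _; exact: sqr_ge0. Qed.

Definition form_cst s1 s2 : R := schur_cst s1 + schur_cst s2.

Lemma form_cst_gt0 s s1 s2 K M : ker_data s s1 s2 K M -> 0 < form_cst s1 s2.
Proof. by case=> a b _ _ _; rewrite addr_gt0// schur_cst_gt0. Qed.

(** Since $n+2s=(n/2+s_1)+(n/2+s_2)$, the weight splits between the two increments. The free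
    parameter [l] takes the place of Cauchy-Schwarz: it is chosen at each use so that one of the two
    terms can be absorbed. *)
Lemma form_integrand_le s s1 s2 K M phi f (l : R) q : ker_data s s1 s2 K M -> 0 < l ->
  `|form_integrand s s1 s2 K phi f q| <= M / 2 * (
    l * ((riesz_potential s1 phi q.1 - riesz_potential s1 phi q.2) ^+ 2 / enorm (q.1 - q.2) `^ (n%:R + 2 * s1)) +
    l^-1 * ((riesz_potential s2 f q.1 - riesz_potential s2 f q.2) ^+ 2 / enorm (q.1 - q.2) `^ (n%:R + 2 * s2))).
Proof.
move=> kd l0; have [s101 s201 s12 mK KM] := kd.
rewrite /form_integrand; set a := riesz_potential s1 phi q.1 - _; set b := riesz_potential s2 f q.1 - _.
set u := enorm (q.1 - q.2).
have u0 : 0 <= u by exact: enorm_ge0.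
have nz (c : R) : 0 < c -> n%:R / 2 + c != 0.
  by move=> c0; rewrite gt_eqF// ltr_wpDl.
have h1 (c : R) : 0 < c -> u `^ (n%:R + 2 * c) = (u `^ (n%:R / 2 + c)) ^+ 2.
  move=> c0; rewrite -powR_mulrn ?powR_ge0// -powRrM; congr (_ `^ _); by field.
have h2 : u `^ (n%:R + 2 * s) = u `^ (n%:R / 2 + s1) * u `^ (n%:R / 2 + s2).
  move: u0; rewrite le_eqVlt => /predU1P[<-|u0]; last by rewrite powR_add// -s12; congr (_ `^ _); field.
  have a0 : 0 < s1 by case/andP: s101.
  have b0 : 0 < s2 by case/andP: s201.
  rewrite !powR0 ?mulr0 ?nz// gt_eqF// -s12 ltr_wpDl// addr_gt0//.
rewrite h2 (h1 s1) ?(h1 s2); [|by case/andP: s201|by case/andP: s101].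
exact: amgm_quot.
Qed.

Lemma int_form_integrand s s1 s2 K M phi f (l : R) : ker_data s s1 s2 K M -> Linfc phi -> Linfc f -> 0 < l ->
  (\int[mu2]_q (`|form_integrand s s1 s2 K phi f q|)%:E <=
   (M * form_cst s1 s2 / 2 * (l * sqint phi + l^-1 * sqint f))%:E)%E.
Proof.
move=> kd lp lf l0; have [s101 s201 s12 mK KM] := kd; have M0 := ker_data_ge0 kd.
have mF := mf_potential s1 (Linfc_mf lp); have mG := mf_potential s2 (Linfc_mf lf).
have [A AE] := ex_fun (fun q : X * X => (riesz_potential s1 phi q.1 - riesz_potential s1 phi q.2) ^+ 2 / enorm (q.1 - q.2) `^ (n%:R + 2 * s1)).
have [B BE] := ex_fun (fun q : X * X => (riesz_potential s2 f q.1 - riesz_potential s2 f q.2) ^+ 2 / enorm (q.1 - q.2) `^ (n%:R + 2 * s2)).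
have mA : meas A by rewrite (funext AE); mfun.
have mB : meas B by rewrite (funext BE); mfun.
have A0 q : 0 <= A q by rewrite AE divr_ge0 ?sqr_ge0 ?powR_ge0.
have B0 q : 0 <= B q by rewrite BE divr_ge0 ?sqr_ge0 ?powR_ge0.
have i1 : (\int[mu2]_q (A q)%:E <= (schur_cst s1 * sqint phi)%:E)%E.
  by under eq_integral do rewrite AE; rewrite EFinM -sqintE//; exact: potential_L2.
have i2 : (\int[mu2]_q (B q)%:E <= (schur_cst s2 * sqint f)%:E)%E.
  by under eq_integral do rewrite BE; rewrite EFinM -sqintE//; exact: potential_L2.
have l0' : 0 <= l^-1 by nneg.
have h q : `|form_integrand s s1 s2 K phi f q| <= M / 2 * (l * A q + l^-1 * B q).
  by rewrite AE BE; exact: form_integrand_le.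
apply: (le_via (M / 2 * (l * (schur_cst s1 * sqint phi) + l^-1 * (schur_cst s2 * sqint f)))%:E).
  apply: (le_via (\int[mu2]_q (M / 2 * (l * A q + l^-1 * B q))%:E)%E).
    apply: int_le; [by apply: mfnorm; exact: mf_form_integrand|mfun|] => q.
    by rewrite normr_ge0; exact: h.
  apply: intZl_le; [by nneg|mfun|by nneg|].
  apply: intD_le; [mfun|mfun|by nneg|by nneg| |].
    by apply: intZl_le => //; exact: ltW.
  exact: intZl_le.
have alg (S1 S2 p q k k' : R) : 0 <= S1 -> 0 <= S2 -> 0 <= p -> 0 <= q -> 0 <= k -> 0 <= k' ->
    M / 2 * (k * (S1 * p) + k' * (S2 * q)) <= M * (S1 + S2) / 2 * (k * p + k' * q).
  move=> s10 s20 p0 q0 k0 k'0; rewrite -subr_ge0.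
  have -> : M * (S1 + S2) / 2 * (k * p + k' * q) - M / 2 * (k * (S1 * p) + k' * (S2 * q)) =
    M / 2 * (S2 * (k * p) + S1 * (k' * q)) by field.
  by nneg.
rewrite lee_fin; apply: alg => //; try exact: sqint_ge0; try exact: ltW; by apply: ltW; exact: schur_cst_gt0.
Qed.

Lemma form_integrable s s1 s2 K M phi f : ker_data s s1 s2 K M -> Linfc phi -> Linfc f ->
  integ mu2 (form_integrand s s1 s2 K phi f).
Proof.
move=> kd lp lf; apply: int_integ; first by apply: mf_form_integrand; case: kd.
exact: le_lt_trans (int_form_integrand kd lp lf ltr01) (ltry _).
Qed.

Lemma pairing_le s s1 s2 K M phi f (l : R) : ker_data s s1 s2 K M -> Linfc phi -> Linfc f -> 0 < l ->
  `|pairing s s1 s2 K phi f| <= M * form_cst s1 s2 / 2 * (l * sqint phi + l^-1 * sqint f).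
Proof.
move=> kd lp lf l0; rewrite -lee_fin; apply: Rint_le; last exact: int_form_integrand.
by apply: mf_form_integrand; case: kd.
Qed.

Lemma potentialD t (c : R) f g x : 0 < t < 1 -> Linfc f -> Linfc g ->
  riesz_potential t (fun z => f z + c * g z) x = riesz_potential t f x + c * riesz_potential t g x.
Proof.
move=> t01 lf lg; rewrite /riesz_potential; under eq_Rintegral do rewrite mulrDr (mulrCA _ c).
have gi := potential_integ x t01 lg; have fi := potential_integ x t01 lf.
by rewrite RintegralD//; [rewrite RintegralZl|exact: (integrableZl measurableT c gi)].
Qed.

Lemma pairingD s s1 s2 K M phi (c : R) f g : ker_data s s1 s2 K M -> Linfc phi -> Linfc f -> Linfc g ->
  pairing s s1 s2 K phi (fun z => f z + c * g z) = pairing s s1 s2 K phi f + c * pairing s s1 s2 K phi g.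
Proof.
move=> kd lp lf lg; have [s101 s201 _ _ _] := kd.
have i1 := form_integrable kd lp lf; have i2 := form_integrable kd lp lg.
rewrite /pairing -RintegralZl// -RintegralD//; last exact: (integrableZl measurableT c i2).
apply: eq_Rintegral => q _; rewrite /form_integrand !potentialD//.
have alg (k a b1 b2 b3 b4 u : R) : k * a * (b1 + c * b2 - (b3 + c * b4)) / u =
  k * a * (b1 - b3) / u + c * (k * a * (b2 - b4) / u) by ring.
exact: alg.
Qed.

Lemma Rint_shift f (v : X) : meas f -> \int[mu]_x f (x + v) = \int[mu]_x f x.
Proof.
move=> mf; rewrite !Rint_posneg; congr (fine (_ - _)%E).
- apply: (@int_shift R n (fun x => (Num.max (f x) 0)%:E) v); first by mfun.
  by move=> x; rewrite lee_fin le_max lexx orbT.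
- apply: (@int_shift R n (fun x => (Num.max (- f x) 0)%:E) v); first by mfun.
  by move=> x; rewrite lee_fin le_max lexx orbT.
Qed.

Definition ball_cst t (r : R) : R := C t + (2 * r) ^+ n.

(** The bound is uniform in [x]: on the unit ball around [x] the kernel has integral at most [C t],
    and beyond it the kernel is at most 1. *)
Lemma int_riesz_cball0 t (r : R) x : 0 < t < 1 -> 0 <= r ->
  (\int[mu]_z (riesz t x z * \1_(cball 0 r) z)%:E <= (ball_cst t r)%:E)%E.
Proof.
move=> t01 r0.
have mB a b : meas (\1_(cball a b) : X -> R) by apply: mfindic; exact: meas_cball.
apply: (le_via (\int[mu]_z (riesz t x z * \1_(cball x 1) z + \1_(cball 0 r) z)%:E)%E).
  apply: int_le; [by mfun|by mfun|] => z.
  rewrite mulr_ge0 ?riesz_ge0//= !indicE; case: (boolP (z \in cball x 1)) => xz.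
    rewrite mulr1; case: (_ \in _); first by rewrite mulr1 lerDl.
    by rewrite mulr0 addr0 riesz_ge0.
  rewrite mulr0 add0r ler_piMl// /riesz.
  have nt : 0 <= n%:R - t by rewrite subr_ge0 (@le_trans _ _ 1) ?ler1n; case/andP: t01 => _ /ltW.
  have {}xz : 1 <= enorm (x - z).
    by rewrite leNgt; apply/negP => h; move/negP: xz; apply; rewrite inE /cball /= enormC; exact: ltW.
  have := @powR_neg_antitone R _ 1 _ nt ltr01 xz.
  by rewrite opprB powR1.
apply: intD_le; [mfun|exact: mB|by move=> z; rewrite mulr_ge0 ?riesz_ge0| | |].
- by [].
- by have := int_riesz_ball x t01 (@ltr01 R); rewrite powR1 mul1r.
- rewrite integral_indic// ?setIT; [exact: mu_cball_le|exact: meas_cball].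
Qed.

Lemma potential_le t (N r : R) g x : 0 < t < 1 -> 0 <= r -> 0 <= N -> meas g ->
  (forall z, `|g z| <= N * \1_(cball 0 r) z) ->
  `|\int[mu]_z (riesz t x z * g z)| <= N * ball_cst t r.
Proof.
move=> t01 r0 N0 mg gN.
rewrite -lee_fin; apply: Rint_le; first by mfun.
apply: (le_via (\int[mu]_z (N * (riesz t x z * \1_(cball 0 r) z))%:E)%E).
  apply: int_le; [mfun|mfun|] => z; rewrite normr_ge0/= normrM.
  by rewrite (ger0_norm (riesz_ge0 _ _ _)) mulrCA ler_wpM2l ?riesz_ge0.
apply: intZl_le => //; [mfun|by move=> z; rewrite mulr_ge0 ?riesz_ge0|exact: int_riesz_cball0].
Qed.

Definition lipschitz_rV f := exists2 L : R, 0 <= L & forall x y, `|f x - f y| <= L * enorm (x - y).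

(** By translation, an increment of the potential is the potential of an increment of [f]. The
    latter is at most $L|x-y|$ and, for $|x-y|<1$, supported in the ball of radius $r+1$. *)
Lemma potential_lipschitz t f : 0 < t < 1 -> Linfc f -> lipschitz_rV f ->
  exists2 A : R, 0 <= A & forall x y,
    `|riesz_potential t f x - riesz_potential t f y| <= A * Num.min 1 (enorm (x - y)).
Proof.
move=> t01 lf [L L0 fL]; have [mf [M [r [M0 [r0 fM]]]]] := lf.
have r10 : 0 <= r + 1 by nneg.
have P0 : 0 <= ball_cst t (r + 1).
  apply: addr_ge0; last by nneg.
  by apply: annular_cst_ge0; case/andP: t01.
have wide z : (\1_(cball 0 r) z : R) <= \1_(cball 0 (r + 1)) z.
  rewrite !indicE; case: (boolP (z \in cball 0 r)) => // zr; rewrite mem_set//.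
  by rewrite inE in zr; apply: (le_trans zr); rewrite lerDl.
have bd x : `|riesz_potential t f x| <= M * ball_cst t (r + 1).
  apply: potential_le => // z; apply: (le_trans (fM z)); exact: ler_wpM2l.
exists ((2 * M + L) * ball_cst t (r + 1)); first by nneg.
move=> x y; have [u1|u1] := leP 1 (enorm (x - y)).
  rewrite mulr1; apply: (le_trans (ler_normB _ _)); apply: (le_trans (lerD (bd x) (bd y))).
  by rewrite -mulrDl ler_wpM2r// -mulr2n -[M *+ 2]mulr_natl lerDl.
have -> : riesz_potential t f x - riesz_potential t f y =
    - \int[mu]_z (riesz t x z * (f (z + (y - x)) - f z)).
  have mfs : meas (fun z : X => f (z + (y - x))) by apply: (measurableT_comp mf); mfun.
  rewrite {2}/riesz_potential -(@Rint_shift (fun z => riesz t y z * f z) (y - x)); last by mfun.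
  under [X in _ - X]eq_Rintegral do rewrite riesz_shift.
  rewrite /riesz_potential.
  have i1 := potential_integ x t01 lf.
  have lfs : Linfc (fun z : X => f (z + (y - x))).
    have [N N0 fN] := Linfc_bounded lf; have [r' r'0 fr'] := Linfc_support lf.
    apply: (@Linfc_intro _ N (r' + enorm (y - x))) => // z /fr' h.
    apply: (le_via (enorm (z + (y - x)) + enorm (y - x))); last by rewrite lerD2r.
    by rewrite -{1}(addrK (y - x) z); apply: (le_trans (enormD _ _)); rewrite enormN.
  have i2 := potential_integ x t01 lfs.
  rewrite (_ : \int[mu]_z (riesz t x z * (f (z + (y - x)) - f z)) =
      \int[mu]_z (riesz t x z * f (z + (y - x)) - riesz t x z * f z)); last first.
    by apply: eq_Rintegral => z _; rewrite mulrBr.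
  by rewrite -(Rint_sub i2 i1) opprB.
rewrite normrN.
have mfs : meas (fun z : X => f (z + (y - x)) - f z).
  by apply: mfB; apply: (measurableT_comp mf); mfun.
have Lu0 : 0 <= L * enorm (x - y) by nneg.
apply: (le_trans (@potential_le t (L * enorm (x - y)) (r + 1) _ x t01 r10 Lu0 mfs _)).
  move=> z; have zE : `|f (z + (y - x)) - f z| <= L * enorm (x - y).
    by apply: (le_trans (fL _ _)); rewrite addrC addKr enormC.
  rewrite indicE; case: (boolP (z \in cball 0 (r + 1))) => [_|zr]; first by rewrite mulr1.
  have {}zr : r + 1 < enorm z.
    by rewrite ltNge; apply/negP => h; move/negP: zr; apply; rewrite inE /cball /= subr0.
  have f0 w : r < enorm w -> f w = 0.
    move=> wr; apply/eqP; rewrite -normr_le0; apply: (le_trans (fM w)); rewrite indicE memNset ?mulr0//.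
    by rewrite /cball /= subr0; apply/negP; rewrite -ltNge.
  rewrite !f0 ?subrr ?normr0 ?mulr0//; first by apply: le_lt_trans zr; rewrite lerDl.
  have h : enorm z <= enorm (z + (y - x)) + enorm (x - y).
    by rewrite -{1}(addrK (y - x) z); apply: (le_trans (enormD _ _)); rewrite enormN (enormC y).
  by move: h zr u1; move: (enorm _) (enorm _) (enorm _) => p q v; clear -p q v; lra.
rewrite mulrAC; apply: ler_wpM2r; first exact: enorm_ge0.
apply: ler_wpM2r => //.
by rewrite lerDr mulr_ge0.
Qed.

End form_estimates.

Section pointwise_operator.
Implicit Types (x y z h : X) (s t d M : R) (K : X * X -> R) (f g phi : X -> R).

Definition T0_integrand s s1 s2 K f z (q : X * X) : R :=
  K q * rdiff s1 q.1 q.2 z * (riesz_potential s2 f q.1 - riesz_potential s2 f q.2)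
  / enorm (q.1 - q.2) `^ (n%:R + 2 * s).

(* For Lipschitz [f] the double integral defining the operator converges pointwise. *)
Definition T0 s s1 s2 K f z : R := \int[mu2]_q T0_integrand s s1 s2 K f z q.

Definition Lipc f := Linfc f /\ lipschitz_rV f.

(** The Lipschitz bound on the second potential leaves $u^{-n+1-s_2}$ near the diagonal and
    $u^{-n-s_2}$ far from it, both within a bump of scale 1. *)
Lemma T0_weight (s1 s2 s d u : R) : 0 < d -> d <= s2 -> d <= 1 - s2 -> 0 < s1 -> s1 + s2 = 2 * s -> 0 <= u ->
  u `^ s1 * Num.min 1 u / u `^ (n%:R + 2 * s) <= G d 1 u.
Proof.
move=> d0 ds2 ds2' s10 s12; rewrite le_eqVlt => /predU1P[<-|u0].
  by rewrite (powR0 (x := s1)) ?gt_eqF// !mul0r annular_ge0.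
have -> : u `^ s1 * Num.min 1 u / u `^ (n%:R + 2 * s) = u `^ (- n%:R) * (Num.min 1 u * u `^ (- s2)).
  rewrite -powRN mulrAC powR_add// [RHS]mulrCA mulrC powR_add//; congr (_ * _ `^ _); rewrite -s12; ring.
have [u1|u1] := leP 1 u.
  rewrite annular_geu// !mul1r ler_wpM2l ?powR_ge0//.
  rewrite -powR_inv1 ?(ltW u0)// -powRrM mulN1r ler_powR// lerN2//.
rewrite annular_ler ?(ltW u1)// divr1 ler_wpM2l ?powR_ge0//.
rewrite -{1}(powRr1 (ltW u0)) powR_add//; apply: ger_powR => //; by rewrite u0 ltW.
Qed.

Lemma T0_integrand_le s s1 s2 K M f (A : R) z q : ker_data s s1 s2 K M -> 0 <= A ->
  (forall x y, `|riesz_potential s2 f x - riesz_potential s2 f y| <= A * Num.min 1 (enorm (x - y))) ->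
  let d := ker_d s1 s2 in
  `|T0_integrand s s1 s2 K f z q| <= M * n%:R * A * (G d 1 (enorm (q.1 - q.2)) * annular2 d q z).
Proof.
move=> kd A0 fA /=; set d := ker_d s1 s2; have [e1 e2 e3 e4 _] := ker_dP kd.
have M0 := ker_data_ge0 kd; have [s101 s201 s12 mK KM] := kd.
have h1 : `|rdiff s1 q.1 q.2 z| <= n%:R * enorm (q.1 - q.2) `^ s1 * annular2 d q z by exact: riesz_diff_le.
have h2 := fA q.1 q.2.
have h3 : enorm (q.1 - q.2) `^ s1 * Num.min 1 (enorm (q.1 - q.2)) / enorm (q.1 - q.2) `^ (n%:R + 2 * s) <= G d 1 (enorm (q.1 - q.2)).
  have d0 : 0 < d by case/andP: e1.
  have ds2 : d <= s2 by case/andP: e3.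
  have s10 : 0 < s1 by case/andP: s101.
  exact: (T0_weight d0 ds2 e4 s10 s12 (enorm_ge0 _)).
have m0 : 0 <= Num.min 1 (enorm (q.1 - q.2)) by rewrite le_min ler01 enorm_ge0.
have alg (k m a b v w f0 r1 r2 g : R) : 0 <= m -> 0 <= v -> 0 <= a -> 0 <= b -> 0 <= f0 ->
    `|k| <= M -> `|r1| <= m * a * v -> `|r2| <= A * b -> a * b / f0 <= g ->
    `|k * r1 * r2 / f0| <= M * m * A * (g * v).
  move=> m0' v0 a0 b0 f00 kM k1 k2 k3; rewrite !normrM normfV (ger0_norm f00).
  apply: (le_via (M * (m * a * v) * (A * b) / f0)).
    by rewrite ler_wpM2r ?invr_ge0//; apply: ler_pM => //; apply: ler_pM.
  have -> : M * (m * a * v) * (A * b) / f0 = M * m * A * v * (a * b / f0) by ring.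
  have -> : M * m * A * (g * v) = M * m * A * v * g by ring.
  by rewrite ler_wpM2l// !mulr_ge0.
exact: (alg _ _ _ _ _ 0 _ _ _ _ (ler0n _ n) (annular2_ge0 _ _ _) (powR_ge0 _ _) m0 (powR_ge0 _ _) (KM q) h1 h2 h3).
Qed.

Lemma mf_T0_integrand s s1 s2 K f : meas K -> meas f ->
  meas (fun p : (X * X) * X => T0_integrand s s1 s2 K f p.2 p.1).
Proof.
move=> mK mf; rewrite /T0_integrand; have mF := mf_potential s2 mf.
by mfun.
Qed.

Lemma mf_T0 s s1 s2 K f : meas K -> meas f ->
  meas (T0 s s1 s2 K f).
Proof. by move=> mK mf; exact: (mf_Rint2 pm (mf_T0_integrand s s1 s2 mK mf)). Qed.

Lemma int_T0_integrand s s1 s2 K M f : ker_data s s1 s2 K M -> Lipc f ->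
  exists2 B : R, 0 <= B & forall z, (\int[mu2]_q (`|T0_integrand s s1 s2 K f z q|)%:E <= B%:E)%E.
Proof.
move=> kd [lf fL]; have [s101 s201 s12 mK KM] := kd; have M0 := ker_data_ge0 kd.
have [A A0 fA] := potential_lipschitz s201 lf fL.
have [/andP[d0 _] _ _ _ _] := ker_dP kd.
set d := ker_d s1 s2 in d0.
have mf := Linfc_mf lf.
exists (M * n%:R * A * (2 * C d * C d)); first by nneg.
move=> z; apply: (le_via (\int[mu2]_q (M * n%:R * A * (G d 1 (enorm (q.1 - q.2)) * annular2 d q z))%:E)%E).
  have mi := mf_section2 z (mf_T0_integrand s s1 s2 mK mf).
  have mg : meas (fun q : X * X => M * n%:R * A * (G d 1 (enorm (q.1 - q.2)) * annular2 d q z)).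
    by apply: mfM; [mfun|apply: mfM; [mfun|apply: mf_annular2; by mfun]].
  apply: int_le; [exact: mfnorm|exact: mg|] => q.
  by rewrite normr_ge0; exact: T0_integrand_le.
apply: intZl_le; [by nneg| | |].
- by apply: mfM; [mfun|apply: mf_annular2; by mfun].
- by move=> q; rewrite mulr_ge0 ?annular_ge0 ?annular2_ge0.
- apply: (@int_radial_annular R n n0 (G d 1) (C d) d z) => //; first by mfun.
    by nneg.
  exact: int_annular0.
Qed.

Lemma T0_integrable s s1 s2 K M f z : ker_data s s1 s2 K M -> Lipc f ->
  integ mu2 (T0_integrand s s1 s2 K f z).
Proof.
move=> kd lf; have [B B0 h] := int_T0_integrand kd lf; have [_ _ _ mK _] := kd.
apply: int_integ; last exact: le_lt_trans (h z) (ltry _).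
by have mi := mf_section2 z (mf_T0_integrand s s1 s2 mK (Linfc_mf lf.1)).
Qed.

Lemma T0_bounded s s1 s2 K M f : ker_data s s1 s2 K M -> Lipc f ->
  exists2 B : R, 0 <= B & forall z, `|T0 s s1 s2 K f z| <= B.
Proof.
move=> kd lf; have [B B0 h] := int_T0_integrand kd lf; exists B => // z.
rewrite -lee_fin; apply: Rint_le => //.
exact: integrable_mf (T0_integrable z kd lf).
Qed.

Lemma T0_pairing s s1 s2 K M f phi : ker_data s s1 s2 K M -> Lipc f -> Linfc phi ->
  \int[mu]_z (T0 s s1 s2 K f z * phi z) = pairing s s1 s2 K phi f.
Proof.
move=> kd lf lp; have [s101 s201 s12 mK KM] := kd; have M0 := ker_data_ge0 kd.
have [B B0 hB] := int_T0_integrand kd lf.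
have mphi := Linfc_mf lp; have mf := Linfc_mf lf.1.
have mH := mf_T0_integrand s s1 s2 mK mf.
have [H HE] := ex_fun (fun p : (X * X) * X => T0_integrand s s1 s2 K f p.2 p.1 * phi p.2).
have mH2 : meas H by rewrite (funext HE); apply: mfM => //; apply: (measurableT_comp mphi measurable_snd).
have mTi z : meas (T0_integrand s s1 s2 K f z) by exact: (mf_section2 z mH).
have Hi : (pm \x mu)%E.-integrable setT (EFin \o H).
  apply: integrable_prod2 => //.
  apply: (le_lt_via (\int[mu]_z (B * `|phi z|)%:E)%E).
    apply: (@double_le2 _ _ _ _ _ pm mu (fun p => `|H p|) (fun z => B * `|phi z|)) => //; [mfun|mfun|].
    move=> z; under eq_integral do rewrite HE /= normrM mulrC.
    rewrite mulrC; apply: intZl_le => //; first by mfun.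
  rewrite intZl//; last by mfun.
  apply: lte_mul_pinfty => //.
  exact: integrable_int (Linfc_integ lp).
transitivity (\int[mu]_z \int[pm]_q H (q, z)).
  apply: eq_Rintegral => z _; under eq_Rintegral do rewrite HE /= mulrC.
  rewrite Rint_scale; last exact: mTi.
  by rewrite mulrC.
rewrite -(Rfubini Hi); apply: eq_Rintegral => q _.
pose c := K q * (riesz_potential s2 f q.1 - riesz_potential s2 f q.2) / enorm (q.1 - q.2) `^ (n%:R + 2 * s).
transitivity (c * \int[mu]_z (rdiff s1 q.1 q.2 z * phi z)).
  rewrite -Rint_scale; last by mfun.
  apply: eq_Rintegral => z _; rewrite HE /= /c.
  have alg (k r p u v : R) : k * r * p / u * v = k * p / u * (r * v) by ring.
  exact: alg.
rewrite -potentialB// /c.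
have alg (k p u v : R) : k * p / u * v = k * v * p / u by ring.
exact: alg.
Qed.

Lemma kernel_far_le s s1 s2 K M z1 z2 (r : R) : ker_data s s1 s2 K M -> 0 < r -> r <= enorm (z1 - z2) ->
  (\int[mu2]_q (`|kernel_integrand s s1 s2 K z1 z2 q|)%:E <= (M * size_cst s1 s2 * r `^ (- n%:R))%:E)%E.
Proof.
move=> kd r0 rz; have z12 : z1 != z2 by rewrite -enormB_gt0; exact: lt_le_trans rz.
apply: (le_trans (int_kernel_integrand kd z12)); rewrite lee_fin.
apply: ler_wpM2l; first by apply: mulr_ge0; [exact: ker_data_ge0 kd|exact: size_cst_ge0 kd].
exact: powR_neg_antitone.
Qed.

Lemma T0_kernel s s1 s2 K M f z (r : R) : ker_data s s1 s2 K M -> Lipc f -> 0 < r ->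
  (forall y, f y != 0 -> r <= enorm (z - y)) ->
  integ mu (fun y => kernelA s s1 s2 K z y * f y) /\
  T0 s s1 s2 K f z = \int[mu]_y (kernelA s s1 s2 K z y * f y).
Proof.
move=> kd lf r0 fr; have [s101 s201 s12 mK KM] := kd; have M0 := ker_data_ge0 kd.
have mf := Linfc_mf lf.1.
pose B := M * size_cst s1 s2 * r `^ (- n%:R).
have B0 : 0 <= B.
  by apply: mulr_ge0; [apply: mulr_ge0 => //; exact: size_cst_ge0 kd|exact: powR_ge0].
have [H HE] := ex_fun (fun p : (X * X) * X => kernel_integrand s s1 s2 K z p.2 p.1 * f p.2).
have mki : meas (fun p : (X * X) * X => kernel_integrand s s1 s2 K z p.2 p.1).
  by apply: mf_kernel_integrand; mfun.
have mkz y : meas (kernel_integrand s s1 s2 K z y) by exact: (mf_section2 y mki).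
have mH : meas H by rewrite (funext HE); apply: mfM => //; apply: (measurableT_comp mf measurable_snd).
have fB y : (\int[mu2]_q (`|H (q, y)|)%:E <= (B * `|f y|)%:E)%E.
  under eq_integral do rewrite HE /= normrM mulrC.
  have [->|fy] := eqVneq (f y) 0.
    by under eq_integral do rewrite normr0 mul0r; rewrite integral0 normr0 mulr0.
  rewrite mulrC; apply: intZl_le => //; first by apply: mfnorm; exact: mkz.
  by apply: kernel_far_le => //; exact: fr.
have Bi : (\int[mu]_y (B * `|f y|)%:E < +oo)%E.
  rewrite intZl//; last by mfun.
  apply: lte_mul_pinfty => //.
  exact: integrable_int (Linfc_integ lf.1).
have Hi : (pm \x mu)%E.-integrable setT (EFin \o H).
  apply: integrable_prod2 => //; apply: le_lt_trans Bi.
  apply: (@double_le2 _ _ _ _ _ pm mu (fun p => `|H p|) (fun z => B * `|f z|)); by mfun.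
have AE y : kernelA s s1 s2 K z y * f y = \int[pm]_q H (q, y).
  transitivity (\int[pm]_q (kernel_integrand s s1 s2 K z y q * f y)); last first.
    by apply: eq_Rintegral => q _; rewrite HE.
  by symmetry; exact: (Rint_scaler pm (f y) (mkz y)).
have mA : meas (fun y => kernelA s s1 s2 K z y * f y).
  by apply: mfM => //; apply: mf_kernelA; mfun.
split.
  apply: int_integ => //; apply: le_lt_trans Bi.
  apply: int_le; [exact: mfnorm mA|mfun|] => y; rewrite normr_ge0/= -lee_fin AE.
  by apply: Rint_le; [exact: (mf_section2 y mH)|exact: fB].
under eq_Rintegral do rewrite AE.
rewrite -(Rfubini Hi); apply: eq_Rintegral => q _.
pose c := K q * rdiff s1 q.1 q.2 z / enorm (q.1 - q.2) `^ (n%:R + 2 * s).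
transitivity (c * \int[mu]_y (rdiff s2 q.1 q.2 y * f y)); last first.
  rewrite -Rint_scale; last by mfun.
  apply: eq_Rintegral => y _; rewrite HE /= /c.
  have alg (k r' p u v : R) : k * r' / u * (p * v) = k * r' * p / u * v by ring.
  exact: alg.
rewrite -potentialB//; last by case: lf.
have alg (k r' p u : R) : k * r' * p / u = k * r' / u * p by ring.
exact: alg.
Qed.

(** Atoms are not Lipschitz, so [T0_kernel] does not reach them. When the supports are separated,
    the kernel integrals are uniformly bounded on them, and Fubini's theorem represents the form
    itself. *)
Lemma pairing_separated s s1 s2 K M phi g (r : R) : ker_data s s1 s2 K M -> Linfc phi -> Linfc g -> 0 < r ->
  (forall x y, phi x != 0 -> g y != 0 -> r <= enorm (x - y)) ->
  integ mu2 (fun p => kernelA s s1 s2 K p.1 p.2 * (phi p.1 * g p.2)) /\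
  pairing s s1 s2 K phi g = \int[mu2]_p (kernelA s s1 s2 K p.1 p.2 * (phi p.1 * g p.2)).
Proof.
move=> kd lp lg r0 sep; have [s101 s201 s12 mK KM] := kd; have M0 := ker_data_ge0 kd.
have mphi := Linfc_mf lp; have mg := Linfc_mf lg.
pose B := M * size_cst s1 s2 * r `^ (- n%:R).
have B0 : 0 <= B.
  by apply: mulr_ge0; [apply: mulr_ge0 => //; exact: size_cst_ge0 kd|exact: powR_ge0].
have [w wE] := ex_fun (fun p : X * X => phi p.1 * g p.2).
have [wi0 wi1] := Rint_prod (Linfc_integ lp) (Linfc_integ lg).
have wi : integ mu2 w by rewrite (funext wE).
have mw := integrable_mf wi.
have [H HE] := ex_fun (fun p : (X * X) * (X * X) => kernel_integrand s s1 s2 K p.2.1 p.2.2 p.1 * w p.2).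
have m21 : meas (fun p : (X * X) * (X * X) => p.2.1).
  by apply: (measurableT_comp measurable_fst); by [].
have m22 : meas (fun p : (X * X) * (X * X) => p.2.2).
  by apply: (measurableT_comp measurable_snd); by [].
have mki : meas (fun p : (X * X) * (X * X) => kernel_integrand s s1 s2 K p.2.1 p.2.2 p.1).
  by apply: mf_kernel_integrand; by [].
have mkz (p : X * X) : meas (kernel_integrand s s1 s2 K p.1 p.2) by exact: (mf_section2 p mki).
have mH : meas H by rewrite (funext HE); apply: mfM => //; apply: (measurableT_comp mw measurable_snd).
have fB (p : X * X) : (\int[mu2]_q (`|H (q, p)|)%:E <= (B * `|w p|)%:E)%E.
  under eq_integral do rewrite HE /= normrM mulrC.
  have [->|wp] := eqVneq (w p) 0.
    by under eq_integral do rewrite normr0 mul0r; rewrite integral0 normr0 mulr0.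
  rewrite mulrC; apply: intZl_le => //; first by apply: mfnorm; exact: mkz.
  apply: kernel_far_le => //; apply: sep; move: wp; rewrite wE mulf_eq0 negb_or => /andP[]//.
have Bi : (\int[mu2]_p (B * `|w p|)%:E < +oo)%E.
  rewrite intZl//; last by mfun.
  apply: lte_mul_pinfty => //.
  exact: integrable_int wi.
have Hi : (pm \x pm)%E.-integrable setT (EFin \o H).
  apply: integrable_prod2 => //; apply: (le_lt_via (\int[pm]_p (B * `|w p|)%:E)%E) => //.
  have mk : meas (fun p => B * `|w p|) by mfun.
  exact: (double_le2 (m1 := pm) pm (mfnorm mH) (fun p => normr_ge0 _) mk fB).
have AE (p : X * X) : kernelA s s1 s2 K p.1 p.2 * (phi p.1 * g p.2) = \int[pm]_q H (q, p).
  transitivity (\int[pm]_q (kernel_integrand s s1 s2 K p.1 p.2 q * w p)); last first.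
    by apply: eq_Rintegral => q _; rewrite HE.
  by rewrite -wE; symmetry; exact: (Rint_scaler pm (w p) (mkz p)).
have mA : meas (fun p : X * X => kernelA s s1 s2 K p.1 p.2 * (phi p.1 * g p.2)).
  by apply: mfM; [apply: mf_kernelA; by mfun|mfun].
split.
  apply: int_integ => //; apply: le_lt_trans Bi.
  apply: int_le; [exact: mfnorm mA|mfun|] => p; rewrite normr_ge0/= -lee_fin AE.
  by apply: Rint_le; [exact: (mf_section2 p mH)|exact: fB].
under eq_Rintegral do rewrite AE.
rewrite -(Rfubini Hi); apply: eq_Rintegral => q _.
pose c := K q / enorm (q.1 - q.2) `^ (n%:R + 2 * s).
transitivity (c * \int[mu2]_p ((rdiff s1 q.1 q.2 p.1 * phi p.1) * (rdiff s2 q.1 q.2 p.2 * g p.2))); last first.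
  rewrite -Rint_scale; last by mfun.
  apply: eq_Rintegral => p _; rewrite HE /= /c wE.
  have alg (k r' p' u v v' : R) : k / u * ((r' * v) * (p' * v')) = k * r' * p' / u * (v * v') by ring.
  exact: alg.
have ri t f : 0 < t < 1 -> Linfc f -> integ mu (fun z => rdiff t q.1 q.2 z * f z).
  move=> t01 lf; have i1 := potential_integ q.1 t01 lf; have i2 := potential_integ q.2 t01 lf.
  have := integrableB measurableT i1 i2.
  by apply: eq_integrable => // x _ /=; rewrite mulrBl.
have [_ ->] := Rint_prod (ri s1 phi s101 lp) (ri s2 g s201 lg).
rewrite -!potentialB//.
have alg (k r' p u : R) : k * r' * p / u = k / u * (r' * p) by ring.
exact: alg.
Qed.

End pointwise_operator.

(** * Hörmander's condition and atoms *)

Section atoms.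
Implicit Types (x y z h c : X) (s t d M : R) (K : X * X -> R) (f g phi b : X -> R).

Definition l1int f : R := \int[mu]_x `|f x|.

Lemma l1intE f : integ mu f -> (\int[mu]_x (`|f x|)%:E = (l1int f)%:E)%E.
Proof. by move=> fi; rewrite RintE//; exact: (integrable_norm fi). Qed.

Lemma l1int_ge0 f : 0 <= l1int f.
Proof. by apply: Rintegral_ge0 => x _; by []. Qed.

Definition atom_cst s1 s2 : R := holder_cst s1 s2 * C (ker_alpha s1 s2).

(** Hörmander's condition: outside the doubled ball the Hölder bound is a bump of scale $|h|$ around
    [c], whose integral does not depend on its scale. *)
Lemma int_kernel_increment s s1 s2 K M c h (r : R) : ker_data s s1 s2 K M -> 0 < r -> enorm h <= r ->
  (\int[mu]_x (`|kernelA s s1 s2 K x (c + h) - kernelA s s1 s2 K x c| * \1_(~` eball c (2 * r)) x)%:E <=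
   (M * atom_cst s1 s2)%:E)%E.
Proof.
move=> kd r0 hr; have [s101 s201 s12 mK KM] := kd; have M0 := ker_data_ge0 kd.
have [a0 _ _ _ _] := ker_alphaP kd.
have H0 := holder_cst_ge0 kd.
have mB : measurable (~` eball c (2 * r)) by apply: measurableC; exact: meas_eball.
have mA w : meas (fun x => kernelA s s1 s2 K x w) by apply: mf_kernelA; mfun.
apply: (le_via (\int[mu]_x (M * holder_cst s1 s2 * G (ker_alpha s1 s2) (enorm h) (enorm (x - c)))%:E)%E).
  apply: int_le.
  - apply: mfM => //; apply: mfnorm; apply: mfB; exact: mA.
  - by mfun.
  move=> x; apply/andP; split; first by [].
  rewrite indicE; case: (boolP (x \in _)) => [|_]; last by rewrite mulr0; nneg.
  rewrite inE /= => /negP; rewrite -leNgt => xc.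
  rewrite mulr1.
  have xc0 : x != c by rewrite -enormB_gt0; apply: lt_le_trans xc; rewrite mulr_gt0.
  apply: (le_trans (kernelA_holder2 kd xc0 _)).
    by rewrite -ler_pdivrMl ?invr_gt0// invrK; apply: le_trans xc; rewrite ler_pM2l.
  apply: ler_wpM2l; first by nneg.
  apply: holder_annular => //.
  by apply: le_trans xc; rewrite ler_pM2l.
rewrite /atom_cst mulrA; apply: intZl_le; [by nneg|mfun|by nneg|].
apply: int_annular; by [].
Qed.

(* The mean value of [b] being 0, its kernel may be recentred at [c]. *)
Lemma pairing_atom s s1 s2 K M phi b c (r : R) : ker_data s s1 s2 K M -> Linfc phi -> Linfc b -> 0 < r ->
  (forall x, `|phi x| <= 1) -> (forall y, b y != 0 -> enorm (y - c) <= r) ->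
  (forall x, phi x != 0 -> 2 * r <= enorm (x - c)) -> \int[mu]_y b y = 0 ->
  `|pairing s s1 s2 K phi b| <= M * atom_cst s1 s2 * l1int b.
Proof.
move=> kd lp lb r0 phi1 br phir b0; have [s101 s201 s12 mK KM] := kd; have M0 := ker_data_ge0 kd.
have mphi := Linfc_mf lp; have mb := Linfc_mf lb.
have sep x y : phi x != 0 -> b y != 0 -> r <= enorm (x - y).
  move=> /phir h1 /br h2; have h3 := enormBD x y c.
  by move: h1 h2 h3; move: (enorm _) (enorm _) (enorm _) => p q v; clear -p q v; lra.
have [i1 ->] := pairing_separated kd lp lb r0 sep.
have mA w : meas (fun x => kernelA s s1 s2 K x w) by apply: mf_kernelA; mfun.
have Aci : integ mu (fun x => kernelA s s1 s2 K x c * phi x).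
  apply: int_integ; first by apply: mfM.
  apply: (le_lt_via (\int[mu]_x (M * size_cst s1 s2 * (2 * r) `^ (- n%:R) * `|phi x|)%:E)%E).
    apply: int_le; [by apply: mfnorm; apply: mfM|mfun|] => x; rewrite normr_ge0/= normrM.
    have [->|px] := eqVneq (phi x) 0; first by rewrite normr0 !mulr0.
    apply: ler_wpM2r => //.
    have xc0 : x != c by rewrite -enormB_gt0; apply: lt_le_trans (phir x px); rewrite mulr_gt0.
    apply: (le_trans (kernelA_size kd xc0)); apply: ler_wpM2l.
      by apply: mulr_ge0 => //; exact: size_cst_ge0 kd.
    by apply: powR_neg_antitone; rewrite ?mulr_gt0//; exact: phir.
  rewrite intZl//; last by mfun.
    apply: lte_mul_pinfty => //; last exact: integrable_int (Linfc_integ lp).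
    by rewrite lee_fin mulr_ge0 ?powR_ge0// mulr_ge0//; exact: size_cst_ge0 kd.
  by rewrite mulr_ge0 ?powR_ge0// mulr_ge0//; exact: size_cst_ge0 kd.
have [i2 z2] := Rint_prod Aci (Linfc_integ lb).
rewrite b0 mulr0 in z2.
rewrite -[X in `|X|]subr0 -z2 (Rint_sub i1 i2).
have mAcy y : meas (fun x => kernelA s s1 s2 K x y - kernelA s s1 s2 K x c).
  by apply: mfB; exact: mA.
have md := mfB (integrable_mf i1) (integrable_mf i2).
rewrite -lee_fin; apply: Rint_le => //.
(* Integrated first in the variable of [phi], by Hörmander's condition, and then against $|b|$. *)
pose H (p : X * X) := `|kernelA s s1 s2 K p.1 p.2 - kernelA s s1 s2 K p.1 c| * \1_(~` eball c (2 * r)) p.1 * `|b p.2|.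
have mI : meas (\1_(~` eball c (2 * r)) : X -> R).
  by apply: mfindic; apply: measurableC; exact: meas_eball.
have mI1 : meas (fun p : X * X => \1_(~` eball c (2 * r)) p.1 : R) by apply: (measurableT_comp mI measurable_fst).
have mH : meas H by rewrite /H; mfun.
have H0 p : 0 <= H p by rewrite /H.
apply: (le_via (\int[mu2]_p (H p)%:E)%E).
  apply: int_le; [exact: mfnorm md|exact: mH|] => p; rewrite normr_ge0/= /H.
  have [px|px] := eqVneq (phi p.1) 0.
    have z (a a' v w : R) : v = 0 -> a * (v * w) - a' * v * w = 0 by move=> ->; ring.
    by rewrite (z _ _ _ _ px) normr0; exact: H0 p.
  rewrite indicE mem_set; last by rewrite /=; apply/negP; rewrite -leNgt; exact: phir.
  have alg (a a' v w : R) : a * (v * w) - a' * v * w = (a - a') * v * w by ring.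
  rewrite alg !normrM mulr1 ler_wpM2r// ler_piMr//.
rewrite (tonelli2 mu mu mH H0).
apply: (le_via (\int[mu]_y (M * atom_cst s1 s2 * `|b y|)%:E)%E); last first.
  rewrite intZl//; [by rewrite l1intE//; exact: Linfc_integ|by rewrite mulr_ge0// mulr_ge0 ?(holder_cst_ge0 kd)// annular_cst_ge0//; by have [] := ker_alphaP kd|mfun].
apply: (double_le2 (m1 := mu) mu mH H0); first by mfun.
move=> y; rewrite /H /=; under eq_integral do rewrite mulrC.
have [->|by0] := eqVneq (b y) 0.
  by under eq_integral do rewrite normr0 mul0r; rewrite integral0 normr0 mulr0.
rewrite (mulrC _ `|b y|); apply: intZl_le => //.
- by apply: mfM; [exact: mfnorm (mAcy y)|exact: mI].
have := @int_kernel_increment s s1 s2 K M c (y - c) r kd r0 (br y by0).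
by rewrite (addrC c) subrK.
Qed.

End atoms.

(** * Weak type (1,1), interpolation and duality *)

Section calderon_zygmund_decomposition.
Implicit Types (x y z a : X) (l : R) (q : X * R).

Definition hcube (q : X * R) : set X := [set x | forall i, q.1 ord0 i <= x ord0 i < q.1 ord0 i + q.2].

Definition child (q : X * R) (e : {ffun 'I_n -> bool}) : X * R :=
  (\row_i (q.1 ord0 i + (e i)%:R * (q.2 / 2)), q.2 / 2).

Lemma measurable_hcube q : measurable (hcube q).
Proof.
have -> : hcube q = \bigcap_(i in [set: 'I_n]) ([set x | q.1 ord0 i <= x ord0 i] `&` [set x | x ord0 i < q.1 ord0 i + q.2]).
  apply/seteqP; split => [x h i _|x h i] /=; first by apply/andP; exact: h.
  by have [/= a b] := h i I; rewrite a.
apply: fin_bigcap_measurable => // i _; apply: measurableI.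
- by apply: mf_le; [mfun|exact: measurable_coord].
- by apply: mf_lt; [exact: measurable_coord|mfun].
Qed.

Lemma hcube_indic q x : (\1_(hcube q) x : R) =
  \prod_i ((q.1 ord0 i <= x ord0 i < q.1 ord0 i + q.2)%R)%:R.
Proof.
rewrite indicE; case: (boolP (x \in hcube q)) => [|xq].
  by rewrite inE => h; rewrite big1// => i _; rewrite h.
have /existsP[i ni] : [exists i, ~~ (q.1 ord0 i <= x ord0 i < q.1 ord0 i + q.2)].
  rewrite -negb_forall; apply/negP => /forallP h; move/negP: xq; apply.
  by rewrite inE => i; exact: h.
by rewrite (bigD1 i)//= (negPf ni) mul0r.
Qed.

(** The indicator of a cube is a product over the coordinates. Each factor is the sum of those of
    its two halves, and distributivity produces one term for each choice of halves. *)
Lemma sum_child q x : 0 < q.2 -> \sum_e (\1_(hcube (child q e)) x : R) = \1_(hcube q) x.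
Proof.
move=> q0; rewrite hcube_indic.
have -> : \sum_e (\1_(hcube (child q e)) x : R) = \sum_e \prod_i
    (((child q e).1 ord0 i <= x ord0 i < (child q e).1 ord0 i + (child q e).2)%R)%:R.
  by apply: eq_bigr => e _; exact: hcube_indic.
transitivity (\prod_i \sum_(b : bool) ((q.1 ord0 i + b%:R * (q.2 / 2) <= x ord0 i < q.1 ord0 i + b%:R * (q.2 / 2) + q.2 / 2)%R%:R : R)).
  by rewrite bigA_distr_bigA; apply: eq_bigr => e _; apply: eq_bigr => i _; rewrite mxE.
apply: eq_bigr => i _; rewrite big_bool /= mul0r mul1r addr0.
have [u uE] : exists u, q.2 = u + u by exists (q.2 / 2); exact: splitr.
have u2 : q.2 / 2 = u by rewrite uE; field.
have u0 : 0 < u by rewrite -u2 divr_gt0.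
rewrite u2 uE addrA; move: (q.1 ord0 i) (x ord0 i) => a v.
case: (leP (a + u) v) => h; case: (leP a v) => k; case: (ltP v (a + u + u)) => m; rewrite ?addr0 ?add0r//; exfalso; move: h k m u0; clear -a u v; lra.
Qed.

Lemma mu_hcube_le q : 0 <= q.2 -> (mu (hcube q) <= (q.2 ^+ n)%:E)%E.
Proof.
move=> q0.
have -> : q.2 ^+ n = \prod_(i < n) ((q.1 ord0 i + q.2) - q.1 ord0 i).
  by under eq_bigr do rewrite addrC addKr; rewrite prodr_const card_ord.
rewrite -lebesgue_rV_box; last by move=> i; rewrite lerDl.
apply: le_measure; rewrite ?inE; [exact: measurable_hcube|exact: measurable_box|].
by move=> x h i; have /andP[p1 /ltW p2] := h i; rewrite p1.
Qed.

(** [lebesgue_rV_box] concerns closed boxes, and one of half the side fits into the half-open cube.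
    This loss turns the usual doubling constant $2^n$ into $4^n$ in [vol_child]. *)
Lemma mu_hcube_ge q : 0 < q.2 -> (((q.2 / 2) ^+ n)%:E <= mu (hcube q))%E.
Proof.
move=> q0.
have -> : (q.2 / 2) ^+ n = \prod_(i < n) ((q.1 ord0 i + q.2 / 2) - q.1 ord0 i).
  by under eq_bigr do rewrite addrC addKr; rewrite prodr_const card_ord.
rewrite -lebesgue_rV_box; last by move=> i; rewrite lerDl divr_ge0// ltW.
apply: le_measure; rewrite ?inE; [exact: measurable_box|exact: measurable_hcube|].
move=> x h i; have /andP[-> p2] := h i; apply: (le_lt_trans p2).
by rewrite ltrD2l ltr_pdivrMr// ltr_pMr// ltr1n.
Qed.

Definition vol (q : X * R) : R := fine (mu (hcube q)).

Lemma volE q : 0 <= q.2 -> (mu (hcube q) = (vol q)%:E)%E.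
Proof. by move=> q0; rewrite fineK// ge0_fin_numE//; exact: le_lt_trans (mu_hcube_le q0) (ltry _). Qed.

Lemma vol_le q : 0 <= q.2 -> vol q <= q.2 ^+ n.
Proof. by move=> q0; rewrite -lee_fin -volE//; exact: mu_hcube_le. Qed.

Lemma vol_ge q : 0 < q.2 -> (q.2 / 2) ^+ n <= vol q.
Proof. by move=> q0; rewrite -lee_fin -volE ?(ltW q0)//; exact: mu_hcube_ge. Qed.

Lemma vol_gt0 q : 0 < q.2 -> 0 < vol q.
Proof. by move=> q0; apply: lt_le_trans (vol_ge q0); rewrite exprn_gt0// divr_gt0. Qed.

Lemma vol_child q e : 0 < q.2 -> vol q <= 4 ^+ n * vol (child q e).
Proof.
move=> q0; apply: (le_trans (vol_le (ltW q0))).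
have h : 0 < (child q e).2 by rewrite divr_gt0.
apply: (le_via (4 ^+ n * ((child q e).2 / 2) ^+ n)); last by rewrite ler_wpM2l ?exprn_ge0// vol_ge.
rewrite -exprMn (_ : 4 * (q.2 / 2 / 2) = q.2)//; by field.
Qed.

Lemma hcube_diam q x y : 0 <= q.2 -> hcube q x -> hcube q y -> enorm (x - y) <= n%:R * q.2.
Proof.
move=> q0 qx qy; apply: enorm_le_coord => // i; rewrite !mxE.
have /andP[a1 a2] := qx i; have /andP[b1 b2] := qy i.
rewrite ler_norml; move: (q.1 ord0 i) (x ord0 i) (y ord0 i) a1 a2 b1 b2 => a u v a1 a2 b1 b2.
apply/andP; split; lra.
Qed.

Lemma corner_hcube q : 0 < q.2 -> hcube q q.1.
Proof. by move=> q0 i; rewrite lexx ltrDl. Qed.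

Lemma Rint_sum_seq (J : Type) (S : seq J) (F : J -> X -> R) :
  (forall j, integ mu (F j)) ->
  integ mu (fun x => \sum_(j <- S) F j x) /\
  \int[mu]_x (\sum_(j <- S) F j x) = \sum_(j <- S) \int[mu]_x F j x.
Proof.
move=> Fi; elim: S => [|j S [IH1 IH2]].
  under [X in _ /\ X = _]eq_Rintegral do rewrite big_nil.
  rewrite big_nil Rintegral_cst// mul0r; split => //.
  have -> : (fun x : X => \sum_(j <- [::]) F j x) = (fun=> 0) by apply/funext => x; rewrite big_nil.
  exact: integrable0.
have e : (fun x : X => \sum_(j <- j :: S) F j x) = (fun x => F j x + \sum_(j <- S) F j x).
  by apply/funext => x; rewrite big_cons.
rewrite e big_cons -IH2 -RintegralD//; split => //.
have := integrableD measurableT (Fi j) IH1.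
by [].
Qed.

Section decomposition.
Variable f : X -> R.
Hypothesis lf : Linfc f.
Variable l : R.
Hypothesis l0 : 0 < l.

Definition mass q : R := \int[mu]_x (`|f x| * \1_(hcube q) x).

(** The stopping cubes within [k] generations below [q]. A finite depth is enough because [f] will
    be Lipschitz, and it keeps the bad part a finite sum. *)
Fixpoint cz (k : nat) q : seq (X * R) :=
  if k is k'.+1 then
    flatten [seq (if l * vol (child q e) < mass (child q e) then [:: child q e] else cz k' (child q e))
            | e <- enum {ffun 'I_n -> bool}]
  else [::].

Let mf : meas f := Linfc_mf lf.

Lemma mf_hcube q : meas (\1_(hcube q) : X -> R).
Proof. by apply: mfindic; exact: measurable_hcube. Qed.

Lemma mass_Linfc q : Linfc (fun x => `|f x| * \1_(hcube q) x).
Proof.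
have mq := mf_hcube q.
apply: Linfc_le lf; first by mfun.
by move=> x; rewrite normrM normr_id ler_piMr// ger0_norm.
Qed.

Lemma child_indic_le q e x : 0 < q.2 -> (\1_(hcube (child q e)) x : R) <= \1_(hcube q) x.
Proof.
move=> q0; rewrite -(sum_child x q0) (bigD1 e)//= lerDl; apply: sumr_ge0 => i _.
by [].
Qed.

Lemma mass_child q e : 0 < q.2 -> mass (child q e) <= mass q.
Proof.
move=> q0; apply: le_Rintegral => //; [exact: Linfc_integ (mass_Linfc _)|exact: Linfc_integ (mass_Linfc _)|].
by move=> x _; apply: ler_wpM2l => //; exact: child_indic_le.
Qed.

(** A selected cube is the first one in its chain with a large average, so its parent bounds its
    mass from above. *)
Lemma cz_cubes k q q' : 0 < q.2 -> mass q <= l * vol q -> q' \in cz k q ->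
  [/\ 0 < q'.2, l * vol q' < mass q' & mass q' <= 4 ^+ n * l * vol q'].
Proof.
elim: k q => [|k IH] q q0 mq //= /flattenP[s /mapP[e _ ->]].
have c0 : 0 < (child q e).2 by rewrite divr_gt0.
case: ltP => h; last exact: IH.
rewrite inE => /eqP ->; split => //.
apply: (le_trans (mass_child e q0)); apply: (le_trans mq).
by rewrite (mulrC (4 ^+ n)) -mulrA ler_pM2l//; exact: vol_child.
Qed.

Lemma cz_sum k q (F : X * R -> R) : \sum_(q' <- cz k.+1 q) F q' =
  \sum_e (if l * vol (child q e) < mass (child q e) then F (child q e) else \sum_(q' <- cz k (child q e)) F q').
Proof.
rewrite /= big_flatten big_map big_enum /=; apply: eq_bigr => e _.
by case: ifP => _; rewrite ?big_seq1.
Qed.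

Lemma cz_disjoint k q x : 0 < q.2 -> \sum_(q' <- cz k q) \1_(hcube q') x <= (\1_(hcube q) x : R).
Proof.
elim: k q => [|k IH] q q0; first by rewrite big_nil.
rewrite cz_sum -sum_child//; apply: ler_sum => e _; case: ifP => _ //.
by apply: IH; rewrite divr_gt0.
Qed.

(** At each generation the point lies in a child that was not selected; following these children
    down reaches generation [k] with the average still small. *)
Lemma cz_outside k q x : 0 < q.2 -> mass q <= l * vol q -> hcube q x ->
  \sum_(q' <- cz k q) \1_(hcube q') x = 0 :> R ->
  exists q', [/\ 0 < q'.2, q'.2 = q.2 / 2 ^+ k, hcube q' x & mass q' <= l * vol q'].
Proof.
elim: k q => [|k IH] q q0 mq qx; first by move=> _; exists q; rewrite divr1.
rewrite cz_sum => /eqP; rewrite psumr_eq0; last first.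
  by move=> e _; case: ifP => _; [rewrite indicE|apply: sumr_ge0 => q' _; rewrite indicE].
move=> /allP hall.
have [e xe] : exists e, hcube (child q e) x.
  apply: contrapT => /forallNP h; have := sum_child x q0.
  rewrite big1 => [/esym/eqP|e _]; first by rewrite indicE mem_set// oner_eq0.
  by rewrite indicE memNset.
have := hall e (mem_index_enum e); case: ltP => h /=.
  by rewrite indicE mem_set// oner_eq0.
move=> /eqP s0.
have c0 : 0 < (child q e).2 by rewrite divr_gt0.
have [q' [h1 h2 h3 h4]] := IH _ c0 h xe s0; exists q'; split => //.
by rewrite exprS invfM mulrA.
Qed.

Definition cz_mean q : R := (vol q)^-1 * \int[mu]_x (f x * \1_(hcube q) x).
Definition cz_bad q x : R := (f x - cz_mean q) * \1_(hcube q) x.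

Lemma fhcube_Linfc q : Linfc (fun x => f x * \1_(hcube q) x).
Proof.
have mq := mf_hcube q.
apply: Linfc_le lf; first by mfun.
by move=> x; rewrite normrM ler_piMr// ger0_norm.
Qed.

Lemma cz_mean_le q : 0 < q.2 -> vol q * `|cz_mean q| <= mass q.
Proof.
move=> q0; rewrite normrM normfV (ger0_norm (ltW (vol_gt0 q0))) mulrA divff ?gt_eqF ?vol_gt0// mul1r.
rewrite -lee_fin; apply: Rint_le; first exact: Linfc_mf (fhcube_Linfc q).
have e := RintE (Linfc_integ (mass_Linfc q)); rewrite e.
apply: le_of_eq; apply: eq_integral => x _.
by rewrite normrM (ger0_norm (ler0n _ _)).
Qed.

Lemma hcube_Linfc q : 0 < q.2 -> Linfc (\1_(hcube q) : X -> R).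
Proof.
move=> q0; apply: (@Linfc_intro _ 1 (n%:R * q.2 + enorm q.1)); first exact: mf_hcube.
  by move=> x; rewrite ger0_norm.
move=> x; rewrite pnatr_eq0 eqb0 negbK inE => qx.
have := enormD (x - q.1) q.1; rewrite subrK => h; apply: (le_trans h).
by rewrite lerD2r; apply: hcube_diam => //; [exact: ltW|exact: corner_hcube].
Qed.

Lemma cz_badE q : cz_bad q = (fun x => f x * \1_(hcube q) x - cz_mean q * \1_(hcube q) x).
Proof. by apply/funext => x; rewrite /cz_bad mulrBl. Qed.

Lemma cz_bad_Linfc q : 0 < q.2 -> Linfc (cz_bad q).
Proof.
by move=> q0; rewrite cz_badE; apply: LinfcB; [exact: fhcube_Linfc|apply: LinfcZ; exact: hcube_Linfc].
Qed.

Lemma Rint_hcube q : \int[mu]_x (\1_(hcube q) x) = vol q.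
Proof. by rewrite /Rintegral integral_indic ?setIT//; exact: measurable_hcube. Qed.

Lemma cz_bad_mean q : 0 < q.2 -> \int[mu]_x cz_bad q x = 0.
Proof.
move=> q0; rewrite cz_badE -Rint_sub; last 2 first.
- exact: Linfc_integ (fhcube_Linfc q).
- exact: Linfc_integ (LinfcZ _ (hcube_Linfc q0)).
rewrite Rint_scale; last exact: mf_hcube.
by rewrite Rint_hcube mulrAC mulVf ?gt_eqF ?vol_gt0// mul1r subrr.
Qed.

Lemma cz_bad_support q x : 0 < q.2 -> cz_bad q x != 0 -> enorm (x - q.1) <= n%:R * q.2.
Proof.
move=> q0; rewrite /cz_bad indicE; case: (boolP (x \in hcube q)) => [|_]; last by rewrite mulr0 eqxx.
rewrite inE => qx _.
by apply: hcube_diam => //; [exact: ltW|exact: corner_hcube].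
Qed.

Lemma cz_bad_l1 q : 0 < q.2 -> l1int (cz_bad q) <= 2 * mass q.
Proof.
move=> q0; apply: (le_via (\int[mu]_x (`|f x| * \1_(hcube q) x + `|cz_mean q| * \1_(hcube q) x))).
  apply: le_Rintegral => //.
  - exact: (integrable_norm (Linfc_integ (cz_bad_Linfc q0))).
  - exact: Linfc_integ (LinfcD (mass_Linfc q) (LinfcZ _ (hcube_Linfc q0))).
  move=> x _; rewrite normrM (ger0_norm (ler0n _ _)) -mulrDl ler_wpM2r//.
  exact: ler_normB.
rewrite RintegralD//; last 2 first.
- exact: Linfc_integ (mass_Linfc q).
- exact: Linfc_integ (LinfcZ _ (hcube_Linfc q0)).
rewrite Rint_scale; last exact: mf_hcube.
by rewrite Rint_hcube mulr_natl lerD2l mulrC; exact: cz_mean_le.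
Qed.

End decomposition.
End calderon_zygmund_decomposition.

Section weak_type.
Implicit Types (x y z c : X) (s M l : R) (K : X * X -> R) (f g phi : X -> R) (q : X * R).

Lemma mass_le f q : Linfc f -> mass f q <= l1int f.
Proof.
move=> lf; apply: le_Rintegral => //; [exact: Linfc_integ (mass_Linfc lf q)|exact: (integrable_norm (Linfc_integ lf))|].
by move=> x _; rewrite ler_piMr.
Qed.

Lemma sum_mass_le f (S : seq (X * R)) : Linfc f ->
  (forall x, \sum_(q <- S) \1_(hcube q) x <= 1 :> R) -> \sum_(q <- S) mass f q <= l1int f.
Proof.
move=> lf S1; have [i e] := @Rint_sum_seq _ S (fun q x => `|f x| * \1_(hcube q) x) (fun q => Linfc_integ (mass_Linfc lf q)).
rewrite -e; apply: le_Rintegral => //; first exact: (integrable_norm (Linfc_integ lf)).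
by move=> x _; rewrite -mulr_sumr ler_piMr.
Qed.

Lemma sum_Linfc (S : seq (X * R)) (F : X * R -> X -> R) : (forall q, q \in S -> Linfc (F q)) ->
  Linfc (fun x => \sum_(q <- S) F q x).
Proof.
elim: S => [|q S IH] h.
  have -> : (fun x : X => \sum_(q <- [::]) F q x) = (fun=> 0) by apply/funext => x; rewrite big_nil.
  by apply: (@Linfc_intro _ 0 0) => //; [move=> x; rewrite normr0|move=> x; rewrite eqxx].
have -> : (fun x : X => \sum_(q <- q :: S) F q x) = (fun x => F q x + \sum_(q <- S) F q x).
  by apply/funext => x; rewrite big_cons.
by apply: LinfcD; [apply: h; rewrite mem_head|apply: IH => q' q'S; apply: h; rewrite inE q'S orbT].
Qed.

Lemma ler_sum_in (S : seq (X * R)) (F G : X * R -> R) : (forall q, q \in S -> F q <= G q) ->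
  \sum_(q <- S) F q <= \sum_(q <- S) G q.
Proof.
elim: S => [|q S IH] h; first by rewrite !big_nil.
rewrite !big_cons lerD//; first by apply: h; rewrite mem_head.
by apply: IH => q' q'S; apply: h; rewrite inE q'S orbT.
Qed.

(* A point outside the selected cubes lies in a small cube with small average, hence [f] is small there. *)
Lemma lipschitz_small f q x (L l : R) : Linfc f -> 0 <= L -> (forall x y, `|f x - f y| <= L * enorm (x - y)) ->
  0 < q.2 -> hcube q x -> mass f q <= l * vol q -> `|f x| <= l + L * (n%:R * q.2).
Proof.
move=> lf L0 fL q0 qx mq; have v0 := vol_gt0 q0.
set D := L * (n%:R * q.2).
suff : (`|f x| - D) * vol q <= l * vol q by rewrite ler_pM2r// lerBlDr.
apply: le_trans mq; rewrite -Rint_hcube -Rint_scale; last exact: mf_hcube.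
apply: le_Rintegral => //.
- exact: Linfc_integ (LinfcZ _ (hcube_Linfc q0)).
- exact: Linfc_integ (mass_Linfc lf q).
move=> y _; rewrite indicE; case: (boolP (y \in hcube q)) => [|_]; last by rewrite !mulr0.
rewrite inE => qy; apply: ler_wpM2r => //.
have h1 : `|f x| - `|f y| <= `|f x - f y| by exact: lerB_dist.
have h2 : `|f x - f y| <= D.
  apply: (le_trans (fL x y)); rewrite ler_wpM2l//; apply: hcube_diam qx qy; exact: ltW.
by move: h1 h2; move: (`|f x|) (`|f y|) (`|f x - f y|) => a b c; clear -a b c D; lra.
Qed.

Lemma l1int_subr_le f g : Linfc f -> Linfc g -> l1int (fun x => f x - g x) <= l1int f + l1int g.
Proof.
move=> lf lg; have i1 := integrable_norm (Linfc_integ lf); have i2 := integrable_norm (Linfc_integ lg).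
rewrite -RintegralD//; apply: le_Rintegral => //.
- exact: (integrable_norm (Linfc_integ (LinfcB lf lg))).
- by have := integrableD measurableT i1 i2; apply: eq_integrable => // x _ /=.
- by move=> x _; exact: ler_normB.
Qed.

Lemma l1int_sub_sum f (S : seq (X * R)) (F : X * R -> X -> R) : Linfc f ->
  (forall q, q \in S -> Linfc (F q)) ->
  l1int (fun x => f x - \sum_(q <- S) F q x) <= l1int f + \sum_(q <- S) l1int (F q).
Proof.
elim: S f => [|q S IH] f lf h.
  rewrite big_nil addr0 (_ : (fun x => _) = f)//.
  by apply/funext => x; rewrite big_nil subr0.
have lq : Linfc (F q) by apply: h; rewrite mem_head.
have -> : (fun x => f x - \sum_(q0 <- q :: S) F q0 x) = (fun x => (f x - F q x) - \sum_(q <- S) F q x).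
  by apply/funext => x; rewrite big_cons opprD addrA.
apply: (le_trans (IH _ (LinfcB lf lq) _)).
  by move=> q' q'S; apply: h; rewrite inE q'S orbT.
by rewrite big_cons addrA lerD2r; exact: l1int_subr_le.
Qed.

Lemma cz_decomposition f l : Lipc f -> 0 < l -> exists S : seq (X * R),
  [/\ forall q, q \in S -> 0 < q.2, \sum_(q <- S) vol q <= l1int f / l,
   \sum_(q <- S) l1int (cz_bad f q) <= 2 * l1int f,
   forall x, `|f x - \sum_(q <- S) cz_bad f q x| <= 2 * 4 ^+ n * l &
   l1int (fun x => f x - \sum_(q <- S) cz_bad f q x) <= 3 * l1int f].
Proof.
move=> [lf [L L0 fL]] l0; have [r r0 fr] := Linfc_support lf.
have f10 := l1int_ge0 f.
(* The initial cube, of side [2 * rho], has to contain the support of [f], and its volume, at least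
   $\rho^n\ge\rho$, has to make the average of $|f|$ at most [l]. *)
pose rho := r + 1 + l1int f / l.
have e0 : 0 <= l1int f / l by nneg.
have rho1 : 1 <= rho by rewrite /rho; move: r0 e0; move: (l1int f / l) => e; clear -r e; lra.
have rhor : r < rho by rewrite /rho; move: e0; move: (l1int f / l) => e; clear -r e; lra.
have rhoe : l1int f / l <= rho by rewrite /rho; move: r0; move: (l1int f / l) => e; clear -r e; lra.
have rho0 : 0 < rho by exact: lt_le_trans rho1.
clearbody rho.
have [Q [QE1 QE2]] : exists Q : X * R, Q.1 = const_mx (- rho) /\ Q.2 = 2 * rho by exists (const_mx (- rho), 2 * rho).
have Q0 : 0 < Q.2 by rewrite QE2 mulr_gt0.
have mQ : mass f Q <= l * vol Q.
  apply: (le_trans (mass_le Q lf)); rewrite mulrC -ler_pdivrMr//; apply: (le_trans rhoe).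
  apply: (le_trans _ (vol_ge Q0)); rewrite QE2 mulrAC divff// mul1r.
  exact: ler_eXnr.
(* After [k] generations the oscillation of [f] on the cubes that are left is at most [l]. *)
have [k kP] : exists k, L * (n%:R * (Q.2 / 2 ^+ k)) <= l.
  exists (Num.bound (L * n%:R * Q.2 / l)); set B := L * n%:R * Q.2 / l; set k := Num.bound B.
  have B0 : 0 <= B by rewrite divr_ge0 ?(ltW l0)// mulr_ge0 ?(ltW Q0)// mulr_ge0.
  have Bk : B <= 2 ^+ k.
    apply: (le_trans (ltW (archi_boundP B0))); rewrite -natrX ler_nat; exact: ltnW (ltn_expl _ _).
  have -> : L * (n%:R * (Q.2 / 2 ^+ k)) = B / 2 ^+ k * l.
    rewrite /B; have := gt_eqF l0; move: (2 ^+ k)^-1 => c lz; field; by rewrite lz.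
  by rewrite ler_piMl ?(ltW l0)// ler_pdivrMr ?exprn_gt0// mul1r.
have Scubes := @cz_cubes f lf l l0 k Q.
set S := cz f l k Q in Scubes *.
have S1 x : \sum_(q <- S) \1_(hcube q) x <= 1 :> R.
  by apply: (le_trans (cz_disjoint f l k x Q0)); rewrite lern1 leq_b1.
(* A sum of indicators is a natural number, here at most 1. *)
have Sdich x : \sum_(q <- S) \1_(hcube q) x = 0 :> R \/ \sum_(q <- S) \1_(hcube q) x = 1 :> R.
  have := S1 x; rewrite (_ : \sum_(q <- S) \1_(hcube q) x = (\sum_(q <- S) (x \in hcube q))%:R); last first.
    by rewrite natr_sum; apply: eq_bigr => q _; rewrite indicE.
  rewrite -[1]/(1%:R) ler_nat; case: (\sum_(q <- S) _)%N => [|[|m]] //; by [left|right].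
have Sm := sum_mass_le lf S1.
exists S; split.
- by move=> q qS; have [] := Scubes q Q0 mQ qS.
- rewrite ler_pdivlMr// mulr_suml; apply: le_trans Sm; apply: ler_sum_in => q qS.
  by have [_ /ltW h _] := Scubes q Q0 mQ qS; rewrite mulrC.
- apply: (le_via (\sum_(q <- S) 2 * mass f q)).
    by apply: ler_sum_in => q qS; have [q0 _ _] := Scubes q Q0 mQ qS; exact: cz_bad_l1.
  by rewrite -mulr_sumr ler_pM2l.
- move=> x.
  (* The good part equals [f] outside the selected cubes and the mean of [f] inside each of them. *)
  have -> : f x - \sum_(q <- S) cz_bad f q x = f x * (1 - \sum_(q <- S) \1_(hcube q) x) +
      \sum_(q <- S) cz_mean f q * \1_(hcube q) x.
    rewrite (_ : \sum_(q <- S) cz_bad f q x = \sum_(q <- S) (f x * \1_(hcube q) x - cz_mean f q * \1_(hcube q) x)); last first.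
      by apply: eq_bigr => q _; rewrite cz_badE.
    by rewrite sumrB -mulr_sumr; ring.
  have m4 : `|\sum_(q <- S) cz_mean f q * \1_(hcube q) x| <= 4 ^+ n * l * \sum_(q <- S) \1_(hcube q) x.
    rewrite mulr_sumr; apply: (le_trans (ler_norm_sum _ _ _)); apply: ler_sum_in => q qS.
    have [q0 _ h] := Scubes q Q0 mQ qS.
    rewrite normrM (ger0_norm (ler0n _ _)) ler_wpM2r//.
    have := le_trans (cz_mean_le lf q0) h; rewrite mulrC ler_pM2r//; exact: vol_gt0.
  have p4 : 1 <= 4 ^+ n :> R by apply: exprn_ege1; rewrite ler1n.
  apply: (le_trans (ler_normD _ _)); have [sx|sx] := Sdich x; rewrite sx in m4 *; last first.
    rewrite subrr mulr0 normr0 add0r mulr1 in m4 *; apply: (le_trans m4).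
    by rewrite -mulrA mulr_natl lerDl mulr_ge0 ?(ltW l0).
  rewrite mulr0 normr_le0 in m4; rewrite subr0 mulr1 (eqP m4) normr0 addr0.
  have fx : `|f x| <= l + l.
    have [qx|qx] := pselect (hcube Q x).
      have [q' [q'0 q'2 q'x q'm]] := cz_outside Q0 mQ qx sx.
      apply: (le_trans (lipschitz_small lf L0 fL q'0 q'x q'm)).
      by rewrite lerD2l q'2.
    have [->|fx0] := eqVneq (f x) 0; first by rewrite normr0 addr_ge0// ltW.
    exfalso; apply: qx => i; rewrite QE1 QE2 mxE.
    have := le_trans (coord_le_enorm x i) (fr x fx0); rewrite ler_norml.
    by move: (x ord0 i) rhor => v; clear -v rho r => h1 /andP[h2 h3]; apply/andP; split; lra.
  by apply: (le_trans fx); rewrite -mulrA mulr_natl lerD// ler_peMl// ltW.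
- have h := @l1int_sub_sum f S (cz_bad f) lf.
  apply: (le_trans (h _)).
    by move=> q qS; have [q0 _ _] := Scubes q Q0 mQ qS; exact: cz_bad_Linfc.
  have -> : 3 * l1int f = l1int f + 2 * l1int f by ring.
  rewrite lerD2l; apply: (le_via (\sum_(q <- S) 2 * mass f q)).
    by apply: ler_sum_in => q qS; have [q0 _ _] := Scubes q Q0 mQ qS; exact: cz_bad_l1.
  by rewrite -mulr_sumr ler_pM2l.
Qed.

Lemma pairing_split s s1 s2 K M phi f g : ker_data s s1 s2 K M -> Linfc phi -> Linfc f -> Linfc g ->
  pairing s s1 s2 K phi f = pairing s s1 s2 K phi (fun x => f x - g x) + pairing s s1 s2 K phi g.
Proof.
move=> kd lp lf lg; have e := pairingD 1 kd lp (LinfcB lf lg) lg.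
rewrite mul1r in e; rewrite -e; congr pairing.
by apply/funext => x; rewrite mul1r subrK.
Qed.

Lemma pairing_sub_sum s s1 s2 K M phi f (S : seq (X * R)) (F : X * R -> X -> R) : ker_data s s1 s2 K M ->
  Linfc phi -> Linfc f -> (forall q, q \in S -> Linfc (F q)) ->
  pairing s s1 s2 K phi f = pairing s s1 s2 K phi (fun x => f x - \sum_(q <- S) F q x) +
    \sum_(q <- S) pairing s s1 s2 K phi (F q).
Proof.
move=> kd lp; elim: S f => [|q S IH] f lf h.
  by rewrite big_nil addr0; congr pairing; apply/funext => x; rewrite big_nil subr0.
have lq : Linfc (F q) by apply: h; rewrite mem_head.
have lfq := LinfcB lf lq.
rewrite big_cons.
have -> : (fun x => f x - \sum_(q0 <- q :: S) F q0 x) = (fun x => (f x - F q x) - \sum_(q <- S) F q x).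
  by apply/funext => x; rewrite big_cons opprD addrA.
have hS q' : q' \in S -> Linfc (F q') by move=> q'S; apply: h; rewrite inE q'S orbT.
have e1 := IH _ lfq hS; rewrite (pairing_split kd lp lf lq) e1 -addrA; congr (_ + _).
exact: addrC.
Qed.

(** The bad part on [q] is supported within [n * q.2] of the corner, and [pairing_atom] asks for
    twice this distance. *)
Definition cz_cover (S : seq (X * R)) : set X := [set x | has (fun q => enorm (x - q.1) < 2 * (n%:R * q.2)) S].

(** A ball of radius $2n\ell$ lies in a cube of side $4n\ell=8n\cdot\frac\ell2$, and $(\ell/2)^n$ is
    at most the volume of the selected cube of side $\ell$. *)
Lemma cz_cover_le (S : seq (X * R)) : (forall q, q \in S -> 0 < q.2) -> measurable (cz_cover S) /\
  (mu (cz_cover S) <= ((8 * n%:R) ^+ n * \sum_(q <- S) vol q)%:E)%E.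
Proof.
elim: S => [|q S IH] h.
  have -> : cz_cover [::] = set0 by apply/seteqP; split => x.
  by rewrite measure0 big_nil; split.
have [mS muS] : measurable (cz_cover S) /\ (mu (cz_cover S) <= ((8 * n%:R) ^+ n * \sum_(q <- S) vol q)%:E)%E.
  by apply: IH => q' q'S; apply: h; rewrite inE q'S orbT.
have q0 : 0 < q.2 by apply: h; rewrite mem_head.
have -> : cz_cover (q :: S) = eball q.1 (2 * (n%:R * q.2)) `|` cz_cover S.
  apply/seteqP; split => x; rewrite /cz_cover /eball /=; first by move/orP.
  by move=> h'; apply/orP.
have mE := meas_eball q.1 (2 * (n%:R * q.2)).
split; first exact: measurableU.
rewrite big_cons mulrDr EFinD.
apply: (le_trans (measureU2 _ mE mS)); apply: leeD => //.
apply: (le_via (mu (cball q.1 (2 * (n%:R * q.2))))).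
  apply: le_measure; rewrite ?inE//; first exact: meas_cball.
  by move=> x; rewrite /=; exact: ltW.
apply: (le_trans (mu_cball_le _ _)); first by nneg.
rewrite lee_fin (_ : 2 * (2 * (n%:R * q.2)) = (8 * n%:R) * (q.2 / 2)); last by field.
by rewrite exprMn ler_wpM2l ?mulr_ge0//; exact: vol_ge.
Qed.

Lemma mu_cball_limit (A : set X) (c : \bar R) : measurable A ->
  (forall k : nat, mu (A `&` cball 0 k%:R) <= c)%E -> (mu A <= c)%E.
Proof.
move=> mA h.
have mAk k : measurable (A `&` cball (0 : X) k%:R) by apply: measurableI => //; exact: meas_cball.
have -> : mu A = (\int[mu]_x (\1_A x)%:E)%E by rewrite integral_indic// setIT.
apply: (@int_lim_le _ _ _ mu (fun k => \1_(A `&` cball 0 k%:R))).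
- by [].
- by [].
- move=> x; apply: cvg_near_cst; exists (Num.bound (enorm x)) => // k /= xk.
  rewrite !indicE (_ : (x \in A `&` cball 0 k%:R) = (x \in A))//.
  apply/idP/idP; rewrite !inE; first by case.
  move=> Ax; split => //; rewrite /cball /= subr0.
  by apply: (le_trans (ltW (archi_boundP (enorm_ge0 x)))); rewrite ler_nat.
- by move=> k; rewrite integral_indic ?setIT//; exact: h.
Qed.

(** The first term measures the cover; the others stem from the good part and from the atoms,
    doubled because half of the left-hand side is absorbed. *)
Definition weak_cst s1 s2 : R := (8 * n%:R) ^+ n +
  2 * (3 * 4 ^+ n * form_cst s1 s2 ^+ 2 + 2 * atom_cst s1 s2).

(** Testing with the sign of $T_0f$ on the exceptional set [P] bounds $t|P|$ by the form at [f],
    which splits into the good part, treated in $L^2$, and the atoms. The ball of radius [k] makes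
    $|P|$ finite, so that half of $t|P|$ can be absorbed. *)
Lemma weak_type_off s s1 s2 K M f (t l : R) (S : seq (X * R)) (k : nat) : ker_data s s1 s2 K M -> 0 < M -> Lipc f ->
  0 < t -> l = t / M ->
  (forall q, q \in S -> 0 < q.2) -> \sum_(q <- S) l1int (cz_bad f q) <= 2 * l1int f ->
  (forall x, `|f x - \sum_(q <- S) cz_bad f q x| <= 2 * 4 ^+ n * l) ->
  l1int (fun x => f x - \sum_(q <- S) cz_bad f q x) <= 3 * l1int f ->
  (mu ((superlevel (T0 s s1 s2 K f) t `\` cz_cover S) `&` cball 0 k%:R) <=
    (2 * (3 * 4 ^+ n * form_cst s1 s2 ^+ 2 + 2 * atom_cst s1 s2) * (M * l1int f) / t)%:E)%E.
Proof.
move=> kd M0 lf t0 lE S0 Sb gl g1.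
have mK : meas K by case: kd.
have [mS _] := cz_cover_le S0.
have mT := mf_T0 s s1 s2 mK (Linfc_mf lf.1).
set P := _ `&` _.
have mP : measurable P.
  apply: measurableI; last exact: meas_cball.
  by apply: measurableD => //; apply: mf_lt; mfun.
have lP : Linfc (\1_P : X -> R).
  apply: (@Linfc_intro _ 1 k%:R) => //; first by move=> x; rewrite ger0_norm.
  by move=> x; rewrite pnatr_eq0 eqb0 negbK inE => -[_]; rewrite /cball /= subr0.
have [v vE] := ex_fun (T0 s s1 s2 K f).
have mv : meas v by rewrite (funext vE).
have [phi phiE] := ex_fun (fun x => v x / `|v x| * \1_P x).
have vv x : `|v x / `|v x| | <= 1.
  have [->|vx] := eqVneq (v x) 0; first by rewrite mul0r normr0.
  by rewrite normrM normfV normr_id divff// normr_eq0.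
have phi_le x : `|phi x| <= \1_P x.
  by rewrite phiE normrM (ger0_norm (ler0n _ _)) ler_piMl.
have lphi : Linfc phi.
  apply: Linfc_le lP; first by rewrite (funext phiE); mfun.
  by move=> x; apply: (le_trans (phi_le x)); exact: ler_norm.
have phi1 x : `|phi x| <= 1 by apply: (le_trans (phi_le x)); rewrite lern1 leq_b1.
have phi0 x : phi x != 0 -> P x.
  by move=> px; apply: contrapT => nP; move/negP: px; apply; rewrite phiE indicE memNset// mulr0.
have [p pE] : exists p : R, (mu P = p%:E)%E.
  exists (fine (mu P)); rewrite fineK// ge0_fin_numE//.
  by apply: le_lt_trans (mu_cball_lty (0 : X) k%:R); apply: le_measure; rewrite ?inE//; [exact: meas_cball|move=> x []].
have p0 : 0 <= p by rewrite -lee_fin -pE.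
have Ip : \int[mu]_x \1_P x = p by rewrite /Rintegral integral_indic// setIT (_ : _ P = p%:E).
have sqp : sqint phi <= p.
  rewrite -Ip; apply: le_Rintegral => //.
  - by have := Linfc_integ (LinfcM lphi lphi); apply: eq_integrable => // x _.
  - exact: Linfc_integ lP.
  move=> x _; rewrite -(real_normK (num_real (phi x))) expr2.
  by apply: (le_trans (ler_wpM2r (normr_ge0 _) (phi1 x))); rewrite mul1r.
have lb q : q \in S -> Linfc (cz_bad f q) by move=> qS; apply: cz_bad_Linfc lf.1 _ _; exact: S0.
have [g gE] := ex_fun (fun x => f x - \sum_(q <- S) cz_bad f q x).
rewrite -(funext gE) in g1; have {}gl x : `|g x| <= 2 * 4 ^+ n * l by rewrite gE.
have lg : Linfc g by rewrite (funext gE); apply: LinfcB; [exact: lf.1|exact: sum_Linfc].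
have l0 : 0 < l by rewrite lE divr_gt0.
have sqg : sqint g <= 2 * 4 ^+ n * l * (3 * l1int f).
  apply: (le_via (2 * 4 ^+ n * l * l1int g)); last first.
    by rewrite ler_wpM2l// mulr_ge0 ?(ltW l0).
  rewrite -Rint_scale; last by apply: mfnorm; exact: Linfc_mf.
  apply: le_Rintegral => //.
  - by have := Linfc_integ (LinfcM lg lg); apply: eq_integrable => // x _.
  - exact: (integrableZl measurableT (2 * 4 ^+ n * l) (integrable_norm (Linfc_integ lg))).
  move=> x _; rewrite -(real_normK (num_real (g x))); exact: ler_wpM2r.
have tp : t * p <= pairing s s1 s2 K phi f.
  rewrite -(T0_pairing kd lf lphi) -Ip -Rint_scale//.
  have [B B0 TB] := T0_bounded kd lf.
  apply: le_Rintegral => //.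
  - exact: Linfc_integ (LinfcZ t lP).
  - apply: Linfc_integ; apply: (@Linfc_le _ (fun x => B * phi x)); [|move=> x|exact: LinfcZ].
      by apply: mfM => //; exact: Linfc_mf.
    by rewrite !normrM (ger0_norm B0) ler_wpM2r.
  move=> x _; rewrite -vE phiE indicE; case: (boolP (x \in P)) => [|_]; last by rewrite !mulr0.
  rewrite inE => -[[tv _] _]; rewrite /superlevel /= -vE in tv.
  have v0 : `|v x| != 0 by rewrite gt_eqF// (lt_trans t0).
  rewrite mulrA mulrA -expr2 -(real_normK (num_real (v x))) mulfK//.
  by rewrite ler_wpM2r// ltW.
have atoms : `|\sum_(q <- S) pairing s s1 s2 K phi (cz_bad f q)| <= M * atom_cst s1 s2 * (2 * l1int f).
  apply: (le_trans (ler_norm_sum _ _ _)).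
  apply: (le_via (\sum_(q <- S) M * atom_cst s1 s2 * l1int (cz_bad f q))).
    apply: ler_sum_in => q qS; have q0 := S0 q qS.
    apply: (@pairing_atom s s1 s2 K M phi _ q.1 (n%:R * q.2)) => //.
    - exact: lb.
    - by rewrite mulr_gt0// ltr0n.
    - by move=> y; exact: cz_bad_support.
    - move=> x /phi0[[_ nc] _]; rewrite leNgt; apply/negP => xq; apply: nc.
      by apply/hasP; exists q.
    - by apply: cz_bad_mean => //; exact: lf.1.
  rewrite -mulr_sumr ler_wpM2l//; apply: mulr_ge0; first exact: ltW.
  have [a0 _ _ _ _] := ker_alphaP kd.
  by apply: mulr_ge0; [exact: holder_cst_ge0 kd|exact: annular_cst_ge0].
have c0 := form_cst_gt0 kd.
(* With this parameter the term of the good part that contains [sqint phi] is at most $t|P|/2$. *)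
have Mc0 : 0 < t / (M * form_cst s1 s2) by rewrite divr_gt0// mulr_gt0.
have good := pairing_le kd lphi lg Mc0.
rewrite pE lee_fin.
have := pairing_sub_sum kd lphi lf.1 lb; rewrite -(funext gE) => pf.
rewrite pf in tp.
have F0 := l1int_ge0 f.
move: tp atoms good sqg sqp.
move: (pairing s s1 s2 K phi g) (\sum_(q <- S) pairing s s1 s2 K phi (cz_bad f q)).
move: (sqint g) (sqint phi) (l1int f) F0 (form_cst s1 s2) c0 (atom_cst s1 s2) => sg sp F F0 c c0 a w1 w2.
rewrite lE; have e4 : 0 <= 4 ^+ n :> R by [].
move: (4 ^+ n) e4 => e e4.
clear -M0 t0 p0 F0 c0 e4 => tp atoms good sqg sqp.
have h1 : w2 <= M * a * (2 * F) by exact: le_trans (ler_norm _) atoms.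
have h2 : w1 <= t * p / 2 + 3 * e * c ^+ 2 * (M * F).
  apply: (le_trans (ler_norm _)); apply: (le_trans good).
  apply: (le_via (M * c / 2 * (t / (M * c) * p + (t / (M * c))^-1 * (2 * e * (t / M) * (3 * F))))).
    rewrite ler_wpM2l//; first by nneg.
    by apply: lerD; apply: ler_wpM2l => //; rewrite ?invr_ge0 divr_ge0 ?mulr_ge0 ?(ltW t0) ?(ltW M0) ?(ltW c0).
  apply: le_of_eq; field.
  by rewrite !gt_eqF.
rewrite ler_pdivlMr// mulrC.
have -> : 2 * (3 * e * c ^+ 2 + 2 * a) * (M * F) = 2 * (3 * e * c ^+ 2 * (M * F) + M * a * (2 * F)) by ring.
move: h1 h2 tp; set A := M * a * (2 * F); set B := 3 * e * c ^+ 2 * (M * F); set D := t * p.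
clearbody A B D; clear -w1 w2 A B D => *; lra.
Qed.

(** Decomposing at the height $t/M$ makes every term proportional to $M\|f\|_1/t$. *)
Lemma weak_type_Lipc s s1 s2 K M f (t : R) : ker_data s s1 s2 K M -> 0 < M -> Lipc f -> 0 < t ->
  (mu (superlevel (T0 s s1 s2 K f) t) <= (weak_cst s1 s2 * (M * l1int f) / t)%:E)%E.
Proof.
move=> kd M0 lf t0; have l0 : 0 < t / M by rewrite divr_gt0.
have mK : meas K by case: kd.
have [S [S0 Sv Sb gl g1]] := cz_decomposition lf l0.
have [mS muS] := cz_cover_le S0.
have mT := mf_T0 s s1 s2 mK (Linfc_mf lf.1).
set D := superlevel _ _.
have mD : measurable D by apply: mf_lt; mfun.
have mDS : measurable (D `\` cz_cover S) by exact: measurableD.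
apply: (le_via (mu (cz_cover S `|` (D `\` cz_cover S)))).
  apply: le_measure; rewrite ?inE//; first exact: measurableU.
  by move=> x Dx; have [xS|xS] := pselect (cz_cover S x); [left|right].
apply: (le_trans (measureU2 _ mS mDS)).
rewrite (mulrDl _ _ (M * _)) mulrDl EFinD; apply: leeD.
  apply: (le_trans muS); rewrite lee_fin -mulrA ler_wpM2l ?mulr_ge0//.
  by apply: (le_trans Sv); rewrite invf_div mulrC mulrAC.
apply: mu_cball_limit => // k; exact: weak_type_off.
Qed.

End weak_type.

(** * Interpolation between the weak type (1,1) and $L^2$ *)

Section strong_type.
Implicit Types (x y z c : X) (s M l : R) (K : X * X -> R) (f g phi : X -> R).

Lemma LipcD f g (c : R) : Lipc f -> Lipc g -> Lipc (fun x => f x + c * g x).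
Proof.
move=> [lf [L L0 fL]] [lg [L' L'0 gL]]; split; first by apply: LinfcD => //; exact: LinfcZ.
exists (L + `|c| * L'); first by nneg.
move=> x y; have -> : f x + c * g x - (f y + c * g y) = (f x - f y) + c * (g x - g y) by ring.
apply: (le_trans (ler_normD _ _)); rewrite mulrDl; apply: lerD => //.
by rewrite normrM -mulrA ler_wpM2l.
Qed.

Lemma Lipc_clip f (c : R) : 0 <= c -> Lipc f -> Lipc (fun x => clip c (f x)).
Proof.
move=> c0 [lf [L L0 fL]]; split.
  have mf := Linfc_mf lf.
  apply: (Linfc_le _ _ lf); first by rewrite /clip; mfun.
  by move=> x; rewrite clip_abs// ge_min lexx.
by exists L => // x y; apply: le_trans (fL x y); exact: clip_lipschitz.
Qed.

Lemma T0D s s1 s2 K M f g (c : R) z : ker_data s s1 s2 K M -> Lipc f -> Lipc g ->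
  T0 s s1 s2 K (fun x => f x + c * g x) z = T0 s s1 s2 K f z + c * T0 s s1 s2 K g z.
Proof.
move=> kd lf lg; have [_ s201 _ _ _] := kd.
have i1 := T0_integrable z kd lf; have i2 := T0_integrable z kd lg.
rewrite /T0 -RintegralZl// -RintegralD//; last exact: (integrableZl measurableT c i2).
apply: eq_Rintegral => q _; rewrite /T0_integrand !(potentialD)//; [|exact: lf.1|exact: lg.1|exact: lf.1|exact: lg.1].
have alg (k a b1 b2 b3 b4 u : R) : k * a * (b1 + c * b2 - (b3 + c * b4)) / u =
  k * a * (b1 - b3) / u + c * (k * a * (b2 - b4) / u) by ring.
exact: alg.
Qed.

(** The operator is tested against its own restriction [phi] to a ball. With $l=1/(Mc)$, [c] being
    [form_cst], the bound on the form contains $\frac12\int\phi^2$, which is absorbed; the ball then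
    grows. *)
Lemma T0_L2 s s1 s2 K M f : ker_data s s1 s2 K M -> 0 < M -> Lipc f ->
  (\int[mu]_x (T0 s s1 s2 K f x ^+ 2)%:E <= ((M * form_cst s1 s2) ^+ 2 * sqint f)%:E)%E.
Proof.
move=> kd M0 lf; have mK : meas K by case: kd.
have [v vE] := ex_fun (T0 s s1 s2 K f).
have mv : meas v by rewrite (funext vE); apply: mf_T0 => //; exact: Linfc_mf lf.1.
under eq_integral do rewrite -vE.
apply: (@int_lim_le _ _ _ mu (fun k x => (v x * \1_(cball 0 k%:R) x) ^+ 2)).
- by move=> k; mfun.
- by nneg.
- move=> x; apply: cvg_near_cst; exists (Num.bound (enorm x)) => // k /= xk.
  rewrite indicE mem_set ?mulr1//; rewrite /cball /= subr0.
  by apply: (le_trans (ltW (archi_boundP (enorm_ge0 x)))); rewrite ler_nat.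
move=> k; have [phi phiE] := ex_fun (fun x => v x * \1_(cball 0 k%:R) x).
have [B B0 TB] := T0_bounded kd lf.
have lphi : Linfc phi.
  apply: (@Linfc_intro _ B k%:R); first by rewrite (funext phiE); mfun.
    move=> x; rewrite phiE normrM vE (ger0_norm (ler0n _ _)).
    by apply: (le_trans _ (TB x)); rewrite ler_piMr// lern1 leq_b1.
  move=> x; rewrite phiE indicE; case: (boolP (x \in _)) => [|_]; last by rewrite mulr0 eqxx.
  by rewrite inE /cball /= subr0.
under eq_integral do rewrite -phiE.
rewrite sqintE// lee_fin.
have sE : sqint phi = pairing s s1 s2 K phi f.
  rewrite -(T0_pairing kd lf lphi); apply: eq_Rintegral => x _.
  rewrite -vE phiE indicE; case: (_ \in _); by rewrite ?mulr1 ?mulr0 ?expr2 ?mul0r.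
have c0 := form_cst_gt0 kd.
have Mc0 : 0 < M * form_cst s1 s2 by rewrite mulr_gt0.
have := pairing_le kd lphi lf.1 (l := (M * form_cst s1 s2)^-1).
rewrite invr_gt0 => /(_ Mc0); rewrite -sE invrK => h.
have := le_trans (ler_norm _) h; move: Mc0; move: (M * _) (sqint phi) (sqint f) => D a b D0.
rewrite mulrDr mulrA (_ : D / 2 * D^-1 = 2^-1); last by field; rewrite gt_eqF.
rewrite mulrA (_ : D / 2 * D = D ^+ 2 / 2); last by ring.
rewrite mulrAC; move: (D ^+ 2 * b) => e; clear -a e; lra.
Qed.

Lemma chebyshev2 f (a : R) : meas f -> 0 < a ->
  (mu (superlevel f a) <= \int[mu]_x (a^-1 ^+ 2 * f x ^+ 2)%:E)%E.
Proof.
move=> mf a0; have mS : measurable (superlevel f a) by apply: mf_lt; mfun.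
have -> : mu (superlevel f a) = (\int[mu]_x (\1_(superlevel f a) x)%:E)%E by rewrite integral_indic// setIT.
apply: int_le; [by []|mfun|] => x.
rewrite indicE ler0n/=; case: (boolP (x \in _)) => [|_]; last by rewrite mulr_ge0 ?sqr_ge0.
rewrite inE /superlevel /= -exprMn -(real_normK (num_real (a^-1 * f x))) => fx.
rewrite normrM gtr0_norm ?invr_gt0// exprn_ege1// ler_pdivlMl// mulr1.
exact: ltW.
Qed.

(** The density, at $y=M|f|$, of the bound for the measure of $\{|T_0f|>2a\}$: the part of [f] below
    the height $a/M$ is treated in $L^2$, the part above it by the weak type. *)
Definition marc s1 s2 (a y : R) : R := form_cst s1 s2 ^+ 2 * (a^-1 ^+ 2 * Num.min y a ^+ 2) +
  weak_cst s1 s2 * (a^-1 * Num.max (y - a) 0).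

Lemma weak_cst_ge0 s s1 s2 K M : ker_data s s1 s2 K M -> 0 <= weak_cst s1 s2.
Proof.
move=> kd; have [a0 _ _ _ _] := ker_alphaP kd.
rewrite /weak_cst; apply: addr_ge0; first by [].
apply: mulr_ge0 => //; apply: addr_ge0; first by nneg.
apply: mulr_ge0 => //; apply: mulr_ge0; [exact: holder_cst_ge0 kd|exact: annular_cst_ge0].
Qed.

Lemma marc_ge0 s s1 s2 K M (a y : R) : ker_data s s1 s2 K M -> 0 < a -> 0 <= marc s1 s2 a y.
Proof.
move=> kd a0; rewrite /marc; apply: addr_ge0; first by nneg.
rewrite mulr_ge0 ?(weak_cst_ge0 kd)// mulr_ge0 ?invr_ge0 ?(ltW a0)// le_max lexx orbT//.
Qed.

Lemma mf_marc s1 s2 (a : R) dT (T : measurableType dT) (f : T -> R) : meas f ->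
  meas (fun w => marc s1 s2 a (f w)).
Proof. by move=> mf; rewrite /marc; mfun. Qed.

Lemma superlevelD (v v1 v2 : X -> R) (a : R) : meas v1 -> meas v2 ->
  (forall x, v x = v1 x + v2 x) ->
  (mu (superlevel v (2 * a)) <= mu (superlevel v1 a) + mu (superlevel v2 a))%E.
Proof.
move=> mv1 mv2 vE.
have m1 : measurable (superlevel v1 a) by apply: mf_lt; mfun.
have m2 : measurable (superlevel v2 a) by apply: mf_lt; mfun.
have m : measurable (superlevel v (2 * a)) by rewrite (funext vE); apply: mf_lt; mfun.
apply: le_trans (measureU2 _ m1 m2).
apply: le_measure; [rewrite inE; exact: m|rewrite inE; exact: measurableU m1 m2|].
move=> x; rewrite /superlevel /= vE => fx.
have [h|h] := ltP a (`|v1 x|); [by left|right].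
have := lt_le_trans fx (ler_normD _ _); move: h; move: (`|v1 x|) (`|v2 x|) => u w; clear -u w a; lra.
Qed.

Lemma superlevel_split s s1 s2 K M f (a : R) : ker_data s s1 s2 K M -> 0 < M -> Lipc f -> 0 < a ->
  (mu (superlevel (T0 s s1 s2 K f) (2 * a)) <= \int[mu]_x (marc s1 s2 a (M * `|f x|))%:E)%E.
Proof.
move=> kd M0 lf a0; have mK : meas K by case: kd.
have mf := Linfc_mf lf.1.
have g0 : 0 < a / M by rewrite divr_gt0.
have [f1 f1E] := ex_fun (fun x => clip (a / M) (f x)).
have [f2 f2E] := ex_fun (fun x => f x + -1 * clip (a / M) (f x)).
have lf1 : Lipc f1 by rewrite (funext f1E); exact: Lipc_clip (ltW g0) lf.
have lf2 : Lipc f2 by rewrite (funext f2E); apply: LipcD => //; exact: Lipc_clip (ltW g0) lf.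
have mT1 := mf_T0 s s1 s2 mK (Linfc_mf lf1.1); have mT2 := mf_T0 s s1 s2 mK (Linfc_mf lf2.1).
have fE x : T0 s s1 s2 K f x = T0 s s1 s2 K f1 x + T0 s s1 s2 K f2 x.
  have e := T0D 1 x kd lf1 lf2; rewrite mul1r in e; rewrite -e.
  by congr (T0 _ _ _ _ _ x); apply/funext => w; rewrite f2E f1E mulN1r mul1r subrKC.
apply: (le_trans (superlevelD a mT1 mT2 fE)).
have c0 := form_cst_gt0 kd; have W0 := weak_cst_ge0 kd.
under eq_integral do rewrite /marc.
rewrite intD; last 4 first.
- by mfun.
- by mfun.
- by nneg.
- by nneg.
have minE x : Num.min (M * `|f x|) a = M * `|f1 x|.
  rewrite f1E clip_abs ?(ltW g0)// minr_pMr ?(ltW M0)// [M * (a / M)]mulrC divfK ?gt_eqF//.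
have maxE x : Num.max (M * `|f x| - a) 0 = M * `|f2 x|.
  rewrite f2E mulN1r clip_sub_abs ?(ltW g0)// maxr_pMr ?(ltW M0)// mulr0 mulrBr [M * (a / M)]mulrC divfK ?gt_eqF//.
apply: leeD.
  apply: (le_trans (chebyshev2 mT1 a0)).
  rewrite intZl; [|by nneg|mfun|by nneg].
  apply: (le_trans (lee_wpmul2l _ (T0_L2 kd M0 lf1))); first by rewrite lee_fin exprn_ge0// invr_ge0 ltW.
  under eq_integral do rewrite minE exprMn (real_normK (num_real _)) mulrA mulrA.
  rewrite [leRHS]intZl; [|by nneg|have := Linfc_mf lf1.1 => mf1; by mfun|by nneg].
  rewrite sqintE; last exact: lf1.1.
  rewrite lee_fin le_eqVlt; apply/orP; left; apply/eqP; move: (form_cst _ _) (a^-1) (sqint _); clear -M => *; ring.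
apply: (le_trans (weak_type_Lipc kd M0 lf2 a0)).
under eq_integral do rewrite maxE !mulrA.
rewrite intZl; [|by nneg|have := Linfc_mf lf2.1 => mf2; by mfun|by []].
rewrite l1intE; last exact: Linfc_integ lf2.1.
rewrite lee_fin le_eqVlt; apply/orP; left; apply/eqP; move: (weak_cst _ _) (a^-1) (l1int _); clear -M => *; ring.
Qed.

Section geometric_sums.
Variables (a : nat -> R) (e y : R).
Hypotheses (a0 : forall i, 0 < a i) (a2 : forall i, a i.+1 = 2 * a i) (e0 : 0 < e) (y0 : 0 < y).

Let q : R := 1 - 2 `^ (- e).

Lemma pow2_gap : 0 < q.
Proof. by have /andP[_ h] := pow2N_lt1 e0; rewrite subr_gt0. Qed.

Let pow2V : 2 `^ (- e) * 2 `^ e = 1.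
Proof. by rewrite mulrC powR_add// subrr powRr0. Qed.

(** After multiplication by [q] the terms telescope: as $a_{i+1}=2a_i$, one has
    $q\,a_{i+1}^e=a_{i+1}^e-a_i^e$. The same device, with the opposite sign of the exponent, gives
    [geometric_above]. *)
Lemma geometric_below m :
  \sum_(i < m) (if a i <= y then a i `^ e else 0) <= q^-1 * y `^ e.
Proof.
rewrite mulrC ler_pdivlMr ?pow2_gap// mulrC mulr_sumr.
suff h k : \sum_(i < k.+1) q * (if a i <= y then a i `^ e else 0) <= Num.min (a k) y `^ e.
  case: m => [|k]; first by rewrite big_ord0 powR_ge0.
  apply: (le_trans (h k)); apply: ge0_ler_powR; rewrite ?nnegrE ?le_min ?(ltW (a0 _)) ?(ltW y0) ?(ltW e0)//.
  by rewrite ge_min lexx orbT.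
elim: k => [|k IH].
  rewrite big_ord_recr big_ord0 /= add0r; case: ifP => h; last by rewrite mulr0 powR_ge0.
  rewrite min_l// ler_piMl ?powR_ge0// gerBl powR_ge0//.
rewrite big_ord_recr /=; apply: (le_trans (lerD IH (lexx _))).
have mono : Num.min (a k) y `^ e <= Num.min (a k.+1) y `^ e.
  apply: ge0_ler_powR; rewrite ?nnegrE ?le_min ?(ltW (a0 _)) ?(ltW y0) ?(ltW e0)//.
  rewrite !ge_min lexx orbT andbT; apply/orP; left.
  by rewrite a2 ler_peMl ?(ltW (a0 _))// ler1n.
case: ifP => h; last by rewrite mulr0 addr0.
have h' : a k <= y by apply: (le_trans _ h); rewrite a2 ler_peMl ?(ltW (a0 _))// ler1n.
rewrite !min_l// a2 powRM ?(ltW (a0 _))// mulrBl mul1r mulrA pow2V mul1r.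
by rewrite addrC subrK.
Qed.

Lemma geometric_above m :
  \sum_(i < m) (if a i <= y then 0 else a i `^ (- e)) <= q^-1 * y `^ (- e).
Proof.
rewrite mulrC ler_pdivlMr ?pow2_gap// mulrC mulr_sumr.
suff h k : \sum_(i < k) q * (if a i <= y then 0 else a i `^ (- e)) <= y `^ (- e) - Num.max (a k) y `^ (- e).
  by apply: (le_trans (h m)); rewrite gerBl powR_ge0.
elim: k => [|k IH].
  rewrite big_ord0 subr_ge0; apply: powR_neg_antitone => //; first exact: ltW.
  by rewrite le_max lexx orbT.
rewrite big_ord_recr /=; apply: (le_trans (lerD IH (lexx _))).
rewrite -addrA lerD2l lerNr opprD opprK.
have mono : Num.max (a k.+1) y `^ (- e) <= Num.max (a k) y `^ (- e).
  apply: powR_neg_antitone; [exact: ltW|by rewrite lt_max a0|].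
  rewrite !ge_max !le_max lexx orbT andbT; apply/orP; left.
  by rewrite a2 ler_peMl ?(ltW (a0 _))// ler1n.
case: ifP => h; first by rewrite mulr0 oppr0 addr0.
have h' : y < a k by rewrite ltNge h.
have h2 : y <= a k.+1 by rewrite a2; apply: (le_trans (ltW h')); rewrite ler_peMl ?(ltW (a0 _))// ler1n.
rewrite (max_l h2) (max_l (ltW h')) a2 powRM ?(ltW (a0 _))// mulrBl mul1r.
by rewrite opprB addrC subrK.
Qed.

End geometric_sums.

(** The series are those of $a^p$ and $a^{p-1}$ over the levels $a\le y$ and of $a^{p-2}$ over the
    levels $a>y$. The last two are geometric with ratio below 1 exactly because $1<p<2$. *)
Definition marc_cst s1 s2 (p : R) : R := 8 `^ p * (form_cst s1 s2 ^+ 2 *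
  ((1 - 2 `^ (- p))^-1 + (1 - 2 `^ (- (2 - p)))^-1) + weak_cst s1 s2 * (1 - 2 `^ (- (p - 1)))^-1).

Lemma marc_cst_ge0 s s1 s2 K M (p : R) : ker_data s s1 s2 K M -> 1 < p < 2 -> 0 <= marc_cst s1 s2 p.
Proof.
move=> kd /andP[p1 p2]; rewrite /marc_cst.
have g1 : 0 < 1 - 2 `^ (- p) by apply: pow2_gap; move: p1; clear -p; lra.
have g2 : 0 < 1 - 2 `^ (- (2 - p)) by apply: pow2_gap; move: p2; clear -p; lra.
have g3 : 0 < 1 - 2 `^ (- (p - 1)) by apply: pow2_gap; move: p1; clear -p; lra.
apply: mulr_ge0; first by [].
apply: addr_ge0; apply: mulr_ge0; rewrite ?sqr_ge0 ?invr_ge0 ?(weak_cst_ge0 kd) ?(ltW g3)//.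
by apply: addr_ge0; rewrite invr_ge0 ltW.
Qed.

Lemma marc_sum s s1 s2 K M (p : R) (a : nat -> R) (m : nat) (y : R) : ker_data s s1 s2 K M -> 1 < p < 2 ->
  (forall i, 0 < a i) -> (forall i, a i.+1 = 2 * a i) -> 0 <= y ->
  \sum_(i < m) (8 * a i) `^ p * marc s1 s2 (a i) y <= marc_cst s1 s2 p * y `^ p.
Proof.
move=> kd /andP[p1 p2] a0 a2.
have p0 : 0 < p by move: p1; clear -p; lra.
rewrite le_eqVlt => /predU1P[<-|y0].
  rewrite powR0 ?gt_eqF// mulr0 big1// => i _.
  rewrite /marc min_l ?(ltW (a0 _))// sub0r max_r ?oppr_le0 ?(ltW (a0 _))//.
  by rewrite expr0n !mulr0 addr0 mulr0.
have pm1 : 0 < p - 1 by rewrite subr_gt0.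
have p2m : 0 < 2 - p by rewrite subr_gt0.
have B1 := geometric_below a0 a2 p0 y0 m.
have B2 := geometric_above a0 a2 p2m y0 m.
have B3 := geometric_below a0 a2 pm1 y0 m.
have c0 : 0 <= form_cst s1 s2 ^+ 2 by nneg.
have W0 := weak_cst_ge0 kd.
have q40 := powR_ge0 8 p.
pose c := form_cst s1 s2; pose W := weak_cst s1 s2.
apply: (le_via (\sum_(i < m) 8 `^ p * (c ^+ 2 * ((if a i <= y then a i `^ p else 0) +
    y ^+ 2 * (if a i <= y then 0 else a i `^ (- (2 - p)))) + W * (y * (if a i <= y then a i `^ (p - 1) else 0))))).
  apply: ler_sum => i _; rewrite powRM ?(ltW (a0 i))// -mulrA ler_wpM2l// /marc -/c -/W.
  have ai := a0 i; have ap : a i `^ p * (a i)^-1 ^+ 2 = a i `^ (- (2 - p)).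
    have -> : (a i)^-1 ^+ 2 = a i `^ (- 2).
      by rewrite powRN powR_mulrn ?(ltW ai)// exprVn.
    by rewrite powR_add//; congr (_ `^ _); ring.
  have ap1 : a i `^ p * (a i)^-1 = a i `^ (p - 1).
    by rewrite -[(a i)^-1]powR_inv1 ?(ltW ai)// powR_add.
  case: ifP => ay.
    rewrite (min_r ay) max_l ?subr_ge0// mulr0 addr0 mulrDr; apply: lerD.
      rewrite mulrCA ler_wpM2l// mulrA ap -(powR_mulrn _ (ltW ai)) powR_add//.
      by apply: le_of_eq; congr (_ `^ _); ring.
    rewrite mulrCA ler_wpM2l// mulrA ap1 mulrC ler_wpM2r ?powR_ge0// gerBl; exact: ltW.
  have {}ay : y <= a i by apply: ltW; rewrite ltNge ay.
  rewrite (min_l ay) max_r ?subr_le0// !mulr0 !addr0 add0r.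
  by rewrite mulrCA ler_wpM2l// mulrA ap mulrC.
rewrite -mulr_sumr -mulrA ler_wpM2l// big_split -!mulr_sumr big_split/= -mulr_sumr [leRHS]mulrDl; apply: lerD.
  rewrite -mulrA ler_wpM2l// mulrDl; apply: lerD => //.
  apply: (le_trans (ler_wpM2l (sqr_ge0 y) B2)); rewrite mulrCA ler_wpM2l ?invr_ge0 ?(ltW (pow2_gap p2m))//.
  rewrite -(powR_mulrn _ (ltW y0)) powR_add// le_eqVlt; apply/orP; left; apply/eqP; congr (_ `^ _); ring.
rewrite -mulrA ler_wpM2l//; apply: (le_trans (ler_wpM2l (ltW y0) B3)).
rewrite mulrCA ler_wpM2l ?invr_ge0 ?(ltW (pow2_gap pm1))//.
rewrite -{1}(powRr1 (ltW y0)) powR_add// le_eqVlt; apply/orP; left; apply/eqP; congr (_ `^ _); ring.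
Qed.

(** A finite substitute for the layer-cake formula: once [m] is large, some level $a=2^i/2^m$ with
    $i<2m$ satisfies $v>2a$ and $v^p\le(8a)^p$. *)
Lemma dyadic_between (v : R) : 0 < v -> exists N : nat, forall m, (N <= m)%N ->
  exists2 i, (i < m + m)%N & 2 * (2 ^+ i / 2 ^+ m) < v <= 8 * (2 ^+ i / 2 ^+ m).
Proof.
move=> v0; exists (maxn (Num.bound v) (Num.bound (4 / v))) => m.
rewrite geq_max => /andP[m1 m2].
have pm : m%:R <= 2 ^+ m :> R by rewrite -natrX ler_nat; exact: ltnW (ltn_expl _ _).
have vm : v < 2 ^+ m.
  by apply: (lt_le_trans (archi_boundP (ltW v0))); apply: le_trans pm; rewrite ler_nat.
have vm4 : 4 <= v * 2 ^+ m.
  rewrite mulrC -ler_pdivrMr//; have v40 : 0 <= 4 / v by nneg.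
  by apply: (le_trans (ltW (archi_boundP v40))); apply: le_trans pm; rewrite ler_nat.
have vm1 : 1 <= v * 2 ^+ m by apply: le_trans vm4; rewrite ler1n.
have [k /andP[k1 k2]] := dyadic_scale vm1.
(* The level is taken two steps below the dyadic position [k] of $v2^m$, which makes the lower bound
   strict; $k\ge2$ because $v2^m\ge4$. *)
case: k k1 k2 => [|[|i]] k1 k2.
- by have := le_lt_trans vm4 k2; rewrite ltr_nat.
- by have := le_lt_trans vm4 k2; rewrite -natrX ltr_nat.
exists i.
  have h : 2 ^+ i.+2 < 2 ^+ (m + m) :> R.
    by apply: (le_lt_trans k1); rewrite exprD ltr_pM2r.
  have := h; rewrite -!natrX ltr_nat ltn_exp2l// => h'.
  by apply: leq_trans h'; rewrite ltnW.
move: k1 k2; rewrite !exprS => k1 k2; apply/andP; split.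
  rewrite mulrA ltr_pdivrMr//; apply: lt_le_trans k1.
  by rewrite mulrA ltr_pM2r ?exprn_gt0//; rewrite ltr_pMr// ltr1n.
rewrite mulrA ler_pdivlMr//; apply: (le_trans (ltW k2)); apply: le_of_eq; ring.
Qed.

Lemma T0_Lp s s1 s2 K M f (p : R) : ker_data s s1 s2 K M -> 0 < M -> Lipc f -> 1 < p < 2 ->
  (\int[mu]_x (`|T0 s s1 s2 K f x| `^ p)%:E <= (marc_cst s1 s2 p * M `^ p)%:E * \int[mu]_x (`|f x| `^ p)%:E)%E.
Proof.
move=> kd M0 lf p12; have mK : meas K by case: kd.
have p0 : 0 < p by case/andP: p12 => p1 _; move: p1; clear -p; lra.
have mf := Linfc_mf lf.1.
have mT := mf_T0 s s1 s2 mK mf.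
have [a aE] := ex_fun (fun mi : nat * nat => 2 ^+ mi.2 / 2 ^+ mi.1 : R).
have a0 m i : 0 < a (m, i) by rewrite aE.
have a2 m i : a (m, i.+1) = 2 * a (m, i) by rewrite !aE exprS mulrA.
have mSup b : measurable (superlevel (T0 s s1 s2 K f) b) by apply: mf_lt; mfun.
have mI b : meas (\1_(superlevel (T0 s s1 s2 K f) b) : X -> R) by [].
(* The discretised layer-cake sum, cut at $|T_0f|^p$: by [dyadic_between] it is eventually equal to
   $|T_0f|^p$ at each point, so Fatou's lemma applies. *)
have [g gE] := ex_fun (fun p1 : nat * X => Num.min (`|T0 s s1 s2 K f p1.2| `^ p)
  (\sum_(i < p1.1 + p1.1) (8 * a (p1.1, i : nat)) `^ p * \1_(superlevel (T0 s s1 s2 K f) (2 * a (p1.1, i : nat))) p1.2)).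
have msum m : meas (fun x => \sum_(i < m + m) (8 * a (m, i : nat)) `^ p * \1_(superlevel (T0 s s1 s2 K f) (2 * a (m, i : nat))) x : R).
  by apply: measurable_sum => i; apply: mfM.
have mg m : meas (fun x => g (m, x)).
  by under eq_fun do rewrite gE; apply: mfmin; [mfun|exact: msum].
have s0 m x : 0 <= \sum_(i < m + m) (8 * a (m, i : nat)) `^ p * \1_(superlevel (T0 s s1 s2 K f) (2 * a (m, i : nat))) x :> R.
  by apply: sumr_ge0 => i _; rewrite mulr_ge0 ?powR_ge0.
apply: (@int_lim_le _ _ _ mu (fun m x => g (m, x))).
- exact: mg.
- by move=> m x; rewrite gE le_min powR_ge0 s0.
- move=> x; have [v0|v0] := eqVneq (T0 s s1 s2 K f x) 0.
    rewrite v0 normr0 powR0 ?gt_eqF//.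
    have gz m : g (m, x) = 0 by rewrite gE v0 normr0 powR0 ?gt_eqF// min_l//; exact: s0.
    by under eq_fun do rewrite gz; exact: cvg_cst.
  apply: cvg_near_cst; have v1 : 0 < `|T0 s s1 s2 K f x| by rewrite normr_gt0.
  have [N hN] := dyadic_between v1; exists N => // m /= Nm.
  have [i im /andP[i1 i2]] := hN m Nm.
  rewrite gE min_l// (bigD1 (Ordinal im))//=.
  apply: (le_via ((8 * a (m, i)) `^ p)).
    by apply: ge0_ler_powR; rewrite ?nnegrE ?(ltW p0)// aE.
  rewrite indicE mem_set ?mulr1; last by rewrite aE.
  rewrite lerDl; apply: sumr_ge0 => j _; by nneg.
move=> m.
have mmarc b : meas (fun x => marc s1 s2 b (M * `|f x|)) by apply: mf_marc; mfun.
apply: (le_via (\int[mu]_x (\sum_(i < m + m) (8 * a (m, i : nat)) `^ p * \1_(superlevel (T0 s s1 s2 K f) (2 * a (m, i : nat))) x)%:E)%E).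
  apply: int_le => // => x.
  by rewrite gE le_min powR_ge0 s0 ge_min lexx orbT.
apply: (le_via (\int[mu]_x (\sum_(i < m + m) (8 * a (m, i : nat)) `^ p * marc s1 s2 (a (m, i : nat)) (M * `|f x|))%:E)%E).
  under eq_integral do rewrite -sumEFin.
  under [leRHS]eq_integral do rewrite -sumEFin.
  rewrite ge0_integral_sum//; last 2 first.
  - by move=> i; apply: mfE; apply: mfM.
  - by move=> i x _; rewrite lee_fin mulr_ge0 ?powR_ge0.
  rewrite ge0_integral_sum//; last 2 first.
  - by move=> i; apply: mfE; apply: mfM; [mfun|by []].
  - by move=> i x _; rewrite lee_fin mulr_ge0 ?powR_ge0//; exact: marc_ge0 kd (a0 _ _).
  apply: lee_sum => i _.
  rewrite intZl; [|exact: powR_ge0|exact: mI|by []].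
  rewrite intZl; [|exact: powR_ge0|by []|by move=> x; exact: marc_ge0 kd (a0 _ _)].
  apply: lee_wpmul2l; first by rewrite lee_fin powR_ge0.
  rewrite integral_indic// setIT; exact: superlevel_split.
apply: (le_via (\int[mu]_x (marc_cst s1 s2 p * (M * `|f x|) `^ p)%:E)%E).
  apply: int_le.
  - by apply: measurable_sum => i; apply: mfM; [mfun|by []].
  - by mfun.
  move=> x; apply/andP; split.
    by apply: sumr_ge0 => i _; rewrite mulr_ge0 ?powR_ge0//; exact: marc_ge0 kd (a0 _ _).
  by apply: (marc_sum (a := fun i => a (m, i)) (m + m) kd) => //; rewrite mulr_ge0// ltW.
rewrite -intZl.
- apply: le_of_eq; apply: eq_integral => x _.
  by rewrite powRM ?(ltW M0)// mulrA.
- by rewrite mulr_ge0 ?powR_ge0// (marc_cst_ge0 kd).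
- by mfun.
- by [].
Qed.

End strong_type.

(** * Density of test functions *)

Section directional_calculus.
Implicit Types (x v : X) (f g : X -> R) (k : nat).

Lemma is_derive_line f x v (b : R) :
  is_derive x v f b <-> is_derive (0 : R) (1 : R) (fun h : R => f (h *: v + x)) b.
Proof.
have E : (fun h : R => h^-1 *: ((f \o shift x) (h *: v) - f x)) =
    (fun h : R => h^-1 *: (((fun h : R => f (h *: v + x)) \o shift 0) (h *: (1 : R)) - f (0 *: v + x))).
  by apply/funext => h /=; rewrite addr0 scale0r add0r /GRing.scale /= mulr1.
split=> -[D e].
  by split; [rewrite /derivable -E|rewrite /derive -E].
by split; [rewrite /derivable E|rewrite /derive E].
Qed.

Lemma is_derive_comp_line (chi : R -> R) f x v (a b : R) :
  is_derive x v f b -> is_derive (f x) (1 : R) chi a -> is_derive x v (fun y => chi (f y)) (a * b).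
Proof.
move=> /is_derive_line Df Dc; apply/is_derive_line.
have Dc' : is_derive ((fun h : R => f (h *: v + x)) 0) (1 : R) chi a by rewrite scale0r add0r.
by have := @is_derive1_comp _ _ _ _ _ _ Dc' Df.
Qed.

(** Both conditions are listed, since derivability in every direction does not imply continuity in
    several variables. *)
Definition C1 f := continuous f /\ forall x v, derivable f x v.

(** Inductive counterpart of [smooth]: the product, inverse and chain rules express a derivative
    through functions of order one less, so the closure properties follow by induction on [k]. *)
Fixpoint Cdiff k f : Prop :=
  if k is k'.+1 then C1 f /\ forall v, Cdiff k' (fun x => 'D_v f x) else C1 f.

Lemma CdiffS k f : Cdiff k.+1 f -> Cdiff k f.
Proof.
elim: k f => [|k IH] f; first by case.
by move=> [f1 f2]; split => // v; apply: IH; exact: f2.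
Qed.

Lemma smoothP f : smooth f <-> forall k, Cdiff k f.
Proof.
split.
  move=> sf k; elim: k f sf => [|k IH] f sf; first by have := sf [::].
  split; first by have := sf [::].
  by move=> v; apply: IH => vs; have := sf (rcons vs v); rewrite foldr_rcons.
move=> Cf vs; have {Cf} : Cdiff (size vs) f by [].
elim/last_ind: vs f => [|vs v IH] f; first by [].
move=> H g; rewrite /g foldr_rcons; apply: IH; move: H; rewrite size_rcons => -[_]; exact.
Qed.

Lemma C1_cst (c : R) : C1 (fun=> c).
Proof. by split=> [x|x v]; [exact: cst_continuous|by []]. Qed.

Lemma Cdiff_cst k (c : R) : Cdiff k (fun=> c).
Proof.
elim: k c => [|k IH] c; first exact: C1_cst.
split; first exact: C1_cst.
move=> v; rewrite (_ : (fun x => _) = (fun=> 0 : R)); first by [].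
by apply/funext => x; rewrite derive_cst.
Qed.

Lemma CdiffD k f g : Cdiff k f -> Cdiff k g -> Cdiff k (fun x => f x + g x).
Proof.
have H h1 h2 : C1 h1 -> C1 h2 -> C1 (fun x => h1 x + h2 x).
  move=> [c1 d1] [c2 d2]; split=> [x|x v]; first by apply: continuousD; [exact: (c1 x)|exact: (c2 x)].
  exact: derivableD.
elim: k f g => [|k IH] f g; first exact: H.
move=> [f1 f2] [g1 g2]; split; first exact: H.
move=> v; rewrite (_ : (fun x => _) = (fun x => 'D_v f x + 'D_v g x)); first exact: (IH _ _ (f2 v) (g2 v)).
by apply/funext => x; rewrite deriveD//; [exact: f1.2|exact: g1.2].
Qed.

Lemma CdiffM k f g : Cdiff k f -> Cdiff k g -> Cdiff k (fun x => f x * g x).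
Proof.
have H h1 h2 : C1 h1 -> C1 h2 -> C1 (fun x => h1 x * h2 x).
  move=> [c1 d1] [c2 d2]; split=> [x|x v]; first by apply: continuousM; [exact: (c1 x)|exact: (c2 x)].
  exact: derivableM.
elim: k f g => [|k IH] f g; first exact: H.
move=> sf sg; have [f1 f2] := sf; have [g1 g2] := sg; split; first exact: H.
move=> v; rewrite (_ : (fun x => _) = (fun x => f x * 'D_v g x + g x * 'D_v f x)).
  by apply: CdiffD; apply: IH; [exact: CdiffS|exact: g2|exact: CdiffS|exact: f2].
by apply/funext => x; rewrite deriveM//; [exact: f1.2|exact: g1.2].
Qed.

Lemma Cdiff_coord k (i : 'I_n) : Cdiff k (fun x => x ord0 i).
Proof.
have D x v : is_derive x v (fun x : X => x ord0 i) (v ord0 i).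
  apply/is_derive_line.
  rewrite (_ : (fun h : R => _) = (fun h : R => h * v ord0 i + x ord0 i)); last first.
    by apply/funext => h; rewrite !mxE.
  apply: is_derive_eq; by rewrite /GRing.scale /= ?mulr0 ?mulr1 ?add0r ?addr0.
have h : C1 (fun x : X => x ord0 i).
  split; first by move=> x; exact: coord_continuous.
  by [].
case: k => [|k]//.
split => //.
move=> v; rewrite (_ : (fun x => _) = (fun=> v ord0 i)); first exact: Cdiff_cst.
by apply/funext => x; have [_ ->] := D x v.
Qed.

Lemma CdiffV k g : (forall x, g x != 0) -> Cdiff k g -> Cdiff k (fun x => (g x)^-1).
Proof.
move=> g0; have H : C1 g -> C1 (fun x => (g x)^-1).
  move=> [c1 d1]; split=> [x|x v]; first by apply: continuousV; [exact: g0|exact: (c1 x)].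
  by apply: derivableV.
elim: k => [|k IH]; first exact: H.
move=> sg; have [g1 g2] := sg; split; first exact: H.
move=> v; rewrite (_ : (fun x => _) = (fun x => -1 * ((g x)^-1 * (g x)^-1) * 'D_v g x)).
  have iV : Cdiff k (fun x => (g x)^-1) by apply: IH; exact: CdiffS.
  apply: CdiffM; last exact: g2.
  by apply: CdiffM; [exact: Cdiff_cst|exact: CdiffM].
apply/funext => x; rewrite deriveV//; last exact: g1.2.
by rewrite invfM mulN1r.
Qed.

End directional_calculus.

Section test_functions.
Implicit Types (x v : X) (f g u : X -> R) (k : nat).

Lemma flat_comp_derive j g x v : C1 g -> is_derive x v (fun y => flat j (g y))
  ((flat j.+2 (g x) - j%:R * flat j.+1 (g x)) * 'D_v g x).
Proof.
by move=> g1; apply: is_derive_comp_line (flat_derive j (g x)); split => //; exact: g1.2.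
Qed.

Lemma C1_flat j g : C1 g -> C1 (fun x => flat j (g x)).
Proof.
move=> g1; split => [x|x v]; last by have [] := flat_comp_derive j x v g1.
by apply: (continuous_comp (g1.1 x)); exact: flat_continuous.
Qed.

Lemma Cdiff_flat k j g : Cdiff k g -> Cdiff k (fun x => flat j (g x)).
Proof.
elim: k j => [|k IH] j; first exact: C1_flat.
move=> sg; have [g1 g2] := sg; split; first exact: C1_flat.
move=> v; rewrite (_ : (fun x => _) =
  (fun x => (flat j.+2 (g x) + (- j%:R) * flat j.+1 (g x)) * 'D_v g x)); last first.
  by apply/funext => x; have [_ ->] := flat_comp_derive j x v g1; rewrite mulNr.
have sg' := CdiffS sg.
apply: CdiffM; last exact: (g2 v).
apply: CdiffD; first exact: (IH j.+2 sg').
by apply: CdiffM; [exact: Cdiff_cst|exact: (IH j.+1 sg')].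
Qed.

Lemma supp_min f (B : set X) : closed B -> (forall x, f x != 0 -> B x) -> supp f `<=` B.
Proof. by move=> cB fB; rewrite /supp closureE; apply: smallest_sub. Qed.

Lemma supp_in f x : f x != 0 -> supp f x.
Proof. by move=> fx; exact: (@subset_closure _ [set x | f x != 0]). Qed.

Definition vbox (r : R) : set X := [set x | forall i : 'I_n, `[- r, r]%classic (x ord0 i)].

Lemma vbox_compact (r : R) : compact (vbox r).
Proof. by apply: (@rV_compact _ _ (fun=> `[- r, r]%classic)) => i; exact: segment_compact. Qed.

Lemma supp_vbox f (r : R) : (forall x, f x != 0 -> enorm x <= r) -> supp f `<=` vbox r.
Proof.
move=> fr; apply: supp_min.
  by apply: compact_closed; [by []|exact: vbox_compact].
move=> x /fr xr i; rewrite /= in_itv; rewrite -ler_norml.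
by apply: le_trans xr; exact: coord_le_enorm.
Qed.

Lemma test_intro f (r : R) : smooth f -> (forall x, f x != 0 -> enorm x <= r) -> test_function f.
Proof.
move=> sf fr; split=> //; apply: (subclosed_compact _ (@vbox_compact r) (supp_vbox fr)).
exact: closed_closure.
Qed.

Lemma test_support f : test_function f -> exists2 r : R, 0 <= r & forall x, f x != 0 -> enorm x <= r.
Proof.
move=> [_ cf]; have [M [Mr H]] := compact_bounded cf.
have M1 : M < `|M| + 1 by rewrite (le_lt_trans (ler_norm M))// ltrDl.
exists (n%:R * (`|M| + 1)); first by [].
move=> x fx; apply: enorm_le_coord; first by [].
move=> i; have := H _ M1 x (supp_in fx); apply: le_trans.
rewrite /Num.norm /= mx_normrE; exact: (@le_bigmax _ _ _ _ (fun ij => `|x ij.1 ij.2|) (ord0, i)).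
Qed.

Lemma Cdiff_vanish k f x v : ~ supp f x -> 'D_v f x = 0.
Proof.
move=> sx; have : \near x, f x = 0.
  have : nbhs x (~` supp f) by apply: open_nbhs_nbhs; split=> //; exact/closed_openC/closed_closure.
  by apply: filterS => y sy; apply/eqP/negPn/negP => /supp_in.
by move=> h; rewrite (near_eq_derive v h) derive_cst.
Qed.

Lemma compact_support_bounded f : continuous f -> compact (supp f) -> exists2 M : R, 0 <= M & forall x, `|f x| <= M.
Proof.
move=> cf cs; have [[x0 sx0]|s0] := pselect (supp f !=set0); last first.
  exists 0 => // x; have [->|fx] := eqVneq (f x) 0; first by rewrite normr0.
  by exfalso; apply: s0; exists x; exact: supp_in.
have cn : {within supp f, continuous (fun x => `|f x|)}.
  by apply: continuous_subspaceT => y; apply: (continuous_comp (cf y)); exact: norm_continuous.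
have [c _ hc] := EVT_max_rV (ex_intro _ x0 sx0) cs cn.
exists (`|f c|) => // x; have [->|fx] := eqVneq (f x) 0; first by rewrite normr0.
by apply: hc; rewrite inE; exact: supp_in.
Qed.

Lemma derive_bounded f v : test_function f -> exists2 L : R, 0 <= L & forall x, `|'D_v f x| <= L.
Proof.
move=> [sf cf]; have /smoothP C := sf; have [_ /(_ v) [cD _]] := C 1%N.
apply: compact_support_bounded => //.
apply: (subclosed_compact _ cf); first exact: closed_closure.
apply: supp_min; first exact: closed_closure.
move=> x Dx; apply: contrapT => sx; move/eqP: Dx; apply; exact: (@Cdiff_vanish 0).
Qed.

Lemma segment_mvt f v (L : R) : C1 f -> 0 <= L -> (forall x, `|'D_v f x| <= L) ->
  forall x (t : R), `|f (t *: v + x) - f x| <= L * `|t|.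
Proof.
move=> f1 L0 DL x t.
have Dh (h : R) : is_derive h (1 : R) (fun h : R => f (h *: v + x)) ('D_v f (h *: v + x)).
  have /is_derive_line : is_derive (h *: v + x) v f ('D_v f (h *: v + x)) by split => //; exact: f1.2.
  move=> [D e]; have E : (fun k : R => k^-1 *: (((fun h : R => f (h *: v + x)) \o shift h) (k *: (1 : R)) - f (h *: v + x)))
     = (fun k : R => k^-1 *: (((fun k : R => f (k *: v + (h *: v + x))) \o shift 0) (k *: (1 : R)) - f (0 *: v + (h *: v + x)))).
    apply/funext => k /=; rewrite addr0 scale0r add0r.
    by rewrite ?scalerDl ?addrA.
  by split; [rewrite /derivable E|rewrite /derive E].
have cont (A : set R) : {within A, continuous (fun h : R => f (h *: v + x))}.
  apply: continuous_subspaceT => h; apply: differentiable_continuous; apply/derivable1_diffP.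
  by [].
have [t0|t0] := leP 0 t.
  have [c _ e] := MVT_segment t0 (fun h _ => Dh h) (cont _).
  move: e; rewrite scale0r add0r subr0 => ->; rewrite normrM; apply: ler_wpM2r => //; exact: DL.
have [c _ e] := MVT_segment (ltW t0) (fun h _ => Dh h) (cont _).
move: e; rewrite scale0r add0r sub0r distrC => ->; rewrite normrM normrN; apply: ler_wpM2r => //; exact: DL.
Qed.

Lemma test_lipschitz f : test_function f -> lipschitz_rV f.
Proof.
move=> tf; have /smoothP/(_ 0%N) f1 := tf.1.
have /choice[L hL] : forall i : 'I_n, exists L : R, 0 <= L /\ forall x, `|'D_(delta_mx ord0 i) f x| <= L.
  by move=> i; have [L L0 h] := derive_bounded (delta_mx ord0 i) tf; exists L.
exists (\sum_i L i); first by apply: sumr_ge0 => i _; have [] := hL i.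
(* The path from [y] to [x] changes one coordinate at a time, so that only the bounds on the partial
   derivatives are used. *)
move=> x y; pose z k : X := \row_i (if (i < k)%N then x ord0 i else y ord0 i).
have zn : z n = x by apply/rowP => i; rewrite mxE ltn_ord.
have z0 : z 0%N = y by apply/rowP => i; rewrite mxE.
have zS (i : 'I_n) : z i.+1 = (x ord0 i - y ord0 i) *: delta_mx ord0 i + z i.
  apply/rowP => j; rewrite !mxE /=; have [->|ji] := eqVneq j i.
    by rewrite leqnn ltnn mulr1 subrK.
  by rewrite mulr0 add0r ltnS leq_eqVlt (inj_eq val_inj) (negPf ji).
rewrite -{1}zn -{1}z0 -(telescope_sumr (fun k => f (z k)) (leq0n n)) big_mkord.
apply: (le_trans (ler_norm_sum _ _ _)); rewrite mulr_suml; apply: ler_sum => i _.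
rewrite zS; have [L0 Li] := hL i; apply: (le_trans (segment_mvt f1 L0 Li _ _)).
apply: ler_wpM2l => //; apply: le_trans (coord_le_enorm _ i); by rewrite !mxE.
Qed.

Lemma test_Lipc f : test_function f -> Lipc f.
Proof.
move=> tf; split; last exact: test_lipschitz.
have cf : continuous f by have /smoothP/(_ 0%N)[] := tf.1.
have [M M0 fM] := compact_support_bounded cf tf.2.
have [r r0 fr] := test_support tf.
by apply: (@Linfc_intro _ M r) => //; exact: continuous_measurable_rV.
Qed.

Lemma testD f g (c : R) : test_function f -> test_function g -> test_function (fun x => f x + c * g x).
Proof.
move=> tf tg; have [r r0 fr] := test_support tf; have [r' r'0 gr] := test_support tg.
apply: (@test_intro _ (r + r')).
  apply/smoothP => k; apply: CdiffD; first by have /smoothP := tf.1.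
  by apply: CdiffM; [exact: Cdiff_cst|have /smoothP := tg.1].
move=> x; have [f0|f0] := eqVneq (f x) 0; have [g0|g0] := eqVneq (g x) 0.
- by rewrite f0 g0 mulr0 addr0 eqxx.
- by move=> _; apply: (le_trans (gr x g0)); rewrite lerDr.
- by move=> _; apply: (le_trans (fr x f0)); rewrite lerDl.
- by move=> _; apply: (le_trans (fr x f0)); rewrite lerDl.
Qed.

Lemma testM f g : smooth f -> test_function g -> test_function (fun x => f x * g x).
Proof.
move=> sf tg; have [r r0 gr] := test_support tg.
apply: (@test_intro _ r).
  by apply/smoothP => k; apply: CdiffM; [have /smoothP := sf|have /smoothP := tg.1].
by move=> x; rewrite mulf_eq0 negb_or => /andP[_ /gr].
Qed.

(** A smooth map into $[-1,1]$ that fixes 0 and 1. Composed with a test function it gives a test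
    function bounded by 1, and the distance to an indicator at most doubles. *)
Definition smooth_clip (t : R) : R := 2 * t * (1 + t ^+ 2)^-1.

Lemma smooth_clip_le t : `|smooth_clip t| <= 1.
Proof.
have p : 0 < 1 + t ^+ 2 by rewrite ltr_pwDl// sqr_ge0.
rewrite normrM [`|_^-1|]gtr0_norm ?invr_gt0// ler_pdivrMr// mul1r ler_norml.
have := sqr_ge0 (t - 1); have := sqr_ge0 (t + 1); rewrite sqrrB sqrrD !mulr1 expr1n.
move: (t ^+ 2) => w; clear -t; move: t => a; lra.
Qed.

Lemma smooth_clip_lipschitz t (b : bool) : `|b%:R - smooth_clip t| <= 2 * `|b%:R - t|.
Proof.
have p : 0 < 1 + t ^+ 2 by rewrite ltr_pwDl// sqr_ge0.
case: b.
  rewrite /smooth_clip (_ : true%:R = 1)//.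
  rewrite (_ : 1 - _ = (1 - t) * ((1 - t) / (1 + t ^+ 2))); last first.
    by field; rewrite gt_eqF.
  rewrite normrM [leRHS]mulrC; apply: ler_wpM2l => //.
  rewrite normrM [`|_^-1|]gtr0_norm ?invr_gt0// ler_pdivrMr// ler_norml.
  have := sqr_ge0 (t - 1); have := sqr_ge0 (t + 1); rewrite sqrrB sqrrD !mulr1 expr1n.
  move: (t ^+ 2) (sqr_ge0 t) => w; clear -t; move: t => a; lra.
rewrite !sub0r !normrN normrM normrM ger0_norm//.
rewrite [`|_^-1|]gtr0_norm ?invr_gt0// ler_pdivrMr// ler_peMr ?mulr_ge0//.
by rewrite lerDl sqr_ge0.
Qed.

Lemma test_clip f : test_function f -> test_function (fun x => smooth_clip (f x)).
Proof.
move=> tf; rewrite (_ : (fun x => _) = (fun x => (2 * (1 + f x * f x)^-1) * f x)); last first.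
  by apply/funext => x; rewrite mulrAC.
apply: testM => //; apply/smoothP => k; have /smoothP/(_ k) Cf := tf.1.
apply: CdiffM; first exact: Cdiff_cst.
apply: CdiffV => [x|]; first by rewrite gt_eqF// ltr_pwDl// sqr_ge0.
by apply: CdiffD; [exact: Cdiff_cst|exact: CdiffM].
Qed.

Definition box_bump (a b : 'I_n -> R) (m : R) x : R :=
  \prod_i (flat 0 (m * (x ord0 i - a i)) * flat 0 (m * (b i - x ord0 i))).

Definition obox (a b : 'I_n -> R) : set X := [set x | forall i, a i < x ord0 i < b i].

Lemma bump_outside a b (m : R) x : 0 < m -> ~ obox a b x -> box_bump a b m x = 0.
Proof.
move=> m0 /existsNP[i /negP]; rewrite negb_and -!leNgt => h.
rewrite /box_bump (bigD1 i)//=; case/orP: h => h.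
  by rewrite (flat_npos 0 (x := m * (x ord0 i - a i))) ?mul0r// pmulr_rle0// subr_le0.
by rewrite (flat_npos 0 (x := m * (b i - x ord0 i))) ?mulr0 ?mul0r// pmulr_rle0// subr_le0.
Qed.

Lemma flat01 (t : R) : 0 <= flat 0 t <= 1.
Proof.
rewrite flat_ge0 /= /flat; case: ifPn => // t0; rewrite mul1r.
by rewrite -expR0 ler_expR oppr_le0 invr_ge0 ltW.
Qed.

Lemma bump01 a b (m : R) x : 0 <= box_bump a b m x <= 1.
Proof.
rewrite /box_bump; apply/andP; split.
  by apply: prodr_ge0 => i _; rewrite mulr_ge0 ?flat_ge0.
apply: prodr_ile1 => i _; rewrite mulr_ge0 ?flat_ge0//=.
by have /andP[? ?] := flat01 (m * (x ord0 i - a i)); have /andP[? ?] := flat01 (m * (b i - x ord0 i)); rewrite mulr_ile1.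
Qed.

Lemma bump_gt0 a b (m : R) x : 0 < m -> obox a b x -> 0 < box_bump a b m x.
Proof.
move=> m0 h; apply: prodr_gt0 => i _; have /andP[h1 h2] := h i.
have F (t : R) : 0 < t -> 0 < flat 0 t by move=> t0; rewrite /flat t0 mulr_gt0 ?expR_gt0.
by apply: mulr_gt0; apply: F; rewrite mulr_gt0// subr_gt0.
Qed.

Lemma bump_test a b (m : R) : 0 < m -> test_function (box_bump a b m).
Proof.
move=> m0; apply: (@test_intro _ (n%:R * \sum_i (`|a i| + `|b i|))).
  apply/smoothP => k; rewrite /box_bump.
  elim: (index_enum _) => [|i S IH].
    by under eq_fun do rewrite big_nil; exact: Cdiff_cst.
  under eq_fun do rewrite big_cons; apply: CdiffM => //.
  by apply: CdiffM; apply: Cdiff_flat; (apply: CdiffM; first exact: Cdiff_cst);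
    apply: CdiffD; do ?[exact: Cdiff_cst|exact: Cdiff_coord];
    rewrite (_ : (fun x => - _) = (fun x => -1 * x ord0 i)); do ?[by apply/funext => x; rewrite mulN1r];
    apply: CdiffM; [exact: Cdiff_cst|exact: Cdiff_coord].
move=> x hx; have {}hx : obox a b x by apply: contrapT => /(bump_outside m0) h; rewrite h eqxx in hx.
have s0 : 0 <= \sum_i (`|a i| + `|b i|) by apply: sumr_ge0 => i _; rewrite addr_ge0.
apply: enorm_le_coord => // i; apply: (le_via (`|a i| + `|b i|)).
  have /andP[h1 h2] := hx i; rewrite ler_norml.
  have := ler_norm (b i); have := ler_norm (- a i); have := normr_ge0 (a i); have := normr_ge0 (b i).
  rewrite normrN; move: h1 h2; move: (x ord0 i) (a i) (b i) `|a i| `|b i| => v A B A' B'.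
  by clear => *; lra.
by rewrite (bigD1 i)//= lerDl; apply: sumr_ge0 => j _; rewrite addr_ge0.
Qed.

Lemma bump_cvg a b x : box_bump a b (k.+1%:R) x @[k --> \oo] --> (\1_(obox a b) x : R).
Proof.
have [h|h] := pselect (obox a b x); last first.
  rewrite indicE memNset// (_ : (fun k => _) = (fun=> 0)); first exact: cvg_cst.
  by apply/funext => k; rewrite bump_outside.
rewrite indicE mem_set//.
have H (y : R) : 0 < y -> flat 0 (k.+1%:R * y) @[k --> \oo] --> (1 : R).
  move=> y0; rewrite (_ : (fun k => _) = (fun k => expR (- (y^-1 * k.+1%:R^-1)))); last first.
    by apply/funext => k; rewrite /flat mulr_gt0// mul1r invfM mulrC.
  rewrite -[X in _ --> X]expR0; apply: continuous_cvg; first exact: continuous_expR.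
  rewrite -[X in _ --> X]oppr0; apply: cvgN; rewrite -[X in _ --> X](mulr0 y^-1).
  by apply: cvgM; [exact: cvg_cst|exact: cvg_harmonic].
rewrite /box_bump; elim: (index_enum _) => [|i S IH].
  by under eq_fun do rewrite big_nil; exact: cvg_cst.
under eq_fun do rewrite big_cons; rewrite (_ : true%:R = 1 * 1 * 1); last by rewrite !mulr1.
have /andP[h1 h2] := h i.
by apply: cvgM => //; apply: cvgM; apply: H; rewrite subr_gt0.
Qed.

End test_functions.

Section density.
Implicit Types (x v : X) (f g u : X -> R) (k : nat).

Lemma test0 : test_function ((fun=> 0) : X -> R).
Proof.
by apply: (@test_intro _ 0) => [|x]; [apply/smoothP => k; exact: Cdiff_cst|rewrite eqxx].
Qed.

Lemma test_mf u : test_function u -> meas u.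
Proof. by move=> tu; exact: Linfc_mf (test_Lipc tu).1. Qed.

Definition cubeN (N : R) : set X := obox (fun=> - N) (fun=> N).

Lemma obox_measurable (a b : 'I_n -> R) : measurable (obox a b : set X).
Proof.
rewrite (_ : obox a b = \bigcap_(i in [set: 'I_n]) (fun x : X => x ord0 i) @^-1` `]a i, b i[%classic).
  apply: fin_bigcap_measurable => // i _; rewrite -[X in measurable X]setTI; exact: measurable_coord.
by apply/seteqP; split => [x h i _|x h i]; [rewrite /=; exact: h|have := h i I; rewrite /=].
Qed.

Lemma mu_cubeN (N : R) : 0 <= N -> (mu (cubeN N) < +oo)%E.
Proof.
move=> N0; apply: (le_lt_trans _ (mu_cball_lty (0 : X) (n%:R * N))).
apply: le_measure; [by rewrite inE; exact: obox_measurable|by rewrite inE; exact: meas_cball|].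
move=> x h; rewrite /cball /= subr0; apply: enorm_le_coord => // i.
by rewrite ler_norml; have /andP[h1 h2] := h i; rewrite !ltW.
Qed.

Lemma int_cubeN (N : R) : 0 <= N -> (\int[mu]_x (\1_(cubeN N) x)%:E < +oo)%E.
Proof.
by move=> N0; rewrite integral_indic ?setIT//; [exact: mu_cubeN|exact: obox_measurable].
Qed.

Definition l1_approx (N : R) (A : set X) : Prop := measurable A /\ forall e : R, 0 < e ->
  exists2 u, test_function u & (\int[mu]_x (`|\1_(A `&` cubeN N) x - u x|)%:E <= e%:E)%E.

Lemma indic_le (A B : set X) x : A `<=` B -> (\1_A x : R) <= \1_B x.
Proof.
move=> AB; rewrite !indicE; case: (boolP (x \in A)) => // /set_mem /AB xB.
by rewrite mem_set.
Qed.

Lemma indic01 (A : set X) x : 0 <= (\1_A x : R) <= 1.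
Proof. by rewrite indicE; case: (x \in A); rewrite ?lexx ler01. Qed.

Lemma l1_approx_obox (N : R) (a b : 'I_n -> R) (A : set X) : 0 <= N -> measurable A ->
  A `&` cubeN N = obox a b -> l1_approx N A.
Proof.
move=> N0 mA AE; split=> // e e0; rewrite AE.
have mI : meas (\1_(obox a b) : X -> R) by apply: mfindic; exact: obox_measurable.
have mB k : meas (box_bump a b k.+1%:R : X -> R) by apply: test_mf; exact: bump_test.
have [||||||K hK] := @dominated_vanish _ _ _ mu (fun k x => \1_(obox a b) x - box_bump a b k.+1%:R x) (\1_(cubeN N)) e.
- by move=> k; apply: mfB.
- by move=> x; rewrite -[X in _ --> X](subrr (\1_(obox a b) x)); apply: cvgB; [exact: cvg_cst|exact: bump_cvg].
- by apply: mfindic; exact: obox_measurable.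
- move=> k x; have [h|h] := pselect (obox a b x).
    have /andP[h0 h1] := bump01 a b k.+1%:R x.
    have hN : cubeN N x by move: h; rewrite -AE => -[].
    by rewrite !indicE !mem_set//= ger0_norm ?subr_ge0// lerBlDr lerDl.
  by rewrite bump_outside// subr0 indicE memNset// normr0; have /andP[] := indic01 (cubeN N) x.
- exact: int_cubeN.
- exact: e0.
by exists (box_bump a b K.+1%:R); [exact: bump_test|exact: (hK K)].
Qed.

(** These sets form a generating family, closed under intersection, whose members meet a cube
    [cubeN N] in an open box. *)
Definition corner (a : 'I_n -> R) : set X := [set x | forall i, a i < x ord0 i].

Lemma corner_measurable a : measurable (corner a).
Proof.
rewrite (_ : corner a = \bigcap_(i in [set: 'I_n]) (fun x : X => x ord0 i) @^-1` `]a i, +oo[%classic).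
  apply: fin_bigcap_measurable => // i _; rewrite -[X in measurable X]setTI; exact: measurable_coord.
by apply/seteqP; split => [x h i _|x h i]; [rewrite /= in_itv andbT; exact: h|have := h i I; rewrite /= in_itv andbT].
Qed.

Definition corners : set (set X) := [set A | exists a, A = corner a].

Lemma corners_setI : setI_closed corners.
Proof.
move=> _ _ [a ->] [b ->]; exists (fun i => Num.max (a i) (b i)).
apply/seteqP; split=> [x [ha hb] i|x h]; first by rewrite gt_max ha hb.
by split=> i; have := h i; rewrite gt_max => /andP[].
Qed.

Lemma corners_generate : (measurable : set (set X)) `<=` <<s corners >>.
Proof.
apply: smallest_sub; first by [].
rewrite -bigcup_seq /=; apply: bigcup_sub => i _.
have H : meas (fun x : g_sigma_algebraType corners => (x : X) ord0 i : R).
  apply: (measurability _ (RGenOInfty.measurableE R)).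
  move=> _ [_ [t ->] <-]; rewrite setTI.
  (* A half-space is exhausted by corners whose other coordinates are bounded below by $-m$. *)
  rewrite (_ : _ @^-1` _ = \bigcup_m corner (fun j => if j == i then t else - m%:R)).
    apply: bigcupT_measurable => m; apply: sub_sigma_algebra; by eexists.
  apply/seteqP; split=> x /=.
    rewrite in_itv /= andbT => tx.
    have [m hm] : exists m : nat, enorm x < m%:R.
      by exists (Num.bound (enorm x)); apply: archi_boundP; exact: enorm_ge0.
    exists m => // j; case: eqP => [->//|_].
    rewrite ltrNl; apply: le_lt_trans hm; apply: le_trans (coord_le_enorm x j).
    by rewrite -normrN ler_norm.
  by move=> [m _ /(_ i)]; rewrite eqxx in_itv andbT.
by move=> _ [B mB <-]; exact: H.
Qed.

(** Dynkin's theorem: sets whose trace on the cube is an $L^1$ limit of test functions include the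
    corners and are stable under proper differences and increasing unions. The trace keeps all
    measures finite. *)
Lemma measurable_l1_approx (N : R) (A : set X) : 0 <= N -> measurable A -> l1_approx N A.
Proof.
move=> N0 mA; have := corners_generate mA.
have mC := obox_measurable (fun=> - N) (fun=> N).
have mI B : measurable B -> meas (\1_(B `&` cubeN N) : X -> R).
  by move=> mB; apply: mfindic; exact: measurableI.
apply: (lambda_system_subset corners_setI) => //; last first.
  move=> _ [a ->]; apply: (@l1_approx_obox _ (fun i => Num.max (a i) (- N)) (fun=> N)) => //.
    exact: corner_measurable.
  apply/seteqP; split=> [x [h1 h2] i|x h].
    by have /andP[h3 h4] := h2 i; rewrite gt_max h1 h3.
  by split=> i; have /andP[] := h i; rewrite gt_max => /andP[h1 h2] h3; rewrite ?h2.
split=> //.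
- by apply: (l1_approx_obox N0 measurableT); rewrite setTI.
- move=> B C CB [mB hB] [mC' hC]; split; first exact: measurableD.
  move=> e e0; have e2 : 0 < e / 2 by rewrite divr_gt0.
  have [u tu hu] := hB _ e2; have [w tw hw] := hC _ e2.
  exists (fun x => u x + -1 * w x); first exact: testD.
  rewrite [e]splitr; have mu' := test_mf tu; have mw := test_mf tw.
  apply: (le_via (\int[mu]_x (`|\1_(B `&` cubeN N) x - u x| + `|\1_(C `&` cubeN N) x - w x|)%:E)%E).
    have mD := mI _ (measurableD mB mC'); have mB' := mI _ mB; have mC'' := mI _ mC'.
    apply: int_le; [by mfun|by mfun|] => x; rewrite normr_ge0 /=.
    rewrite (_ : _ - _ = (\1_(B `&` cubeN N) x - u x) - (\1_(C `&` cubeN N) x - w x)) ?ler_normB//.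
    suff -> : (\1_((B `\` C) `&` cubeN N) x : R) = \1_(B `&` cubeN N) x - \1_(C `&` cubeN N) x by ring.
    rewrite !indicE !in_setI; have [xC|xC] := pselect (C x).
      by rewrite (mem_set xC) (mem_set (CB _ xC)) memNset ?subrr// => -[].
    rewrite (memNset xC) (mem_set (xC : (fun y => ~ C y) x)) andbT subr0//.
  have mB' := mI _ mB; have mC'' := mI _ mC'; by apply: intD_le; mfun.
move=> F ndF hF; have mF k : measurable (F k) by have [] := hF k.
have mUF : measurable (\bigcup_k F k) by exact: bigcup_measurable.
split=> // e e0; have e2 : 0 < e / 2 by rewrite divr_gt0.
have [||||||K hK] := @dominated_vanish _ _ _ mu (fun k x => \1_(\bigcup_k F k `&` cubeN N) x - \1_(F k `&` cubeN N) x) (\1_(cubeN N)) (e / 2).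
- by move=> k; apply: mfB; exact: mI.
- move=> x; apply: cvg_near_cst.
  have [[k _ Fk]|h] := pselect ((\bigcup_k F k) x); last first.
    apply: nearW => k; rewrite !indicE !in_setI memNset// (memNset (A := F k)) ?subrr// => Fk.
    by apply: h; exists k.
  exists k => // j /= kj; rewrite !indicE !in_setI mem_set; last by exists k.
  have Fj : F j x by have := ndF _ _ kj => /subsetPset /(_ x Fk).
  by rewrite (_ : (x \in F j) = true) ?subrr//; exact: mem_set.
- by [].
- move=> k x; have /andP[a0 a1] := indic01 (F k `&` cubeN N) x.
  have h1 : (\1_(F k `&` cubeN N) x : R) <= \1_(\bigcup_k F k `&` cubeN N) x.
    by apply: indic_le; apply: setSI => y Fy; exists k.
  have h2 : (\1_(\bigcup_k F k `&` cubeN N) x : R) <= \1_(cubeN N) x by apply: indic_le; by [].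
  by rewrite ger0_norm ?subr_ge0//; apply: le_trans h2; rewrite lerBlDr lerDl.
- exact: int_cubeN.
- exact: e2.
have [_ /(_ _ e2)[u tu hu]] := hF K; exists u => //.
by rewrite [e]splitr; apply: l1_triangle (hK K (leqnn K)) hu; [exact: mI|exact: mI|exact: test_mf].
Qed.

Lemma indic_unit_approx (N e : R) (A : set X) : 0 <= N -> measurable A -> 0 < e ->
  exists u, [/\ test_function u, forall x, `|u x| <= 1 &
    (\int[mu]_x (`|\1_(A `&` cubeN N) x - u x|)%:E <= e%:E)%E].
Proof.
move=> N0 mA e0; have e2 : 0 < e / 2 by rewrite divr_gt0.
have [_ /(_ _ e2)[u tu hu]] := measurable_l1_approx N0 mA.
exists (fun x => smooth_clip (u x)); split; [exact: test_clip|by move=> x; exact: smooth_clip_le|].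
have mu' := test_mf tu; have mc := test_mf (test_clip tu).
have mI : meas (\1_(A `&` cubeN N) : X -> R).
  by apply: mfindic; apply: measurableI => //; exact: obox_measurable.
apply: (le_via (\int[mu]_x (2 * `|\1_(A `&` cubeN N) x - u x|)%:E)%E).
  apply: int_le; [by mfun|by mfun|] => x; rewrite normr_ge0 /= indicE.
  exact: smooth_clip_lipschitz.
rewrite (_ : e = 2 * (e / 2)); last by rewrite mulrC divfK.
by apply: intZl_le; mfun.
Qed.

(** Binary expansion: with $A=\{f\ge\frac12\}$, on the cube $f=\frac12(1_A+f')$ where [f'] again has
    values in $[0,1]$. Each step approximates one digit and halves the remainder, and averaging
    preserves the bound $|u|\le1$. *)
Lemma unit_approx (m : nat) (N e : R) f : 0 <= N -> 0 < e -> meas f ->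
  (forall x, 0 <= f x <= \1_(cubeN N) x) ->
  exists u, [/\ test_function u, forall x, `|u x| <= 1 &
    (\int[mu]_x (`|f x - u x|)%:E <= (e + 2^-1 ^+ m * fine (mu (cubeN N)))%:E)%E].
Proof.
move=> N0; have mC : measurable (cubeN N) by exact: obox_measurable.
elim: m e f => [|m IH] e f e0 mf f01.
  exists (fun=> 0); split; [|by move=> x; rewrite normr0|].
    exact: test0.
  apply: (le_via (\int[mu]_x (\1_(cubeN N) x)%:E)%E).
    apply: int_le; [mfun|by []|] => x; rewrite normr_ge0 subr0 ger0_norm.
      by have /andP[] := f01 x.
    by have /andP[] := f01 x.
  rewrite integral_indic// setIT mul1r -[leLHS]fineK ?lee_fin ?lerDr ?(ltW e0)//.
  by rewrite ge0_fin_numE//; exact: mu_cubeN.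
have [A AE] : exists A : set X, A = [set x | 2^-1 <= f x] by eexists.
have mA : measurable A by rewrite AE; apply: mf_le; by [].
have mI : meas (\1_(A `&` cubeN N) : X -> R).
  by apply: mfindic; exact: measurableI.
have [w [tw w1 hw]] := indic_unit_approx N0 mA e0.
have [f' f'E] := ex_fun (fun x => 2 * f x - \1_(A `&` cubeN N) x).
have mf' : meas f' by rewrite (funext f'E); mfun.
have [|u [tu u1 hu]] := IH e f' e0 mf'.
  move=> x; rewrite f'E; have /andP[h0 h1] := f01 x; move: h1; rewrite !indicE in_setI.
  rewrite (_ : (x \in A) = (2^-1 <= f x)); last by rewrite AE; apply/idP/idP => [/set_mem//|h]; exact: mem_set.
  case: (x \in cubeN N); case: (leP 2^-1 (f x)) => /= h2 h1; move: h0 h1 h2; clear; lra.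
exists (fun x => 0 + 2^-1 * (w x + 1 * u x)); split.
- apply: testD; last exact: testD.
  exact: test0.
- move=> x; have := w1 x; have := u1 x; move: (w x) (u x) => a b; clear.
  rewrite !ler_norml => /andP[? ?] /andP[? ?]; apply/andP; split; lra.
have mw := test_mf tw; have mu' := test_mf tu.
apply: (le_via (\int[mu]_x (2^-1 * `|\1_(A `&` cubeN N) x - w x| + 2^-1 * `|f' x - u x|)%:E)%E).
  apply: int_le; [mfun|mfun|] => x; rewrite normr_ge0 /= f'E.
  rewrite (_ : f x - _ = 2^-1 * (\1_(A `&` cubeN N) x - w x) + 2^-1 * (2 * f x - \1_(A `&` cubeN N) x - u x)).
    by apply: (le_trans (ler_normD _ _)); rewrite !normrM ger0_norm.
  by field.
rewrite (_ : e + _ = 2^-1 * e + 2^-1 * (e + 2^-1 ^+ m * fine (mu (cubeN N)))).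
  by apply: intD_le; [mfun|mfun|by []|by []| |]; apply: intZl_le; mfun.
by rewrite exprS; field.
Qed.

Lemma Linfc_cubeN f : Linfc f -> exists2 N : R, 0 <= N & forall x, f x != 0 -> cubeN N x.
Proof.
move=> lf; have [r r0 fr] := Linfc_support lf; exists (r + 1); first by nneg.
move=> x /fr xr i; rewrite -ltr_norml; apply: (le_lt_trans (coord_le_enorm x i)).
by apply: (le_lt_trans xr); rewrite ltrDl.
Qed.

Lemma half_pow_small (V e : R) : 0 < e -> exists m : nat, 2^-1 ^+ m * V <= e.
Proof.
move=> e0; have V0 : 0 <= `|V| / e by nneg.
exists (Num.bound (`|V| / e)); set m := Num.bound _.
have h : `|V| / e < 2 ^+ m.
  apply: (lt_trans (archi_boundP V0)); rewrite -natrX ltr_nat; exact: ltn_expl.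
apply: (le_via (2^-1 ^+ m * `|V|)).
  by rewrite ler_wpM2l ?ler_norm.
by rewrite exprVn mulrC ler_pdivrMr ?exprn_gt0// mulrC -ler_pdivrMr// ltW.
Qed.

Lemma unit_approx_small (N e : R) f : 0 <= N -> 0 < e -> meas f ->
  (forall x, 0 <= f x <= \1_(cubeN N) x) ->
  exists u, [/\ test_function u, forall x, `|u x| <= 1 & (\int[mu]_x (`|f x - u x|)%:E <= e%:E)%E].
Proof.
move=> N0 e0 mf f01; have e2 : 0 < e / 2 by rewrite divr_gt0.
have [m hm] := half_pow_small (fine (mu (cubeN N))) e2.
have [u [tu u1 hu]] := unit_approx m N0 e2 mf f01.
exists u; split => //; apply: (le_trans hu); rewrite lee_fin [leRHS]splitr lerD2l.
exact: hm.
Qed.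

(** The bound [B] does not depend on [e]; this is what turns closeness in $L^1$ into closeness in
    every $L^p$. *)
Lemma Linfc_approx f : Linfc f -> exists2 B : R, 0 < B & (forall x, `|f x| <= B) /\
  forall e : R, 0 < e -> exists u, [/\ test_function u, forall x, `|u x| <= B &
    (\int[mu]_x (`|f x - u x|)%:E <= e%:E)%E].
Proof.
move=> lf; have mf := Linfc_mf lf.
have [N N0 fN] := Linfc_cubeN lf; have [M M0 fM] := Linfc_bounded lf.
have L0 : 0 < M + 1 by rewrite ltr_pwDr.
exists (2 * (M + 1)); first by rewrite mulr_gt0.
split.
  move=> x; apply: (le_trans (fM x)); move: M0; clear; lra.
move=> e e0; pose L := M + 1; have e' : 0 < e / (2 * L) by rewrite divr_gt0// mulr_gt0.
have U (g : X -> R) : meas g -> (forall x, `|g x| <= `|f x|) ->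
    meas (fun x => Num.max (g x) 0 / L) /\ forall x, 0 <= Num.max (g x) 0 / L <= \1_(cubeN N) x.
  move=> mg gf; split; first by mfun.
  move=> x; rewrite divr_ge0 ?le_max ?lexx ?orbT ?(ltW L0)//= indicE.
  have [xN|xN] := pselect (cubeN N x).
    rewrite mem_set// ler_pdivrMr// mul1r ge_max (ltW L0) andbT.
    apply: (le_trans (ler_norm _)); apply: (le_trans (gf x)); apply: (le_trans (fM x)).
    by rewrite lerDl.
  rewrite memNset//; have f0 : f x = 0 by apply/eqP/negPn/negP => /fN.
  have := gf x; rewrite f0 normr0 normr_le0 => /eqP ->.
  by rewrite max_l// mul0r.
have [m1 h1] := U f mf (fun x => lexx _).
have [m2 h2] := U (fun x => - f x) (mfN mf) (fun x => ltac:(by rewrite normrN)).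
have [u [tu u1 hu]] := unit_approx_small N0 e' m1 h1.
have [w [tw w1 hw]] := unit_approx_small N0 e' m2 h2.
have mu' := test_mf tu; have mw := test_mf tw.
exists (fun x => 0 + L * (u x + -1 * w x)); split.
- by apply: testD; [exact: test0|exact: testD].
- move=> x; rewrite add0r normrM gtr0_norm// [leRHS]mulrC ler_pM2l//.
  have := u1 x; have := w1 x; rewrite !ler_norml; move: (u x) (w x) => a b; clear.
  move=> /andP[? ?] /andP[? ?]; apply/andP; split; lra.
apply: (le_via (\int[mu]_x (L * `|Num.max (f x) 0 / L - u x| + L * `|Num.max (- f x) 0 / L - w x|)%:E)%E).
  apply: int_le; [mfun|mfun|] => x; rewrite normr_ge0 /=.
  have E : f x - (0 + L * (u x + -1 * w x)) = L * (Num.max (f x) 0 / L - u x) - L * (Num.max (- f x) 0 / L - w x).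
    have -> : f x - (0 + L * (u x + -1 * w x)) = Num.max (f x) 0 - Num.max (- f x) 0 - L * (u x - w x).
      rewrite add0r mulN1r; congr (_ - _); have [f0|f0] := leP (f x) 0.
        by rewrite max_l ?sub0r ?opprK// oppr_ge0.
      by rewrite max_r ?subr0// oppr_le0 ltW.
    have L1 : L != 0 by rewrite gt_eqF.
    by field.
  by rewrite E; apply: (le_trans (ler_normB _ _)); rewrite !normrM (gtr0_norm L0).
have L00 := ltW L0.
rewrite (_ : e = L * (e / (2 * L)) + L * (e / (2 * L))).
  by apply: intD_le; [mfun|mfun|by nneg|by nneg| |]; apply: intZl_le; mfun.
have L1 : L != 0 by rewrite gt_eqF.
by field.
Qed.

Definition Lp (p : R) f := meas f /\ (\int[mu]_x (`|f x| `^ p)%:E < +oo)%E.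

Definition trunc f k x : R := f x * (\1_(cball 0 k%:R) x * (`|f x| <= k%:R)%R%:R).

Lemma mf_trunc f k : meas f -> meas (trunc f k).
Proof.
move=> mf; have mA : measurable [set x | `|f x| <= k%:R] by apply: mf_le; mfun.
rewrite (_ : trunc f k = fun x => f x * (\1_(cball 0 k%:R) x * \1_[set x | `|f x| <= k%:R] x)).
  by apply: mfM => //; apply: mfM; apply: mfindic => //; exact: meas_cball.
apply/funext => x; rewrite /trunc; congr (_ * (_ * _)); rewrite indicE.
by congr (_%:R); congr nat_of_bool; apply/idP/idP => [h|/set_mem//]; exact: mem_set.
Qed.

Lemma trunc_Linfc f k : meas f -> Linfc (trunc f k).
Proof.
move=> mf; apply: (@Linfc_intro _ k%:R k%:R); first exact: mf_trunc.
  move=> x; rewrite /trunc; have [h|h] := boolP (`|f x| <= k%:R); last by rewrite !mulr0 normr0.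
  rewrite mulr1 normrM indicE; case: (x \in _); first by rewrite normr1 mulr1.
  by rewrite normr0 mulr0.
move=> x; rewrite /trunc indicE; case: (boolP (x \in _)) => [/set_mem|]; last by rewrite mul0r mulr0 eqxx.
by rewrite /cball /= subr0.
Qed.

Lemma trunc_error f k x : `|f x - trunc f k x| <= `|f x|.
Proof.
by rewrite /trunc indicE; case: (x \in _); case: (`|f x| <= k%:R); rewrite ?mulr1 ?mulr0 ?subr0 ?subrr ?normr0.
Qed.

Lemma trunc_eventually f x : \forall k \near \oo, trunc f k x = f x.
Proof.
exists (Num.bound (enorm x + `|f x|)) => // k /= hk.
have h0 : 0 <= enorm x + `|f x| by nneg.
have h : enorm x + `|f x| <= k%:R.
  by apply: (le_trans (ltW (archi_boundP h0))); rewrite ler_nat.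
rewrite /trunc indicE mem_set; last first.
  by rewrite /cball /= subr0; apply: le_trans h; rewrite lerDl.
by rewrite (_ : (_ <= _)%R = true) ?mulr1//; apply: le_trans h; rewrite lerDr enorm_ge0.
Qed.

Lemma trunc_Lp (p e : R) f : 0 < p -> Lp p f -> 0 < e ->
  exists N : nat, forall k, (N <= k)%N -> (\int[mu]_x (`|f x - trunc f k x| `^ p)%:E <= e%:E)%E.
Proof.
move=> p0 [mf fp] e0.
have [||||||N hN] := @dominated_vanish _ _ _ mu (fun k x => `|f x - trunc f k x| `^ p) (fun x => `|f x| `^ p) e.
- by move=> k; have := mf_trunc k mf => mt; mfun.
- move=> x; apply: cvg_near_cst; apply: filterS (trunc_eventually f x) => k ->.
  by rewrite subrr normr0 powR0 ?gt_eqF.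
- by mfun.
- move=> k x; rewrite ger0_norm ?powR_ge0//; apply: ge0_ler_powR; rewrite ?(ltW p0)//.
  exact: trunc_error.
- exact: fp.
- exact: e0.
exists N => k /hN; under eq_integral do rewrite ger0_norm ?powR_ge0//.
by [].
Qed.

Lemma powR_le_ratio (p v B : R) : 1 <= p -> 0 < B -> 0 <= v <= B -> v `^ p <= B `^ p / B * v.
Proof.
move=> p1 B0 /andP[v0 vB]; have p0 : 0 <= p by apply: le_trans p1.
have [->|v1] := eqVneq v 0; first by rewrite powR0 ?mulr0// gt_eqF// (lt_le_trans _ p1).
have {v1}v0 : 0 < v by rewrite lt_neqAle eq_sym v1.
have E : v = B * (v / B) by rewrite mulrC divfK// gt_eqF.
rewrite {1}E powRM ?divr_ge0 ?(ltW B0) ?(ltW v0)// -mulrA ler_wpM2l ?powR_ge0//.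
by rewrite [B^-1 * v]mulrC; apply: ge1r_powR => //; rewrite divr_gt0//= ler_pdivrMr// mul1r.
Qed.

Lemma Linfc_approx_Lp (p q e : R) f : 1 <= p -> 1 <= q -> Linfc f -> 0 < e ->
  exists u, [/\ test_function u, (\int[mu]_x (`|f x - u x| `^ p)%:E <= e%:E)%E &
    (\int[mu]_x (`|f x - u x| `^ q)%:E <= e%:E)%E].
Proof.
move=> p1 q1 lf e0; have [B B0 [fB H]] := Linfc_approx lf; have mf := Linfc_mf lf.
have B2 : 0 < 2 * B by rewrite mulr_gt0.
pose c (r : R) := (2 * B) `^ r / (2 * B).
have c0 r : 0 < c r by rewrite divr_gt0// powR_gt0.
have d0 : 0 < e / (c p + c q) by rewrite divr_gt0// addr_gt0.
have [u [tu uB hu]] := H _ d0; have mu' := test_mf tu.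
have K (r : R) : 1 <= r -> c r <= c p + c q -> (\int[mu]_x (`|f x - u x| `^ r)%:E <= e%:E)%E.
  move=> r1 rc; apply: (le_via (\int[mu]_x (c r * `|f x - u x|)%:E)%E).
    apply: int_le; [mfun|mfun|] => x; rewrite powR_ge0; apply: powR_le_ratio => //.
    rewrite normr_ge0; apply: (le_trans (ler_normB _ _)).
    by rewrite mulr_natl lerD.
  have h : c r * (e / (c p + c q)) <= e.
    by rewrite mulrCA ger_pMr// ler_pdivrMr ?addr_gt0// mul1r.
  apply: (le_trans _ (_ : ((c r * (e / (c p + c q)))%:E <= e%:E)%E)); last by [].
  by apply: intZl_le => //; [exact: ltW|mfun].
exists u; split => //; apply: K => //; [rewrite lerDl|rewrite lerDr]; exact: ltW.
Qed.

Lemma Lp_triangle (p a b : R) f g (h : X -> R) : 0 <= p -> meas f -> meas g -> meas h ->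
  (\int[mu]_x (`|f x - g x| `^ p)%:E <= a%:E)%E -> (\int[mu]_x (`|g x - h x| `^ p)%:E <= b%:E)%E ->
  (\int[mu]_x (`|f x - h x| `^ p)%:E <= (2 `^ p * (a + b))%:E)%E.
Proof.
move=> p0 mf mg mh fa gb.
apply: (le_via (\int[mu]_x (2 `^ p * (`|f x - g x| `^ p + `|g x - h x| `^ p))%:E)%E).
  apply: int_le; [mfun|mfun|] => x; rewrite powR_ge0 /=.
  by rewrite -[f x - h x](subrKA (g x)); exact: powR_add_le.
apply: intZl_le; [by []|mfun|by []|].
by apply: intD_le; mfun.
Qed.

(** Truncation in space and height converges in both exponents at once. The common approximants
    later identify the extensions to $L^p$ and $L^q$ on the intersection of the spaces. *)
Lemma Lp_approx (p q e : R) f : 1 <= p -> 1 <= q -> Lp p f -> Lp q f -> 0 < e ->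
  exists u, [/\ test_function u, (\int[mu]_x (`|f x - u x| `^ p)%:E <= e%:E)%E &
    (\int[mu]_x (`|f x - u x| `^ q)%:E <= e%:E)%E].
Proof.
move=> p1 q1 fp fq e0; have mf := fp.1.
have p0 : 0 < p by apply: lt_le_trans p1.
have q0 : 0 < q by apply: lt_le_trans q1.
pose d := e / (2 * (2 `^ p + 2 `^ q)).
have d0 : 0 < d by rewrite mulr_gt0.
have [N hN] := trunc_Lp p0 fp d0; have [N' hN'] := trunc_Lp q0 fq d0.
have [u [tu up uq]] := Linfc_approx_Lp p1 q1 (trunc_Linfc (N + N') mf) d0.
have mt := mf_trunc (N + N') mf; have mu' := test_mf tu.
have K (r : R) : 2 `^ r <= 2 `^ p + 2 `^ q :> R -> 2 `^ r * (d + d) <= e.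
  move=> rc; rewrite /d (_ : _ + _ = e / (2 `^ p + 2 `^ q)).
    by rewrite mulrCA ger_pMr// ler_pdivrMr ?addr_gt0// mul1r.
  have : 2 `^ p + 2 `^ q != 0 :> R by [].
  by move: (2 `^ p + 2 `^ q) => s s0; field.
exists u; split => //.
  apply: (le_trans (Lp_triangle (ltW p0) mf mt mu' (hN _ (leq_addr _ _)) up)).
  by rewrite lee_fin; apply: K; rewrite lerDl.
apply: (le_trans (Lp_triangle (ltW q0) mf mt mu' (hN' _ (leq_addl _ _)) uq)).
by rewrite lee_fin; apply: K; rewrite lerDr.
Qed.

Lemma Linfc_Lp (p : R) f : 1 <= p -> Linfc f -> Lp p f.
Proof.
move=> p1 lf; have mf := Linfc_mf lf; split=> //.
have [M M0 fM] := Linfc_bounded lf; have L0 : 0 < M + 1 by rewrite ltr_pwDr.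
apply: (le_lt_via (\int[mu]_x ((M + 1) `^ p / (M + 1) * `|f x|)%:E)%E).
  apply: int_le; [mfun|mfun|] => x; rewrite powR_ge0; apply: powR_le_ratio => //.
  by rewrite normr_ge0; apply: (le_trans (fM x)); rewrite lerDl.
rewrite intZl; [|by nneg|mfun|by []].
by rewrite lte_mul_pinfty ?lee_fin ?divr_ge0 ?powR_ge0 ?(ltW L0)//; exact: integrable_int (Linfc_integ lf).
Qed.

(* Du Bois-Reymond: [sgn g] on a ball is an L1 limit of uniformly bounded test
   functions, so [g] tested against it vanishes. *)
Lemma integrable_test_eq0 g : integ mu g ->
  (forall phi, test_function phi -> \int[mu]_x (g x * phi x) = 0) ->
  {ae mu, forall x, g x = 0}.
Proof.
move=> ig H; have mg := integrable_mf ig; have ig' := integrable_int ig.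
have Z N : (\int[mu]_x (`|g x| * \1_(cball 0 N%:R) x)%:E = 0)%E.
  apply/eqP; rewrite eq_le integral_ge0 ?andbT; last by [].
  apply/lee_addgt0Pr => e e0; rewrite add0e.
  have [f fE] := ex_fun (fun x => g x / `|g x| * \1_(cball 0 N%:R) x).
  have gf x : g x * f x = `|g x| * \1_(cball 0 N%:R) x.
    rewrite fE; have [->|g0] := eqVneq (g x) 0; first by rewrite normr0 !mul0r.
    rewrite !mulrA -expr2 -(real_normK (num_real (g x))) mulfK// normr_eq0//.
  have f1 x : `|f x| <= 1.
    rewrite fE normrM normrM normfV normr_id indicE.
    apply: mulr_ile1; rewrite ?invr_ge0//; last by case: (x \in _); rewrite ?normr0 ?normr1.
    by have [->|g0] := eqVneq (g x) 0; [rewrite normr0|rewrite divff// normr_eq0].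
  have mf : meas f by rewrite (funext fE); mfun.
  have lf : Linfc f.
    apply: (@Linfc_intro _ 1 N%:R) => //.
    move=> x; rewrite fE indicE; case: (boolP (x \in _)) => [/set_mem|]; last by rewrite mulr0 eqxx.
    by rewrite /cball /= subr0.
  have [B B0 [fB A]] := Linfc_approx lf.
  have B2 : 0 < 2 * B by rewrite mulr_gt0.
  have e2 : 0 < e / (2 * (2 * B)) by rewrite divr_gt0// mulr_gt0.
  have mI k : meas (\1_(superlevel g k%:R) : X -> R).
    by apply: mfindic; apply: mf_lt; mfun.
  (* Where $|g|\le k$, the $L^1$ distance between the sign and its approximant enters with a factor
     below $k+1$; where $|g|>k$, the uniform bound [2 * B] is paid on a small tail of [g]. *)
  have [|||||k /(_ k (leqnn k)) hk] := @dominated_vanish _ _ _ mu (fun k x => `|g x| * \1_(superlevel g k%:R) x) (fun x => `|g x|) _ _ _ _ _ _ e2.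
  - by move=> k; apply: mfM; [mfun|exact: mI].
  - move=> x; apply: cvg_near_cst; exists (Num.bound `|g x|) => // k /= hk.
    rewrite indicE memNset ?mulr0// /superlevel /= => h; move: (lt_le_trans h (ltW (archi_boundP (normr_ge0 (g x))))).
    by rewrite ltr_nat ltnNge hk.
  - by mfun.
  - move=> k x; rewrite normrM normr_id indicE; case: (x \in _); rewrite ?normr1 ?mulr1// normr0 mulr0//.
  - exact: ig'.
  have d0 : 0 < e / (2 * k.+1%:R) by rewrite mulr_gt0.
  have [u [tu uB hu]] := A _ d0; have mu' := test_mf tu.
  have D : (\int[mu]_x (`|g x * f x - g x * u x|)%:E <= e%:E)%E.
    apply: (le_via (\int[mu]_x (k.+1%:R * `|f x - u x| + 2 * B * (`|(`|g x| * \1_(superlevel g k%:R) x)|))%:E)%E).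
      have mk := mI k; apply: int_le; [by mfun|by mfun|] => x; rewrite normr_ge0 /=.
      rewrite -mulrBr normrM; have [h|h] := leP `|g x| k%:R.
        apply: (le_via (k.+1%:R * `|f x - u x|)); last by rewrite lerDl !mulr_ge0// ltW.
        by rewrite ler_wpM2r//; apply: (le_trans h); rewrite ler_nat.
      apply: (le_via (2 * B * (`|(`|g x| * \1_(superlevel g k%:R) x)|))); last by rewrite lerDr.
      rewrite indicE mem_set// mulr1 normr_id mulrC ler_wpM2r//.
      by apply: (le_trans (ler_normB _ _)); rewrite mulr_natl lerD.
    rewrite (_ : e = k.+1%:R * (e / (2 * k.+1%:R)) + 2 * B * (e / (2 * (2 * B)))).
      have mk := mI k; apply: intD_le; [by mfun|by mfun|by []|by nneg| |].
        by apply: intZl_le; mfun.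
      by apply: intZl_le => //; [exact: ltW|mfun].
    have : k.+1%:R != 0 :> R by []. have : B != 0 by rewrite gt_eqF.
    by move: (k.+1%:R : R) => z B1 z1; field; rewrite B1.
  have iF : integ mu (fun x => g x * f x).
    apply: int_integ; first by mfun.
    apply: le_lt_trans ig'; apply: int_le; [mfun|mfun|] => x.
    by rewrite normr_ge0 normrM ler_piMr.
  have iU : integ mu (fun x => g x * u x).
    apply: int_integ; first by mfun.
    apply: (le_lt_via (\int[mu]_x (B * `|g x|)%:E)%E).
      apply: int_le; [mfun|mfun|] => x.
      by rewrite normr_ge0 normrM mulrC ler_wpM2r.
    rewrite intZl; [|exact: ltW|mfun|by []].
    by rewrite lte_mul_pinfty// ltW.
  have E : \int[mu]_x (g x * f x) = \int[mu]_x (g x * f x - g x * u x).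
    by rewrite -Rint_sub// (H u tu) subr0.
  under eq_integral do rewrite -gf.
  rewrite -RintE// E; apply: le_trans (Rint_le _ D); last by mfun.
  by rewrite lee_fin ler_norm.
have Z' N : {ae mu, forall x, `|g x| * \1_(cball 0 N%:R) x = 0}.
  have m1 : meas (fun x => (`|g x| * \1_(cball 0 N%:R) x)%:E) by mfun.
  have [h _] := ae_eq_integral_abs mu measurableT m1.
  have : ae_eq mu setT (fun x => (`|g x| * \1_(cball 0 N%:R) x)%:E) (cst 0%E).
    by apply: h; rewrite -[RHS](Z N); apply: eq_integral => x _; rewrite abse_EFin ger0_norm.
  by apply: filterS => x /(_ I) /= [].
have := ae_foralln Z'; apply: filterS => x hx.
have := hx (Num.bound (enorm x)); rewrite indicE mem_set.
  by rewrite mulr1 => /eqP; rewrite normr_eq0 => /eqP.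
by rewrite /cball /= subr0 ltW// archi_boundP// enorm_ge0.
Qed.

(** Multiplying [g] by a bump makes it integrable; the bump may be moved into the test function and
    is positive on a large cube. *)
Lemma test_eq0 g : locally_integrable_rV g ->
  (forall phi, test_function phi -> \int[mu]_x (g x * phi x) = 0) ->
  {ae mu, forall x, g x = 0}.
Proof.
move=> [mg lg] H.
have Z (N : nat) : {ae mu, forall x, g x * box_bump (fun=> - N%:R) (fun=> N%:R) 1 x = 0}.
  have [w wE] := ex_fun (box_bump (fun=> - N%:R) (fun=> N%:R : R) 1 : X -> R).
  have tw : test_function w by rewrite (funext wE); exact: bump_test.
  have mw := test_mf tw.
  suff : {ae mu, forall x, g x * w x = 0} by apply: filterS => x <-; rewrite wE.
  apply: integrable_test_eq0; last first.
    move=> phi tphi; rewrite -(H (fun x => w x * phi x)); last by apply: testM => //; exact: tw.1.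
    by congr Rintegral; apply/funext => x; rewrite mulrA.
  apply: int_integ; first by mfun.
  apply: le_lt_trans (lg (vbox N%:R) (@vbox_compact _)).
  rewrite [leRHS]integral_mkcond; apply: ge0_le_integral => //.
  - by apply: mfE; mfun.
  - apply/(measurable_restrict _ _ _) => //; first by apply: compact_measurable_rV; exact: vbox_compact.
    by apply: measurable_funTS; apply: mfE; mfun.
  move=> x _; rewrite patchE; have [h|h] := pselect (cubeN N%:R x).
    rewrite mem_set; last by move=> i; rewrite /= in_itv /=; have /andP[? ?] := h i; rewrite !ltW.
    rewrite lee_fin normrM ler_piMr// wE; have /andP[b0 b1] := bump01 (fun=> - N%:R) (fun=> N%:R : R) 1 x.
    by rewrite ger0_norm.
  by rewrite wE bump_outside// mulr0 normr0; case: ifP => // _; rewrite lee_fin.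
have := ae_foralln Z; apply: filterS => x hx.
pose N := (Num.bound (enorm x)); have := hx N => /eqP; rewrite mulf_eq0 => /orP[/eqP//|].
rewrite gt_eqF// bump_gt0// => i; rewrite -ltr_norml; apply: (le_lt_trans (coord_le_enorm x i)).
by apply: archi_boundP; exact: enorm_ge0.
Qed.

End density.

(** * The case p > 2 by duality *)

Section duality.
Implicit Types (x y z c : X) (s M l : R) (K : X * X -> R) (f g u phi : X -> R).

Definition conj_exp (p : R) : R := p / (p - 1).

Lemma conj_expP (p : R) : 2 < p -> [/\ 1 < conj_exp p < 2, (conj_exp p)^-1 + p^-1 = 1 & (p - 1) * conj_exp p = p].
Proof.
move=> p2; have p1 : 0 < p - 1 by move: p2; clear; lra.
have p0 : 0 < p by move: p2; clear; lra.
split; rewrite /conj_exp.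
- rewrite ltr_pdivlMr// ltr_pdivrMr; move: p2; clear; lra.
- by rewrite invf_div; field; rewrite gt_eqF.
- by rewrite mulrC divfK// gt_eqF.
Qed.

(* Young's inequality with the weight absorbing the operator norm. *)
Lemma dual_pairing_le s s1 s2 K M u phi (p : R) : ker_data s s1 s2 K M -> 0 < M -> Lipc u -> Lipc phi -> 2 < p ->
  forall q k : R, q = conj_exp p -> k = 2 `^ q * (marc_cst s2 s1 q + 1) * M `^ q ->
  (`|pairing s s1 s2 K phi u|%:E <= (2 `^ q * q)^-1%:E * \int[mu]_x (`|phi x| `^ q)%:E +
     (k `^ (p - 1) / p)%:E * \int[mu]_x (`|u x| `^ p)%:E)%E.
Proof.
move=> kd M0 lu lphi p2 q k qE kE; have [/andP[q1 q2] pq _] := conj_expP p2; rewrite -!qE in q1 q2 pq.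
have kd' := ker_data_sym kd; have mK : meas K by case: kd.
have p0 : 0 < p by move: p2; clear; lra.
have q0 : 0 < q by move: q1; clear; lra.
have c0 : 0 <= marc_cst s2 s1 q by apply: marc_cst_ge0 kd' _; rewrite q1.
have k0 : 0 < k by rewrite kE !mulr_gt0 ?powR_gt0// ltr_pwDr.
have lphi1 := lphi.1; have lu1 := lu.1.
have mphi := Linfc_mf lphi1; have mu' := Linfc_mf lu1.
have mT := mf_T0 s s2 s1 mK mphi.
rewrite pairingC -(T0_pairing kd' lphi lu1).
apply: Rint_le; first by mfun.
apply: (le_via (\int[mu]_x ((k^-1 / q) * `|T0 s s2 s1 K phi x| `^ q + (k `^ (p - 1) / p) * `|u x| `^ p)%:E)%E).
  apply: int_le; [mfun|mfun|] => x; rewrite normr_ge0 /= normrM.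
  have -> : `|T0 s s2 s1 K phi x| * `|u x| = (k `^ (- q^-1) * `|T0 s s2 s1 K phi x|) * (k `^ q^-1 * `|u x|).
    by rewrite mulrACA powR_add// addNr powRr0 mul1r.
  apply: (le_trans (conjugate_powR _ _ q0 p0 pq)); rewrite ?mulr_ge0 ?powR_ge0//.
  rewrite !powRM ?powR_ge0// -!powRrM mulNr mulVf ?gt_eqF//.
  rewrite (powR_inv1 (ltW k0)) le_eqVlt; apply/orP; left; apply/eqP.
  have -> : q^-1 * p = p - 1.
    have : q^-1 = 1 - p^-1 by rewrite -pq addrK.
    by move=> ->; rewrite mulrBl mul1r mulVf// gt_eqF.
  by rewrite [X in X + _]mulrAC [X in _ + X]mulrAC.
rewrite intD; [|mfun|mfun|by nneg|by nneg].
rewrite !intZl; [|by nneg|mfun|by []|by nneg|mfun|by []].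
apply: leeD; last exact: lexx.
have q12 : 1 < q < 2 by rewrite q1.
apply: (le_trans (lee_wpmul2l _ (T0_Lp kd' M0 lphi q12))).
  by rewrite lee_fin divr_ge0 ?invr_ge0 ?(ltW k0) ?(ltW q0).
rewrite muleA -EFinM; apply: lee_wpmul2r; first by apply: integral_ge0 => x _; rewrite lee_fin.
rewrite lee_fin kE; have : 0 < 2 `^ q :> R by [].
have : 0 < M `^ q by rewrite powR_gt0.
move: (2 `^ q) (M `^ q) (marc_cst _ _ _) c0 => A B C C0 B0 A0.
have C1 : 0 < C + 1 by rewrite ltr_pwDr.
rewrite [leLHS](_ : _ = (C / (C + 1)) * (A * q)^-1); last first.
  by field; rewrite !gt_eqF.
by rewrite ler_piMl ?invr_ge0 ?mulr_ge0 ?(ltW A0) ?(ltW q0)// ler_pdivrMr// mul1r lerDl.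
Qed.

Definition dual_cst s1 s2 (p : R) : R :=
  (2 `^ conj_exp p * (marc_cst s2 s1 (conj_exp p) + 1)) `^ (p - 1).

(** Tested against its extremal function on a ball, the integral [S] to be bounded reappears on the
    right with the factor $1/q<1$; after absorption the factor $1/p$ is left on both sides. *)
Lemma T0_Lp_dual s s1 s2 K M u (p : R) : ker_data s s1 s2 K M -> 0 < M -> Lipc u -> 2 < p ->
  (\int[mu]_x (`|T0 s s1 s2 K u x| `^ p)%:E <= (dual_cst s1 s2 p * M `^ p)%:E * \int[mu]_x (`|u x| `^ p)%:E)%E.
Proof.
move=> kd M0 lu p2; have [/andP[q1 q2] pq pq'] := conj_expP p2.
have [q qE] : exists q : R, q = conj_exp p by eexists.
have [k kE] : exists k : R, k = 2 `^ q * (marc_cst s2 s1 q + 1) * M `^ q by eexists.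
rewrite -!qE in q1 q2 pq pq'.
have mK : meas K by case: kd.
have p1 : 1 <= p by move: p2; clear; lra.
have p0 : 0 < p by move: p2; clear; lra.
have q0 : 0 < q by move: q1; clear; lra.
have c0 : 0 <= marc_cst s2 s1 q by apply: marc_cst_ge0 (ker_data_sym kd) _; rewrite q1.
have lu1 := lu.1; have mu' := Linfc_mf lu1.
have mT := mf_T0 s s1 s2 mK mu'.
have [_ uoo] := Linfc_Lp p1 lu1.
have [U UE] : exists U : R, (\int[mu]_x (`|u x| `^ p)%:E = U%:E)%E.
  exists (fine (\int[mu]_x (`|u x| `^ p)%:E)); rewrite fineK// ge0_fin_numE//.
  by apply: integral_ge0 => x _; rewrite lee_fin.
have cE : dual_cst s1 s2 p * M `^ p = k `^ (p - 1).
  rewrite kE powRM ?mulr_ge0 ?powR_ge0 ?addr_ge0//.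
  by rewrite -[(M `^ q) `^ _]powRrM [q * _]mulrC pq' /dual_cst -qE.
rewrite cE UE -EFinM.
have [v vE] := ex_fun (T0 s s1 s2 K u).
have [B B0 vB] := T0_bounded kd lu.
have mv : meas v by rewrite (funext vE).
under eq_integral do rewrite -vE.
have S N : (\int[mu]_x (`|v x| `^ p * \1_(cball 0 N%:R) x)%:E <= (k `^ (p - 1) * U)%:E)%E.
  (* The extremal function for the exponents [p] and [q]: on the ball, $v\phi=|\phi|^q=|v|^p$. *)
  have [phi phiE] := ex_fun (fun x => v x * `|v x| `^ (p - 2) * \1_(cball 0 N%:R) x).
  have absphi x : `|phi x| = `|v x| `^ (p - 1) * \1_(cball 0 N%:R) x.
    rewrite phiE !normrM [`|_ `^ _|]ger0_norm ?powR_ge0//; congr (_ * _); last first.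
      by rewrite ger0_norm.
    have [->|vx] := eqVneq (v x) 0.
      by rewrite normr0 mul0r powR0// gt_eqF// subr_gt0 (lt_le_trans _ (ltW p2))// ltr1n.
    rewrite -{1}[`|v x|]powRr1// powR_add ?normr_gt0//; congr powR; ring.
  have vphi x : v x * phi x = `|v x| `^ p * \1_(cball 0 N%:R) x.
    rewrite phiE !mulrA; congr (_ * _); have [->|vx] := eqVneq (v x) 0.
      by rewrite normr0 !mul0r powR0// gt_eqF.
    rewrite -expr2 -(real_normK (num_real (v x))) -powR_mulrn// powR_add ?normr_gt0//; congr powR; ring.
  have phiq x : `|phi x| `^ q = `|v x| `^ p * \1_(cball 0 N%:R) x.
    rewrite absphi indicE; case: (x \in _); rewrite ?mulr1 ?mulr0; last by rewrite powR0// gt_eqF.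
    by rewrite -powRrM pq'.
  have mphi : meas phi by rewrite (funext phiE); mfun.
  have lphi : Linfc phi.
    apply: (@Linfc_intro _ (B `^ (p - 1)) N%:R) => //.
      move=> x; rewrite absphi; apply: (le_via (`|v x| `^ (p - 1))).
        by rewrite ler_piMr.
      apply: ge0_ler_powR; rewrite ?vE// subr_ge0//.
    move=> x; rewrite phiE indicE; case: (boolP (x \in _)) => [/set_mem|]; last by rewrite mulr0 eqxx.
    by rewrite /cball /= subr0.
  have iv (w : X -> R) : Linfc w -> integ mu (fun x => v x * w x).
    move=> lw; have mw := Linfc_mf lw; apply: int_integ; first by mfun.
    apply: (le_lt_via (\int[mu]_x (B * `|w x|)%:E)%E).
      by apply: int_le; [mfun|mfun|move=> x; rewrite normr_ge0 normrM ler_wpM2r// vE].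
    rewrite intZl//; last by mfun.
    by rewrite lte_mul_pinfty//; exact: integrable_int (Linfc_integ lw).
  have [S SE] : exists S : R, S = \int[mu]_x (v x * phi x) by eexists.
  have SE' : (\int[mu]_x (`|v x| `^ p * \1_(cball 0 N%:R) x)%:E = S%:E)%E.
    by rewrite SE RintE ?iv//; apply: eq_integral => x _; rewrite vphi.
  rewrite SE' lee_fin -(ler_pM2r (x := p^-1)) ?invr_gt0//.
  apply: (@le_linear_eps _ _ _ (q^-1 + B)); first by nneg.
  (* [dual_pairing_le] concerns Lipschitz functions, so [phi] is replaced by a test function close
     to it in $L^q$ and in $L^1$. The factor $2^q$ built into [k] pays for the triangle inequality
     of q-th powers. *)
  move=> e e0; have [w [tw wq w1]] := Linfc_approx_Lp (ltW q1) (lexx 1) lphi e0.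
  have mw := test_mf tw; have lw := (test_Lipc tw).1.
  have h1 : S <= \int[mu]_x (v x * w x) + B * e.
    rewrite -lerBlDl SE Rint_sub ?iv//; apply: (le_trans (ler_norm _)); rewrite -lee_fin.
    apply: Rint_le; first by mfun.
    apply: (le_via (\int[mu]_x (B * `|phi x - w x|)%:E)%E).
      by apply: int_le; [mfun|mfun|move=> x; rewrite normr_ge0 -mulrBr normrM ler_wpM2r// vE].
    apply: intZl_le => //; first by mfun.
    by apply: le_trans w1; apply: le_of_eq; apply: eq_integral => x _; rewrite powRr1.
  have h2 : \int[mu]_x (v x * w x) <= (2 `^ q * q)^-1 * (2 `^ q * (e + S)) + k `^ (p - 1) / p * U.
    have -> : \int[mu]_x (v x * w x) = pairing s s1 s2 K w u.
      by rewrite -(T0_pairing kd lu lw); congr Rintegral; apply/funext => x; rewrite vE.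
    apply: (le_trans (ler_norm _)); rewrite -lee_fin.
    apply: (le_trans (dual_pairing_le kd M0 lu (test_Lipc tw) p2 qE kE)).
    rewrite UE EFinD leeD2r// EFinM; apply: lee_wpmul2l.
      by rewrite lee_fin invr_ge0 mulr_ge0 ?powR_ge0// ltW.
    have m0 : meas ((fun=> 0) : X -> R) by mfun.
    have := @Lp_triangle q e S w phi (fun=> 0) (ltW q0) mw mphi m0.
    under [in X in (_ -> _ -> X)%E]eq_integral do rewrite subr0.
    apply; first by under eq_integral do rewrite distrC.
    by rewrite -SE'; under eq_integral do rewrite subr0 phiq.
  have h3 : S / p = S - q^-1 * S by rewrite mulrC -{2}[S]mul1r -mulrBl -pq addrAC subrr add0r.
  rewrite h3 -subr_ge0; move: h1 h2.
  have -> : (2 `^ q * q)^-1 * (2 `^ q * (e + S)) = q^-1 * (e + S).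
    by rewrite invfM [(2 `^ q)^-1 * _]mulrC -mulrA [(2 `^ q)^-1 * _]mulrA mulVf ?mul1r.
  move: (\int[mu]_x (v x * w x)) (q^-1) (k `^ (p - 1)) (p^-1) => I Q Kp P'; clear => h1 h2.
  have : S <= Q * (e + S) + Kp * P' * U + B * e by apply: (le_trans h1); rewrite lerD2r.
  rewrite -subr_ge0 => h3; apply: (le_trans h3); apply: le_of_eq; ring.
apply: (@int_lim_le _ _ _ mu (fun N x => `|v x| `^ p * \1_(cball 0 N%:R) x)) => //.
- by move=> N; apply: mfM; [mfun|apply: mfindic; exact: meas_cball].
move=> x; apply: cvg_near_cst; exists (Num.bound (enorm x)) => // N /= hN.
rewrite indicE mem_set ?mulr1// /cball /= subr0; apply: (le_trans (ltW (archi_boundP (enorm_ge0 x)))).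
by rewrite ler_nat.
Qed.

Lemma T0_strong s1 s2 (p : R) : 1 < p -> exists2 C : R, 0 <= C & forall s K M u,
  ker_data s s1 s2 K M -> 0 < M -> Lipc u ->
  (\int[mu]_x (`|T0 s s1 s2 K u x| `^ p)%:E <= (C * M `^ p)%:E * \int[mu]_x (`|u x| `^ p)%:E)%E.
Proof.
move=> p1; have [p2|p2|p2] := ltgtP p 2.
- exists `|marc_cst s1 s2 p| => // s K M u kd M0 lu.
  have p12 : 1 < p < 2 by rewrite p1.
  by rewrite ger0_norm ?(marc_cst_ge0 kd)//; exact: (T0_Lp kd M0 lu p12).
- exists `|dual_cst s1 s2 p| => // s K M u kd M0 lu.
  by rewrite ger0_norm ?powR_ge0//; exact: T0_Lp_dual.
- exists (form_cst s1 s2 ^+ 2) => [|s K M u kd M0 lu]; first exact: sqr_ge0.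
  rewrite p2; under eq_integral do rewrite powR_mulrn// real_normK ?num_real//.
  under [in leRHS]eq_integral do rewrite powR_mulrn// real_normK ?num_real//.
  rewrite (sqintE lu.1).
  rewrite powR_mulrn ?(ltW M0)// -EFinM [_ * M ^+ 2]mulrC -exprMn.
  exact: T0_L2.
Qed.

Lemma chebyshev_powR (v : X -> R) (p t : R) : meas v -> 0 < p -> 0 < t ->
  (mu (superlevel v t) <= (t `^ p)^-1%:E * \int[mu]_x (`|v x| `^ p)%:E)%E.
Proof.
move=> mv p0 t0; have mS := meas_superlevel t mv.
have tp : 0 < t `^ p by rewrite powR_gt0.
rewrite -[superlevel v t]setIT -integral_indic// -intZl.
- apply: int_le; [by []|mfun|] => x; rewrite indicE; case: (boolP (x \in _)) => [/set_mem h|_].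
    rewrite ler01 mulrC ler_pdivlMr// mul1r; apply: ge0_ler_powR; rewrite ?nnegrE ?(ltW p0) ?(ltW t0)//.
    exact: ltW.
  by rewrite lexx mulr_ge0 ?powR_ge0// invr_ge0 ltW.
- by nneg.
- by mfun.
- by [].
Qed.

Lemma T0_weak s1 s2 (p : R) : 1 <= p -> exists2 C : R, 0 <= C & forall s K M u (t : R),
  ker_data s s1 s2 K M -> 0 < M -> Lipc u -> 0 < t ->
  (mu (superlevel (T0 s s1 s2 K u) t) <= (C * M `^ p / t `^ p)%:E * \int[mu]_x (`|u x| `^ p)%:E)%E.
Proof.
rewrite le_eqVlt => /predU1P[<-|p1].
  exists `|weak_cst s1 s2| => // s K M u t kd M0 lu t0.
  rewrite ger0_norm ?(weak_cst_ge0 kd)//; apply: (le_trans (weak_type_Lipc kd M0 lu t0)).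
  rewrite !powRr1 ?(ltW M0) ?(ltW t0)//; under eq_integral do rewrite powRr1//.
  rewrite l1intE; last exact: Linfc_integ lu.1.
  rewrite lee_fin le_eqVlt; apply/orP; left; apply/eqP.
  by have t1 : t != 0 by [rewrite gt_eqF]; field.
have [C C0 H] := T0_strong s1 s2 p1; exists C => // s K M u t kd M0 lu t0.
have p0 : 0 < p by apply: lt_trans p1.
have mK : meas K by case: kd.
have mT := mf_T0 s s1 s2 mK (Linfc_mf lu.1).
apply: (le_trans (chebyshev_powR mT p0 t0)).
rewrite mulrC EFinM -muleA; apply: lee_wpmul2l; first by rewrite lee_fin invr_ge0 powR_ge0.
exact: H.
Qed.

End duality.

(** * Mean oscillation on cubes *)

Section oscillation.
Implicit Types (x y z : X) (f g u v : X -> R) (p q t e c l : R) (Q : set X).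

Lemma int_setE Q f : measurable Q -> (\int[mu]_(x in Q) (f x)%:E = \int[mu]_x (f x * \1_Q x)%:E)%E.
Proof.
move=> mQ; rewrite integral_mkcond; apply: eq_integral => x _; rewrite patchE indicE.
by case: (x \in Q); rewrite ?mulr1 ?mulr0.
Qed.

Lemma Rint_setE Q f : measurable Q -> \int[mu]_(x in Q) f x = \int[mu]_x (f x * \1_Q x).
Proof. by move=> mQ; rewrite /Rintegral int_setE. Qed.

Lemma int_ae_le f g : meas f -> meas g -> (forall x, 0 <= f x) -> (forall x, 0 <= g x) ->
  {ae mu, forall x, f x <= g x} -> (\int[mu]_x (f x)%:E <= \int[mu]_x (g x)%:E)%E.
Proof.
move=> mf mg f0 g0 fg; apply: ae_ge0_le_integral => //; [by move=> x _; rewrite lee_fin|mfun|by move=> x _; rewrite lee_fin|mfun|].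
by apply: filterS fg => x h _; rewrite lee_fin.
Qed.

Lemma cube_measurable x l : measurable (cube x l).
Proof. exact: (@measurable_box _ _ (fun i => x ord0 i) (fun i => x ord0 i + l)). Qed.

Lemma mu_cube x l : 0 <= l -> mu (cube x l) = (l ^+ n)%:E.
Proof.
move=> l0; rewrite (@lebesgue_rV_box _ _ (fun i => x ord0 i) (fun i => x ord0 i + l)); last first.
  by move=> i; rewrite lerDl.
congr (_%:E); rewrite (eq_bigr (fun=> l)) ?prodr_const ?card_ord// => i _.
by rewrite addrC addKr.
Qed.

(** On the cube, [g] differs from a constant by a part controlled in $L^2$ and a bounded part;
    replacing the constant by the average costs the factor 2. The parameter [lam] enters through
    $|g_1|\le\lambda g_1^2+\lambda^{-1}$. *)
Lemma oscillation_le Q (V : R) g c g1 (tau lam G : R) : measurable Q -> mu Q = V%:E -> 0 < V ->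
  meas g -> meas g1 -> 0 <= tau -> 0 < lam ->
  (\int[mu]_x (`|g1 x| `^ 2)%:E <= G%:E)%E ->
  {ae mu, forall x, Q x -> `|g x - c| <= `|g1 x| + tau} ->
  ((fine (mu Q))^-1%:E * \int[mu]_(x in Q) `|g x - average Q g|%:E <= (2 * (lam * G / V + (lam^-1 + tau)))%:E)%E.
Proof.
move=> mQ QV V0 mg mg1 tau0 lam0 hG hae.
have mI : meas (\1_Q : X -> R) by [].
have I0 x : 0 <= (\1_Q x : R) by [].
have iV : (\int[mu]_x (\1_Q x)%:E = V%:E)%E by rewrite integral_indic// setIT.
have k0 : 0 <= lam^-1 + tau by nneg.
pose W := lam * G + (lam^-1 + tau) * V.
have hW : (\int[mu]_x (`|g x - c| * \1_Q x)%:E <= W%:E)%E.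
  apply: (le_via (\int[mu]_x (lam * `|g1 x| `^ 2 + (lam^-1 + tau) * \1_Q x)%:E)%E).
    apply: int_ae_le.
    - by mfun.
    - by mfun.
    - by [].
    - by nneg.
    apply: filterS hae => x hx; rewrite powR_norm2 indicE; case: (boolP (x \in Q)) => [/set_mem/hx h|_].
      rewrite !mulr1 addrA; apply: (le_trans h); rewrite lerD2r.
      by have := amgm_eps 1 (g1 x) lam0; rewrite normr1 mul1r expr1n mulr1.
    by rewrite !mulr0 addr0 mulr_ge0 ?sqr_ge0// ltW.
  apply: intD_le; [mfun|mfun|by nneg|by nneg| |].
    by apply: intZl_le; [exact: ltW|by mfun|by []|exact: hG].
  by apply: intZl_le; [exact: k0|exact: mI|exact: I0|rewrite iV].
have W0 : 0 <= W.
  by rewrite -lee_fin; apply: le_trans hW; apply: integral_ge0 => x _; rewrite lee_fin.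
have iI : integ mu (\1_Q : X -> R).
  by apply: int_integ => //; under eq_integral do rewrite (ger0_norm (I0 _)); rewrite iV ltry.
have igc : integ mu (fun x => (g x - c) * \1_Q x).
  apply: int_integ; first by mfun.
  by under eq_integral do rewrite normrM (ger0_norm (I0 _)); exact: le_lt_trans hW (ltry _).
have icI : integ mu (fun x => c * \1_Q x).
  apply: int_integ; first by mfun.
  under eq_integral do rewrite normrM (ger0_norm (I0 _)).
  by rewrite intZl// iV ltry.
have RI : \int[mu]_x (\1_Q x) = V by apply/eqP; rewrite -eqe RintE// iV.
have av : `|average Q g - c| <= W / V.
  rewrite /average QV /= Rint_setE//.
  have -> : \int[mu]_x (g x * \1_Q x) = \int[mu]_x ((g x - c) * \1_Q x) + c * V.
    rewrite -RI -Rint_scale// -RintegralD//; congr Rintegral; apply/funext => x /=; ring.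
  rewrite mulrDr [V^-1 * (c * V)]mulrC mulfK ?gt_eqF// addrK normrM gtr0_norm ?invr_gt0// mulrC.
  rewrite ler_pM2r ?invr_gt0// -lee_fin; apply: Rint_le; first by mfun.
  by under eq_integral do rewrite normrM (ger0_norm (I0 _)).
rewrite QV [fine _]/= int_setE//.
have -> : 2 * (lam * G / V + (lam^-1 + tau)) = V^-1 * (W + W).
  by rewrite /W; field; rewrite !gt_eqF.
rewrite EFinM; apply: lee_wpmul2l; first by rewrite lee_fin invr_ge0 ltW.
apply: (le_via (\int[mu]_x (`|g x - c| * \1_Q x + W / V * \1_Q x)%:E)%E).
  apply: int_le; [mfun|mfun|] => x; rewrite mulr_ge0//= -mulrDl; apply: ler_wpM2r => //.
  rewrite -[g x - _](subrKA c); apply: (le_trans (ler_normD _ _)); rewrite lerD2l distrC; exact: av.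
apply: intD_le; [mfun|mfun|by []|by nneg|exact: hW|].
rewrite intZl//; last by nneg.
by rewrite iV -EFinM divfK// gt_eqF.
Qed.

End oscillation.

(** * Extension to L^p and to L^oo *)

Section extension.
Variables (s s1 s2 M : R) (K : X * X -> R).
Hypotheses (kd : ker_data s s1 s2 K M) (M0 : 0 < M).
Implicit Types (x y z : X) (f g u v phi : X -> R) (p q t e c : R).
Implicit Types l : R.
Local Notation T0 := (T0 s s1 s2 K).
Local Notation A := (kernelA s s1 s2 K).

(* [g] is the value at [f] of the extension of T0 to L^p. *)
Definition near_T0 p f g : Prop := meas g /\ exists2 C : R, 0 <= C &
  forall u t, test_function u -> 0 < t ->
    (mu (superlevel (fun x => (T0 u x - g x)%R) t) <= (C / t `^ p)%:E * \int[mu]_x (`|f x - u x| `^ p)%:E)%E.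

Lemma mf_T0_test u : test_function u -> meas (T0 u).
Proof. by move=> tu; apply: mf_T0; [case: kd|exact: test_mf]. Qed.

Lemma T0_weak_diff p : 1 <= p -> exists2 C : R, 0 <= C & forall u v t,
  test_function u -> test_function v -> 0 < t ->
  (mu (superlevel (fun x => (T0 u x - T0 v x)%R) t) <= (C / t `^ p)%:E * \int[mu]_x (`|u x - v x| `^ p)%:E)%E.
Proof.
move=> p1; have [C C0 H] := T0_weak s1 s2 p1.
exists (C * M `^ p) => [|u v t tu tv t0]; first by nneg.
have E : (fun x => T0 u x - T0 v x) = T0 (fun x => u x + -1 * v x).
  by apply/funext => x; rewrite (T0D _ _ kd (test_Lipc tu) (test_Lipc tv)) mulN1r.
rewrite E; apply: (le_trans (H _ _ _ _ t kd M0 (LipcD _ (test_Lipc tu) (test_Lipc tv)) t0)).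
by under eq_integral do rewrite mulN1r.
Qed.

Lemma near_test p u : 1 <= p -> test_function u -> near_T0 p u (T0 u).
Proof.
move=> p1 tu; split; first exact: mf_T0_test.
have [C C0 H] := T0_weak_diff p1; exists C => // v t tv t0.
apply: (le_trans (H v u t tv tu t0)); apply: lee_wpmul2l; first by rewrite lee_fin divr_ge0 ?powR_ge0.
by under eq_integral do rewrite distrC.
Qed.

(** If the test functions approach [f] fast enough, the weak-type inequality and Borel-Cantelli give
    convergence almost everywhere. The rate [d] and the second exponent are left to the user of the
    lemma. *)
Lemma near_ae p q f g (d : nat -> R) : 1 <= p -> 1 <= q -> Lp p f -> Lp q f -> near_T0 p f g ->
  (forall k, 0 < d k) -> exists v : nat -> X -> R, [/\ forall k, test_function (v k),
    forall k, (\int[mu]_x (`|f x - v k x| `^ p)%:E <= (d k)%:E)%E,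
    forall k, (\int[mu]_x (`|f x - v k x| `^ q)%:E <= (d k)%:E)%E &
    {ae mu, forall x, T0 (v k) x @[k --> \oo] --> g x}].
Proof.
move=> p1 q1 fp fq [mg [C C0 H]] d0.
have h0 k : 0 < (2^-1 ^+ k : R) by [].
(* The second entry brings the weak-type bound at the level $2^{-k}$ down to $2^{-k}$. *)
have [e eE] := ex_fun (fun k : nat => Num.min (d k) (2^-1 ^+ k / ((C + 1) / (2^-1 ^+ k) `^ p))).
have C1 : 0 < C + 1 by rewrite ltr_pwDr.
have e0 k : 0 < e k by rewrite eE lt_min d0 divr_gt0// divr_gt0.
have /choice[v vP] : forall k, exists u, [/\ test_function u, (\int[mu]_x (`|f x - u x| `^ p)%:E <= (e k)%:E)%E &
    (\int[mu]_x (`|f x - u x| `^ q)%:E <= (e k)%:E)%E].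
  by move=> k; exact: Lp_approx.
have ed k : e k <= d k by rewrite eE ge_min lexx.
exists v; split.
- by move=> k; have [] := vP k.
- by move=> k; have [_ h _] := vP k; apply: (le_trans h); rewrite lee_fin.
- by move=> k; have [_ _ h] := vP k; apply: (le_trans h); rewrite lee_fin.
have [||N [mN N0 hN]] := @borel_cantelli_cvg _ _ _ mu (fun k x => T0 (v k) x - g x).
- by move=> k; have [tv _ _] := vP k; have := mf_T0_test tv => mT; mfun.
- move=> k; have [tv h _] := vP k; apply: (le_trans (H _ _ tv (h0 k))).
  apply: (le_trans (lee_wpmul2l _ h)); first by rewrite lee_fin divr_ge0.
  rewrite -EFinM; apply: (le_via ((C + 1) / (2^-1 ^+ k) `^ p * e k)).
    by rewrite ler_wpM2r ?(ltW (e0 k))// ler_wpM2r ?powR_ge0// lerDl.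
  have a0 : 0 < (C + 1) / (2^-1 ^+ k) `^ p by rewrite divr_gt0.
  apply: (le_via ((C + 1) / (2^-1 ^+ k) `^ p * (2^-1 ^+ k / ((C + 1) / (2^-1 ^+ k) `^ p)))).
    by rewrite ler_pM2l// eE ge_min lexx orbT.
  by rewrite mulrCA divff ?gt_eqF// mulr1.
exists N; split => // x /= hx; apply: contrapT => xN; apply: hx.
have [m hm] := hN x xN; apply/subr_cvg0; apply/cvgr0Pnorm_le => eps eps0.
have [j hj] := half_pow_small 1 eps0; exists (m + j)%N => // k /= mk.
apply: (le_trans (hm k (leq_trans (leq_addr _ _) mk))); apply: le_trans hj; rewrite mulr1.
by apply: ler_wiXn2l; rewrite ?invf_le1 ?ler1n//; exact: leq_trans (leq_addl _ _) mk.
Qed.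

Lemma LpD p c f g : 0 <= p -> Lp p f -> Lp p g -> Lp p (fun x => f x + c * g x).
Proof.
move=> p0 [mf fp] [mg gp]; split; first by mfun.
apply: (le_lt_via (\int[mu]_x (2 `^ p * (`|f x| `^ p + `|c| `^ p * `|g x| `^ p))%:E)%E).
  apply: int_le; [mfun|mfun|] => x; rewrite powR_ge0 -powRM// -normrM; exact: powR_add_le.
rewrite intZl; [|by []|mfun|by []].
rewrite intD; [|mfun|mfun|by []|by []].
rewrite intZl; [|by []|mfun|by []].
have c0 (a : R) : (0 <= (a `^ p)%:E)%E by rewrite lee_fin powR_ge0.
apply: lte_mul_pinfty => //; apply: lte_add_pinfty; first exact: fp.
by apply: lte_mul_pinfty.
Qed.

Lemma Lp_real p f : Lp p f -> exists2 F : R, 0 <= F & (\int[mu]_x (`|f x| `^ p)%:E = F%:E)%E.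
Proof.
move=> [mf fp]; have h : (0 <= \int[mu]_x (`|f x| `^ p)%:E)%E by apply: integral_ge0 => x _; rewrite lee_fin.
exists (fine (\int[mu]_x (`|f x| `^ p)%:E)); first exact: fine_ge0.
by rewrite fineK// ge0_fin_numE.
Qed.

Lemma Lp_test_diff p f u : 1 <= p -> Lp p f -> test_function u ->
  exists2 F : R, 0 <= F & (\int[mu]_x (`|f x - u x| `^ p)%:E = F%:E)%E.
Proof.
move=> p1 fp tu; have p0 : 0 <= p by apply: le_trans p1.
have := Lp_real (LpD (-1) p0 fp (Linfc_Lp p1 (test_Lipc tu).1)).
by under eq_integral do rewrite mulN1r.
Qed.

Lemma pow_half_small c e : 0 < e -> exists N : nat, forall k, (N <= k)%N -> c * 2^-1 ^+ k <= e.
Proof.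
move=> e0; have [N hN] := half_pow_small `|c| e0; exists N => k Nk; apply: le_trans hN.
rewrite mulrC; apply: (le_via (2^-1 ^+ k * `|c|)).
  by apply: ler_wpM2l; [rewrite exprn_ge0|exact: ler_norm].
by apply: ler_wpM2r => //; apply: ler_wiXn2l; rewrite ?invf_le1 ?ler1n.
Qed.

(** Converse of [near_ae]: almost everywhere convergence along one fast sequence identifies the
    value, because weak-type bounds pass to such limits ([superlevel_lim_le]). *)
Lemma near_of_seq p f g c (v : nat -> X -> R) : 1 <= p -> Lp p f -> meas g ->
  (forall k, test_function (v k)) ->
  (forall k, (\int[mu]_x (`|f x - v k x| `^ p)%:E <= (c * 2^-1 ^+ k)%:E)%E) ->
  {ae mu, forall x, T0 (v k) x @[k --> \oo] --> g x} -> near_T0 p f g.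
Proof.
move=> p1 fp mg tv fv cv; split=> //; have [C C0 H] := T0_weak_diff p1.
have p0 : 0 <= p by apply: le_trans p1.
exists (C * 2 `^ p) => [|u t tu t0]; first by nneg.
have [F F0 FE] := Lp_test_diff p1 fp tu; rewrite FE.
have C1 : 0 <= C / t `^ p * 2 `^ p by nneg.
apply/lee_addgt0Pr => e e0.
have e1 : 0 < e / (C / t `^ p * 2 `^ p + 1) by rewrite divr_gt0// ltr_pwDr.
have [N hN] := pow_half_small c e1.
have mT := mf_T0_test tu; have mf := fp.1; have mu' := test_mf tu.
apply: (@superlevel_lim_le _ _ _ mu (fun k x => T0 u x - T0 (v (k + N)%N) x)).
- by move=> k; have := mf_T0_test (tv (k + N)%N) => mTv; mfun.
- by mfun.
- apply: filterS cv => x cx; apply: cvgB; first exact: cvg_cst.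
  by rewrite (cvg_shiftn N (fun k => T0 (v k) x)).
move=> k; have tk := tv (k + N)%N; have mk := test_mf tk.
apply: (le_trans (H _ _ _ tu tk t0)).
have h1 : (\int[mu]_x (`|u x - f x| `^ p)%:E <= F%:E)%E by rewrite -FE; under eq_integral do rewrite distrC.
have h2 : (\int[mu]_x (`|f x - v (k + N)%N x| `^ p)%:E <= (e / (C / t `^ p * 2 `^ p + 1))%:E)%E.
  by apply: (le_trans (fv _)); rewrite lee_fin; apply: hN; exact: leq_addl.
apply: (le_trans (lee_wpmul2l _ (Lp_triangle p0 mu' mf mk h1 h2))).
  by rewrite lee_fin divr_ge0 ?powR_ge0.
rewrite lee_fin mulrA mulrDr [C * _ / _]mulrAC lerD2l.
by rewrite mulrCA ger_pMr// ler_pdivrMr ?mul1r ?lerDl// ltr_pwDr.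
Qed.

Lemma geometric_increments_cvg (b : nat -> R) (m : nat) :
  (forall k, (m <= k)%N -> `|b k.+1 - b k| <= 2^-1 ^+ k) -> cvgn b.
Proof.
move=> H; pose d (j : nat) := b (j + m).+1 - b (j + m)%N.
have cd : cvgn (series d).
  apply: normed_cvg; apply: (@series_le_cvg _ _ (geometric 1 2^-1)).
  - by move=> k; exact: normr_ge0.
  - by move=> k; rewrite /=.
  - move=> k /=; rewrite mul1r; apply: (le_trans (H _ (leq_addl _ _))).
    by apply: ler_wiXn2l; rewrite ?invf_le1 ?ler1n// leq_addr.
  - by apply: is_cvg_geometric_series; rewrite ger0_norm ?invr_ge0// invf_lt1// ltr1n.
have E : (fun k => b (k + m)%N) = (fun k => b m + series d k).
  apply/funext => k; rewrite /series /= (telescope_sumr (fun j => b (j + m)%N))//.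
  by rewrite addrC subrK.
have : cvgn (fun k => b (k + m)%N) by rewrite E; apply: is_cvgD => //; exact: is_cvg_cst.
move=> /cvg_ex[l hl]; apply/cvg_ex; exists l.
by move: hl; rewrite cvg_shiftn.
Qed.

Lemma near_exists p f : 1 <= p -> Lp p f -> exists g, near_T0 p f g.
Proof.
move=> p1 fp; have p0 : 0 <= p by apply: le_trans p1.
have [C C0 H] := T0_weak_diff p1.
have h0 k : 0 < (2^-1 ^+ k : R) by [].
have hS k : (2^-1 ^+ k.+1 : R) <= 2^-1 ^+ k.
  by rewrite exprS ler_piMl ?(ltW (h0 k))// invf_le1// ler1n.
have h1 k : (2^-1 ^+ k : R) <= 1 by rewrite exprn_ile1// invf_le1// ler1n.
have [D DE] : exists D : R, D = C * (2 `^ p * 2) + 1 by eexists.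
have D1 : 1 <= D by rewrite DE lerDr !mulr_ge0.
have D0 : 0 < D by apply: lt_le_trans D1.
(* Chosen so that the increments of [T0] along the sequence exceed $2^{-k}$ only on a set of measure
   at most $2^{-k}$. *)
have [e eE] := ex_fun (fun k : nat => (2^-1 ^+ k : R) * (2^-1 ^+ k) `^ p / D).
have e0 k : 0 < e k by rewrite eE divr_gt0.
have eS k : e k.+1 <= e k.
  rewrite !eE ler_wpM2r ?invr_ge0 ?(ltW D0)//; apply: ler_pM; rewrite ?(ltW (h0 _))//.
  by apply: ge0_ler_powR; rewrite ?nnegrE.
have e1 k : e k <= 2^-1 ^+ k.
  rewrite eE -mulrA ger_pMr// ler_pdivrMr// mul1r; apply: le_trans D1.
  by rewrite -[leRHS](powRr0 (2^-1 ^+ k)); apply: ger_powR; rewrite ?h0 ?h1.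
have /choice[v vP] : forall k, exists u, test_function u /\ (\int[mu]_x (`|f x - u x| `^ p)%:E <= (e k)%:E)%E.
  by move=> k; have [u [tu hu _]] := Lp_approx p1 p1 fp fp (e0 k); exists u.
have tv k : test_function (v k) by have [] := vP k.
have mf := fp.1; have mv k := test_mf (tv k); have mT k := mf_T0_test (tv k).
have [||N [mN N0 hN]] := @borel_cantelli_cvg _ _ _ mu (fun k x => T0 (v k.+1) x - T0 (v k) x).
- by move=> k; have m1 := mT k; have m2 := mT k.+1; mfun.
- move=> k; apply: (le_trans (H _ _ _ (tv k.+1) (tv k) (h0 k))).
  have a1 : (\int[mu]_x (`|v k.+1 x - f x| `^ p)%:E <= (e k)%:E)%E.
    under eq_integral do rewrite distrC; apply: (le_trans (vP k.+1).2); rewrite lee_fin; exact: eS.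
  apply: (le_trans (lee_wpmul2l _ (Lp_triangle p0 (mv k.+1) mf (mv k) a1 (vP k).2))).
    by rewrite lee_fin divr_ge0.
  rewrite lee_fin (_ : e k + e k = 2%:R * e k); last by ring.
  rewrite eE.
  have : 0 < (2^-1 ^+ k) `^ p by [].
  have alg (A B h : R) : 0 < A -> 0 <= B -> 0 < h -> D = C * (B * 2) + 1 -> C / A * (B * (2%:R * (h * A / D))) <= h.
    move=> A0 B0 hh DB; rewrite (_ : _ * _ = (C * (B * 2) / D) * h); last first.
      by field; rewrite !gt_eqF.
    by rewrite ger_pMl// ler_pdivrMr// mul1r DB lerDl.
  by move=> A0; apply: alg; by [].
have [g' g'E] := ex_fun (fun x => lim (T0 (v k) x * \1_(~` N) x @[k --> \oo])).
have cv x : T0 (v k) x * \1_(~` N) x @[k --> \oo] --> g' x.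
  suff : cvgn (fun k => T0 (v k) x * \1_(~` N) x) by rewrite g'E.
  have [xN|xN] := pselect (N x).
    rewrite indicE memNset; last by [].
    by under eq_fun do rewrite mulr0; exact: is_cvg_cst.
  have [m hm] := hN x xN; rewrite indicE mem_set//; under eq_fun do rewrite mulr1.
  exact: geometric_increments_cvg hm.
have mg : meas g'.
  apply: (@measurable_fun_cvg _ _ _ setT (fun k x => T0 (v k) x * \1_(~` N) x)) => //.
  by move=> k; have m1 := mT k; apply: mfM => //; apply: mfindic; exact: measurableC.
exists g'; apply: (@near_of_seq _ _ _ 1 v) => //.
  by move=> k; rewrite mul1r; apply: (le_trans (vP k).2); rewrite lee_fin.
exists N; split => // x /= hx; apply: contrapT => xN; apply: hx; have := cv x.
by rewrite indicE mem_set//; under eq_fun do rewrite mulr1.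
Qed.

(** A sequence converging in both exponents makes [g] a value for [q] too; then a single test
    function close to [f] shows that all superlevel sets of $g-h$ are null. *)
Lemma near_unique p q f g h : 1 <= p -> 1 <= q -> Lp p f -> Lp q f ->
  near_T0 p f g -> near_T0 q f h -> {ae mu, forall x, g x = h x}.
Proof.
move=> p1 q1 fp fq ng nh.
have [mg _] := ng; have [mh [C C0 H]] := nh.
have half0 k : 0 < (2^-1 ^+ k : R) by [].
have [v [tv vp vq cv]] := near_ae p1 q1 fp fq ng half0.
have nq : near_T0 q f g.
  by apply: (@near_of_seq _ _ _ 1 v) => // k; rewrite mul1r; exact: vq.
have [_ [C' C'0 H']] := nq.
apply: ae_eq_superlevel => // t e t0 e0.
have t2 : 0 < t / 2 by rewrite divr_gt0.
pose D := (C + C') / (t / 2) `^ q + 1.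
have D0 : 0 < D by rewrite ltr_pwDr// divr_ge0 ?addr_ge0 ?powR_ge0.
have [u [tu hu _]] := Lp_approx q1 q1 fq fq (divr_gt0 e0 D0).
have mT := mf_T0_test tu.
have := @superlevelD (fun x => g x - h x) (fun x => T0 u x - h x) (fun x => - (T0 u x - g x)) (t / 2).
rewrite (_ : 2 * (t / 2) = t); last by rewrite mulrC divfK.
move=> /(_ _ _ _)/le_trans; apply; [mfun|mfun|by move=> x; ring|].
rewrite (_ : superlevel (fun x => - (T0 u x - g x)) (t / 2) = superlevel (fun x => T0 u x - g x) (t / 2)); last first.
  by apply/funext => x; rewrite /superlevel /= normrN.
apply: (le_trans (leeD (H _ _ tu t2) (H' _ _ tu t2))).
rewrite -ge0_muleDl ?lee_fin ?divr_ge0 ?powR_ge0// -EFinD -mulrDl.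
apply: (le_trans (lee_wpmul2l _ hu)); first by rewrite lee_fin divr_ge0 ?addr_ge0 ?powR_ge0.
rewrite lee_fin mulrCA ger_pMr// ler_pdivrMr// mul1r lerDl//.
Qed.

Lemma near_exponent p q f g : 1 <= p -> 1 <= q -> Lp p f -> Lp q f -> near_T0 p f g -> near_T0 q f g.
Proof.
move=> p1 q1 fp fq ng.
have half0 k : 0 < (2^-1 ^+ k : R) by [].
have [v [tv vp vq cv]] := near_ae p1 q1 fp fq ng half0.
by apply: (@near_of_seq _ _ _ 1 v) => //; [case: ng|move=> k; rewrite mul1r; exact: vq].
Qed.

Lemma near_ae_eq p f f' g : near_T0 p f g -> {ae mu, forall x, f x = f' x} ->
  meas f -> meas f' -> near_T0 p f' g.
Proof.
move=> [mg [C C0 H]] ff' mf mf'; split => //.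
exists C; first exact: C0.
move=> u t tu t0.
have mu' := test_mf tu.
have -> : (\int[mu]_x (`|f' x - u x| `^ p)%:E = \int[mu]_x (`|f x - u x| `^ p)%:E)%E.
  apply: ae_eq_integral => //; [mfun|mfun|].
  by apply: filterS ff' => x ->.
exact: H.
Qed.

Lemma near_lin p f1 f2 g1 g2 c : 1 <= p -> Lp p f1 -> Lp p f2 -> near_T0 p f1 g1 -> near_T0 p f2 g2 ->
  near_T0 p (fun x => f1 x + c * f2 x) (fun x => g1 x + c * g2 x).
Proof.
move=> p1 fp1 fp2 ng1 ng2; have p0 : 0 <= p by apply: le_trans p1.
have half0 k : 0 < (2^-1 ^+ k : R) by [].
have [v [tv vp _ cv]] := near_ae p1 p1 fp1 fp1 ng1 half0.
have [w [tw wp _ cw]] := near_ae p1 p1 fp2 fp2 ng2 half0.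
have [mg1 _] := ng1; have [mg2 _] := ng2; have mf1 := fp1.1; have mf2 := fp2.1.
apply: (@near_of_seq _ _ _ (2 `^ p * (1 + `|c| `^ p)) (fun k x => v k x + c * w k x)).
- exact: p1.
- exact: LpD.
- by mfun.
- by move=> k; exact: testD.
- move=> k; have mv := test_mf (tv k); have mw := test_mf (tw k).
  apply: (le_via (\int[mu]_x (2 `^ p * (`|f1 x - v k x| `^ p + `|c| `^ p * `|f2 x - w k x| `^ p))%:E)%E).
    apply: int_le; [mfun|mfun|] => x; rewrite powR_ge0 /= -powRM// -normrM.
    by rewrite (_ : _ - _ = (f1 x - v k x) + c * (f2 x - w k x)); [exact: powR_add_le|ring].
  rewrite -mulrA mulrDl mul1r; apply: intZl_le; [by []|mfun|by []|].
  apply: intD_le; [mfun|mfun|by []|by []|exact: vp|].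
  by apply: intZl_le; [by []|mfun|by []|exact: wp].
near=> x; rewrite (_ : (fun k => _) = (fun k => T0 (v k) x + c * T0 (w k) x)).
  apply: cvgD; first by near: x.
  by apply: cvgM; [exact: cvg_cst|near: x].
by apply/funext => k; rewrite (T0D _ _ kd (test_Lipc (tv k)) (test_Lipc (tw k))).
Unshelve. all: by end_near.
Qed.

Lemma cvg_powR_norm p (a : nat -> R) (b : R) : 1 <= p -> a k @[k --> \oo] --> b ->
  `|a k| `^ p @[k --> \oo] --> `|b| `^ p.
Proof.
move=> p1 ab; have [b0|b0] := eqVneq b 0.
  rewrite b0 normr0 powR0 ?gt_eqF//; last by apply: lt_le_trans p1.
  rewrite b0 in ab; apply/cvgr0Pnorm_le => e e0.
  have e1 : 0 < Num.min 1 e by rewrite lt_min ltr01.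
  move/cvgr0Pnorm_le : ab => /(_ _ e1); apply: filterS => k; rewrite le_min => /andP[h1 h2].
  rewrite ger0_norm ?powR_ge0//; apply: le_trans h2.
  have := @powR_le_ratio p `|a k| 1 p1 ltr01; rewrite powR1 divr1 mul1r; apply.
  by rewrite normr_ge0.
have b1 : 0 < `|b| by rewrite normr_gt0.
have cont : {for `|b|, continuous (fun y : R => y `^ p)}.
  apply: differentiable_continuous; apply/derivable1_diffP.
  by have [] := is_derive1_powR p b1.
exact: (cvg_comp _ _ (cvg_norm ab) cont).
Qed.

(** Fatou's lemma along a sequence from [near_ae]. The factor $2^p$ comes from the crude triangle
    inequality for p-th powers. *)
Lemma near_strong p f g (B : R) : 1 <= p -> 0 <= B ->
  (forall u, test_function u -> (\int[mu]_x (`|T0 u x| `^ p)%:E <= B%:E * \int[mu]_x (`|u x| `^ p)%:E)%E) ->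
  Lp p f -> near_T0 p f g ->
  (\int[mu]_x (`|g x| `^ p)%:E <= (2 `^ p * B)%:E * \int[mu]_x (`|f x| `^ p)%:E)%E.
Proof.
move=> p1 B0 H fp ng; have p0 : 0 <= p by apply: le_trans p1.
have [F F0 FE] := Lp_real fp; rewrite FE.
have mf := fp.1; have [mg _] := ng.
rewrite -EFinM; apply/lee_addgt0Pr => e e0; rewrite -EFinD.
have B1 : 0 < B * 2 `^ p + 1 by rewrite ltr_pwDr// mulr_ge0.
have [v [tv vp _ cv]] := near_ae p1 p1 fp fp ng (fun=> divr_gt0 e0 B1).
apply: (@int_lim_ae_le _ _ _ mu (fun k x => `|T0 (v k) x| `^ p)).
- by move=> k; have := mf_T0_test (tv k) => mT; mfun.
- by mfun.
- by [].
- by [].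
- by apply: filterS cv => x; exact: cvg_powR_norm.
move=> k; apply: (le_trans (H _ (tv k))); have mv := test_mf (tv k).
have m0 : meas ((fun=> 0) : X -> R) by mfun.
have h1 : (\int[mu]_x (`|v k x - f x| `^ p)%:E <= (e / (B * 2 `^ p + 1))%:E)%E.
  by under eq_integral do rewrite distrC; exact: vp.
have h2 : (\int[mu]_x (`|f x - 0| `^ p)%:E <= F%:E)%E by rewrite -FE; under eq_integral do rewrite subr0.
have := Lp_triangle p0 mv mf m0 h1 h2; under eq_integral do rewrite subr0.
move=> h3; apply: (le_trans (lee_wpmul2l _ h3)); first by [].
rewrite lee_fin mulrA mulrDr addrC [2 `^ p * B]mulrC lerD2l.
by rewrite mulrCA ger_pMr// ler_pdivrMr// mul1r lerDl.
Qed.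

Lemma near_weak p f g (B : R) : 1 <= p -> 0 <= B ->
  (forall u t, test_function u -> 0 < t ->
     (mu (superlevel (T0 u) t) <= (B / t `^ p)%:E * \int[mu]_x (`|u x| `^ p)%:E)%E) ->
  Lp p f -> near_T0 p f g -> forall t, 0 < t ->
  (mu (superlevel g t) <= (2 `^ p * B / t `^ p)%:E * \int[mu]_x (`|f x| `^ p)%:E)%E.
Proof.
move=> p1 B0 H fp ng t t0; have p0 : 0 <= p by apply: le_trans p1.
have [F F0 FE] := Lp_real fp; rewrite FE.
have mf := fp.1; have [mg _] := ng.
rewrite -EFinM; apply/lee_addgt0Pr => e e0; rewrite -EFinD.
have Bt : 0 <= B / t `^ p by nneg.
have B1 : 0 < B / t `^ p * 2 `^ p + 1 by rewrite ltr_pwDr// mulr_ge0.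
have [v [tv vp _ cv]] := near_ae p1 p1 fp fp ng (fun=> divr_gt0 e0 B1).
apply: (@superlevel_lim_le _ _ _ mu (fun k x => T0 (v k) x)).
- by move=> k; have := mf_T0_test (tv k); exact.
- exact: mg.
- exact: cv.
move=> k; apply: (le_trans (H _ _ (tv k) t0)); have mv := test_mf (tv k).
have m0 : meas ((fun=> 0) : X -> R) by mfun.
have h1 : (\int[mu]_x (`|v k x - f x| `^ p)%:E <= (e / (B / t `^ p * 2 `^ p + 1))%:E)%E.
  by under eq_integral do rewrite distrC; exact: vp.
have h2 : (\int[mu]_x (`|f x - 0| `^ p)%:E <= F%:E)%E by rewrite -FE; under eq_integral do rewrite subr0.
have := Lp_triangle p0 mv mf m0 h1 h2; under eq_integral do rewrite subr0.
move=> h3; apply: (le_trans (lee_wpmul2l _ h3)); first by [].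
have alg (a b c : R) : 0 <= b * a -> b * (a * (e / (b * a + 1) + c)) <= a * b * c + e.
  move=> ba0; have ba1 : b * a + 1 != 0 by rewrite gt_eqF// ltr_pwDr.
  rewrite -subr_ge0 (_ : _ - _ = e / (b * a + 1)); last by field.
  by rewrite divr_ge0 ?addr_ge0// ltW.
rewrite lee_fin [2 `^ p * B / _](_ : _ = 2 `^ p * (B / t `^ p)); last by rewrite mulrA.
by apply: alg; rewrite mulr_ge0.
Qed.

Lemma Linfc_prod_integrable g phi : Lp 2 g -> Linfc phi -> integ mu (fun x => g x * phi x).
Proof.
move=> [mg g2] lphi; have mphi := Linfc_mf lphi; apply: int_integ; first by mfun.
apply: (le_lt_via (\int[mu]_x (`|g x| `^ 2 + phi x ^+ 2)%:E)%E).
  apply: int_le; [mfun|mfun|] => x; rewrite normr_ge0 /= powR_norm2 normrM.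
  by have := amgm_eps (g x) (phi x) ltr01; rewrite invr1 !mul1r addrC.
rewrite intD; [|mfun|mfun|by []|by nneg].
by rewrite (sqintE lphi) lte_add_pinfty// ltry.
Qed.

Definition strong2 (B : R) : Prop := 0 <= B /\ forall u, test_function u ->
  (\int[mu]_x (`|T0 u x| `^ 2)%:E <= B%:E * \int[mu]_x (`|u x| `^ 2)%:E)%E.

Lemma strong2_exists : exists B, strong2 B.
Proof.
have [C C0 H] := T0_strong s1 s2 (ltr1n R 2).
exists (C * M `^ 2); split; first by nneg.
by move=> u tu; apply: H => //; exact: test_Lipc.
Qed.

Lemma near_Lp2 f g : Lp 2 f -> near_T0 2 f g -> Lp 2 g.
Proof.
move=> f2 ng; have [B [B0 HB]] := strong2_exists; have [mg _] := ng; split=> //.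
apply: (le_lt_trans (near_strong (ler1n R 2) B0 HB f2 ng)).
by rewrite lte_mul_pinfty ?lee_fin ?mulr_ge0 ?powR_ge0//; exact: f2.2.
Qed.

(** [h] need not be Lipschitz, so [T0_pairing] does not apply; but both sides are continuous in [h]
    for the $L^2$ distance and agree on test functions. *)
Lemma near_pairing h g phi : Linfc h -> near_T0 2 h g -> Linfc phi ->
  \int[mu]_x (g x * phi x) = pairing s s1 s2 K phi h.
Proof.
move=> lh ng lphi; have [B [B0 HB]] := strong2_exists.
have two1 : 1 <= 2 :> R by rewrite ler1n.
have h2 := Linfc_Lp two1 lh; have g2 := near_Lp2 h2 ng.
have mphi := Linfc_mf lphi; have mg := g2.1; have mh := h2.1.
apply/eqP; rewrite -subr_eq0 -normr_le0.
have c0 := form_cst_gt0 kd; pose c := M * form_cst s1 s2 / 2.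
have c1 : 0 <= c by rewrite divr_ge0// mulr_ge0// ltW.
have P0 : 0 <= sqint phi by rewrite -lee_fin -(sqintE lphi); apply: integral_ge0 => x _; rewrite lee_fin sqr_ge0.
apply: (@le_linear_eps _ _ _ ((1 + c) * sqint phi + (2 `^ 2 * B + c))).
  by nneg.
move=> e e0; rewrite add0r.
(* The squared $L^2$ distance is taken to be $e^2$ and the weight in the arithmetic-geometric
   inequality [e], so that both terms are of order [e]. *)
have e2 : 0 < e ^+ 2 by rewrite exprn_gt0.
have [v [tv vp _]] := Lp_approx two1 two1 h2 h2 e2.
have lv := test_Lipc tv; have lv1 := lv.1; have mT := mf_T0_test tv.
have v2 := Linfc_Lp two1 lv1; have T2 := near_Lp2 v2 (near_test two1 tv).
have ngv := near_lin (-1) two1 h2 v2 ng (near_test two1 tv).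
have d2 := LpD (-1) (le_trans ler01 two1) h2 v2.
have bd : (\int[mu]_x (`|g x - T0 v x| `^ 2)%:E <= (2 `^ 2 * B * e ^+ 2)%:E)%E.
  have := near_strong two1 B0 HB d2 ngv; under eq_integral do rewrite mulN1r.
  under [in X in (_ <= _ * X)%E -> _]eq_integral do rewrite mulN1r.
  move=> h3; apply: (le_trans h3); rewrite (EFinM (2 `^ 2 * B)); apply: lee_wpmul2l => //.
  by rewrite lee_fin mulr_ge0.
have E1 : `|\int[mu]_x (g x * phi x) - \int[mu]_x (T0 v x * phi x)| <= e * sqint phi + e^-1 * (2 `^ 2 * B * e ^+ 2).
  rewrite Rint_sub; [|exact: Linfc_prod_integrable|exact: Linfc_prod_integrable].
  rewrite -lee_fin; apply: Rint_le; first by mfun.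
  apply: (le_via (\int[mu]_x (e * phi x ^+ 2 + e^-1 * (`|g x - T0 v x| `^ 2))%:E)%E).
    apply: int_le; [mfun|mfun|] => x; rewrite normr_ge0 /= -mulrBl normrM powR_norm2.
    by apply: (le_trans (amgm_eps (g x - T0 v x) (phi x) e0)).
  apply: intD_le; [mfun|mfun|by nneg|by nneg| |].
    by apply: intZl_le; [exact: ltW|mfun|by nneg|rewrite (sqintE lphi)].
  by apply: intZl_le; [by nneg|mfun|by []|exact: bd].
have lhv := LinfcB lh lv1.
have E2 : `|pairing s s1 s2 K phi v - pairing s s1 s2 K phi h| <= c * (e * sqint phi + e^-1 * e ^+ 2).
  rewrite (pairing_split kd lphi lh lv1) opprD addrC addrNK normrN.
  apply: (le_trans (pairing_le kd lphi lhv e0)); apply: ler_wpM2l => //.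
  rewrite lerD2l ler_pM2l ?invr_gt0// -lee_fin -(sqintE lhv).
  by apply: le_trans vp; under [leRHS]eq_integral do rewrite powR_norm2.
rewrite -(T0_pairing kd lv lphi) in E2.
apply: (le_trans (ler_distD (\int[mu]_x (T0 v x * phi x)) _ _)); apply: (le_trans (lerD E1 E2)).
have e1 : e != 0 by rewrite gt_eqF.
have alg (a b c' b' : R) : e * a + e^-1 * (b * b' * e ^+ 2) + c' * (e * a + e^-1 * e ^+ 2) <= ((1 + c') * a + (b * b' + c')) * e.
  by apply: le_of_eq; field.
exact: alg.
Qed.

Lemma kernel_away h x0 (r : R) : Linfc h -> 0 < r -> (forall y, eball x0 (2 * r) y -> h y = 0) ->
  exists2 c, 0 <= c & forall x, eball x0 r x ->
    integ mu (fun z => A x z * h z) /\ `|\int[mu]_z (A x z * h z)| <= c.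
Proof.
move=> lh r0 h0; have mK : meas K by case: kd.
have mh := Linfc_mf lh.
have S0 : 0 <= M * size_cst s1 s2 by rewrite mulr_ge0 ?(ltW M0)//; exact: size_cst_ge0 kd.
exists (M * size_cst s1 s2 * r `^ (- n%:R) * l1int h).
  by rewrite mulr_ge0 ?l1int_ge0// mulr_ge0 ?powR_ge0.
move=> x xr.
have bd : (\int[mu]_z (`|A x z * h z|)%:E <= (M * size_cst s1 s2 * r `^ (- n%:R) * l1int h)%:E)%E.
  rewrite EFinM -l1intE; last exact: Linfc_integ.
  rewrite -intZl; [|by rewrite mulr_ge0 ?powR_ge0|mfun|by []].
  apply: int_le; [by mfun|by mfun|] => z; rewrite normr_ge0 /= normrM.
  have [->|hz] := eqVneq (h z) 0; first by rewrite normr0 !mulr0.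
  have rz : r <= enorm (x - z).
    rewrite leNgt; apply/negP => xz; move/eqP: hz; apply; apply: h0.
    rewrite /=; apply: (le_lt_trans (enormBD z x x0)).
    by rewrite mulr_natl; apply: ltrD => //; rewrite enormC.
  rewrite ler_wpM2r//; apply: (le_trans (kernelA_size kd _)).
    by rewrite -enormB_gt0; exact: lt_le_trans rz.
  apply: ler_wpM2l => //.
  by apply: powR_neg_antitone => //; rewrite oppr_le0.
split; first by apply: int_integ; [mfun|exact: le_lt_trans bd (ltry _)].
by rewrite -lee_fin; apply: Rint_le; [mfun|exact: bd].
Qed.

(** Both sides are tested against the sign of their difference on the ball. The form represents the
    first, the kernel the form, so the absolute difference has integral 0. *)
Lemma near_separated h g x0 (r : R) : Linfc h -> near_T0 2 h g -> 0 < r ->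
  (forall y, eball x0 (2 * r) y -> h y = 0) ->
  {ae mu, forall x, eball x0 r x -> g x = \int[mu]_z (A x z * h z)}.
Proof.
move=> lh ng r0 h0; have mK : meas K by case: kd.
have mh := Linfc_mf lh; have [c c0 Hc] := kernel_away lh r0 h0.
have [S SE] := ex_fun (fun x => \int[mu]_z (A x z * h z)).
have two1 : 1 <= 2 :> R by rewrite ler1n.
have g2 := near_Lp2 (Linfc_Lp two1 lh) ng; have mg := g2.1.
have mS : meas S.
  rewrite (funext SE); apply: (@mf_Rint1 _ _ _ _ _ mu (fun p : X * X => A p.1 p.2 * h p.2)).
  by apply: mfM; [apply: mf_kernelA; mfun|exact: (measurableT_comp mh measurable_snd)].
have mB : meas (\1_(eball x0 r) : X -> R) by apply: mfindic; exact: meas_eball.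
have lB : Linfc (\1_(eball x0 r) : X -> R).
  apply: (@Linfc_intro _ 1 (r + enorm x0)) => //.
    by move=> x; rewrite ger0_norm indicE// lern1 leq_b1.
  move=> x; rewrite indicE; case: (boolP (x \in _)) => [/set_mem|]; last by rewrite eqxx.
  rewrite /eball /= => xr _; rewrite -{1}[x](subrK x0); apply: (le_trans (enormD _ _)).
  by rewrite lerD2r ltW.
have [phi phiE] := ex_fun (fun x => (g x - S x) / `|g x - S x| * \1_(eball x0 r) x).
have mphi : meas phi by rewrite (funext phiE); mfun.
have phi1 x : `|phi x| <= \1_(eball x0 r) x.
  rewrite phiE normrM [`|\1_ _ _|]ger0_norm ?indicE//; apply: ler_piMl; first by [].
  rewrite normrM normfV normr_id.
  by have [->|d0] := eqVneq (g x - S x) 0; [rewrite normr0|rewrite divff// normr_eq0].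
have lphi : Linfc phi.
  by apply: Linfc_le lB => // x; apply: (le_trans (phi1 x)); exact: ler_norm.
have phi0 x : phi x != 0 -> eball x0 r x.
  by move=> px; apply: contrapT => nP; move/negP: px; apply; rewrite phiE indicE memNset// mulr0.
have Dphi x : g x * phi x - S x * phi x = `|g x - S x| * \1_(eball x0 r) x.
  rewrite -mulrBl phiE mulrA; congr (_ * _); have [->|d0] := eqVneq (g x - S x) 0; first by rewrite normr0 !mul0r.
  by rewrite mulrA -expr2 -(real_normK (num_real (g x - S x))) mulfK// normr_eq0.
have sep x y : phi x != 0 -> h y != 0 -> r <= enorm (x - y).
  move=> /phi0 xr hy; rewrite leNgt; apply/negP => xz; move/eqP: hy; apply; apply: h0.
  rewrite /=; apply: (le_lt_trans (enormBD y x x0)).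
  by rewrite mulr_natl; apply: ltrD => //; rewrite enormC.
have [ip pE] := pairing_separated kd lphi lh r0 sep.
have E : \int[mu]_x (g x * phi x) = \int[mu]_x (S x * phi x).
  rewrite (near_pairing lh ng lphi) pE Rfubini1//; congr Rintegral; apply/funext => x /=.
  rewrite SE mulrC -Rint_scale; last by apply: mfM => //; apply: mf_kernelA; mfun.
  by congr Rintegral; apply/funext => z; ring.
have iS : integ mu (fun x => S x * phi x).
  apply: int_integ; first by mfun.
  apply: (le_lt_via (\int[mu]_x (c * `|\1_(eball x0 r) x|)%:E)%E).
    apply: int_le; [by mfun|by mfun|] => x; rewrite normr_ge0 /= normrM.
    have [p0|p0] := eqVneq (phi x) 0; first by rewrite p0 normr0 mulr0 mulr_ge0.
    apply: ler_pM => //; last by apply: (le_trans (phi1 x)); exact: ler_norm.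
    by rewrite SE; have [] := Hc x (phi0 x p0).
  rewrite intZl//; last by mfun.
  by rewrite lte_mul_pinfty//; exact: integrable_int (Linfc_integ lB).
have ig := Linfc_prod_integrable g2 lphi.
have Z : (\int[mu]_x (`|g x - S x| * \1_(eball x0 r) x)%:E = 0)%E.
  under eq_integral do rewrite -Dphi.
  rewrite -RintE; last exact: (integrableB measurableT ig iS).
  by rewrite -Rint_sub// E subrr.
have m1 : meas (fun x => (`|g x - S x| * \1_(eball x0 r) x)%:E) by mfun.
have [H _] := ae_eq_integral_abs mu measurableT m1.
have : ae_eq mu setT (fun x => (`|g x - S x| * \1_(eball x0 r) x)%:E) (cst 0%E).
  by apply: H; rewrite -[RHS]Z; apply: eq_integral => x _; rewrite abse_EFin ger0_norm.
apply: filterS => x /(_ I) /= [] hx xr; rewrite -SE; move: hx; rewrite indicE mem_set// mulr1.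
by move=> /eqP; rewrite normr_eq0 subr_eq0 => /eqP.
Qed.

(** Hörmander's condition for the transposed kernel, hence the order [s2 s1] in the constant. *)
Lemma int_tail_le f (F : R) x0 x (r : R) : meas f -> 0 <= F -> (forall z, `|f z| <= F) ->
  0 < r -> eball x0 r x ->
  (\int[mu]_z (`|((A x z - A x0 z) * f z) * \1_(~` eball x0 (2 * r)) z|)%:E <= (M * atom_cst s2 s1 * F)%:E)%E.
Proof.
move=> mf F0 fF r0 xr; have mK : meas K by case: kd.
have mA y : meas (fun z => A y z) by apply: mf_kernelA; mfun.
have mx := mA x; have mx0 := mA x0.
have I0 z : 0 <= (\1_(~` eball x0 (2 * r)) z : R) by [].
have [D DE] := ex_fun (fun z => A x z - A x0 z).
have mD : meas D.
  rewrite (funext DE); apply: mfB; [exact: mx|exact: mx0].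
have hr : enorm (x - x0) <= r by apply: ltW.
have DI : (\int[mu]_z (`|D z| * \1_(~` eball x0 (2 * r)) z)%:E <= (M * atom_cst s2 s1)%:E)%E.
  have := int_kernel_increment x0 (ker_data_sym kd) r0 hr.
  by rewrite [x0 + _]addrC subrK; under eq_integral do rewrite -!(kernelAC s s1 s2) -DE.
under eq_integral do rewrite -DE; clear mA mx mx0.
apply: (le_via (\int[mu]_z (F * (`|D z| * \1_(~` eball x0 (2 * r)) z))%:E)%E).
  apply: int_le; [by mfun|by mfun|] => z; rewrite normr_ge0 /= !normrM (ger0_norm (I0 z)).
  rewrite [F * _]mulrC -!mulrA; apply: ler_wpM2l; first by [].
  rewrite [leLHS]mulrC; apply: ler_wpM2l => //.
rewrite [M * _ * F]mulrC; apply: intZl_le; [exact: F0|mfun|by []|exact: DI].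
Qed.

Lemma tail_bound f (F : R) x0 x (r : R) : meas f -> 0 <= F -> {ae mu, forall z, `|f z| <= F} ->
  0 < r -> eball x0 r x ->
  `|\int[mu]_(z in ~` eball x0 (2 * r)) ((A x z - A x0 z) * f z)| <= M * atom_cst s2 s1 * F.
Proof.
move=> mf F0 fF r0 xr; have mK : meas K by case: kd.
have mE : measurable (~` eball x0 (2 * r)) by apply: measurableC; exact: meas_eball.
have [D DE] := ex_fun (fun z => A x z - A x0 z).
have mD : meas D by rewrite (funext DE); apply: mfB; apply: mf_kernelA; mfun.
rewrite Rint_setE// -lee_fin; under eq_fun do rewrite -DE.
apply: Rint_le; first by mfun.
have mc : meas (fun z => clip F (f z)) by rewrite /clip; apply: mfmax; [mfun|apply: mfmin; mfun].
have cF z : `|clip F (f z)| <= F by rewrite clip_abs// ge_min lexx orbT.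
have := int_tail_le mc F0 cF r0 xr; under [X in (X <= _)%E -> _]eq_integral do rewrite -DE.
apply: le_trans; apply: le_of_eq; apply: ae_eq_integral => //; [by mfun|by mfun|].
apply: filterS fF => z fz _; congr (`|_ * _ * _|%:E).
by apply/eqP; rewrite -subr_eq0 -normr_eq0 clip_sub_abs// max_r// subr_le0.
Qed.

(** For the parameter $\lambda=1/(MF)$ the three terms of [oscillation_le] are multiples of $MF$:
    the $L^2$ bound on a doubled ball, which lies in a cube of side $4(n+1)\ell$ for a cube of side
    $\ell$; $\lambda^{-1}$; and the tail. *)
Definition bmo_cst (C2 : R) (s1 s2 : R) : R :=
  2 * (4 * C2 * (4 * n.+1%:R) ^+ n + 1 + atom_cst s2 s1).

Lemma bmo_bound f g (F C2 : R) : 0 < F -> 0 <= C2 ->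
  (forall u, test_function u -> (\int[mu]_x (`|T0 u x| `^ 2)%:E <= (C2 * M ^+ 2)%:E * \int[mu]_x (`|u x| `^ 2)%:E)%E) ->
  meas f -> {ae mu, forall z, `|f z| <= F} -> meas g ->
  (forall x0 (r : R), 0 < r -> exists c g1, near_T0 2 (fun z => f z * \1_(eball x0 (2 * r)) z) g1 /\
     {ae mu, forall x, eball x0 r x ->
        g x = g1 x + \int[mu]_(z in ~` eball x0 (2 * r)) ((A x z - A x0 z) * f z) + c}) ->
  (bmo_norm g <= (bmo_cst C2 s1 s2 * M * F)%:E)%E.
Proof.
move=> F0 C20 HC mf fF mg H; apply: ge_ereal_sup => _ [[x0 l] /= l0 <-].
have r0 : 0 < n.+1%:R * l by rewrite mulr_gt0.
have [c [g1 [ng hg]]] := H x0 _ r0; have [mg1 _] := ng.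
have two1 : 1 <= 2 :> R by rewrite ler1n.
have mB : meas (\1_(eball x0 (2 * (n.+1%:R * l))) : X -> R) by apply: mfindic; exact: meas_eball.
have V0 : 0 < l ^+ n by rewrite exprn_gt0.
pose V2 := (4 * n.+1%:R) ^+ n * l ^+ n.
have fB : (\int[mu]_x (`|f x * \1_(eball x0 (2 * (n.+1%:R * l))) x| `^ 2)%:E <= (F ^+ 2 * V2)%:E)%E.
  apply: (le_via (\int[mu]_x (F ^+ 2 * \1_(eball x0 (2 * (n.+1%:R * l))) x)%:E)%E).
    apply: int_ae_le.
    - by mfun.
    - by mfun.
    - by [].
    - by nneg.
    apply: filterS fF => x fx; rewrite powR_norm2 exprMn indicE; case: (x \in _).
      by rewrite expr1n !mulr1 -(real_normK (num_real (f x))) lerXn2r ?nnegrE// ltW.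
    by rewrite expr0n !mulr0.
  apply: intZl_le; [exact: sqr_ge0|exact: mB|by []|].
  rewrite integral_indic; [|by []|exact: meas_eball]; rewrite setIT.
  have := @mu_cball_le R n x0 (2 * (n.+1%:R * l)); rewrite mulr_ge0 ?(ltW r0)// => /(_ isT).
  rewrite /V2 -exprMn (_ : 2 * (2 * (n.+1%:R * l)) = 4 * n.+1%:R * l); last by ring.
  apply: le_trans; apply: le_measure; rewrite ?inE; [exact: meas_eball|exact: meas_cball|].
  by move=> x; exact: ltW.
have fL : Lp 2 (fun x => f x * \1_(eball x0 (2 * (n.+1%:R * l))) x).
  by split; [mfun|exact: le_lt_trans fB (ltry _)].
have C2M : 0 <= C2 * M ^+ 2 by nneg.
have G1 : (\int[mu]_x (`|g1 x| `^ 2)%:E <= (4 * (C2 * M ^+ 2) * (F ^+ 2 * V2))%:E)%E.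
  have := near_strong two1 C2M HC fL ng => h; apply: (le_trans h).
  have -> : 2 `^ 2 = 4 :> R by rewrite powR_mulrn// expr2 -natrM.
  rewrite (EFinM (4 * (C2 * M ^+ 2))); apply: lee_wpmul2l => //.
  by rewrite lee_fin mulr_ge0.
have MF : 0 < M * F by rewrite mulr_gt0.
have lam0 : 0 < (M * F)^-1 by rewrite invr_gt0.
have a0 : 0 <= atom_cst s2 s1.
  have := int_kernel_increment x0 (ker_data_sym kd) ltr01 (_ : enorm 0 <= 1).
  rewrite enorm0 ler01 => /(_ isT) h; rewrite -(pmulr_rge0 _ M0) -lee_fin; apply: le_trans h.
  by apply: integral_ge0 => x _; rewrite indicE.
have tau0 : 0 <= M * atom_cst s2 s1 * F by nneg.
have sub x : cube x0 l x -> eball x0 (n.+1%:R * l) x.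
  move=> xQ; rewrite /=; apply: (le_lt_via (n%:R * l)); last by rewrite ltr_pM2r// ltr_nat.
  apply: enorm_le_coord; first exact: ltW.
  move=> i; rewrite !mxE; have /andP[h1 h2] := xQ i; rewrite ger0_norm ?subr_ge0//.
  by rewrite lerBlDr addrC.
have hae : {ae mu, forall x, cube x0 l x -> `|g x - c| <= `|g1 x| + M * atom_cst s2 s1 * F}.
  apply: filterS hg => x hx /sub xb; rewrite (hx xb) addrK; apply: (le_trans (ler_normD _ _)).
  by rewrite lerD2l; apply: tail_bound => //; exact: ltW.
apply: (le_trans (oscillation_le (cube_measurable x0 l) (mu_cube x0 (ltW l0)) V0 mg mg1 tau0 lam0 G1 hae)).
rewrite lee_fin /bmo_cst /V2 invrK le_eqVlt; apply/orP; left; apply/eqP.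
have M1 : M != 0 by rewrite gt_eqF. have F1 : F != 0 by rewrite gt_eqF. have V1 : l ^+ n != 0 by rewrite gt_eqF.
by move: (l ^+ n) V1 ((4 * n.+1%:R) ^+ n : R) (atom_cst s2 s1) => w w1 u a; field; rewrite w1 F1.
Qed.

Lemma T0_locally_integrable u : test_function u -> locally_integrable_rV (T0 u).
Proof.
move=> tu; have mT := mf_T0_test tu; split => //.
move=> D cD; have mD := compact_measurable_rV cD.
have [B B0 hB] := T0_bounded kd (test_Lipc tu).
rewrite int_setE//; apply: (le_lt_via (\int[mu]_x (B * \1_D x)%:E)%E).
  apply: int_le; [mfun|mfun|] => x; rewrite mulr_ge0 ?indicE//=; apply: ler_wpM2r => //; exact: hB.
rewrite intZl//.
rewrite lte_mul_pinfty ?lee_fin// integral_indic// setIT.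
have [m hm] : exists m : R, D `<=` cball 0 m.
  have [m [_ hm]] := compact_bounded cD; exists (n%:R * (`|m| + 1)) => x Dx.
  rewrite /cball /= subr0; apply: enorm_le_coord; first by [].
  move=> i; have m1 : m < `|m| + 1 by rewrite (le_lt_trans (ler_norm m))// ltrDl.
  apply: le_trans (hm _ m1 x Dx); rewrite [leRHS]/Num.norm /= mx_normrE.
  exact: (@le_bigmax _ _ _ _ (fun ij => `|x ij.1 ij.2|) (ord0, i)).
apply: le_lt_trans (mu_cball_lty (0 : X) m); apply: le_measure; rewrite ?inE //.
exact: meas_cball.
Qed.

Lemma test_product_integrable g phi : locally_integrable_rV g -> test_function phi ->
  integ mu (fun x => g x * phi x).
Proof.
move=> [mg lg] tphi; have mphi := test_mf tphi; apply: int_integ; first by mfun.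
have [B B0 hB] := Linfc_bounded (test_Lipc tphi).1.
have mS := compact_measurable_rV tphi.2.
apply: (le_lt_via (\int[mu]_x (B * (`|g x| * \1_(supp phi) x))%:E)%E).
  apply: int_le; [by mfun|by mfun|] => x; rewrite normr_ge0 /= normrM.
  have [->|px] := eqVneq (phi x) 0; first by rewrite normr0 mulr0 !mulr_ge0.
  by rewrite indicE (mem_set (supp_in px)) mulr1 mulrC ler_wpM2r.
rewrite intZl; [|exact: B0|mfun|by []].
by rewrite lte_mul_pinfty ?lee_fin// -int_setE//; apply: lg; exact: tphi.2.
Qed.

(** * Bounds for every operator that satisfies the definition *)

Section operator.
Variable T : (X -> R) -> X -> R.
Hypothesis HT : is_operatorT s s1 s2 K T.

(** Both functions are locally integrable and have the same integrals against test functions. *)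
Lemma operator_test u : test_function u -> {ae mu, forall x, T u x = T0 u x}.
Proof.
move=> tu; have [lT wT] := operatorT_weak HT tu; have l0 := T0_locally_integrable tu.
have [mT _] := lT; have [m0 _] := l0.
have lD : locally_integrable_rV (fun x => T u x - T0 u x).
  split; first by mfun.
  move=> D cD; have mD := compact_measurable_rV cD.
  rewrite int_setE//; apply: (le_lt_via (\int[mu]_x (`|T u x| * \1_D x + `|T0 u x| * \1_D x)%:E)%E).
    apply: int_le; [by mfun|by mfun|] => x; rewrite mulr_ge0 ?indicE//= -mulrDl; apply: ler_wpM2r => //.
    exact: ler_normB.
  rewrite intD; [|mfun|mfun|by []|by []].
  by rewrite -!int_setE// lte_add_pinfty//; [exact: lT.2|exact: l0.2].
have : {ae mu, forall x, T u x - T0 u x = 0}.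
  apply: test_eq0 lD _ => phi tphi.
  have [_ h] := wT phi tphi.
  rewrite -(_ : \int[mu]_x (T u x * phi x) - \int[mu]_x (T0 u x * phi x) = 0); last first.
    by rewrite h (T0_pairing kd (test_Lipc tu) (test_Lipc tphi).1) subrr.
  rewrite Rint_sub; [|exact: test_product_integrable|exact: test_product_integrable].
  by congr Rintegral; apply/funext => x; rewrite mulrBl.
by apply: filterS => x /eqP; rewrite subr_eq0 => /eqP.
Qed.

(** Along test functions converging to [f], the values of [T] converge in measure to [T f] and
    coincide with those of [T0], whose increments obey the weak-type bound. *)
Lemma operator_near p f : 1 <= p -> Lp p f -> near_T0 p f (T f).
Proof.
move=> p1 fp; have p0 : 0 < p by apply: lt_le_trans p1.
have fL : f \in Lfun mu p%:E by apply/(Lfun_int mu f p1).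
have mT : meas (T f) by apply: (operatorT_measurable HT _ fL); rewrite lee_fin.
split => //.
have [C C0 H] := T0_weak_diff p1.
(* One factor $2^p$ comes from halving the level, the other from the triangle inequality for p-th
   powers. *)
exists (C * 2 `^ p * 2 `^ p) => [|v t tv t0]; first by nneg.
have half0 k : 0 < (2^-1 ^+ k : R) by [].
have /choice[w wP] : forall k, exists u, test_function u /\ (\int[mu]_x (`|f x - u x| `^ p)%:E <= (2^-1 ^+ k)%:E)%E.
  by move=> k; have [u [tu hu _]] := Lp_approx p1 p1 fp fp (half0 k); exists u.
have tw k : test_function (w k) by have [] := wP k.
have mw k := test_mf (tw k); have mf := fp.1; have mv := test_mf tv.
have cw : ('N[mu]_p%:E[EFin \o (w k \- f)%R])%E @[k --> \oo] --> 0%E.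
  apply/(Lnorm_cvg0 mu (fun k => (w k \- f)%R) p1) => e e0.
  have [N hN] := pow_half_small 1 e0; exists N => k /hN; rewrite mul1r => h.
  have [_ h2] := wP k; under eq_integral do rewrite distrC.
  by apply: (le_trans h2); rewrite lee_fin.
have t2 : 0 < t / 2 by rewrite divr_gt0.
have cm := operatorT_Lp HT p1 fL tw cw t2.
have [F F0 FE] := Lp_test_diff p1 fp tv; rewrite FE.
apply/lee_addgt0Pr => e e0.
have e2 : 0 < e / 2 by rewrite divr_gt0.
have D0 : 0 < C / (t / 2) `^ p * 2 `^ p + 1 by rewrite ltr_pwDr// mulr_ge0 ?divr_ge0 ?powR_ge0.
have [N hN] := pow_half_small 1 (divr_gt0 e2 D0).
have m0 k : (0 <= mu [set x | (t / 2 <= `|T (w k) x - T f x|)%R])%E by [].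
have [N' hN'] := (cvge0_nonneg m0).1 cm _ e2.
pose k := (N + N')%N.
have mTv := mf_T0_test tv; have mTw := mf_T0_test (tw k).
have := @superlevelD (fun x => T0 v x - T f x) (fun x => T0 v x - T0 (w k) x) (fun x => T0 (w k) x - T f x) (t / 2).
rewrite (_ : 2 * (t / 2) = t); last by rewrite mulrC divfK.
move=> /(_ (mfB mTv mTw) (mfB mTw mT) (fun x => esym (subrKA _ _ _)))/le_trans; apply.
rewrite [e]splitr EFinD addeA; apply: leeD; last first.
  have aeq := operator_test (tw k).
  have [mTwk _] := (operatorT_weak HT (tw k)).1.
  rewrite (@superlevel_ae_eq _ _ _ mu _ (fun x => T (w k) x - T f x)); [|mfun|mfun|by apply: filterS aeq => x ->].
  apply: le_trans (hN' k (leq_addl _ _)); apply: le_measure; rewrite ?inE.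
  - by apply: meas_superlevel; mfun.
  - by apply: mf_le; mfun.
  - by move=> x; exact: ltW.
apply: (le_trans (H _ _ _ tv (tw k) t2)).
have h1 : (\int[mu]_x (`|v x - f x| `^ p)%:E <= F%:E)%E by rewrite -FE; under eq_integral do rewrite distrC.
have h2 : (\int[mu]_x (`|f x - w k x| `^ p)%:E <= (e / 2 / (C / (t / 2) `^ p * 2 `^ p + 1))%:E)%E.
  have [_ h] := wP k; apply: (le_trans h); rewrite -[2^-1 ^+ k]mul1r; apply: hN; exact: leq_addr.
apply: (le_trans (lee_wpmul2l _ (Lp_triangle (ltW p0) mv mf (mw k) h1 h2))).
  by rewrite lee_fin divr_ge0 ?powR_ge0.
rewrite lee_fin mulrA mulrDr; apply: lerD.
  rewrite powRM ?(ltW t0)// le_eqVlt; apply/orP; left; apply/eqP.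
  have -> : (2^-1 : R) `^ p = (2 `^ p)^-1.
    by apply: (mulfI (_ : 2 `^ p != 0)); rewrite ?powR_gt0// mulfV ?powR_gt0// -powRM// mulfV ?powR1.
  have : 2 `^ p != 0 :> R by [].
  have : t `^ p != 0 :> R by rewrite gt_eqF// powR_gt0.
  by move: (t `^ p) (2 `^ p) => a b a1 b1; field; rewrite a1.
by rewrite mulrCA ger_pMr// ler_pdivrMr// mul1r lerDl.
Qed.

Lemma operator_linear a f g : f \in Lfun mu 2%:E -> g \in Lfun mu 2%:E ->
  {ae mu, forall x, T (fun y => a * f y + g y) x = a * T f x + T g x}.
Proof.
have two1 : 1 <= 2 :> R by rewrite ler1n.
move=> /(Lfun_int mu f two1) f2 /(Lfun_int mu g two1) g2.
have nl := near_lin a two1 g2 f2 (operator_near two1 g2) (operator_near two1 f2).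
have l2 := LpD a (le_trans ler01 two1) g2 f2.
have E : (fun x => g x + a * f x) = (fun y => a * f y + g y) by apply/funext => x; rewrite addrC.
rewrite E in nl l2.
have := near_unique two1 two1 l2 l2 (operator_near two1 l2) nl.
by apply: filterS => x ->; rewrite addrC.
Qed.

Lemma operator_strong p : 1 < p -> forall C, 0 <= C ->
  (forall u, Lipc u -> (\int[mu]_x (`|T0 u x| `^ p)%:E <= (C * M `^ p)%:E * \int[mu]_x (`|u x| `^ p)%:E)%E) ->
  forall f, f \in Lfun mu p%:E ->
  ('N[mu]_p%:E[EFin \o T f] <= ((2 `^ p * C) `^ p^-1 * M)%:E * 'N[mu]_p%:E[EFin \o f])%E.
Proof.
move=> p1 C C0 H f; have p0 : 0 < p by apply: lt_trans p1.
move=> /(Lfun_int mu f (ltW p1)) fp.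
have CM : 0 <= C * M `^ p by nneg.
apply: Lnorm_bound; [exact: ltW|by nneg|exact: fp.2|].
rewrite powRM ?powR_ge0 ?(ltW M0)// -powRrM mulVf ?gt_eqF// powRr1 ?mulr_ge0 ?powR_ge0// -mulrA.
apply: (near_strong (ltW p1) CM _ fp (operator_near (ltW p1) fp)) => u tu.
by apply: H; exact: test_Lipc.
Qed.

Lemma operator_weak C : 0 <= C ->
  (forall u t, Lipc u -> 0 < t -> (mu (superlevel (T0 u) t) <= (C * M `^ 1 / t `^ 1)%:E * \int[mu]_x (`|u x| `^ 1)%:E)%E) ->
  forall f, f \in Lfun mu 1%:E -> (weakL1_norm (T f) <= (2 * C * M)%:E * 'N[mu]_1%:E[EFin \o f])%E.
Proof.
move=> C0 H f /(Lfun_int mu f (lexx 1)) fp.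
have CM : 0 <= C * M by nneg.
apply: ge_ereal_sup => _ [t /= t0 <-].
have h := near_weak (lexx 1) CM _ fp (operator_near (lexx 1) fp) t0.
apply: (le_via (t%:E * ((2 `^ 1 * (C * M) / t `^ 1)%:E * \int[mu]_x (`|f x| `^ 1)%:E))%E).
  apply: lee_wpmul2l; first by rewrite ltW.
  apply: h => u r tu r0; have := H u r (test_Lipc tu) r0; by rewrite [M `^ 1]powRr1 ?(ltW M0).
rewrite muleA -EFinM !powRr1 ?(ltW t0)// (_ : t * _ = 2 * C * M); last first.
  have t1 : t != 0 by rewrite gt_eqF.
  by field.
rewrite LnormE invr1 poweRe1//; apply: integral_ge0 => x _; by [].
Qed.

Lemma operator_bmo C2 f (F : R) : 0 < F -> 0 <= C2 ->
  (forall u, Lipc u -> (\int[mu]_x (`|T0 u x| `^ 2)%:E <= (C2 * M ^+ 2)%:E * \int[mu]_x (`|u x| `^ 2)%:E)%E) ->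
  f \in Lfun mu +oo%E -> {ae mu, forall z, `|f z| <= F} ->
  (bmo_norm (T f) <= (bmo_cst C2 s1 s2 * M * F)%:E)%E.
Proof.
move=> F0 C20 H fL fF; have mf := Linfty_mf fL.
have mT : meas (T f) by apply: (operatorT_measurable HT _ fL); rewrite leey.
apply: (bmo_bound F0 C20 _ mf fF mT) => [u tu|x0 r r0]; first by apply: H; exact: test_Lipc.
have [c hc] := operatorT_Loo HT fL x0 r0.
exists c, (T (fun z => f z * \1_(eball x0 (2 * r)) z)); split.
  apply: operator_near; first by rewrite ler1n.
  have mB : meas (\1_(eball x0 (2 * r)) : X -> R) by apply: mfindic; exact: meas_eball.
  split; first by mfun.
  apply: (le_lt_via (\int[mu]_x (F `^ 2 * \1_(eball x0 (2 * r)) x)%:E)%E).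
    apply: int_ae_le; [mfun|mfun|by []|by nneg|].
    apply: filterS fF => x fx; rewrite indicE; case: (x \in _).
      by rewrite !mulr1; apply: ge0_ler_powR; rewrite ?nnegrE// ltW.
    by rewrite !mulr0 normr0 powR0.
  rewrite intZl; [|exact: powR_ge0|exact: mB|by []].
  rewrite lte_mul_pinfty ?lee_fin ?powR_ge0// integral_indic ?setIT//; last exact: meas_eball.
  apply: le_lt_trans (mu_cball_lty x0 (2 * r)); apply: le_measure; rewrite ?inE; [exact: meas_eball|exact: meas_cball|].
  by move=> x; exact: ltW.
by apply: filterS hc => x hx xb; have [_ ->] := hx xb.
Qed.

Lemma operator_associated : associated_kernel T A.
Proof.
move=> f tf; have := operator_test tf; apply: filterS => x -> sx.
have : nbhs x (~` supp f) by apply: open_nbhs_nbhs; split=> //; exact/closed_openC/closed_closure.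
move=> /rV_nbhs_enorm[r r0 hr].
have away y : f y != 0 -> r <= enorm (x - y).
  move=> fy; rewrite leNgt; apply/negP => xy; apply: (hr y); first by rewrite enormC.
  exact: supp_in.
have [i e] := T0_kernel kd (test_Lipc tf) r0 away.
by [].
Qed.

End operator.

Lemma kernelA_standard : standard_kernel A.
Proof.
have S0 := size_cst_ge0 kd; have H0 := holder_cst_ge0 kd; have H0' := holder_cst_ge0 (ker_data_sym kd).
have [a0 _ _ _ _] := ker_alphaP kd.
pose C := M * size_cst s1 s2 + 2 * (M * holder_cst s1 s2) + 1.
have m1 : 0 <= M * size_cst s1 s2 by nneg.
have m2 : 0 <= M * holder_cst s1 s2 by nneg.
exists C, (ker_alpha s1 s2); split.
- by rewrite ltr_pwDr// addr_ge0// mulr_ge0.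
- exact: a0.
- move=> z1 z2 z12; apply: (le_trans (kernelA_size kd z12)); apply: ler_wpM2r; first exact: powR_ge0.
  by rewrite /C -addrA lerDl addr_ge0// mulr_ge0.
move=> z1 z2 h z12 hh.
apply: (le_trans (lerD (kernelA_holder1 kd z12 hh) (kernelA_holder2 kd z12 hh))).
have alg (m a b c : R) : 0 <= a -> 0 <= b -> 2 * m <= c -> m * (a * b) + m * (a * b) <= c * a * b.
  move=> a1 b1 mc; rewrite (_ : m * (a * b) + m * (a * b) = 2 * m * (a * b)); last by ring.
  by rewrite -[leRHS]mulrA; apply: ler_wpM2r => //; rewrite mulr_ge0.
apply: alg; [exact: powR_ge0|exact: powR_ge0|].
by rewrite /C -addrA addrCA lerDl addr_ge0.
Qed.

(** * Construction of the operator, in particular on $L^\infty$ *)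

Let two1 : 1 <= 2 :> R. Proof. by rewrite ler1n. Qed.

Lemma mu_eball_lty x (r : R) : (mu (eball x r) < +oo)%E.
Proof.
apply: le_lt_trans (mu_cball_lty x r); apply: le_measure; rewrite ?inE; [exact: meas_eball|exact: meas_cball|].
by move=> y; exact: ltW.
Qed.

Lemma ae_ball_exists x0 (r : R) (P : X -> Prop) : 0 < r -> {ae mu, forall x, P x} -> exists2 x, eball x0 r x & P x.
Proof.
move=> r0 [N [mN N0 hN]]; apply: contrapT => H.
have BN : eball x0 r `<=` N.
  by move=> x xr; apply: hN => /= Px; apply: H; exists x.
have l0 : 0 < r / n.+1%:R by rewrite divr_gt0.
have CB : cube x0 (r / n.+1%:R) `<=` eball x0 r.
  move=> x xQ; rewrite /=; apply: (le_lt_via (n%:R * (r / n.+1%:R))).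
    apply: enorm_le_coord; first exact: ltW.
    move=> i; rewrite !mxE; have /andP[h1 h2] := xQ i; rewrite ger0_norm ?subr_ge0//.
    by rewrite lerBlDr addrC.
  by rewrite mulrCA gtr_pMr// ltr_pdivrMr// mul1r ltr_nat.
have : (mu (cube x0 (r / n.+1%:R)) <= mu N)%E.
  apply: le_measure; rewrite ?inE; [exact: cube_measurable|exact: mN|exact: subset_trans CB BN].
rewrite mu_cube ?(ltW l0)// => h.
have N0' : mu N = 0%E by [].
by move: h; rewrite N0' lee_fin leNgt exprn_gt0.
Qed.

Definition on_ball f x0 (r : R) z : R := f z * \1_(eball x0 r) z.

Lemma mf_on_ball f x0 (r : R) : meas f -> meas (on_ball f x0 r).
Proof. by move=> mf; apply: mfM => //; apply: mfindic; exact: meas_eball. Qed.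

Lemma on_ball_Lp f (F : R) q x0 (r : R) : 0 < q -> 0 <= F -> meas f -> {ae mu, forall z, `|f z| <= F} ->
  Lp q (on_ball f x0 r).
Proof.
move=> q0 F0 mf fF; have mB : meas (\1_(eball x0 r) : X -> R) by apply: mfindic; exact: meas_eball.
have mo := mf_on_ball x0 r mf; split=> //.
apply: (le_lt_via (\int[mu]_x (F `^ q * \1_(eball x0 r) x)%:E)%E).
  apply: int_ae_le; [mfun|mfun|by []|by nneg|].
  apply: filterS fF => x fx; rewrite /on_ball indicE; case: (x \in _).
    by rewrite !mulr1; apply: ge0_ler_powR; rewrite ?nnegrE// ltW.
  by rewrite !mulr0 normr0 powR0// gt_eqF.
rewrite intZl; [|exact: powR_ge0|exact: mB|by []].
by rewrite lte_mul_pinfty ?lee_fin ?powR_ge0// integral_indic ?setIT//; [exact: mu_eball_lty|exact: meas_eball].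
Qed.

Section bounded_function.
Variables (f : X -> R) (F : R).
Hypotheses (mf : meas f) (F0 : 0 <= F) (fF : {ae mu, forall z, `|f z| <= F}).

(** A representative of [f] that is bounded everywhere, as the kernel estimates require. *)
Let fc z := clip F (f z).

Let fcE : {ae mu, forall z, f z = fc z}.
Proof.
apply: filterS fF => z fz; apply/eqP.
by rewrite -subr_eq0 -normr_eq0 clip_sub_abs// max_r// subr_le0.
Qed.

Let mfc : meas fc.
Proof. by rewrite /fc; apply: mfmax; [mfun|apply: mfmin; mfun]. Qed.

Let fcF z : `|fc z| <= F.
Proof. by rewrite clip_abs// ge_min lexx orbT. Qed.

Lemma tail_integrable x0 (r : R) x : 0 < r -> eball x0 r x ->
  integ mu (fun z => ((A x z - A x0 z) * f z) * \1_(~` eball x0 (2 * r)) z).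
Proof.
move=> r0 xr; have mK : meas K by case: kd.
have [D DE] := ex_fun (fun z => A x z - A x0 z).
have mD : meas D by rewrite (funext DE); apply: mfB; apply: mf_kernelA; mfun.
have := int_tail_le mfc F0 fcF r0 xr; under [X in (X <= _)%E -> _]eq_integral do rewrite -DE.
move=> h; rewrite (_ : (fun z => _) = (fun z => D z * f z * \1_(~` eball x0 (2 * r)) z)); last first.
  by apply/funext => z; rewrite DE.
apply: int_integ; first by mfun.
apply: le_lt_trans (ltry (M * atom_cst s2 s1 * F)); apply: le_trans h.
apply: le_of_eq; apply: ae_eq_integral => //; [mfun|mfun|].
by apply: filterS fcE => z <-.
Qed.

Definition tail x0 (r : R) x : R := \int[mu]_(z in ~` eball x0 (2 * r)) ((A x z - A x0 z) * f z).

(* [d j] absorbs the (possibly divergent) constants [\int A x0 f] over growing balls. *)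
Lemma ball_sequence x0 (r : R) g1 (N : nat -> nat) (G : nat -> X -> R) : 0 < r ->
  near_T0 2 (on_ball f x0 (2 * r)) g1 -> (forall j, (j <= N j)%N) ->
  (forall j, near_T0 2 (on_ball f 0 (N j)%:R) (G j)) ->
  exists d : nat -> R, {ae mu, forall x, eball x0 r x -> G j x - d j @[j --> \oo] --> g1 x + tail x0 r x}.
Proof.
move=> r0 ng1 jN nG; have mK : meas K by case: kd.
have mB1 := meas_eball x0 (2 * r).
have [h hE] := ex_fun (fun jz : nat * X => fc jz.2 * (\1_(eball 0 (N jz.1)%:R) jz.2 * \1_(~` eball x0 (2 * r)) jz.2)).
have mI : meas (\1_(~` eball x0 (2 * r)) : X -> R).
  by apply: mfindic; apply: measurableC; exact: mB1.
have mh j : meas (fun z => h (j, z)).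
  rewrite (_ : (fun z => _) = (fun z => fc z * (\1_(eball 0 (N j)%:R) z * \1_(~` eball x0 (2 * r)) z))).
    apply: mfM; [exact: mfc|apply: mfM; [|exact: mI]].
    by apply: mfindic; exact: meas_eball.
  by apply/funext => z; rewrite hE.
have lh j : Linfc (fun z => h (j, z)).
  apply: (Linfc_intro (M := F) (r := (N j)%:R)) => //.
    move=> z; rewrite hE !indicE; case: (z \in _); case: (z \in _);
      by rewrite ?mulr1 ?mulr0 ?normr0//; exact: fcF.
  move=> z; rewrite hE /= indicE; have [zN|] := boolP (z \in _); last by rewrite mul0r mulr0 eqxx.
  by move=> _; move: zN; rewrite inE /eball /= subr0 => /ltW.
have [J hJ] : exists J : nat, enorm x0 + 2 * r <= J%:R.
  exists (Num.bound (enorm x0 + 2 * r)); apply/ltW/archi_boundP.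
  by nneg.
have sub j : (J <= j)%N -> eball x0 (2 * r) `<=` eball 0 (N j)%:R.
  move=> jJ z; rewrite /eball /= subr0 => zx.
  have -> : z = (z - x0) + x0 by rewrite subrK.
  apply: (le_lt_trans (enormD _ _)); rewrite addrC.
  apply: (@lt_le_trans _ _ (enorm x0 + 2 * r)); first by rewrite ltrD2l.
  by apply: (le_trans hJ); rewrite ler_nat (leq_trans jJ).
(* By linearity [G j] minus [g1] is a value at [h (j, _)], which vanishes on the doubled ball; there
   the kernel represents it. *)
have hb j : (J <= j)%N -> near_T0 2 (fun z => h (j, z)) (fun x => G j x + -1 * g1 x).
  move=> jJ; have L1 := on_ball_Lp 0 (N j)%:R (ltr0n R 2) F0 mf fF.
  have L2 := on_ball_Lp x0 (2 * r) (ltr0n R 2) F0 mf fF.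
  apply: near_ae_eq (near_lin (-1) two1 L1 L2 (nG j) ng1) _ _ _; last 2 first.
  - exact: (LpD (-1) (ler0n R 2) L1 L2).1.
  - exact: mh.
  apply: filterS fcE => z zE; rewrite hE /on_ball /= -zE !indicE in_setC.
  have [zB|zB] := boolP (z \in eball x0 (2 * r)); last by rewrite !mulr0 addr0 mulr1.
  rewrite (_ : z \in eball 0 (N j)%:R); last by rewrite inE; apply: (sub j jJ); move: zB; rewrite inE.
  by rewrite !mulr0 mulN1r subrr.
exists (fun j => \int[mu]_z (A x0 z * h (j, z))).
have h0 j y : eball x0 (2 * r) y -> h (j, y) = 0.
  by move=> yb; rewrite hE (_ : \1_(~` eball x0 (2 * r)) y = 0) ?mulr0// indicE memNset// => /(_ yb).
have xb0 : eball x0 r x0 by rewrite /eball /= subrr enorm0.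
have S j : {ae mu, forall x, (J <= j)%N -> eball x0 r x -> G j x - g1 x = \int[mu]_z (A x z * h (j, z))}.
  have [jJ|jJ] := leqP J j; last by apply: aeW.
  have := near_separated (lh j) (hb j jJ) r0 (h0 j).
  by apply: filterS => x hx _ xb; rewrite -mulN1r hx.
have := ae_foralln S; apply: filterS => x hx xb.
have E j : (J <= j)%N -> G j x - \int[mu]_z (A x0 z * h (j, z)) =
    g1 x + \int[mu]_z ((A x z - A x0 z) * h (j, z)).
  move=> jJ; have [cc _ Hc] := kernel_away (lh j) r0 (h0 j).
  have [i1 _] := Hc x xb; have [i2 _] := Hc x0 xb0.
  have := hx j jJ xb => /eqP; rewrite subr_eq => /eqP ->.
  rewrite addrAC addrC; congr (_ + _); rewrite (Rint_sub i1 i2).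
  by congr Rintegral; apply/funext => z; rewrite mulrBl.
apply: (@cvg_trans _ ((fun j => g1 x + \int[mu]_z ((A x z - A x0 z) * h (j, z))) @ \oo)).
  apply: near_eq_cvg; exists J => // j /= jJ; by rewrite E.
apply: cvgD; first exact: cvg_cst.
have [D DE] := ex_fun (fun z => A x z - A x0 z).
have mD : meas D by rewrite (funext DE); apply: mfB; apply: mf_kernelA; mfun.
have mw : meas (fun z => D z * fc z * \1_(~` eball x0 (2 * r)) z).
  by apply: mfM; [apply: mfM => //|exact: mI].
have wi : (\int[mu]_z (`|D z * fc z * \1_(~` eball x0 (2 * r)) z|)%:E < +oo)%E.
  apply: le_lt_trans (ltry (M * atom_cst s2 s1 * F)).
  apply: le_trans (int_tail_le mfc F0 fcF r0 xb).
  by under eq_integral do rewrite DE.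
have -> : tail x0 r x = \int[mu]_z (D z * fc z * \1_(~` eball x0 (2 * r)) z).
  rewrite /tail Rint_setE; last exact: measurableC.
  have -> : (fun z => (A x z - A x0 z) * f z * \1_(~` eball x0 (2 * r)) z) = (fun z => D z * f z * \1_(~` eball x0 (2 * r)) z).
    by apply/funext => z; rewrite DE.
  rewrite /Rintegral; congr fine; apply: ae_eq_integral; [by []| | |].
  - by apply/measurable_EFinP; apply: mfM; [apply: mfM => //|exact: mI].
  - by apply/measurable_EFinP; exact: mw.
  - by apply: filterS fcE => z <-.
apply/cvgrPdist_le => e e0.
have me j : meas (fun z => D z * fc z * \1_(~` eball x0 (2 * r)) z - D z * h (j, z)).
  by apply: mfB; [exact: mw|apply: mfM => //].
have hw j z : `|D z * fc z * \1_(~` eball x0 (2 * r)) z - D z * h (j, z)| <= `|D z * fc z * \1_(~` eball x0 (2 * r)) z|.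
  rewrite hE /= [\1_(eball 0 _) z]indicE; case: (z \in eball 0 _).
    by rewrite mul1r mulrA subrr normr0.
  by rewrite mul0r !mulr0 subr0.
have vz z : D z * fc z * \1_(~` eball x0 (2 * r)) z - D z * h (j, z) @[j --> \oo] --> (0 : R).
  have [m hm] : exists m : nat, enorm z < m%:R.
    by exists (Num.bound (enorm z)); apply: archi_boundP; exact: enorm_ge0.
  apply: cvg_near_cst; exists m => // j /= mj; rewrite hE /= [\1_(eball 0 _) z]indicE mem_set.
    by rewrite mul1r mulrA subrr.
  by rewrite /eball /= subr0; apply: (lt_le_trans hm); rewrite ler_nat (leq_trans mj).
(* The part of the tail beyond the growing ball tends to 0 by dominated convergence; Hörmander's
   condition makes the dominating function integrable. *)
have [N1 hN1] := dominated_vanish me vz (mfnorm mw) hw wi e0.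
exists N1 => // j /= /hN1 hj.
have Wi : integ mu (fun z => D z * h (j, z)).
  have [cc _ Hc] := kernel_away (lh j) r0 (h0 j).
  have [i1 _] := Hc x xb; have [i2 _] := Hc x0 xb0.
  rewrite (_ : EFin \o _ = ((EFin \o (fun z => (A x z * h (j, z))%R)) \- (EFin \o (fun z => (A x0 z * h (j, z))%R)))%E).
    exact: (integrableB measurableT i1 i2).
  by apply/funext => z; rewrite /= DE mulrBl.
have -> : \int[mu]_z ((A x z - A x0 z) * h (j, z)) = \int[mu]_z (D z * h (j, z)).
  by congr Rintegral; apply/funext => z; rewrite DE.
rewrite Rint_sub; [|exact: int_integ|exact: Wi].
by rewrite -lee_fin; apply: Rint_le.
Qed.

End bounded_function.

Let two0 : 0 < 2 :> R. Proof. by []. Qed.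

(** Values at bounded functions, determined up to a constant. The radii [N j] are left free so that,
    for [f] also in some $L^p$, they can grow fast enough for convergence almost everywhere. *)
Definition ball_limit f g : Prop := exists (N : nat -> nat) (G : nat -> X -> R) (e : nat -> R),
  [/\ forall j, (j <= N j)%N, forall j, near_T0 2 (on_ball f 0 (N j)%:R) (G j) &
    {ae mu, forall x, G j x - e j @[j --> \oo] --> g x}].

(** The two normalisations [e] and [d] of the same functions differ by a sequence that does not
    depend on the point. Its limit, read off at one good point of the ball, is the constant. *)
Lemma ball_limit_tail f g g1 (F : R) x0 (r : R) : meas f -> 0 <= F -> {ae mu, forall z, `|f z| <= F} ->
  ball_limit f g -> 0 < r -> near_T0 2 (on_ball f x0 (2 * r)) g1 ->
  exists c, {ae mu, forall x, eball x0 r x -> g x = g1 x + tail f x0 r x + c}.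
Proof.
move=> mf F0 fF [N [G [e [jN nG cG]]]] r0 ng1.
have [d cd] := ball_sequence mf F0 fF r0 ng1 jN nG.
have cc : {ae mu, forall x, eball x0 r x -> d j - e j @[j --> \oo] --> g x - (g1 x + tail f x0 r x)}.
  apply: filterS2 cG cd => x h1 h2 xb; have h := cvgB h1 (h2 xb).
  rewrite (_ : (fun j => d j - e j) = (fun j => (G j x - e j) - (G j x - d j))); first exact: h.
  apply/funext => j; have alg (a b c : R) : a - b = (c - b) - (c - a) by ring.
  exact: alg.
have [y yb cy] := ae_ball_exists x0 r0 cc.
exists (g y - (g1 y + tail f x0 r y)).
apply: filterS cc => x hx xb.
have E : g y - (g1 y + tail f x0 r y) = g x - (g1 x + tail f x0 r x).
  have hy := cy yb; have hx' := hx xb.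
  exact: (cvg_unique _ hy hx').
by rewrite E addrC subrK.
Qed.

(** The constants found on the unit ball serve everywhere: on a larger ball convergence holds with
    other constants, and the two sequences differ by a convergent one, since both normalisations
    converge at a common point of the unit ball. *)
Lemma ball_limit_exists f (F : R) : meas f -> 0 <= F -> {ae mu, forall z, `|f z| <= F} ->
  exists2 g, meas g & ball_limit f g.
Proof.
move=> mf F0 fF.
have oL x0 (r : R) : Lp 2 (on_ball f x0 r) by apply: on_ball_Lp fF.
have /choice[G nG] : forall j : nat, exists g, near_T0 2 (on_ball f 0 j%:R) g.
  move=> j; exact: (near_exists two1 (oL _ _)).
have B m : exists d : nat -> R, {ae mu, forall x, eball 0 m.+1%:R x -> cvgn (fun j => G j x - d j)}.
  have m0 : 0 < m.+1%:R :> R by [].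
  have [g1 ng1] := near_exists two1 (oL 0 (2 * m.+1%:R)).
  have [d cd] := ball_sequence mf F0 fF m0 ng1 (fun j => leqnn j) nG.
  by exists d; apply: filterS cd => x h xb; apply/cvg_ex; eexists; exact: (h xb).
have [d cd] := B 0%N.
have C m : {ae mu, forall x, eball 0 m.+1%:R x -> cvgn (fun j => G j x - d j)}.
  have [dm cdm] := B m.
  have W : {ae mu, forall y, eball 0 1 y -> cvgn (fun j => G j y - d j) /\ cvgn (fun j => G j y - dm j)}.
    apply: filterS2 cd cdm => y h1 h2 yb; split; first exact: h1.
    by apply: h2; rewrite /=; apply: (lt_le_trans yb); rewrite ler1n.
  have [y yb /(_ yb)[h1 h2]] := ae_ball_exists 0 ltr01 W.
  apply: filterS cdm => x hx xb.
  have -> : (fun j => G j x - d j) = (fun j => (G j x - dm j) + ((G j y - d j) - (G j y - dm j))).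
    apply/funext => j; have alg' (a b c e : R) : a - b = (a - e) + ((c - b) - (c - e)) by ring.
    exact: alg'.
  by apply: is_cvgD; [exact: hx|apply: is_cvgB].
have : {ae mu, forall x, cvgn (fun j => G j x - d j)}.
  have := ae_foralln C; apply: filterS => x hx.
  apply: (hx (Num.bound (enorm x))); rewrite /eball /= subr0.
  apply: (lt_le_trans (archi_boundP (enorm_ge0 _))); by rewrite ler_nat.
move=> [N [mN N0 hN]].
have mG j : meas (fun x => (G j x - d j) * \1_(~` N) x).
  apply: mfM; last by apply: mfindic; exact: measurableC.
  by apply: mfB; [exact: (nG j).1|mfun].
have cG x : cvgn (fun j => (G j x - d j) * \1_(~` N) x).
  rewrite indicE; have [xN|xN] := boolP (x \in ~` N).
    have : cvgn (fun j => G j x - d j).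
      by apply: contrapT => h; move: xN; rewrite inE; apply; exact: hN.
    by move=> h; apply: is_cvgMl.
  by under eq_fun do rewrite mulr0; exact: is_cvg_cst.
exists (fun x => limn (fun j => (G j x - d j) * \1_(~` N) x)).
  by apply: (measurable_fun_cvg mG) => x _; exact: cG.
exists id, G, d; split=> //.
exists N; split=> // x /= h; apply: contrapT => xN; apply: h.
have := cG x; rewrite indicE mem_set//; by under eq_fun do rewrite mulr1.
Qed.

Lemma on_ball_approx p f (e : R) : 1 <= p -> Lp p f -> 0 < e -> exists N : nat, forall k, (N <= k)%N ->
  (\int[mu]_x (`|f x - on_ball f 0 k%:R x| `^ p)%:E <= e%:E)%E.
Proof.
move=> p1 [mf fp] e0; have p0 : 0 < p by apply: lt_le_trans p1.
pose h k x := `|f x - on_ball f 0 k%:R x| `^ p.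
have mh k : meas (h k).
  by have := mf_on_ball 0 k%:R mf => mo; rewrite /h; mfun.
have ch x : h k x @[k --> \oo] --> (0 : R).
  have [m hm] : exists m : nat, enorm x < m%:R.
    by exists (Num.bound (enorm x)); apply: archi_boundP; exact: enorm_ge0.
  apply: cvg_near_cst; exists m => // j /= mj; rewrite /h /on_ball indicE mem_set.
    by rewrite mulr1 subrr normr0 powR0// gt_eqF.
  by rewrite /eball /= subr0; apply: (lt_le_trans hm); rewrite ler_nat.
have lh k x : `|h k x| <= `|f x| `^ p.
  rewrite ger0_norm ?powR_ge0// /h /on_ball indicE; case: (x \in _).
    by rewrite mulr1 subrr normr0 powR0 ?gt_eqF.
  by rewrite mulr0 subr0.
have mg : meas (fun x => `|f x| `^ p) by mfun.
have [N hN] := dominated_vanish mh ch mg lh fp e0.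
exists N => k /hN; under eq_integral do rewrite ger0_norm ?powR_ge0//.
by [].
Qed.

(** The values on $L^p$ and on $L^\infty$ have to be compatible: for radii growing fast enough, the
    values at the restrictions of [f] to balls converge almost everywhere to the $L^p$ value, with
    no constants to subtract. *)
Lemma near_ball_limit p f g (F : R) : 1 <= p -> Lp p f -> near_T0 p f g -> 0 <= F -> {ae mu, forall z, `|f z| <= F} ->
  ball_limit f g.
Proof.
move=> p1 fp ng F0 fF; have p0 : 0 < p by apply: lt_le_trans p1.
have oL q x0 (r : R) : 0 < q -> Lp q (on_ball f x0 r) by move=> q0; apply: on_ball_Lp fF => //; exact: fp.1.
have [C C0 HC] := T0_weak s1 s2 p1.
pose B := C * M `^ p.
have B0 : 0 <= B by rewrite mulr_ge0 ?powR_ge0.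
have h0 j : 0 < 2^-1 ^+ j :> R by [].
pose del j := 2^-1 ^+ j * (2^-1 ^+ j) `^ p / (2 `^ p * B + 1).
have D0 : 0 < 2 `^ p * B + 1 by rewrite ltr_pwDr// mulr_ge0.
have del0 j : 0 < del j by rewrite divr_gt0.
have /choice[N hN] : forall j : nat, exists m : nat, (j <= m)%N /\ (\int[mu]_x (`|f x - on_ball f 0 m%:R x| `^ p)%:E <= (del j)%:E)%E.
  move=> j; have [m hm] := on_ball_approx p1 fp (del0 j).
  by exists (maxn j m); split; [exact: leq_maxl|apply: hm; exact: leq_maxr].
have /choice[G nG] : forall j : nat, exists g, near_T0 2 (on_ball f 0 (N j)%:R) g.
  move=> j; exact: (near_exists two1 (oL 2 _ _ two0)).
exists N, G, (fun=> 0); split; [by move=> j; have [] := hN j|exact: nG|].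
have nD j : near_T0 p (fun x => f x + -1 * on_ball f 0 (N j)%:R x) (fun x => g x + -1 * G j x).
  apply: (near_lin _ p1 fp (oL p _ _ p0) ng).
  exact: (near_exponent two1 p1 (oL 2 _ _ two0) (oL p _ _ p0) (nG j)).
have W j : (mu (superlevel (fun x => (g x + -1 * G j x)%R) (2^-1 ^+ j)) <= (2^-1 ^+ j)%:E)%E.
  have H u t : test_function u -> 0 < t -> (mu (superlevel (T0 u) t) <= (B / t `^ p)%:E * \int[mu]_x (`|u x| `^ p)%:E)%E.
    by move=> tu t0; apply: HC kd M0 (test_Lipc tu) t0.
  apply: (le_trans (near_weak p1 B0 H (LpD (-1) (ltW p0) fp (oL p _ _ p0)) (nD j) (h0 j))).
  have [_ hj] := hN j.
  apply: (le_via ((2 `^ p * B / (2^-1 ^+ j) `^ p)%:E * (del j)%:E)%E).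
    apply: lee_wpmul2l; first by rewrite lee_fin ?mulr_ge0 ?powR_ge0.
    by under eq_integral do rewrite mulN1r.
  rewrite lee_fin /del.
  have alg (a b c : R) : 0 < a -> 0 < b -> 0 <= c -> c / b * (a * b / (c + 1)) <= a.
    move=> a0 b0 c0; rewrite (_ : _ * _ = a * (c / (c + 1))); last by field; rewrite !gt_eqF// ltr_pwDr.
    by rewrite ger_pMr// ler_pdivrMr ?ltr_pwDr// mul1r lerDl.
  by apply: alg => //; rewrite mulr_ge0.
have [E [mE E0 hE]] := borel_cantelli_cvg (fun j => (nD j).1) W.
exists E; split=> // x /= h; apply: contrapT => xE; apply: h.
have [m hm] := hE x xE; apply/cvgrPdist_le => e e0.
have [m' hm'] := pow_half_small 1 e0.
exists (maxn m m') => // j /= ; rewrite geq_max => /andP[j1 j2].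
by rewrite subr0 -mulN1r; apply: (le_trans (hm j j1)); rewrite -[leLHS]mul1r; exact: hm'.
Qed.

(** The requirements of all spaces at once, so that one choice of [g] satisfies every field of
    [is_operatorT]. *)
Definition extension_value f g : Prop := [/\ meas g,
  forall q, 1 <= q -> Lp q f -> near_T0 q f g &
  forall F : R, 0 <= F -> {ae mu, forall z, `|f z| <= F} -> ball_limit f g].

Lemma extension_value_exists f : meas f ->
  (exists2 p, 1 <= p & Lp p f) \/ (exists2 F : R, 0 <= F & {ae mu, forall z, `|f z| <= F}) ->
  exists g, extension_value f g.
Proof.
move=> mf; have [[p p1 fp] _|Np [//|[F F0 fF]]] := pselect (exists2 p, 1 <= p & Lp p f).
  have [g ng] := near_exists p1 fp; exists g; split; first exact: ng.1.
    by move=> q q1 fq; exact: (near_exponent p1 q1 fp fq ng).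
  by move=> F F0 fF; exact: near_ball_limit p1 fp ng F0 fF.
have [g mg bg] := ball_limit_exists mf F0 fF; exists g; split => //.
by move=> q q1 fq; exfalso; apply: Np; exists q.
Qed.

Lemma operator_exists : exists T, is_operatorT s s1 s2 K T.
Proof.
(* Functions without a value, which belong to none of the spaces concerned, are sent to 0. *)
have /choice[T HT] : forall f, exists g, (exists g', extension_value f g') -> extension_value f g.
  move=> f; have [[g gP]|Ng] := pselect (exists g', extension_value f g'); first by exists g.
  by exists (fun=> 0) => /Ng.
have E f : meas f ->
    (exists2 p, 1 <= p & Lp p f) \/ (exists2 F : R, 0 <= F & {ae mu, forall z, `|f z| <= F}) ->
    extension_value f (T f).
  by move=> mf h; apply: HT; exact: extension_value_exists.
have EL p f : 1 <= p -> Lp p f -> near_T0 p f (T f).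
  by move=> p1 fp; have [_ h _] := E f fp.1 (or_introl (ex_intro2 _ _ p p1 fp)); exact: h.
have tL u p : 1 <= p -> test_function u -> Lp p u.
  by move=> p1 tu; apply: Linfc_Lp => //; exact: (test_Lipc tu).1.
have Einf f : f \in Lfun mu +oo%E -> exists F : R, [/\ 0 <= F, {ae mu, forall z, `|f z| <= F} & extension_value f (T f)].
  move=> fL; have [F F0 FE] := Linfty_fin fL.
  have fF : {ae mu, forall z, `|f z| <= F + 1} by apply: Linfty_ae fL _; rewrite FE lte_fin ltrDl.
  have F1 : 0 <= F + 1 by nneg.
  exists (F + 1); split=> //; apply: E; first exact: Linfty_mf fL.
  by right; exists (F + 1).
exists T; split.
- move=> f tf; have Tf : {ae mu, forall x, T f x = T0 f x}.
    exact: (near_unique two1 two1 (tL f 2 two1 tf) (tL f 2 two1 tf) (EL _ _ two1 (tL f 2 two1 tf)) (near_test two1 tf)).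
  have mT : meas (T f) := (EL _ _ two1 (tL f 2 two1 tf)).1.
  have [m0 l0] := T0_locally_integrable tf.
  split.
    split => //.
    move=> D cD; rewrite (_ : (\int[mu]_(x in D) `|T f x|%:E = \int[mu]_(x in D) `|T0 f x|%:E)%E); first exact: l0.
    have mD := compact_measurable_rV cD.
    apply: ae_eq_integral => //.
    + by apply: measurable_funTS; apply/measurable_EFinP; exact: mfnorm.
    + by apply: measurable_funTS; apply/measurable_EFinP; exact: mfnorm.
    + by apply: filterS Tf => x ->.
  move=> phi tphi; split; first exact: (form_integrable kd (test_Lipc tphi).1 (test_Lipc tf).1).
  rewrite -[RHS](T0_pairing kd (test_Lipc tf) (test_Lipc tphi).1); congr fine.
  have mphi := test_mf tphi.
  apply: ae_eq_integral => //.
  + by apply/measurable_EFinP; exact: mfM.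
  + by apply/measurable_EFinP; exact: mfM.
  + by apply: filterS Tf => x ->.
- case=> [p f|f _|f]; first by rewrite lee_fin => p1 /(Lfun_int mu f p1) fp; exact: (EL p f p1 fp).1.
    by move=> fL; have [F [_ _ []]] := Einf f fL.
  by [].
- move=> f u /(Lfun_int mu f two1) f2 tu /(Lnorm_cvg0 mu (fun k => (u k \- f)%R) two1) h.
  apply/(Lnorm_cvg0 mu (fun k => (T (u k) \- T f)%R) two1) => e e0.
  have [B [B0 HB]] := strong2_exists.
  have D0 : 0 < 2 `^ 2 * B + 1 :> R by rewrite ltr_pwDr// mulr_ge0.
  have [N hN] := h _ (divr_gt0 e0 D0); exists N => k /hN hk.
  have := near_strong two1 B0 HB (LpD (-1) (ltW two0) (tL _ _ two1 (tu k)) f2)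
    (near_lin (-1) two1 (tL _ _ two1 (tu k)) f2 (EL _ _ two1 (tL _ _ two1 (tu k))) (EL _ _ two1 f2)).
  under [X in (X <= _)%E -> _]eq_integral do rewrite mulN1r.
  under [X in (_ <= _ * X)%E -> _]eq_integral do rewrite mulN1r.
  move=> /le_trans; apply; apply: (le_trans (lee_wpmul2l _ hk)); first by rewrite lee_fin mulr_ge0.
  by rewrite lee_fin mulrCA ger_pMr// ler_pdivrMr// mul1r lerDl.
- move=> p f u p1 /(Lfun_int mu f p1) fp tu /(Lnorm_cvg0 mu (fun k => (u k \- f)%R) p1) h t t0.
  have [C C0 HC] := T0_weak s1 s2 p1; have p0 : 0 < p by apply: lt_le_trans p1.
  have B0 : 0 <= C * M `^ p by nneg.
  have mE k : measurable [set x | t <= `|T (u k) x - T f x|].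
    have mTu := (EL _ _ p1 (tL _ _ p1 (tu k))).1; have mTf := (EL _ _ p1 fp).1.
    by apply: mf_le; mfun.
  apply/cvge0_nonneg => [k|e e0]; first by [].
  pose D := 2 `^ p * (C * M `^ p) / (t / 2) `^ p.
  have D0 : 0 <= D by rewrite divr_ge0 ?mulr_ge0 ?powR_ge0.
  have D1 : 0 < D + 1 by rewrite ltr_pwDr.
  have [N hN] := h _ (divr_gt0 e0 D1); exists N => k /hN hk.
  have t2 : 0 < t / 2 by rewrite divr_gt0.
  have nl := near_lin (-1) p1 (tL _ _ p1 (tu k)) fp (EL _ _ p1 (tL _ _ p1 (tu k))) (EL _ _ p1 fp).
  have H v r : test_function v -> 0 < r -> (mu (superlevel (T0 v) r) <= (C * M `^ p / r `^ p)%:E * \int[mu]_x (`|v x| `^ p)%:E)%E.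
    by move=> tv r0; apply: HC kd M0 (test_Lipc tv) r0.
  have := near_weak p1 B0 H (LpD (-1) (ltW p0) (tL _ _ p1 (tu k)) fp) nl t2.
  under eq_integral do rewrite mulN1r.
  (* Convergence in measure is stated with a weak inequality; the strict superlevel set at half the
     level contains that set. *)
  move=> W; apply: (le_via (mu (superlevel (fun x => (T (u k) x + -1 * T f x)%R) (t / 2)))).
    apply: le_measure; rewrite ?inE; [exact: mE|by apply: meas_superlevel; exact: nl.1|].
    move=> x /= tx; rewrite /superlevel /= mulN1r; apply: lt_le_trans tx.
    by rewrite ltr_pdivrMr// ltr_pMr// ltr1n.
  apply: (le_trans W); apply: (le_trans (lee_wpmul2l _ hk)); first by [].
  by rewrite lee_fin mulrCA ger_pMr// ler_pdivrMr// mul1r lerDl.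
- move=> f fL x0 r r0; have [F [F0 fF [_ _ bl]]] := Einf f fL.
  have mf := Linfty_mf fL.
  have [c hc] := ball_limit_tail mf F0 fF (bl F F0 fF) r0 (EL _ _ two1 (on_ball_Lp x0 (2 * r) two0 F0 mf fF)).
  exists c; apply: filterS hc => x hx xb; split; last exact: hx.
  have := tail_integrable mf F0 fF r0 xb.
  have mD : measurable (~` eball x0 (2 * r)) by apply: measurableC; exact: meas_eball.
  move=> h; apply/(integrable_mkcond _ mD).
  rewrite (_ : _ \_ _ = EFin \o (fun z => ((A x z - A x0 z) * f z) * \1_(~` eball x0 (2 * r)) z))//.
  apply/funext => z; rewrite patchE /= indicE; case: (z \in _); first by rewrite mulr1.
  by rewrite mulr0.
Qed.

End extension.

End rV_operators.

(** * Kernels equal almost everywhere, and the final estimates *)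

Lemma le_right_limit {R : realType} (x : \bar R) (b k : R) : 0 <= b ->
  (forall m, k < m -> (x <= (b * m)%:E)%E) -> (x <= (b * k)%:E)%E.
Proof.
move=> b0 H; apply/lee_addgt0Pr => e e0; have b1 : 0 < b + 1 by rewrite ltr_pwDr.
apply: (le_trans (H (k + e / (b + 1)) _)); first by rewrite ltrDl divr_gt0.
rewrite lee_fin mulrDr lerD2l mulrCA ger_pMr// ler_pdivrMr// mul1r lerDl.
by [].
Qed.

Lemma integrable_ae_eq (R : realType) (d : measure_display) (T : measurableType d) (mu : {measure set T -> \bar R})
  (f g : T -> R) : meas g -> {ae mu, forall x, f x = g x} ->
  integ mu f -> integ mu g.
Proof.
move=> mg fg fi; have mf : meas f by apply/measurable_EFinP; exact: measurable_int fi.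
apply: int_integ => //.
rewrite (_ : integral _ _ _ = \int[mu]_x (`|f x|)%:E)%E; first exact: integrable_int fi.
apply: ae_eq_integral; [by []| | |].
- by apply/measurable_EFinP; exact: mfnorm.
- by apply/measurable_EFinP; exact: mfnorm.
- by apply: filterS fg => x -> _.
Qed.

Section almost_equal_kernels.
Context {R : realType} {n : nat}.
Local Notation mu := (@lebesgue_rV R n).
Local Notation mu2 := (@lebesgue_rV R n \x @lebesgue_rV R n)%E.
Local Notation X := 'rV[R]_n.
Implicit Types (f phi : X -> R) (K : X * X -> R).
Variables (s s1 s2 : R).

Lemma kernelA_ae_eq K K' : meas K -> meas K' -> {ae mu2, forall q, K q = K' q} ->
  kernelA s s1 s2 K = kernelA s s1 s2 K'.
Proof.
move=> mK mK' KK; apply/funext => z1; apply/funext => z2; rewrite /kernelA; congr fine.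
apply: ae_eq_integral; [by []| | |].
- by apply/measurable_EFinP; apply: mf_kernel_integrand.
- by apply/measurable_EFinP; apply: mf_kernel_integrand.
- by apply: filterS KK => q Kq _; rewrite /kernel_integrand Kq.
Qed.

Lemma kernel_integrable_ae_eq K K' z1 z2 : meas K' -> {ae mu2, forall q, K q = K' q} ->
  integ mu2 (kernel_integrand s s1 s2 K z1 z2) ->
  integ mu2 (kernel_integrand s s1 s2 K' z1 z2).
Proof.
move=> mK' KK; apply: integrable_ae_eq; first by apply: mf_kernel_integrand.
by apply: filterS KK => q Kq; rewrite /kernel_integrand Kq.
Qed.

Lemma is_operator_ae_eq (n0 : (0 < n)%N) K K' T : meas K -> meas K' -> {ae mu2, forall q, K q = K' q} ->
  is_operatorT s s1 s2 K T -> is_operatorT s s1 s2 K' T.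
Proof.
move=> mK mK' KK [hw hm h2 hp hoo]; have AA := kernelA_ae_eq mK mK' KK.
split; [|exact: hm|exact: h2|exact: hp|by rewrite -AA].
move=> f tf; have [lT H] := hw f tf; split => //.
move=> phi tphi; have [fi fE] := H phi tphi.
have lf := (test_Lipc tf).1; have lphi := (test_Lipc tphi).1.
have m1 := mf_form_integrand s s1 s2 mK lphi lf; have m2 := mf_form_integrand s s1 s2 mK' lphi lf.
have E : ae_eq mu2 setT (EFin \o form_integrand s s1 s2 K phi f) (EFin \o form_integrand s s1 s2 K' phi f).
  by apply: filterS KK => q Kq _; rewrite /form_integrand /= Kq.
split.
  by apply: integrable_ae_eq m2 _ fi; apply: filterS KK => q Kq; rewrite /form_integrand Kq.
rewrite fE; congr fine.
by apply: ae_eq_integral E; [by []|exact/measurable_EFinP|exact/measurable_EFinP].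
Qed.

Lemma clip_kernel K (M : R) : 0 < s1 < 1 -> 0 < s2 < 1 -> s1 + s2 = 2 * s -> K \in Lfun mu2 +oo%E -> 0 <= M ->
  ('N[mu2]_+oo[EFin \o K] < M%:E)%E ->
  [/\ ker_data s s1 s2 (fun q => clip M (K q)) M, meas K, meas (fun q => clip M (K q)) &
    {ae mu2, forall q, K q = clip M (K q)}].
Proof.
move=> s101 s201 s12 KL M0 KM; have mK := Linfty_mf KL.
have mc : meas (fun q => clip M (K q)).
  by rewrite /clip; apply: mfmax; [mfun|apply: mfmin; mfun].
split; [split=> //|exact: mK|exact: mc|].
  by move=> q; rewrite clip_abs// ge_min lexx orbT.
apply: filterS (Linfty_ae KL KM) => q Kq; apply/eqP.
by rewrite -subr_eq0 -normr_eq0 clip_sub_abs// max_r// subr_le0.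
Qed.

End almost_equal_kernels.

Lemma operator_calderon_zygmund (R : realType) (n : nat) (s s1 s2 M : R) K T : (0 < n)%N ->
  ker_data s s1 s2 K M -> 0 < M -> is_operatorT s s1 s2 K T ->
  @calderon_zygmund R n T (kernelA s s1 s2 K).
Proof.
move=> n0 kd M0 HT; split.
- exact: (operator_linear n0 kd M0 HT).
- have two1 : 1 < 2 :> R by rewrite ltr1n.
  have [C C0 HC] := @T0_strong R n n0 s1 s2 2 two1.
  exists ((2 `^ 2 * C) `^ 2^-1 * M) => f fL; split.
    have /(Lfun_int (lebesgue_rV n) f (ltW two1)) f2 := fL.
    apply/(Lfun_int (lebesgue_rV n) (T f) (ltW two1)).
    exact: (near_Lp2 n0 kd M0 f2 (operator_near n0 kd M0 HT (ltW two1) f2)).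
  apply: (operator_strong n0 kd M0 HT two1 C0 _ fL) => u lu; exact: HC kd M0 lu.
- exact: (operator_associated n0 kd HT).
- exact: (kernelA_standard n0 kd M0).
Qed.

Theorem theorem1p1 (R : realType) (n : nat) (s s1 s2 : R)
    (n1 : (1 <= n)%N)
    (s01 : 0 < s < 1) (s101 : 0 < s1 < 1) (s201 : 0 < s2 < 1)
    (s12 : s1 + s2 = 2 * s) :
  let mu := @lebesgue_rV R n in
  let mu2 := (@lebesgue_rV R n \x @lebesgue_rV R n)%E in
  (forall K : 'rV[R]_n * 'rV[R]_n -> R, K \in Lfun mu2 +oo%E ->
    (forall z1 z2, z1 != z2 ->
      mu2.-integrable setT (EFin \o kernel_integrand s s1 s2 K z1 z2)) /\
    (exists T, is_operatorT s s1 s2 K T) /\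
    (forall T, is_operatorT s s1 s2 K T ->
      calderon_zygmund T (kernelA s s1 s2 K))) /\
  (forall p : R, 1 < p -> exists C : R,
    forall K : 'rV[R]_n * 'rV[R]_n -> R, K \in Lfun mu2 +oo%E ->
    forall T, is_operatorT s s1 s2 K T ->
    [/\ forall f, f \in Lfun mu 1%:E ->
          (weakL1_norm (T f) <=
             C%:E * 'N[mu2]_+oo[EFin \o K] * 'N[mu]_1%:E[EFin \o f])%E,
        forall f, f \in Lfun mu p%:E ->
          ('N[mu]_p%:E[EFin \o T f] <=
             C%:E * 'N[mu2]_+oo[EFin \o K] * 'N[mu]_p%:E[EFin \o f])%E &
        forall f, f \in Lfun mu +oo%E ->
          (bmo_norm (T f) <=
             C%:E * 'N[mu2]_+oo[EFin \o K] * 'N[mu]_+oo[EFin \o f])%E]).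
Proof.
move=> mu mu2; split.
  move=> K KL; have [k k0 kE] := Linfty_fin KL.
  have k1 : 0 < k + 1 by rewrite ltr_pwDr.
  have [|kd mK mc KK] := @clip_kernel R n s s1 s2 K (k + 1) s101 s201 s12 KL (ltW k1).
    by rewrite kE lte_fin ltrDl.
  have KK' : {ae mu2, forall q, clip (k + 1) (K q) = K q} by apply: filterS KK.
  split.
    move=> z1 z2 z12; apply: (kernel_integrable_ae_eq mK KK').
    exact: (kernel_integrable n1 kd z12).
  split.
    have [T HT] := operator_exists n1 kd k1; exists T.
    exact: is_operator_ae_eq mc mK KK' HT.
  move=> T HT; rewrite (kernelA_ae_eq s s1 s2 mK mc KK).
  exact: (operator_calderon_zygmund n1 kd k1 (is_operator_ae_eq n1 mK mc KK HT)).
move=> p p1; have two1 : 1 < 2 :> R by rewrite ltr1n.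
have [Cw Cw0 HCw] := @T0_weak R n n1 s1 s2 1 (lexx 1).
have [Cp Cp0 HCp] := @T0_strong R n n1 s1 s2 p p1.
have [C2 C20 HC2] := @T0_strong R n n1 s1 s2 2 two1.
pose a1 := 2 * Cw; pose a2 := (2 `^ p * Cp) `^ p^-1; pose a3 := `|bmo_cst (n := n) C2 s1 s2|.
have a10 : 0 <= a1 by rewrite mulr_ge0.
have a20 : 0 <= a2 by exact: powR_ge0.
have a30 : 0 <= a3 by exact: normr_ge0.
(* The three constants depend on the dimension and the exponents alone; their sum serves for all
   three bounds. *)
exists (a1 + a2 + a3) => K KL T HT; have [k k0 kE] := Linfty_fin KL.
have kd m : k < m -> exists K', [/\ 0 < m, ker_data s s1 s2 K' m & is_operatorT s s1 s2 K' T].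
  move=> km; have m0 : 0 < m by exact: le_lt_trans km.
  have [|kd mK mc KK] := @clip_kernel R n s s1 s2 K m s101 s201 s12 KL (ltW m0).
    by rewrite kE.
  by eexists; split; [exact: m0|exact: kd|exact: (is_operator_ae_eq n1 mK mc KK HT)].
have fin q f : 1 <= q -> f \in Lfun mu q%:E -> exists2 Y : R, 0 <= Y & 'N[mu]_q%:E[EFin \o f]%E = Y%:E.
  move=> q1; rewrite inE => /andP[_]; rewrite inE /finite_norm /= => h.
  exists (fine 'N[mu]_q%:E[EFin \o f]%E); first by rewrite fine_ge0// Lnorm_ge0.
  by rewrite fineK// ge0_fin_numE// Lnorm_ge0.
have conclude (x : \bar R) (a Y : R) : 0 <= a -> a <= a1 + a2 + a3 -> 0 <= Y ->
    (forall m, k < m -> (x <= (a * m * Y)%:E)%E) -> (x <= (a1 + a2 + a3)%:E * k%:E * Y%:E)%E.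
  move=> a0 aC Y0 H; rewrite -!EFinM; apply: (le_via (a * Y * k)%:E).
    by apply: le_right_limit => [|m km]; [rewrite mulr_ge0|rewrite mulrAC; exact: H].
  by rewrite mulrAC; apply: ler_wpM2r => //; apply: ler_wpM2r.
rewrite kE; split=> f fL.
- have [Y Y0 YE] := fin 1 f (lexx 1) fL; rewrite YE.
  apply: (conclude _ a1) => //; first by rewrite -addrA lerDl addr_ge0.
  move=> m /kd[K' [m0 kd' HT']]; rewrite EFinM -YE.
  apply: (operator_weak n1 kd' m0 HT' Cw0 _ fL) => u t lu t0; exact: HCw kd' m0 lu t0.
- have [Y Y0 YE] := fin p f (ltW p1) fL; rewrite YE.
  apply: (conclude _ a2) => //; first by rewrite [a1 + a2]addrC -addrA lerDl addr_ge0.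
  move=> m /kd[K' [m0 kd' HT']]; rewrite EFinM -YE.
  apply: (operator_strong n1 kd' m0 HT' p1 Cp0 _ fL) => u lu; exact: HCp kd' m0 lu.
- have [Y Y0 YE] := Linfty_fin fL; rewrite YE.
  apply: (conclude _ a3) => //; first by rewrite lerDr addr_ge0.
  (* [Linfty_ae] needs a level strictly above the norm of [f], so a second limit from the right is
     taken, in [F]. *)
  move=> m /kd[K' [m0 kd' HT']]; apply: le_right_limit => [|F YF]; first by nneg.
  have F0 : 0 < F by exact: le_lt_trans YF.
  apply: (le_via (bmo_cst (n := n) C2 s1 s2 * m * F)%:E).
    apply: (operator_bmo n1 kd' m0 HT' F0 C20 _ fL) => [u lu|].
      by rewrite -powR_mulrn ?(ltW m0)//; exact: HC2 kd' m0 lu.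
    by apply: Linfty_ae fL _; rewrite YE.
  rewrite lee_fin; apply: ler_wpM2r; first exact: ltW.
  by apply: ler_wpM2r; [exact: ltW|exact: ler_norm].
Qed.
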